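(* Let $r\ge 3$ and let $\mathbb V$ be the initial cluster of $\mathbb C[G^{e,c^2}]$, with $G=\mathrm{SL}_{r+1}(\mathbb C)$. In each item below, ''$(\varphi^G_{\mathbb T})_m$ is the total sum of monomials in the Demazure crystals $B(\lambda)_w\oplus\bigoplus_i B(\lambda_i)_{w_i}$ with highest weight monomials $M, M_i$'' means: $M$ and all $M_i$ are highest weight monomials of weights $\lambda$ and $\lambda_i$ respectively, and there is a weight $\chi$ such that $(\varphi^G_{\mathbb T})_m(a;\mathbf Y)=a^{\chi}\bigl(S_w(M)+\sum_i S_{w_i}(M_i)\bigr)$ for all $a\in H$, $\mathbf Y\in(\mathbb C^\times)^{2r}$. (1) Let $k\in[\lfloor\frac{r+1}{2}\rfloor+1,r-1]$ and $l\in[0,r-k-1]$, and $\mu[l]:=(\mu_{k-\lfloor r/2\rfloor+l}\,\mu_{k+l+1}\,\mu_{k+l})\cdots(\mu_{k-\lfloor r/2\rfloor+1}\,\mu_{k+2}\,\mu_{k+1})(\mu_{k-\lfloor r/2\rfloor}\,\mu_{k+1}\,\mu_k)$. Put $H_1:=\prod_{t=0}^{l-1}Y_{1,j_k-2t-2}\prod_{t=0}^{l}Y_{2,j_k-2t-1}$ and $H_2:=\prod_{t=0}^{l}Y_{1,j_k-2t-2}Y_{2,j_k-2t-1}$. (a) $(\varphi^G_{\mu[l]\mathbb V})_{k-\lfloor r/2\rfloor+l}$ is the total sum of monomials in the Demazure crystals $$B\Bigl(\sum_{s=j_k-2l-1}^{j_k-1}\Lambda_s\Bigr)_{w_1}\oplus\bigoplus_{p>0,\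 (\mathbf b,\mathbf c)\in R^p_{l-1}}B\Bigl(\sum_{s=j_k-2l-1}^{j_k-1}\Lambda_s-\alpha[\mathbf b,\mathbf c;j_k]\Bigr)_{w_1(\mathbf b,\mathbf c)},$$ where $w_1=\prod_{q\in[0,l-1]}s_{j_k-2q-2}$, $w_1(\mathbf b,\mathbf c)=\prod_{q\in[0,l-1]\setminus[\mathbf b,\mathbf c]}s_{j_k-2q-2}$, and the highest weight monomials are $H_1$ and $H_1\cdot\prod_{i=1}^pA[b_i,c_i;j_k]$ respectively. (b) $(\varphi^G_{\mu_{k+l+1}\mu[l]\mathbb V})_{k+l+1}$ is the total sum of monomials in the Demazure crystals $$B\Bigl(\sum_{s=j_k-2l-2}^{j_k-1}\Lambda_s\Bigr)_{w_2}\oplus\bigoplus_{p>0,\ (\mathbf b,\mathbf c)\in R^p_{l}}B\Bigl(\sum_{s=j_k-2l-2}^{j_k-1}\Lambda_s-\alpha[\mathbf b,\mathbf c;j_k]\Bigr)_{w_2(\mathbf b,\mathbf c)},$$ where $w_2=s_{j_k-2l-3}s_{j_k-2l-2}\prod_{q\in[0,l-1]}s_{j_k-2q-2}$, $w_2(\mathbf b,\mathbf c)=s_{j_k-2l-3}\,s_{j_k-2l-2}^{1-\delta_{c_p,l}}\prod_{q\in[0,l-1]\setminus[\mathbf b,\mathbf c]}s_{j_k-2q-2}$, and the highest weight monomials are $H_2$ and $H_2\cdot\prod_{i=1}^pA[b_i,c_i;j_k]$. (2) Let $k\in[1,\lfloor\frac{r+1}{2}\rfloor-2]$ and $l\in[0,\lfloor\frac{r+1}{2}\rfloor-k-2]$,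 and $\mu'[l]:=(\mu_{k+l+1}\mu_{\lfloor r/2\rfloor+k+l+2}\mu_{\lfloor r/2\rfloor+k+l+1})\cdots(\mu_{k+2}\mu_{\lfloor r/2\rfloor+k+3}\mu_{\lfloor r/2\rfloor+k+2})(\mu_{k+1}\mu_{\lfloor r/2\rfloor+k+2}\mu_{\lfloor r/2\rfloor+k+1})\mu_k$. Put $H_3:=\prod_{t=0}^{l+1}Y_{1,j_k-2t+1}Y_{2,j_k-2t}$ and $H_4:=\prod_{t=0}^{l+2}Y_{1,j_k-2t+1}\prod_{t=0}^{l+1}Y_{2,j_k-2t}$. (a) $(\varphi^G_{\mu'[l]\mathbb V})_{k+l+1}$ is the total sum of monomials in the Demazure crystals $$B\Bigl(\sum_{s=j_k-2l-2}^{j_k+1}\Lambda_s\Bigr)_{w_3}\oplus\bigoplus_{p>0,\ (\mathbf b,\mathbf c)}B\Bigl(\sum_{s=j_k-2l-2}^{j_k+1}\Lambda_s-\alpha[\mathbf b,\mathbf c;j_k+3]\Bigr)_{w_3(\mathbf b,\mathbf c)},$$ where $(\mathbf b,\mathbf c)$ runs over $R^p_{l+1}$ if $j_k<r$, and over those $(\mathbf b,\mathbf c)\in R^p_{l+1}$ with $b_1>0$ if $j_k=r$; here $w_3=s_{j_k+2}s_{j_k+1}\prod_{q\in[1,l+1]}s_{j_k-2q+1}$, $w_3(\mathbf b,\mathbf c)=s_{j_k+2}s_{j_k+1}^{1-\delta_{b_1,0}}\prod_{q\in[1,l+1]\setminus[\mathbf b,\mathbf c]}s_{j_k-2q+1}$,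 and the highest weight monomials are $H_3$ and $H_3\cdot\prod_{i=1}^pA[b_i,c_i;j_k+3]$. (b) $(\varphi^G_{\mu_{\lfloor r/2\rfloor+k+l+2}\mu'[l]\mathbb V})_{\lfloor r/2\rfloor+k+l+2}$ is the total sum of monomials in the Demazure crystals $$B\Bigl(\sum_{s=j_k-2l-3}^{j_k+1}\Lambda_s\Bigr)_{w_4}\oplus\bigoplus_{p>0,\ (\mathbf b,\mathbf c)}B\Bigl(\sum_{s=j_k-2l-3}^{j_k+1}\Lambda_s-\alpha[\mathbf b,\mathbf c;j_k+3]\Bigr)_{w_4(\mathbf b,\mathbf c)},$$ where $(\mathbf b,\mathbf c)$ runs over $R^p_{l+2}$ if $j_k<r$, and over those $(\mathbf b,\mathbf c)\in R^p_{l+2}$ with $b_1>0$ if $j_k=r$; here $w_4=s_{j_k+2}s_{j_k+1}s_{j_k-2l-4}s_{j_k-2l-3}\prod_{q\in[1,l+1]}s_{j_k-2q+1}$, $w_4(\mathbf b,\mathbf c)=s_{j_k+2}s_{j_k+1}^{1-\delta_{b_1,0}}s_{j_k-2l-4}s_{j_k-2l-3}^{1-\delta_{c_p,l+2}}\prod_{q\in[1,l+1]\setminus[\mathbf b,\mathbf c]}s_{j_k-2q+1}$, and the highest weight monomials are $H_4$ and $H_4\cdot\prod_{i=1}^pA[b_i,c_i;j_k+3]$. (3) Let $l\in[0,\lfloor\frac r2\rfloor-2]$, and $\mu''[l]:=(\mu_{\lfloor\frac{r+1}{2}\rfloor-l-1}\mu_{r-l-1}\mu_{r-l})\cdots(\mu_{\lfloor\frac{r+1}{2}\rfloor-2}\mu_{r-2}\mu_{r-1})(\mu_{\lfloor\frac{r+1}{2}\rfloor-1}\mu_{r-1}\mu_r)\mu_{\lfloor\frac{r+1}{2}\rfloor}$.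 Put $H_5:=\prod_{t=0}^lY_{1,2t+2}\prod_{t=0}^{l+1}Y_{2,2t+1}$ and $H_6:=\prod_{t=0}^{l+1}Y_{1,2t+2}Y_{2,2t+1}$. (a) $(\varphi^G_{\mu''[l]\mathbb V})_{\lfloor\frac{r+1}{2}\rfloor-l-1}$ is the total sum of monomials in the Demazure crystals $$B\Bigl(\sum_{s=1}^{2l+3}\Lambda_s\Bigr)_{w_5}\oplus\bigoplus_{p>0,\ (\mathbf b,\mathbf c)\in R^p_{l+1},\ b_1>0}B\Bigl(\sum_{s=1}^{2l+3}\Lambda_s-\alpha[-\mathbf c,-\mathbf b;2]\Bigr)_{w_5(\mathbf b,\mathbf c)},$$ where $w_5=\prod_{q\in[1,l+1]}s_{2q}$, $w_5(\mathbf b,\mathbf c)=\prod_{q\in[1,l+1]\setminus[\mathbf b,\mathbf c]}s_{2q}$, and the highest weight monomials are $H_5$ and $H_5\cdot\prod_{i=1}^pA[-c_i,-b_i;2]$. (b) $(\varphi^G_{\mu_{r-l-1}\mu''[l]\mathbb V})_{r-l-1}$ is the total sum of monomials in the Demazure crystals $$B\Bigl(\sum_{s=1}^{2l+4}\Lambda_s\Bigr)_{w_6}\oplus\bigoplus_{p>0,\ (\mathbf b,\mathbf c)\in R^p_{l+2},\ b_1>0}B\Bigl(\sum_{s=1}^{2l+4}\Lambda_s-\alpha[-\mathbf c,-\mathbf b;2]\Bigr)_{w_6(\mathbf b,\mathbf c)},$$ where $w_6=s_{2l+5}s_{2l+4}\prod_{q\in[1,l+1]}s_{2q}$, $w_6(\mathbf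 b,\mathbf c)=s_{2l+5}s_{2l+4}^{1-\delta_{c_p,l+2}}\prod_{q\in[1,l+1]\setminus[\mathbf b,\mathbf c]}s_{2q}$, and the highest weight monomials are $H_6$ and $H_6\cdot\prod_{i=1}^pA[-c_i,-b_i;2]$. Furthermore, if $r$ is odd, then (with $\mu''[-1]:=\mu_{\lfloor\frac{r+1}{2}\rfloor}$) $(\varphi^G_{\mu_1\mu_{\frac{r+3}{2}}\mu''[\frac{r-1}{2}-2]\mathbb V})_1$ is the total sum of monomials in the Demazure crystals $$B\Bigl(\sum_{s=1}^{r}\Lambda_s\Bigr)_{\prod_{q\in[1,\frac{r-1}2]}s_{2q}}\oplus\bigoplus_{p>0,\ (\mathbf b,\mathbf c)\in R^p_{\frac{r-1}{2}},\ b_1>0}B\Bigl(\sum_{s=1}^{r}\Lambda_s-\alpha[-\mathbf c,-\mathbf b;2]\Bigr)_{\prod_{q\in[1,\frac{r-1}2]\setminus[\mathbf b,\mathbf c]}s_{2q}},$$ with highest weight monomials $H_7:=\prod_{t=0}^{\frac{r-3}2}Y_{1,2t+2}\prod_{t=0}^{\frac{r-1}2}Y_{2,2t+1}$ and $H_7\cdot\prod_{i=1}^pA[-c_i,-b_i;2]$.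
   Context: **Group and coordinates.** $r\ge3$, $G=\mathrm{SL}_{r+1}(\mathbb C)$, $H$ the diagonal torus, $B,B_-$ the upper/lower triangular Borel subgroups, $N,N_-$ their unipotent radicals. $[p,q]$ is the set of integers $p,\dots,q$ (empty if $p>q$); empty products are $1$ (or $e$). For $i\in[1,r]$: $x_i(t)=\exp(te_i)=1+tE_{i,i+1}$, $y_i(t)=\exp(tf_i)=1+tE_{i+1,i}$, $\alpha_i^\vee(t)$ is the diagonal matrix with $t,t^{-1}$ in positions $i,i+1$ and $1$ elsewhere. $W$ is the Weyl group with simple reflections $s_i$; $\overline{s_i}=x_i(-1)y_i(1)x_i(-1)$ and $\overline u=\overline{s_{i_1}}\cdots\overline{s_{i_n}}$ for a reduced expression $u=s_{i_1}\cdots s_{i_n}$. $\alpha_i$, $\Lambda_i$ are simple roots and fundamental weights, $(a_{i,j})$ the Cartan matrix of type $A_r$; for $a=\mathrm{diag}(a_1,\dots,a_{r+1})\in H$, $a^{\Lambda_i}=a_1\cdots a_i$, extended to $a^\lambda$ for all integral weights $\lambda$. $G^{e,v}=B\cap B_-\overline vB_-$. Let $(j_r,\dots,j_2,j_1)$ be the sequence consisting of the even numbers of $[1,r]$ in increasing order followed by the odd numbers of $[1,r]$ in increasing order; set $j_{m+r}=j_m$. So $j_k=2(\lfloor\frac{r+1}2\rfloor-k)+1$ for $1\le k\le\lfloor\frac{r+1}2\rfloor$ and $j_k=2(r-k+1)$ for $\lfloor\frac{r+1}2\rfloor<k\le r$. $c=s_{j_r}\cdots s_{j_1}$ is a Coxeter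 element and $\mathbf i=(j_{2r},\dots,j_1)$ is a reduced word of $c^2$. With $\mathbf Y=(Y_{1,j_r},\dots,Y_{1,j_1},Y_{2,j_r},\dots,Y_{2,j_1})\in(\mathbb C^\times)^{2r}$ define $\overline x^G_{\mathbf i}:H\times(\mathbb C^\times)^{2r}\to G^{e,c^2}$, $\overline x^G_{\mathbf i}(a;\mathbf Y)=a\cdot\prod_{m=r,r-1,\dots,1}x_{j_m}(Y_{1,j_m})\alpha^\vee_{j_m}(Y_{1,j_m})\cdot\prod_{m=r,r-1,\dots,1}x_{j_m}(Y_{2,j_m})\alpha^\vee_{j_m}(Y_{2,j_m})$ (factors in this order). **Cluster structure.** The generalized minor $\Delta_{\Lambda_i,w\Lambda_i}$ is the regular function on $G$ with $\Delta_{\Lambda_i,w\Lambda_i}(x)=([x\overline w]_0)^{\Lambda_i}$ whenever $x\overline w\in N_-HN$, where $[\cdot]_0$ is the $H$-component. For $1\le k\le 2r$ put $(\varphi_{\mathbb V})_k=\Delta_{\Lambda_{j_k},s_{j_1}s_{j_2}\cdots s_{j_k}\Lambda_{j_k}}$ and $(\varphi_{\mathbb V})_{-i}=\Delta_{\Lambda_i,\Lambda_i}$ for $i\in[1,r]$, restricted to $G^{e,c^2}$. These form the initial seed of a cluster algebra structure on $\mathbb C[G^{e,c^2}]$; the mutable variables are $(\varphi_{\mathbb V})_1,\dots,(\varphi_{\mathbb V})_r$, all the others are frozen (and invertible). For $i=j_k$, $k\in[1,r]$, write $M_i=(\varphi_{\mathbb V})_k$, $P_i=(\varphi_{\mathbb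 V})_{r+k}$, $Q_i=(\varphi_{\mathbb V})_{-i}$. The initial quiver has arrows $P_i\to M_i\to Q_i$ for all $i$, and, for $i$ odd, $i'$ even, $|i-i'|=1$: $M_i\to M_{i'}$, $M_{i'}\to P_i$, $Q_{i'}\to M_i$. Mutation $\mu_k$ ($k\in[1,r]$) of a seed is the usual quiver mutation at its $k$-th mutable variable $z_k$ with exchange relation $z_kz_k'=\prod_{z\to z_k}z+\prod_{z_k\to z}z$. A composite $\mu_{k_1}\cdots\mu_{k_s}$ is applied from right to left. A cluster $\mathbb T$ has mutable variables $(\varphi_{\mathbb T})_1,\dots,(\varphi_{\mathbb T})_r$, and $(\varphi^G_{\mathbb T})_k(a;\mathbf Y):=(\varphi_{\mathbb T})_k(\overline x^G_{\mathbf i}(a;\mathbf Y))$. **Monomial crystal.** $\mathcal Y$ is the set of Laurent monomials $Y=\prod_{s\in\mathbb Z,i\in[1,r]}Y_{s,i}^{\zeta_{s,i}}$ (finitely many nonzero exponents). $\mathrm{wt}(Y)=\sum\zeta_{s,i}\Lambda_i$, $\varphi_i(Y)=\max_{s\in\mathbb Z}\sum_{k\le s}\zeta_{k,i}$, $\varepsilon_i(Y)=\varphi_i(Y)-\sum_s\zeta_{s,i}$. For $i\ne j$ put $p_{j,i}=1$ if $j$ occurs before $i$ in the sequence $(j_r,\dots,j_1)$, and $0$ otherwise; $A_{s,i}=Y_{s,i}Y_{s+1,i}\prod_{j\ne i}Y_{s+p_{j,i},j}^{a_{j,i}}$. Thus $A_{1,i}=\frac{Y_{1,i}Y_{2,i}}{Y_{1,i-1}Y_{1,i+1}}$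 for $i$ even and $A_{1,i}=\frac{Y_{1,i}Y_{2,i}}{Y_{2,i-1}Y_{2,i+1}}$ for $i$ odd. Kashiwara operators: $\tilde f_iY=A_{n,i}^{-1}Y$ with $n=\min\{n:\varphi_i(Y)=\sum_{k\le n}\zeta_{k,i}\}$ if $\varphi_i(Y)>0$, and $\tilde f_iY=0$ if $\varphi_i(Y)=0$; $\tilde e_iY=A_{n,i}Y$ with $n=\max\{n:\varphi_i(Y)=\sum_{k\le n}\zeta_{k,i}\}$ if $\varepsilon_i(Y)>0$, and $\tilde e_iY=0$ if $\varepsilon_i(Y)=0$. A monomial $M$ with $\varepsilon_i(M)=0$ for all $i$ is a highest weight monomial; its connected component is isomorphic to the crystal $B(\mathrm{wt}(M))$ (the monomial realization with highest weight vector $M$). For $w=s_{i_1}\cdots s_{i_n}$ reduced, the Demazure crystal $B(\mathrm{wt}(M))_w$ is realized by $\{\tilde f_{i_1}^{m_1}\cdots\tilde f_{i_n}^{m_n}M: m_1,\dots,m_n\ge0\}\setminus\{0\}$, and $S_w(M)$ denotes the sum of all the monomials in this set. **Further notation.** Conventions: $Y_{s,j}=1$ and $\Lambda_j=0$ for $j\le0$ or $j\ge r+1$; $s_j=e$ for $j\notin[1,r]$; $A_{1,s}=1$ and $\alpha_s=0$ for $s\le0$. For integers $b<c$ and $x$, $A[b,c;x]=\bigl(\prod_{s=b}^{c-1}A_{1,x-2s-2}A_{1,x-2s-3}\bigr)^{-1}A_{1,x-2c-2}^{-1}$. For $\mathbf b=(b_i)_{i=1}^p$, $\mathbf c=(c_i)_{i=1}^p$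 with $b_i<c_i$, $\alpha[\mathbf b,\mathbf c;x]=\sum_{i=1}^p\sum_{t=x-2c_i-2}^{x-2b_i-2}\alpha_t$ (so $\alpha[-\mathbf c,-\mathbf b;2]=\sum_{i}\sum_{t=2b_i}^{2c_i}\alpha_t$). $R^p_l$ is the set of pairs $(\mathbf b,\mathbf c)\in\mathbb Z_{\ge0}^p\times\mathbb Z_{\ge0}^p$ with $0\le b_1<c_1<b_2<c_2<\cdots<b_p<c_p\le l$ (empty for $p\ge1$, $l\le0$), and $[\mathbf b,\mathbf c]=[b_1,c_1]\cup\cdots\cup[b_p,c_p]$. $\delta$ is the Kronecker delta. *)

(* Defs.v *)
From HB Require Import structures.
From mathcomp Require Import all_boot all_order all_algebra.
From mathcomp Require Import finmap.
From mathcomp Require Import boolp classical_sets functions cardinality fsbigop.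
From mathcomp Require Import reals complex.
From mathcomp Require Import freeg mpoly.

Set Implicit Arguments.
Unset Strict Implicit.
Unset Printing Implicit Defensive.

Import Order.TTheory GRing.Theory Num.Theory.
Local Open Scope ring_scope.
Local Open Scope classical_set_scope.

(* All indices (nodes of the Dynkin diagram, labels of cluster variables, the
   first index of Y_{s,i}) are integers numbered as in the mathematics; in
   particular the nodes are 1, ..., r.  Only matrix rows and columns are
   0-based, so that row p : 'I_r.+1 is the (p + 1)-st row. *)

(* the integers p, p + 1, ..., q in increasing order *)
Definition zrange (p q : int) : seq int :=
  [seq p + t%:Z | t <- iota 0 (if p <= q then `|q - p|%N.+1 else 0%N)].

Section CoxeterWord.
Variable r : nat.

Definition is_node (i : int) : bool := 1 <= i <= r%:Z.

(* (j_r, ..., j_2, j_1), a word of the Coxeter element c *)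
Definition jseq : seq int :=
  [seq i%:Z | i <- iota 1 r & ~~ odd i] ++ [seq i%:Z | i <- iota 1 r & odd i].

(* j_k, extended periodically by j_(k + r) = j_k *)
Definition jnode (k : int) : int := nth 0 (rev jseq) `|((k - 1) %% r%:Z)%Z|%N.

Definition cartan (i j : int) : int :=
  if i == j then 2 else if `|i - j| == 1 then -1 else 0.

(* weights are written in the basis of the fundamental weights; Lam i = 0 when
   i is not a node *)
Definition Lam (i : int) : 'rV[int]_r := \row_(p < r) (p.+1%:Z == i)%:R.

Definition alpha (i : int) : 'rV[int]_r :=
  if is_node i then \row_(p < r) cartan p.+1%:Z i else 0.

(* a product of simple reflections s_i, with the convention s_i = e when i is
   not a node *)
Definition sword (w : seq int) : seq int := [seq i <- w | is_node i].

End CoxeterWord.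

Section Group.
Variables (K : fieldType) (r : nat).
Implicit Types (x a : 'M[K]_r.+1) (w : seq int).

Definition SL : set 'M[K]_r.+1 := [set x | \det x = 1].
Definition upperB : set 'M[K]_r.+1 := [set x | \det x = 1 /\ is_trig_mx x^T].
Definition lowerB : set 'M[K]_r.+1 := [set x | \det x = 1 /\ is_trig_mx x].
Definition upperN : set 'M[K]_r.+1 :=
  [set x | is_trig_mx x^T /\ forall p, x p p = 1].
Definition lowerN : set 'M[K]_r.+1 :=
  [set x | is_trig_mx x /\ forall p, x p p = 1].
Definition torusH : set 'M[K]_r.+1 := [set x | \det x = 1 /\ is_diag_mx x].

Definition xmx (i : int) (t : K) : 'M[K]_r.+1 :=
  1 + t *: \matrix_(p, q) ((p.+1%:Z == i) && (q.+1%:Z == i + 1))%:R.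
Definition ymx (i : int) (t : K) : 'M[K]_r.+1 :=
  1 + t *: \matrix_(p, q) ((p.+1%:Z == i + 1) && (q.+1%:Z == i))%:R.
Definition coroot (i : int) (t : K) : 'M[K]_r.+1 :=
  diag_mx (\row_p if p.+1%:Z == i then t
                  else if p.+1%:Z == i + 1 then t^-1 else 1).

Definition sbar (i : int) : 'M[K]_r.+1 := xmx i (-1) * ymx i 1 * xmx i (-1).

(* the representative of s_(i_1) ... s_(i_n) attached to a reduced word *)
Definition wbar w : 'M[K]_r.+1 := \prod_(i <- w) sbar i.

(* the value a^chi, where a^(Lam i) is the product of the first i diagonal
   entries of a *)
Definition torus_char a (chi : 'rV[int]_r) : K :=
  \prod_(i < r) (\prod_(p < r.+1 | (p <= i)%N) a p p) ^ chi ord0 i.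

(* G^{e,v}, where v is given by a reduced word *)
Definition bruhat_cell (v : seq int) : set 'M[K]_r.+1 :=
  [set x | upperB x /\
     exists b1 b2, [/\ lowerB b1, lowerB b2 & x = b1 * wbar v * b2]].

(* regular functions on a quasi-affine subvariety X of the space of matrices:
   locally quotients of polynomials in the matrix entries; the values of f
   outside X are irrelevant *)
Definition regular_on (X : set 'M[K]_r.+1) (f : 'M[K]_r.+1 -> K) : Prop :=
  forall x, X x -> exists P Q : {mpoly K[(r.+1 * r.+1)%N]},
    Q.@[fun p => mxvec x ord0 p] != 0 /\
    forall y, X y -> Q.@[fun p => mxvec y ord0 p] != 0 ->
      f y = P.@[fun p => mxvec y ord0 p] / Q.@[fun p => mxvec y ord0 p].

(* f is the generalized minor Delta_{Lam i, w (Lam i)}, w being given by a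
   reduced word *)
Definition is_gminor (i : int) w (f : 'M[K]_r.+1 -> K) : Prop :=
  regular_on SL f /\
  forall x l h n, SL x -> lowerN l -> torusH h -> upperN n ->
    x * wbar w = l * h * n -> f x = torus_char h (Lam r i).

(* the chart of G^{e,c^2}; only the variables Y_{1,i} and Y_{2,i} with i a node
   occur *)
Definition xbar a (Y : int -> int -> K) : 'M[K]_r.+1 :=
  a * (\prod_(i <- jseq r) (xmx i (Y 1 i) * coroot i (Y 1 i)))
    * (\prod_(i <- jseq r) (xmx i (Y 2 i) * coroot i (Y 2 i))).

(* A seed of the cluster algebra C[G^{e,c^2}].  The cluster variables are
   labelled by [-r, -1] and [1, 2r], those with labels in [1, r] being mutable;
   they are functions on G^{e,c^2} (values elsewhere are irrelevant).
   arrows u v is the number of arrows u -> v. *)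
Record seed := Seed {
  arrows : int -> int -> nat;
  cvar : int -> 'M[K]_r.+1 -> K
}.

Definition labels : seq int :=
  [seq - i | i <- zrange 1 r%:Z] ++ zrange 1 (2 * r%:Z).

(* With i = j_k, the labels of M_i, P_i, Q_i are k, r + k, - j_k. *)
Definition arrows0 (u v : int) : nat :=
  let j := jnode r in
  has (fun k => [|| (u, v) == (r%:Z + k, k), (u, v) == (k, - j k) |
    has (fun k' => [&& odd `|j k|%N, ~~ odd `|j k'|%N, `|j k - j k'| == 1 &
        [|| (u, v) == (k, k'), (u, v) == (k', r%:Z + k) |
            (u, v) == (- j k', k)]])
      (zrange 1 r%:Z)]) (zrange 1 r%:Z).

Definition is_initial_seed (V : seed) : Prop :=
  [/\ forall u v, arrows V u v = arrows0 u v,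
      forall k, 1 <= k <= 2 * r%:Z ->
        is_gminor (jnode r k) [seq jnode r t | t <- zrange 1 k] (cvar V k) &
      forall i, 1 <= i <= r%:Z -> is_gminor i [::] (cvar V (- i))].

(* Quiver mutation: arrows through k are composed, arrows at k are reversed,
   and the truncated subtraction cancels the 2-cycles. *)
Definition mutate_arrows (k : int) (q : int -> int -> nat) (u v : int) : nat :=
  if (u == k) || (v == k) then q v u
  else ((q u v + q u k * q k v) - (q v u + q v k * q k u))%N.

(* T is the mutation of S at k.  The new variable is the regular function on
   G^{e,c^2} determined by the exchange relation. *)
Definition is_mutation (k : int) (S T : seed) : Prop :=
  let X := bruhat_cell (jseq r ++ jseq r) in
  [/\ forall u v, arrows T u v = mutate_arrows k (arrows S) u v,
      forall v x, v != k -> X x -> cvar T v x = cvar S v x,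
      regular_on X (cvar T k) &
      forall x, X x -> cvar S k x * cvar T k x =
         \prod_(v <- labels) cvar S v x ^+ arrows S v k
         + \prod_(v <- labels) cvar S v x ^+ arrows S k v].

(* T is obtained from S by the composite mu_(k_1) ... mu_(k_s), applied from
   right to left *)
Fixpoint is_mutated (ks : seq int) (S T : seed) : Prop :=
  if ks is k :: ks' then exists2 U, is_mutated ks' S U & is_mutation k U T
  else T = S.

End Group.

(* The generalized minors of is_gminor exist: they are the leading principal
   minors of x * wbar w. *)
Section LeadingMinor.
Variables (K : fieldType) (r : nat).

Definition lead_minor (i : nat) (y : 'M[K]_r.+1) : K :=
  \det (mxsub (inord : 'I_i -> 'I_r.+1) inord y).

Lemma regular_lead_minor i (z : 'M[K]_r.+1) X :
  regular_on X (fun x => lead_minor i (x * z)).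
Proof.
pose G := \matrix_(p, q) 'X_(mxvec_index p q) : 'M[{mpoly K[r.+1 * r.+1]}]_r.+1.
pose P := \det (mxsub (inord : 'I_i -> 'I_r.+1) inord
                  (G *m map_mx (fun c => c%:MP_[(r.+1 * r.+1)]) z)).
have PE y : P.@[fun p => mxvec y ord0 p] = lead_minor i (y * z).
  rewrite /P -det_map_mx; congr (\det _); apply/matrixP => p q.
  rewrite !mxE rmorph_sum; apply: eq_bigr => s _.
  by rewrite /= mevalM !mxE mevalC mevalXU mxvecE.
by move=> x _; exists P, 1; rewrite meval1 oner_neq0; split=> // y _ _;
  rewrite meval1 divr1 PE.
Qed.

Lemma lead_minor_ldu (i : 'I_r) (l h n : 'M[K]_r.+1) :
  lowerN l -> torusH h -> upperN n ->
  lead_minor i.+1 (l * h * n) = torus_char h (Lam r i.+1%:Z).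
Proof.
move=> [/is_trig_mxP lT l1] [_ /is_diag_mxP hD] [/is_trig_mxP nT n1].
have iV (p : 'I_i.+1) : (inord p : 'I_r.+1) = p :> nat.
  by rewrite inordK // (leq_trans (ltn_ord p)) // ltnS ltnW.
pose B (y : 'M[K]_r.+1) := mxsub (inord : 'I_i.+1 -> 'I_r.+1) (inord : 'I_i.+1 -> 'I_r.+1) y.
have nz (p s : 'I_r.+1) : (p < s)%N -> n s p = 0 by move=> ps; have := nT p s ps; rewrite mxE.
have redl (A C : 'M[K]_r.+1) : (forall p s : 'I_r.+1, (p < s)%N -> A p s = 0) ->
    B (A *m C) = B A *m B C.
  move=> AT; apply/matrixP => p q; rewrite !mxE.
  rewrite (bigID (fun s : 'I_r.+1 => (s < i.+1)%N)) /= [X in _ + X]big1 ?addr0.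
    rewrite (big_ord_narrow (ltnW (ltn_ord i) : (i.+1 <= r.+1)%N)) /=.
    apply: eq_bigr => s _; rewrite !mxE.
    by congr (A _ _ * C _ _); apply: val_inj; rewrite /= iV.
  move=> s; rewrite -leqNgt => si; rewrite AT ?mul0r // iV.
  exact: leq_trans (ltn_ord p) si.
have hT (p s : 'I_r.+1) : (p < s)%N -> h p s = 0.
  by move=> ps; apply: hD; rewrite neq_ltn ps.
rewrite /lead_minor -/(B _) -mulrA redl // redl // !det_mulmx.
have iVi (p : 'I_i.+1) : inord p = widen_ord (ltnW (ltn_ord i) : (i.+1 <= r.+1)%N) p :> 'I_r.+1.
  by apply: val_inj; rewrite /= iV.
rewrite (det_trig (A := B l)); last first.
  by apply/is_trig_mxP => p q pq; rewrite mxE lT // !iV.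
rewrite (det_trig (A := B h)); last first.
  by apply/is_trig_mxP => p q pq; rewrite mxE hT // !iV.
rewrite -det_tr (det_trig (A := (B n)^T)); last first.
  by apply/is_trig_mxP => p q pq; rewrite !mxE nz // !iV.
rewrite [X in X * _]big1 ?mul1r => [|p _]; last by rewrite mxE l1.
rewrite [X in _ * X]big1 ?mulr1 => [|p _]; last by rewrite !mxE n1.
rewrite /torus_char (bigD1 i) //= mxE eqxx expr1z [X in _ * X]big1 ?mulr1.
  rewrite [RHS](big_ord_narrow (ltnW (ltn_ord i) : (i.+1 <= r.+1)%N)) /=.
  by apply: eq_bigr => p _; rewrite mxE iVi.
by move=> j ji; rewrite mxE eqz_nat eqSS val_eqE (negPf ji) expr0z.
Qed.

Lemma is_gminor_lead (i : 'I_r) w :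
  is_gminor i.+1%:Z w (fun x => lead_minor i.+1 (x * wbar K r w)).
Proof.
split; first exact: regular_lead_minor.
by move=> x l h n _ lN hH nN ->; rewrite lead_minor_ldu.
Qed.

End LeadingMinor.

(* Laurent monomials in the Y_{s,i}, written additively: the coefficient of
   (s, i) is the exponent zeta_{s,i}. *)
Notation monom := {freeg (int * int)%type}.

Section Crystal.
Variable r : nat.
Implicit Types (Y M : monom) (i s : int).

(* Y_{s,i}, with the convention Y_{s,i} = 1 when i is not a node *)
Definition Yvar s i : monom := if is_node r i then << (s, i) >> else 0.

Definition wt Y : 'rV[int]_r :=
  \sum_(p <- dom Y) Lam r p.2 *~ coeff p Y.

(* the sum of the zeta_{k,i} over k <= s *)
Definition psum i Y s : int :=
  \sum_(p <- dom Y | (p.2 == i) && (p.1 <= s)) coeff p Y.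

(* The partial sums vanish for s << 0 and only change at the support of Y, so
   that it suffices to take the maximum there: see crystal_phiP. *)
Definition crystal_phi i Y : int :=
  \big[Order.max/0]_(p <- dom Y | p.2 == i) psum i Y p.1.

Definition crystal_eps i Y : int :=
  crystal_phi i Y - \sum_(p <- dom Y | p.2 == i) coeff p Y.

(* the exponent p_{j,i} *)
Definition pexp (j i : int) : int :=
  (index j (jseq r) < index i (jseq r))%N%:Z.

(* A_{s,i}, with the convention A_{s,i} = 1 when i is not a node *)
Definition Amon s i : monom :=
  if is_node r i then
    Yvar s i + Yvar (s + 1) i
    + \sum_(j <- zrange 1 r%:Z | j != i) Yvar (s + pexp j i) j *~ cartan j i
  else 0.

(* the least n whose partial sum is crystal_phi i Y, when the latter is
   positive: see fnodeP *)
Definition fnode i Y : int :=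
  let s := [seq p.1 | p <- dom Y & (p.2 == i)
                                     && (psum i Y p.1 == crystal_phi i Y)] in
  \big[Order.min/head 0 s]_(n <- s) n.

Lemma psum_dom i Y s : 0 < psum i Y s ->
  exists p, [/\ p \in dom Y, p.2 == i, p.1 <= s &
                psum i Y p.1 = psum i Y s].
Proof.
move=> s_gt0; pose L := [seq p.1 | p <- dom Y & (p.2 == i) && (p.1 <= s)].
have L_n0 : L != [::].
  apply: contraTneq s_gt0 => L0; rewrite /psum -big_filter.
  have /eqP : size L = 0%N by rewrite L0.
  by rewrite /L size_map size_eq0 => /eqP ->; rewrite big_nil ltxx.
have [n nL nmax] : exists2 n, n \in L & forall m, m \in L -> m <= n.
  elim: L L_n0 => [//|m [|m' L] IH _].
    by exists m; rewrite ?mem_head // => m'; rewrite inE => /eqP ->.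
  have [n nL nmax] := IH isT; exists (Num.max m n).
    by rewrite inE; case: leP => _; rewrite ?nL ?orbT // eqxx.
  move=> q; rewrite inE => /orP[/eqP ->|/nmax qn]; first by rewrite le_max lexx.
  by rewrite le_max qn orbT.
move: nL => /mapP[p]; rewrite mem_filter => /andP[/andP[pi ps] pY] np.
exists p; split => //; rewrite /psum -np.
rewrite big_seq_cond [RHS]big_seq_cond; apply: eq_bigl => q.
case qY: (q \in _) => //=; case qi: (q.2 == i) => //=.
apply/idP/idP => [qn|qs]; first by rewrite (le_trans qn) // np.
by apply/nmax/mapP; exists q; rewrite // mem_filter qi qs.
Qed.

Lemma crystal_phiP i Y :
  (forall s, psum i Y s <= crystal_phi i Y) /\
  (exists s, psum i Y s = crystal_phi i Y).
Proof.
have phi_ge0 : 0 <= crystal_phi i Y.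
  by rewrite /crystal_phi; elim/big_rec: _ => // p x _ x0; rewrite le_max x0 orbT.
split=> [s|].
  case: (lerP (psum i Y s) 0) => [/le_trans-> //|/psum_dom [p [pY pi _ <-]]].
  exact: (le_bigmax_seq _ p _ (fun q => psum i Y q.1)).
pose P x := exists s, psum i Y s = x.
rewrite -/(P _) /crystal_phi; elim/big_rec: _ => [|p x _ Px]; last first.
  by case: leP => _ //; exists p.1.
exists (\big[Order.min/0]_(p <- dom Y) p.1 - 1).
rewrite /psum big_seq_cond big1 // => p /andP[pY /andP[_]].
by rewrite leNgt ltrBlDr ltzD1 (ge_bigmin_seq _ p _ fst).
Qed.

Lemma fnodeP i Y : 0 < crystal_phi i Y ->
  psum i Y (fnode i Y) = crystal_phi i Y /\
  (forall n, psum i Y n = crystal_phi i Y -> fnode i Y <= n).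
Proof.
move=> phi_gt0.
pose s := [seq p.1 | p <- dom Y & (p.2 == i)
                                    && (psum i Y p.1 == crystal_phi i Y)].
have sP n : psum i Y n = crystal_phi i Y -> exists2 m, m \in s & m <= n.
  move=> En; have /psum_dom[p [pY pi pn Ep]] : 0 < psum i Y n by rewrite En.
  exists p.1 => //; apply/mapP; exists p => //.
  by rewrite mem_filter pi Ep En eqxx.
have [[n En] s0] : (exists n, psum i Y n = crystal_phi i Y)
                  /\ {in s, forall n, psum i Y n = crystal_phi i Y}.
  split; first exact: (crystal_phiP i Y).2.
  by move=> n /mapP[p]; rewrite mem_filter => /andP[/andP[_ /eqP Ep] _] ->.
have ns : s != [::] by have [m] := sP n En; case: (s).
have min_s : fnode i Y \in s.
  rewrite /fnode -/s; have : head 0 s \in s by case: (s) ns => // *; exact: mem_head.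
  move: (head 0 s) => d ds.
  suff: forall t, {subset t <= s} -> \big[Order.min/d]_(n <- t) n \in s by apply.
  elim=> [|m t IH] sub; first by rewrite big_nil.
  rewrite big_cons; case: leP => _; first by apply: sub; rewrite mem_head.
  by apply: IH => x xt; apply: sub; rewrite inE xt orbT.
split=> [|m /sP[q qs qm]]; first exact: s0.
apply: le_trans qm; rewrite /fnode -/s.
exact: (ge_bigmin_seq _ q _ id).
Qed.

(* None stands for the element 0 adjoined to the crystal *)
Definition ftilde i Y : option monom :=
  if 0 < crystal_phi i Y then Some (Y - Amon (fnode i Y) i) else None.

(* f_(i_1)^(m_1) ... f_(i_n)^(m_n) M *)
Fixpoint fpow (w : seq int) (m : seq nat) M : option monom :=
  match w, m with
  | i :: w', n :: m' => iter n (obind (ftilde i)) (fpow w' m' M)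
  | _, _ => Some M
  end.

(* the Demazure crystal of the reduced word w in the monomial realization with
   highest weight vector M *)
Definition demazure (w : seq int) M : set monom :=
  [set Y | exists2 m : seq nat, size m = size w & fpow w m M = Some Y].

Definition has_highest_weight M (lam : 'rV[int]_r) : Prop :=
  (forall i, is_node r i -> crystal_eps i M = 0) /\ wt M = lam.

(* for integers b < c *)
Definition Abr (b c x : int) : monom :=
  - (\sum_(s <- zrange b (c - 1))
        (Amon 1 (x - 2 * s - 2) + Amon 1 (x - 2 * s - 3)))
  - Amon 1 (x - 2 * c - 2).

(* A pair of sequences (b, c) of the same length p is represented by the
   sequence (b_1, c_1), ..., (b_p, c_p). *)
Definition Abrs (bc : seq (int * int)) (x : int) : monom :=
  \sum_(d <- bc) Abr d.1 d.2 x.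

Definition alphabr (bc : seq (int * int)) (x : int) : 'rV[int]_r :=
  \sum_(d <- bc) \sum_(t <- zrange (x - 2 * d.2 - 2) (x - 2 * d.1 - 2))
    alpha r t.

End Crystal.

Definition b1 (bc : seq (int * int)) : int := (head (0, 0) bc).1.
Definition cp (bc : seq (int * int)) : int := (last (0, 0) bc).2.

(* (- c, - b) *)
Definition opp_bc (bc : seq (int * int)) : seq (int * int) :=
  [seq (- d.2, - d.1) | d <- bc].

(* the union of the sets R^p_l over p > 0 *)
Definition Rset (l : int) : set (seq (int * int)) :=
  [set bc | bc != [::]
     /\ let s := flatten [seq [:: d.1; d.2] | d <- bc] in
        sorted <%R s && all (fun t => 0 <= t <= l) s].

(* [p, q] \ [b, c] *)
Definition zrange_minus (p q : int) (bc : seq (int * int)) : seq int :=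
  [seq t <- zrange p q | ~~ has (fun d => d.1 <= t <= d.2) bc].

Section TotalSum.
Variables (K : fieldType) (r : nat).

Definition monom_eval (Y : int -> int -> K) (M : monom) : K :=
  \prod_(p <- dom M) Y p.1 p.2 ^ coeff p M.

(* S_w(M) *)
Definition demazure_sum (Y : int -> int -> K) (w : seq int) (M : monom) : K :=
  \sum_(Z \in demazure r w M) monom_eval Y Z.

(* phi, pulled back by xbar, is the total sum of monomials in the Demazure
   crystals B(lam)_w and B(lamI t)_(wI t), t in I, with highest weight
   monomials M and MI t.
   Values are given to all the variables Y_{s,i}, whereas phi (xbar a Y) only
   involves s = 1, 2: the equality also says that S_w(M) + ... does not depend
   on the variables with s <> 1, 2. *)
Definition is_demazure_total (phi : 'M[K]_r.+1 -> K)
    (lam : 'rV[int]_r) (w : seq int) (M : monom)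
    (I : set (seq (int * int)))
    (lamI : seq (int * int) -> 'rV[int]_r)
    (wI : seq (int * int) -> seq int)
    (MI : seq (int * int) -> monom) : Prop :=
  [/\ has_highest_weight M lam,
      forall t, I t -> has_highest_weight (MI t) (lamI t) &
      exists chi : 'rV[int]_r,
        forall (a : 'M[K]_r.+1) (Y : int -> int -> K),
          torusH a -> (forall s i, Y s i != 0) ->
          phi (xbar a Y) = torus_char a chi *
            (demazure_sum Y w M
             + \sum_(t \in I) demazure_sum Y (wI t) (MI t))].

End TotalSum.

Section Sequences.
Variable r : nat.

Definition hf : int := (r./2)%:Z.      (* floor (r / 2) *)
Definition uhf : int := (r.+1./2)%:Z.  (* floor ((r + 1) / 2) *)

Definition mu1 (k l : int) : seq int :=
  flatten [seq [:: k - hf + q; k + q + 1; k + q] | q <- rev (zrange 0 l)].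

Definition mu2 (k l : int) : seq int :=
  flatten [seq [:: k + q + 1; hf + k + q + 2; hf + k + q + 1]
          | q <- rev (zrange 0 l)] ++ [:: k].

(* mu3 (-1) is the single mutation at floor ((r + 1) / 2) *)
Definition mu3 (l : int) : seq int :=
  flatten [seq [:: uhf - q - 1; r%:Z - q - 1; r%:Z - q]
          | q <- rev (zrange 0 l)] ++ [:: uhf].

End Sequences.

(* Main.v *)
(** Multiplying out the factors of the chart two parities at a time, one finds the initial minors as
   explicit rational functions: up to a character of [a] one has P = 1, Q = Y_1 Y_2, and M is a sum of
   at most three terms.  Each sequence of mutations then moves along a ladder of adjacent nodes, three
   mutations at a time; cancelling the variables that are exchanged, the two new variables F, G obtained
   at each rung satisfy
     F' = u v F + Q Q' G / v'    and    G' = u F + M Q' G / v',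
   where u, v, v' are coordinates Y_1, Y_2 of neighbouring nodes.
   On the crystal side every monomial reached is flat: each Kashiwara operator of the Demazure word acts
   on it at most once and distinct letters do not interact, so each Demazure sum is a highest weight
   monomial times a product of factors 1 + A^{-1} (or 1 + A^{-1} (1 + A'^{-1}) at an end).  Summing over
   the configurations of disjoint intervals gives the transfer recursion
     U' = U + E',   E' = A^{-1} (U + O^{-1} E)
   according to whether the last slot is covered, and this is the same recursion as that of F and G. *)
Require Import Defs.
From mathcomp Require Import all_boot all_order all_algebra all_fingroup.
From mathcomp Require Import classical_sets fsbigop boolp reals complex freeg.
From mathcomp Require mpoly.
From mathcomp Require Import zify ring lra.

Set Implicit Arguments.
Unset Strict Implicit.
Unset Printing Implicit Defensive.
Import Order.TTheory GRing.Theory Num.Theory.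
Local Open Scope ring_scope.

(** * Generalized minors and reduced words *)

(** An exchange relation determines the new variable only where the old one is nonzero, and the old
    one may vanish at points of the chart. Each value is therefore compared along the line joining Y
    to the all-ones point, where the functions that occur are positive, and carried back to Y by
    regularity. The same device extends the generalized minors, prescribed only on N_- H N, to the
    whole chart. The mutations climb the diagram in one case and descend it in the others. Both are
    treated at once by a direction d = 1 or -1 and integer positions; positions outside [1, r] stay
    in all lists with value 1, so that the ends of the diagram need few separate formulas. The
    quiver is never described as a whole: only the columns of the exchange matrix at the vertices
    about to be mutated are followed. Two of the three sequences start with an extra mutation at an
    odd node. Their start is recognised as the general step applied to a pair of functions placed
    one step earlier, so that the same recursion covers them. *)

Section Elementary.
Variables (K : fieldType) (r : nat).
Implicit Types (k : 'I_r) (y : 'M[K]_r.+1).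

Definition c0 k : 'I_r.+1 := widen_ord (leqnSn r) k.
Definition c1 k : 'I_r.+1 := fintype.lift (ord0 : 'I_r.+1) k.

Lemma c0_neq_c1 k : (c0 k == c1 k) = false.
Proof. by apply/negbTE; rewrite -val_eqE /= /bump /= add1n neq_ltn ltnSn. Qed.

(** The 2 x 2 matrix with rows (a, b) and (c, d), placed in the rows and columns [c0 k] and [c1 k].
    At the node k + 1 all of [xmx], [ymx], [coroot] and [sbar] have this form, and identities
    between them become 2 x 2 computations through [el_mul_el]. *)
Definition el k (a b c d : K) : 'M[K]_r.+1 := \matrix_(p, q)
  (if q == c0 k then (p == c0 k)%:R * a + (p == c1 k)%:R * c
   else if q == c1 k then (p == c0 k)%:R * b + (p == c1 k)%:R * d
   else (p == q)%:R).

Lemma mul_el y k a b c d p q : (y * el k a b c d) p q =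
  if q == c0 k then y p (c0 k) * a + y p (c1 k) * c
  else if q == c1 k then y p (c0 k) * b + y p (c1 k) * d else y p q.
Proof.
rewrite mxE; under eq_bigr do rewrite mxE.
have sel (u v : K) : \sum_(s < r.+1) y p s * ((s == c0 k)%:R * u + (s == c1 k)%:R * v)
   = y p (c0 k) * u + y p (c1 k) * v.
  under eq_bigr do rewrite mulrDr.
  rewrite big_split /=; congr (_ + _).
    rewrite (bigD1 (c0 k)) //= eqxx mul1r big1 ?addr0 // => s /negPf->.
    by rewrite mul0r mulr0.
  rewrite (bigD1 (c1 k)) //= eqxx mul1r big1 ?addr0 // => s /negPf->.
  by rewrite mul0r mulr0.
case: eqP => _; first exact: sel.
case: eqP => _; first exact: sel.
rewrite (bigD1 q) //= eqxx mulr1 big1 ?addr0 // => s /negPf->.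
by rewrite mulr0.
Qed.

Lemma el_mul_el k a b c d a' b' c' d' :
  el k a b c d * el k a' b' c' d'
  = el k (a * a' + b * c') (a * b' + b * d') (c * a' + d * c') (c * b' + d * d').
Proof.
apply/matrixP => p q; rewrite mul_el !mxE eqxx [c1 k == _]eq_sym c0_neq_c1 eqxx.
by case: eqP => _; [ring|]; case: eqP => _ //; ring.
Qed.

Lemma el1 k : el k 1 0 0 1 = 1.
Proof.
apply/matrixP => p q; rewrite !mxE.
by case: eqP => [->|_]; [|case: eqP => [->|//]]; rewrite mulr0 mulr1 ?addr0 ?add0r.
Qed.

Lemma eqz_c0 (p : 'I_r.+1) k : (p.+1%:Z == k.+1%:Z) = (p == c0 k).
Proof. by rewrite -val_eqE /= eqz_nat eqSS. Qed.

Lemma eqz_c1 (p : 'I_r.+1) k : (p.+1%:Z == k.+1%:Z + 1) = (p == c1 k).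
Proof. by rewrite -val_eqE /= /bump /= add1n; apply/eqP/eqP; lia. Qed.

Lemma mxE_addscale (t : K) (A : 'M[K]_r.+1) p q : (1 + t *: A) p q = (p == q)%:R + t * A p q.
Proof. by rewrite !mxE. Qed.

Lemma xmxE k t : xmx r k.+1%:Z t = el k 1 t 0 1 :> 'M[K]_r.+1.
Proof.
apply/matrixP => p q; rewrite mxE_addscale !mxE eqz_c0 eqz_c1.
case: (eqVneq q (c0 k)) => [->|_] /=; first by rewrite c0_neq_c1 andbF !mulr0 mulr1.
case: (eqVneq q (c1 k)) => [->|_] /=; last by rewrite andbF mulr0 addr0.
by rewrite andbT addrC mulr1 [t * _]mulrC.
Qed.

Lemma ymxE k t : ymx r k.+1%:Z t = el k 1 0 t 1 :> 'M[K]_r.+1.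
Proof.
apply/matrixP => p q; rewrite mxE_addscale !mxE eqz_c0 eqz_c1.
case: (eqVneq q (c0 k)) => [->|_] /=; first by rewrite andbT mulr1 [t * _]mulrC.
case: (eqVneq q (c1 k)) => [->|_] /=; last by rewrite andbF mulr0 addr0.
by rewrite andbF !mulr0 add0r addr0 mulr1.
Qed.

Lemma corootE k t : coroot r k.+1%:Z t = el k t 0 0 t^-1 :> 'M[K]_r.+1.
Proof.
apply/matrixP => p q; rewrite !mxE eqz_c0 eqz_c1.
case: (eqVneq q (c0 k)) => [->|q0].
  case: (eqVneq p (c0 k)) => [->|p0]; first by rewrite c0_neq_c1 mulr1n mul1r mul0r addr0.
  by rewrite mulr0n mul0r mulr0 addr0.
case: (eqVneq q (c1 k)) => [->|q1].
  case: (eqVneq p (c0 k)) => [->|p0]; first by rewrite c0_neq_c1 !mulr0n mul0r mulr0 addr0.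
  by case: eqP => _; rewrite !(mulr1n, mulr0n) ?mul0r ?mul1r ?mulr0 add0r.
case: (eqVneq p q) => [->|//]; first by rewrite (negPf q0) (negPf q1).
Qed.

Lemma sbarE k : sbar K r k.+1%:Z = el k 0 (-1) 1 0.
Proof. by rewrite /sbar xmxE ymxE !el_mul_el; congr el; ring. Qed.

Lemma el_tr k a b c d : (el k a b c d)^T = el k a c b d.
Proof.
apply/matrixP => p q; rewrite !mxE [p == q]eq_sym.
case: (eqVneq p (c0 k)) => [pE|p0]; [|case: (eqVneq p (c1 k)) => [pE|p1]];
  (case: (eqVneq q (c0 k)) => [qE|q0]; [|case: (eqVneq q (c1 k)) => [qE|q1]]);
  by rewrite ?pE ?qE ?eqxx ?[c1 k == _]eq_sym ?c0_neq_c1 ?(negPf q0) ?(negPf q1)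
    ?[c0 k == p]eq_sym ?[c1 k == p]eq_sym ?(negPf p0) ?(negPf p1) ?mul0r ?mul1r ?addr0 ?add0r.
Qed.

Lemma mul_el_l y k a b c d p q : (el k a b c d * y) p q =
  if p == c0 k then a * y (c0 k) q + b * y (c1 k) q
  else if p == c1 k then c * y (c0 k) q + d * y (c1 k) q else y p q.
Proof.
have -> : (el k a b c d * y) p q = (y^T * el k a c b d) q p.
  have /matrixP/(_ q p) <- : (el k a b c d * y)^T = y^T * el k a c b d.
    by rewrite -(el_tr k a b c d); exact: trmx_mul.
  by rewrite [RHS]mxE.
by rewrite mul_el !mxE; case: ifP => _; [|case: ifP => // _]; congr (_ + _); rewrite mulrC.
Qed.

End Elementary.

(** * Leading minors under right multiplication by simple reflections *)

Section Minors.
Variables (K : fieldType) (r : nat).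
Implicit Types (k : 'I_r) (y A C : 'M[K]_r.+1).

Definition lblock (i : nat) y : 'M[K]_i := mxsub (inord : 'I_i -> 'I_r.+1) inord y.

Lemma lead_minorE i y : lead_minor i y = \det (lblock i y).
Proof. by []. Qed.

Lemma inord_lt i (ir : (i <= r.+1)%N) (p : 'I_i) : (inord p : 'I_r.+1) = p :> nat.
Proof. by rewrite inordK // (leq_trans (ltn_ord p)). Qed.

Lemma lblock_mulr i A C : (i <= r.+1)%N ->
  (forall p q : 'I_r.+1, (q < i)%N -> (i <= p)%N -> C p q = 0) ->
  lblock i (A * C) = lblock i A *m lblock i C.
Proof.
move=> ir CT; apply/matrixP => p q; rewrite !mxE.
rewrite (bigID (fun s : 'I_r.+1 => (s < i)%N)) /= [X in _ + X]big1 ?addr0.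
  rewrite (big_ord_narrow ir) /=; apply: eq_bigr => s _; rewrite !mxE.
  by congr (A _ _ * C _ _); apply: val_inj; rewrite /= inord_lt.
by move=> s; rewrite -leqNgt => si; rewrite CT ?mulr0 // inord_lt.
Qed.

Lemma lead_mulr i A C : (i <= r.+1)%N ->
  (forall p q : 'I_r.+1, (q < i)%N -> (i <= p)%N -> C p q = 0) ->
  lead_minor i (A * C) = lead_minor i A * lead_minor i C.
Proof. by move=> ir CT; rewrite !lead_minorE lblock_mulr // det_mulmx. Qed.

Lemma lead_tr i y : lead_minor i y^T = lead_minor i y.
Proof.
by rewrite !lead_minorE -[RHS]det_tr; congr (\det _); apply/matrixP => p q; rewrite !mxE.
Qed.

Lemma lead_mull i A C : (i <= r.+1)%N ->
  (forall p q : 'I_r.+1, (p < i)%N -> (i <= q)%N -> A p q = 0) ->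
  lead_minor i (A * C) = lead_minor i A * lead_minor i C.
Proof.
move=> ir AT; rewrite -lead_tr -[(A * C)]/(A *m C) trmx_mul lead_mulr //.
  by rewrite !lead_tr mulrC.
by move=> p q qi ip; rewrite mxE AT.
Qed.

Lemma lead_upper i y : (i <= r.+1)%N ->
  (forall p q : 'I_r.+1, (q < p)%N -> y p q = 0) ->
  lead_minor i y = \prod_(p < r.+1 | (p < i)%N) y p p.
Proof.
move=> ir yT; rewrite lead_minorE -det_tr (det_trig (A := (lblock i y)^T)); last first.
  by apply/is_trig_mxP => p q pq; rewrite !mxE yT // !inord_lt.
rewrite (big_ord_narrow ir); apply: eq_bigr => p _; rewrite !mxE.
by congr (y _ _); apply: val_inj; rewrite /= inord_lt.
Qed.

Lemma lead_lower i y : (i <= r.+1)%N ->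
  (forall p q : 'I_r.+1, (p < q)%N -> y p q = 0) ->
  lead_minor i y = \prod_(p < r.+1 | (p < i)%N) y p p.
Proof.
move=> ir yT; rewrite -lead_tr lead_upper //; last by move=> p q qp; rewrite mxE yT.
by apply: eq_bigr => p _; rewrite mxE.
Qed.

(** The three elementary factors of [sbar] are block triangular for the cut after the first i
    positions, with leading minor 1, unless the cut separates the two rows of the letter, that is
    unless i is the node k + 1. So the minor attached to a node changes only when its own letter is
    read. *)
Lemma lead_sbar i y k : (i <= r.+1)%N -> i != k.+1 ->
  lead_minor i (y * sbar K r k.+1%:Z) = lead_minor i y.
Proof.
move=> ir ik; have rk := ltn_ord k.
have Hx t : lead_minor i (el k 1 t 0 1 : 'M[K]_r.+1) = 1.
  rewrite lead_upper // => [|p q qp].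
    apply: big1 => p _; rewrite mxE; case: (eqVneq p (c0 k)) => [->|_].
      by rewrite c0_neq_c1 mul0r addr0 mulr1.
    by case: eqP; rewrite ?eqxx // mul0r add0r mulr1.
  rewrite mxE -!val_eqE /= /bump /= add1n.
  case: eqP => [qE|_]; first by rewrite gtn_eqF ?mul0r ?add0r ?mulr0 // -qE.
  case: eqP => [qE|_]; last by rewrite gtn_eqF.
  by rewrite qE in qp; rewrite !gtn_eqF ?mul0r ?addr0 // ltnW.
have Hy t : lead_minor i (el k 1 0 t 1 : 'M[K]_r.+1) = 1.
  by rewrite -lead_tr el_tr Hx.
have Vx t : forall p q : 'I_r.+1, (q < i)%N -> (i <= p)%N -> (el k 1 t 0 1 : 'M[K]_r.+1) p q = 0.
  move=> p q qi ip; have qp := leq_trans qi ip; rewrite mxE -!val_eqE /= /bump /= add1n.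
  case: eqP => [qE|_]; first by rewrite gtn_eqF ?mul0r ?add0r ?mulr0 // -qE.
  case: eqP => [qE|_]; last by rewrite gtn_eqF.
  by rewrite qE in qp; rewrite !gtn_eqF ?mul0r ?addr0 // ltnW.
have Vy t : forall p q : 'I_r.+1, (q < i)%N -> (i <= p)%N -> (el k 1 0 t 1 : 'M[K]_r.+1) p q = 0.
  move=> p q qi ip; have qp := leq_trans qi ip; rewrite mxE -!val_eqE /= /bump /= add1n.
  case: eqP => [qE|_].
    rewrite gtn_eqF -?qE // mul0r add0r; case: eqP => [pE|_]; last by rewrite mul0r.
    by move: ik qi ip; rewrite pE qE; lia.
  case: eqP => [qE|_]; last by rewrite gtn_eqF.
  by rewrite mulr0 add0r qE in qp *; rewrite gtn_eqF ?mul0r.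
rewrite /sbar !xmxE !ymxE !mulrA.
by rewrite (lead_mulr _ ir (Vx _)) (lead_mulr _ ir (Vy _)) (lead_mulr _ ir (Vx _)) !Hx Hy !mulr1.
Qed.

Lemma lead_wbar i y (w : seq 'I_r) : (i <= r.+1)%N -> all (fun k => i != (nat_of_ord k).+1) w ->
  lead_minor i (y * wbar K r [seq (nat_of_ord k).+1%:Z | k <- w]) = lead_minor i y.
Proof.
move=> ir; rewrite /wbar; elim: w y => [|k w IH] y; first by rewrite big_nil mulr1.
by move=> /= /andP[ik iw]; rewrite big_cons mulrA IH // lead_sbar.
Qed.

End Minors.

(** * Products over a reduced word lie in N_- w N_- *)

Section Word.
Variables (K : fieldType) (r : nat).
Implicit Types (k : 'I_r) (l : seq ('I_r * K)) (m y : 'M[K]_r.+1).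

Lemma lowerN1 : @lowerN K r 1.
Proof.
split; last by move=> p; rewrite mxE eqxx.
by apply/is_trig_mxP => p q pq; rewrite mxE -val_eqE /= ltn_eqF.
Qed.

Lemma lowerN_mul m y : lowerN m -> lowerN y -> lowerN (m * y).
Proof.
move=> [/is_trig_mxP mT m1] [/is_trig_mxP yT y1]; split.
  apply/is_trig_mxP => p q pq; rewrite mxE big1 // => s _.
  by case: (ltnP p s) => [/mT->|sp]; rewrite ?mul0r // yT ?mulr0 // (leq_ltn_trans sp).
move=> p; rewrite mxE (bigD1 p) //= m1 y1 mulr1 big1 ?addr0 // => s sp.
case: (ltngtP p s) => [/mT->|/yT->|/val_inj ps]; rewrite ?mul0r ?mulr0 //.
by rewrite ps eqxx in sp.
Qed.

Lemma lowerN_delta c (p q : 'I_r.+1) : (q < p)%N -> lowerN (1 + c *: delta_mx p q : 'M[K]_r.+1).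
Proof.
move=> qp; split.
  apply/is_trig_mxP => u v uv; rewrite !mxE -!val_eqE /= ltn_eqF // add0r.
  case: eqP => [up|_]; last by rewrite mulr0.
  by case: eqP => [vq|_]; rewrite ?mulr0 //; by move: uv; rewrite up vq ltnNge ltnW.
move=> u; rewrite !mxE eqxx; case: eqP => [->|_]; last by rewrite mulr0 addr0.
by rewrite -val_eqE /= gtn_eqF // mulr0 addr0.
Qed.

Lemma el_y_delta k c : el k 1 0 c 1 = 1 + c *: delta_mx (c1 k) (c0 k) :> 'M[K]_r.+1.
Proof.
rewrite -ymxE; congr (1 + _ *: _); apply/matrixP => p q; rewrite !mxE eqz_c0 eqz_c1.
by [].
Qed.

Lemma c0_lt_c1 k : (c0 k < c1 k)%N.
Proof. by rewrite /= /bump /= add1n. Qed.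

Lemma lowerN_y k c : lowerN (el k 1 0 c 1 : 'M[K]_r.+1).
Proof. rewrite el_y_delta; exact/lowerN_delta/c0_lt_c1. Qed.

(** Each factor is x_k(t) times the coroot at t, as in the chart. In [mw] below, the factor
    [el k 0 1 (-1) 0] is the inverse of [sbar]; this is the representative that comes out when a
    factor of [xw] is decomposed. *)
Definition xw l : 'M[K]_r.+1 := \prod_(d <- l) el d.1 d.2 1 0 d.2^-1.
Definition mw (w : seq 'I_r) : 'M[K]_r.+1 := \prod_(k <- w) el k 0 1 (-1) 0.
Definition sw (w : seq 'I_r) : {perm 'I_r.+1} := (\prod_(k <- w) tperm (c0 k) (c1 k))%g.
(** Permutations are composed from left to right, so [sw (k :: w)] applies the transposition of k
    first. Prepending k lengthens the word exactly when [sw w] does not invert the two positions of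
    k. *)
Fixpoint redw (w : seq 'I_r) : bool :=
  if w is k :: w' then (sw w' (c0 k) < sw w' (c1 k))%N && redw w' else true.

(** Signed permutation matrices. The signs are left existential because [mw] and [wbar] of one word
    have the same permutation but different signs. *)
Definition mono (s : {perm 'I_r.+1}) m : Prop :=
  exists2 e : 'I_r.+1 -> K, (forall p, e p ^+ 2 = 1) & forall p q, m p q = (q == s p)%:R * e p.

Lemma mono_mw w : mono (sw w) (mw w).
Proof.
elim: w => [|k w [e e1 IH]]; rewrite /sw /mw.
  exists (fun _ => 1) => [p|p q]; rewrite ?expr1n // !big_nil perm1 mxE mulr1 eq_sym.
  by [].
rewrite !big_cons -/(sw w) -/(mw w).
exists (fun p => if p == c0 k then e (c1 k) else if p == c1 k then - e (c0 k) else e p) => [p|p q].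
  by case: eqP => _; [|case: eqP => _]; rewrite ?sqrrN.
rewrite mul_el_l !IH permM.
case: (eqVneq p (c0 k)) => [->|p0]; first by rewrite tpermL mul0r add0r mul1r.
case: (eqVneq p (c1 k)) => [->|p1]; first by rewrite tpermR mul0r addr0 mulN1r mulrN.
by rewrite tpermD // eq_sym.
Qed.

(** Conjugating y_k(c) by a signed permutation gives an element of the root subgroup at row s (c1 k)
    and column s (c0 k). It is lower triangular when s (c0 k) < s (c1 k), which is the condition in
    [redw]. *)
Lemma mono_y s m k c : mono s m -> exists c',
  el k 1 0 c 1 * m = m * (1 + c' *: delta_mx (s (c1 k)) (s (c0 k))).
Proof.
move=> [e e1 mE]; exists (c * e (c0 k) * e (c1 k)).
rewrite mulrDr mulr1 el_y_delta mulrDl mul1r; congr (_ + _).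
apply/matrixP => p q; rewrite !mxE (bigD1 (c0 k)) //= big1 ?addr0; last first.
  by move=> u u0; rewrite !mxE (negPf u0) andbF mulr0 mul0r.
rewrite (bigD1 (s (c1 k))) //= [X in _ = _ + X]big1 ?addr0; last first.
  by move=> u u0; rewrite !mxE (negPf u0) !mulr0.
rewrite !mxE !mE !eqxx /= andbT (inj_eq perm_inj) [c1 k == p]eq_sym.
case: (eqVneq p (c1 k)) => [->|_]; last by rewrite !mulr0 !mul0r.
case: (q == _); rewrite ?mulr0 ?mul0r ?mulr0 // !mul1r !mulr1.
by rewrite [RHS]mulrC -[RHS]mulrA -expr2 e1 mulr1.
Qed.

(** The entry c of y at the simple root is split off on the right. What remains lies in the
    unipotent radical of the lower minimal parabolic of k, which the reflection normalises. *)
Lemma conj_y_lowerN k y : lowerN y -> exists y', lowerN y' /\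
   exists c, el k 0 1 (-1) 0 * y = y' * el k 0 1 (-1) 0 * el k 1 0 c 1.
Proof.
move=> [/is_trig_mxP yT y1]; set c := y (c1 k) (c0 k).
pose z := y * el k 1 0 (- c) 1.
exists (el k 0 1 (-1) 0 * z * el k 0 (-1) 1 0); split; last first.
  have S1 : el k 0 (-1) 1 0 * el k 0 1 (-1) 0 = 1 :> 'M[K]_r.+1.
    by rewrite el_mul_el -[RHS](el1 K k); congr el; ring.
  have Y1 : el k 1 0 (- c) 1 * el k 1 0 c 1 = 1 :> 'M[K]_r.+1.
    by rewrite el_mul_el -[RHS](el1 K k); congr el; ring.
  exists c; rewrite -(mulrA (_ * z)) S1 mulr1 -mulrA /z -(mulrA y) Y1 mulr1.
  by [].
have y01 : y (c0 k) (c1 k) = 0 by apply/yT/c0_lt_c1.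
split.
  apply/is_trig_mxP => p q pq.
  rewrite mul_el !mul_el_l /z !mul_el !eqxx ![c1 k == c0 k]eq_sym !c0_neq_c1 !y1 y01 -/c.
  case: (eqVneq q (c0 k)) => [qE|q0].
    rewrite qE in pq.
    have p0 : (p == c0 k) = false by rewrite -val_eqE /= ltn_eqF.
    have p1 : (p == c1 k) = false.
      by rewrite -val_eqE /= ltn_eqF // (ltn_trans pq) // c0_lt_c1.
    rewrite p0 p1 !yT // ?(ltn_trans pq) ?c0_lt_c1 //; ring.
  case: (eqVneq q (c1 k)) => [qE|q1].
    rewrite qE in pq.
    case: (eqVneq p (c0 k)) => [pE|p0]; first by ring.
    have p1 : (p == c1 k) = false by rewrite -val_eqE /= ltn_eqF.
    have pc : (p < c0 k)%N.
      by move: pq p0; rewrite -val_eqE /= /bump /= add1n ltnS => pq p0; rewrite ltn_neqAle p0.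
    rewrite p1 !yT //; ring.
  case: (eqVneq p (c0 k)) => [pE|p0].
    rewrite pE in pq.
    have pc : (c1 k < q)%N.
      by move: pq q1; rewrite -!val_eqE /= /bump /= add1n => pq q1; rewrite ltn_neqAle eq_sym q1.
    rewrite !yT //; ring.
  case: (eqVneq p (c1 k)) => [pE|p1].
    rewrite pE in pq.
    rewrite !yT // ?(ltn_trans (c0_lt_c1 k) pq) //; ring.
  by rewrite yT.
move=> p; rewrite mul_el !mul_el_l /z !mul_el !eqxx ![c1 k == c0 k]eq_sym !c0_neq_c1 !y1 y01 -/c.
case: (eqVneq p (c0 k)) => [pE|p0]; first by ring.
by case: (eqVneq p (c1 k)) => [pE|p1]; first by ring.
Qed.

(** Each factor is y_k(t^-1) s y_k(t), with s the inverse of [sbar]. The lower unipotent matrix to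
    the right of s is moved to its left by [conj_y_lowerN], at the price of one factor y_k(c);
    [mono_y] carries that factor through the rest of the word, and reducedness keeps it in N_-. *)
Lemma xw_bruhat l : all (fun d => d.2 != 0) l -> redw [seq d.1 | d <- l] ->
  exists y1 y2, [/\ lowerN y1, lowerN y2 & xw l = y1 * mw [seq d.1 | d <- l] * y2].
Proof.
elim: l => [|[k t] l IH] /=; rewrite /xw /mw.
  by move=> _ _; exists 1, 1; split; rewrite ?big_nil ?mulr1 //; exact: lowerN1.
move=> /andP[t0 /IH{}IH] /andP[sk /IH[y1 [y2 [y1N y2N xE]]]].
rewrite !big_cons -/(xw l) -/(mw [seq d.1 | d <- l]) /= xE.
have -> : el k t 1 0 t^-1 = el k 1 0 t^-1 1 * el k 0 1 (-1) 0 * el k 1 0 t 1 :> 'M[K]_r.+1.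
  by rewrite !el_mul_el; congr el; field.
have [|y' [y'N [c cE]]] := @conj_y_lowerN k (el k 1 0 t 1 * y1).
  exact/lowerN_mul/y1N/lowerN_y.
have [c' c'E] := mono_y k c (mono_mw [seq d.1 | d <- l]).
exists (el k 1 0 t^-1 1 * y'), ((1 + c' *: delta_mx (sw [seq d.1 | d <- l] (c1 k)) (sw [seq d.1 | d <- l] (c0 k))) * y2).
split; first exact/lowerN_mul/y'N/lowerN_y.
  exact/lowerN_mul/y2N/lowerN_delta.
transitivity (el k 1 0 t^-1 1 * (el k 0 1 (-1) 0 * (el k 1 0 t 1 * y1)) * mw [seq d.1 | d <- l] * y2).
  by rewrite !mulrA.
rewrite cE -!mulrA; do 3 congr (_ * _).
by rewrite mulrA c'E -!mulrA.
Qed.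

End Word.

(** * Comparison of Weyl group representatives, and leading minors of conjugates *)

Section Membership.
Variables (K : fieldType) (r : nat).
Implicit Types (k : 'I_r) (w : seq 'I_r).

Definition nodei k : int := (nat_of_ord k).+1%:Z.

Lemma el_sV k : el k 0 1 (-1) 0 * el k 0 (-1) 1 0 = 1 :> 'M[K]_r.+1.
Proof. by rewrite el_mul_el -[RHS](el1 K k); congr el; ring. Qed.

Lemma mono_wbar w : mono (sw w) (wbar K r [seq nodei k | k <- w]).
Proof.
rewrite /wbar big_map; elim: w => [|k w [e e1 IH]]; rewrite /sw.
  exists (fun _ => 1) => [p|p q]; rewrite ?expr1n // !big_nil perm1 mxE mulr1 eq_sym.
  by [].
rewrite !big_cons -/(sw w).
exists (fun p => if p == c0 k then - e (c1 k) else if p == c1 k then e (c0 k) else e p) => [p|p q].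
  by case: eqP => _; [|case: eqP => _]; rewrite ?sqrrN.
rewrite sbarE mul_el_l !IH permM.
case: (eqVneq p (c0 k)) => [->|p0]; first by rewrite tpermL mul0r add0r mulN1r mulrN.
case: (eqVneq p (c1 k)) => [->|p1]; first by rewrite tpermR mul0r addr0 mul1r.
by rewrite tpermD // eq_sym.
Qed.

(** The decomposition above is found with [mw], whereas the cell is defined with [wbar]; the
    diagonal factor h between them is absorbed into B_-. *)
Lemma mono_diag s (m y : 'M[K]_r.+1) : mono s m -> mono s y ->
  exists2 h : 'M[K]_r.+1, is_diag_mx h & m = y * h.
Proof.
move=> [e e1 mE] [f f1 yE].
exists (diag_mx (\row_q (e (s^-1 q)%g * f (s^-1 q)%g))); first exact: diag_mx_is_diag.
apply/matrixP => p q; rewrite mxE (bigD1 q) //= big1 ?addr0 => [|u uq].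
  rewrite !mxE eqxx mulr1n mE yE; case: eqP => [->|_]; last by rewrite !mul0r.
  by rewrite permK !mul1r mulrCA -expr2 f1 mulr1.
by rewrite !mxE (negPf uq) mulr0n mulr0.
Qed.

Lemma det_lead (y : 'M[K]_r.+1) : lead_minor r.+1 y = \det y.
Proof.
rewrite lead_minorE; congr (\det _); apply/matrixP => p q; rewrite !mxE.
by congr (y _ _); apply: val_inj; rewrite /= inordK.
Qed.

Lemma det_wbar w : \det (wbar K r [seq nodei k | k <- w]) = 1.
Proof.
rewrite -det_lead -[wbar _ _ _]mul1r lead_wbar // ?det_lead ?det1 //.
by apply/allP => k _; rewrite gtn_eqF // ltnS.
Qed.

Lemma mw_wbar w : mw K w * wbar K r (rev [seq nodei k | k <- w]) = 1.
Proof.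
rewrite /mw /wbar -map_rev big_map; elim: w => [|k w IH].
  by rewrite /rev /= !big_nil mulr1.
rewrite big_cons rev_cons -cats1 big_cat big_seq1 /= mulrA -(mulrA (el _ _ _ _ _)) IH mulr1.
by rewrite sbarE el_sV.
Qed.

Lemma det_mw w : \det (mw K w) = 1.
Proof.
have := congr1 determinant (mw_wbar w).
by rewrite -[_ * _]/(_ *m _) det_mulmx -map_rev det_wbar mulr1 det1.
Qed.

Lemma det_lowerN (y : 'M[K]_r.+1) : lowerN y -> \det y = 1.
Proof.
by move=> [yT y1]; rewrite det_trig // big1.
Qed.

(** Conjugation by m makes y lower unipotent for the order of the indices p by the value s p. This
    property passes to each leading block, whose determinant is therefore 1. *)
Lemma lead_conj s i (m y W : 'M[K]_r.+1) : (i <= r.+1)%N -> mono s m -> lowerN y -> m * W = 1 ->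
  lead_minor i (m * y * W) = 1.
Proof.
move=> ir [e e1 mE] [/is_trig_mxP yT y1] mW.
have Wm : W * m = 1 by exact: mulmx1C.
have ME p q : (m * y * W) p q = e p * y (s p) (s q) * e q.
  have : (m * y * W * m) p (s q) = (m * y) p (s q) by rewrite -!mulrA Wm mulr1.
  rewrite [LHS]mxE [RHS]mxE (bigD1 q) //= big1 ?addr0 => [|u uq]; last first.
    by rewrite mE (inj_eq perm_inj) eq_sym (negPf uq) mul0r mulr0.
  rewrite mE eqxx mul1r (bigD1 (s p)) //= big1 ?addr0 => [|u us]; last first.
    by rewrite mE (negPf us) !mul0r.
  rewrite mE eqxx mul1r => /(congr1 (fun z => z * e q)) <-.
  by rewrite -[RHS]mulrA -expr2 e1 mulr1.
rewrite lead_minorE /determinant (bigD1 1%g) //= odd_perm1 mul1r.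
rewrite big1 => [|p _]; last first.
  by rewrite perm1 mxE ME y1 mulr1 -expr2 e1.
rewrite big1 ?addr0 // => t t1.
(* A permutation t contributing a nonzero term satisfies f (t p) <= f p for all p. Both sides have
   the same sum over the block, so equality holds everywhere and t is the identity. *)
pose f (p : 'I_i) : nat := s (inord p : 'I_r.+1).
have f_inj : injective f.
  by move=> p q /val_inj /perm_inj /(congr1 val) /=; rewrite !inord_lt // => /val_inj.
case: (pickP (fun p => f p < f (t p))%N) => [p fp|H].
  rewrite (bigD1 p) //= mxE ME yT ?mulr0 ?mul0r ?mulr0 //.
have le p : (f (t p) <= f p)%N by rewrite leqNgt H.
have eqs : (\sum_p f (t p) = \sum_p f p)%N.
  by rewrite [RHS](reindex_inj (@perm_inj _ t)).
case/eqP: t1; apply/permP => p; rewrite perm1; apply: f_inj; apply/eqP.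
have [_] := leqif_sum (I := 'I_i) (P := xpredT) (fun p _ => leqif_eq (le p)).
by rewrite eqs eqxx => /esym/forall_inP/(_ p isT).
Qed.

End Membership.

(** * The word of the square of the Coxeter element is reduced *)

Section Reduced.
Variable r : nat.
Implicit Types (k : 'I_r) (w ls : seq 'I_r).

(** The names refer to the parity of the node k + 1, hence the negation: the 0-based index has the
    opposite parity. *)
Definition odds := [seq k <- enum 'I_r | ~~ odd (k : 'I_r)].
Definition evens := [seq k <- enum 'I_r | odd (k : 'I_r)].

Lemma jseqE : jseq r = [seq nodei k | k <- evens ++ odds].
Proof.
rewrite /jseq map_cat /evens /odds.
have -> : iota 1 r = [seq (nat_of_ord k).+1 | k <- enum 'I_r].
  by rewrite -[1%N]addn0 iotaDl -val_enum_ord -map_comp; apply: eq_map => k /=; rewrite add1n.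
rewrite !filter_map -!map_comp; congr (_ ++ _).
by congr map; apply: eq_filter => k /=; rewrite negbK.
Qed.

Lemma sw_cat w1 w2 p : sw (w1 ++ w2) p = sw w2 (sw w1 p).
Proof. by rewrite /sw big_cat /= permM. Qed.

Lemma sw_notin ls (p : 'I_r.+1) : (forall k, k \in ls -> (p != c0 k) && (p != c1 k)) -> sw ls p = p.
Proof.
elim: ls => [|k ls IH] H; first by rewrite /sw big_nil perm1.
rewrite /sw big_cons permM -/(sw ls).
have /andP[p0 p1] := H k (mem_head _ _).
by rewrite tpermD 1?eq_sym // IH // => k' k'l; rewrite H // inE k'l orbT.
Qed.

Definition same_parity ls := forall k k', k \in ls -> k' \in ls -> odd k = odd k'.

Lemma parity_disjoint k k' : odd k = odd k' -> k != k' ->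
  ((c0 k != c0 k') && (c0 k != c1 k')) && ((c1 k != c0 k') && (c1 k != c1 k')).
Proof. by rewrite -!val_eqE /= /bump /= !add1n; lia. Qed.

Lemma sw_in ls k : uniq ls -> same_parity ls -> k \in ls ->
  sw ls (c0 k) = c1 k /\ sw ls (c1 k) = c0 k.
Proof.
move=> uls par kls; case/splitPr: kls uls par => l1 l2 uls par.
have H k' : k' \in l1 ++ l2 -> (((c0 k != c0 k') && (c0 k != c1 k')) && ((c1 k != c0 k') && (c1 k != c1 k'))).
  move=> k'l; apply: parity_disjoint.
    by apply: par; move: k'l; rewrite !mem_cat !inE ?eqxx ?orbT // => /orP[] ->; rewrite ?orbT.
  move: uls; rewrite -cat1s uniq_catCA cat1s /= => /andP[kn _].
  by apply: contraNneq kn => ->.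
have N1 : sw l1 (c0 k) = c0 k /\ sw l1 (c1 k) = c1 k.
  by split; apply: sw_notin => k' k'l; have /H/andP[] : k' \in l1 ++ l2 by rewrite mem_cat k'l.
have N2 : sw l2 (c0 k) = c0 k /\ sw l2 (c1 k) = c1 k.
  by split; apply: sw_notin => k' k'l; have /H/andP[] : k' \in l1 ++ l2 by rewrite mem_cat k'l orbT.
rewrite -cat1s !sw_cat N1.1 N1.2 /sw big_seq1 tpermL tpermR -/(sw l2).
by rewrite N2.1 N2.2.
Qed.

Lemma uniq_odds : uniq odds. Proof. exact/filter_uniq/enum_uniq. Qed.
Lemma uniq_evens : uniq evens. Proof. exact/filter_uniq/enum_uniq. Qed.
Lemma mem_odds k : (k \in odds) = ~~ odd k. Proof. by rewrite mem_filter mem_enum andbT. Qed.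
Lemma mem_evens k : (k \in evens) = odd k. Proof. by rewrite mem_filter mem_enum andbT. Qed.
Lemma par_odds : same_parity odds.
Proof. by move=> k k'; rewrite !mem_odds => /negPf-> /negPf->. Qed.
Lemma par_evens : same_parity evens.
Proof. by move=> k k'; rewrite !mem_evens => -> ->. Qed.

Lemma sw_odds (p : 'I_r.+1) :
  sw odds p = (if odd p then p.-1 else if (p < r)%N then p.+1 else p) :> nat.
Proof.
case: ifP => [op|ep].
  have p0 : (0 < p)%N by case: (nat_of_ord p) op.
  have pr : (p.-1 < r)%N by rewrite prednK // -ltnS ltn_ord.
  have -> : p = c1 (Ordinal pr) by apply: val_inj; rewrite /= /bump /= add1n prednK.
  rewrite (sw_in uniq_odds par_odds _).2 //= ?/bump ?add1n //.
  by rewrite mem_odds /= -oddS prednK ?op.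
case: ifP => [pr|nr].
  have -> : p = c0 (Ordinal pr) by apply: val_inj.
  by rewrite (sw_in uniq_odds par_odds _).1 /= ?/bump ?add1n // mem_odds /= ep.
rewrite sw_notin // => k; rewrite mem_odds -!val_eqE /= /bump /= add1n.
by have := ltn_ord k; lia.
Qed.

Lemma sw_evens (p : 'I_r.+1) :
  sw evens p = (if odd p then (if (p < r)%N then p.+1 else p) else p.-1) :> nat.
Proof.
case: ifP => [op|ep].
  case: ifP => [pr|nr].
    have -> : p = c0 (Ordinal pr) by apply: val_inj.
    by rewrite (sw_in uniq_evens par_evens _).1 /= ?/bump ?add1n // mem_evens /= op.
  rewrite sw_notin // => k; rewrite mem_evens -!val_eqE /= /bump /= add1n.
  by have := ltn_ord k; lia.
case: (posnP p) => [p0|p0].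
  rewrite sw_notin // ?p0 // => k; rewrite mem_evens -!val_eqE /= /bump /= add1n p0.
  by case: (nat_of_ord k).
have pr : (p.-1 < r)%N by rewrite prednK // -ltnS ltn_ord.
have -> : p = c1 (Ordinal pr) by apply: val_inj; rewrite /= /bump /= add1n prednK.
rewrite (sw_in uniq_evens par_evens _).2 //= ?/bump ?add1n //.
by rewrite mem_evens /= -[odd _]negbK -oddS prednK ?ep.
Qed.

(** Distinct letters of equal parity move disjoint pairs of positions. The other letters of the
    layer therefore fix both positions of k, and the condition for k can be tested on w alone. *)
Lemma redw_layer ls w : uniq ls -> same_parity ls -> redw w ->
  (forall k, k \in ls -> (sw w (c0 k) < sw w (c1 k))%N) -> redw (ls ++ w).
Proof.
elim: ls => [//|k ls IH] /= /andP[kn uls] par rw H.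
rewrite IH // ?andbT; first 1 last.
- by move=> k1 k2 k1l k2l; apply: par; rewrite inE ?k1l ?k2l orbT.
- by move=> k' k'l; apply: H; rewrite inE k'l orbT.
have dis k' : k' \in ls -> ((c0 k != c0 k') && (c0 k != c1 k')) && ((c1 k != c0 k') && (c1 k != c1 k')).
  move=> k'l; apply: parity_disjoint; first by apply: par; rewrite ?mem_head // inE k'l orbT.
  by apply: contraNneq kn => ->.
rewrite !sw_cat (@sw_notin ls (c0 k)) ?(@sw_notin ls (c1 k)) ?H ?mem_head //.
  by move=> k' /dis/andP[].
by move=> k' /dis/andP[].
Qed.

(** The odd and the even layer as maps on 0-based positions, in the form of [sw_odds] and
    [sw_evens]; ascents of a word made of layers become inequalities between their composites. *)
Let fO p := if odd p then p.-1 else if (p < r)%N then p.+1 else p.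
Let fE p := if odd p then (if (p < r)%N then p.+1 else p) else p.-1.

(** Applied alternately, the layers carry k to the left and k + 1 to the right until an end of the
    diagram reflects them; [lhs] and [rhs] list the outcomes without and with reflection. Both
    reflections occur together only for r = 2, where the inequality fails. *)
Lemma fOEO_lt k : (3 <= r)%N -> odd k -> (fO (fE (fO k)) < fO (fE (fO k.+1)))%N.
Proof.
move=> r3 ok; have kr := ltn_ord k.
have E1 : fO k = k.-1 by rewrite /fO ok.
have lhs : (1 < k /\ fO (fE (fO k)) < k.-1)%N \/ (nat_of_ord k = 1%N /\ fO (fE (fO k)) = 1%N).
  rewrite E1; have [k1|k1] := leqP k 1.
    have -> : nat_of_ord k = 1%N by move: ok k1; case: (nat_of_ord k) => [|[|]].
    by right; rewrite /fE /fO /= (ltn_trans _ r3).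
  have -> : fE k.-1 = k.-2.
    by rewrite /fE ifF //; move: ok; case: (nat_of_ord k) => //= n /negPf.
  left; split=> //; rewrite /fO ifT; first lia.
  by move: ok k1; case: (nat_of_ord k) => [|[|n]] //=; rewrite negbK.
have rhs : (k.+1 <= fO (fE (fO k.+1)))%N \/ (k.+1 = r /\ fO (fE (fO k.+1)) = k.-1).
  have e1 : odd k.+1 = false by rewrite /= ok.
  rewrite {2 4}/fO e1; case: ifP => [k2|k2].
    have o2 : odd k.+2 by rewrite /= negbK ok.
    rewrite /fE o2; case: ifP => [k3|k3]; left; rewrite /fO /=.
      by rewrite ok /=; case: ifP => _; lia.
    by rewrite negbK ok /=; lia.
  right; split; first by lia.
  by rewrite /fE e1 /fO /= ok.
case: lhs => [[k1 lhs]|[k1 lhs]]; case: rhs => [rhs|[kE rhs]]; lia.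
Qed.

Lemma fOE_lt k : (3 <= r)%N -> ~~ odd k -> (fO (fE k) < fO (fE k.+1))%N.
Proof.
move=> r3 ek; have kr := ltn_ord k.
have lhs : (1 < k /\ fO (fE k) < k.-1)%N \/ (nat_of_ord k = 0%N /\ fO (fE k) = 1%N).
  case: (posnP k) => [k0|k0]; first by right; rewrite k0 /fE /fO /= (ltn_trans _ r3).
  have -> : fE k = k.-1 by rewrite /fE (negPf ek).
  left; rewrite /fO ifT; last by move: ek k0; case: (nat_of_ord k) => //= n; rewrite negbK.
  by move: ek k0; case: (nat_of_ord k) => [|[|n]] //= _ _; split.
have rhs : (k.+1 < fO (fE k.+1))%N \/ (k.+1 = r /\ fO (fE k.+1) = k).
  have o1 : odd k.+1 by [].
  rewrite /fE o1; case: ifP => [k2|k2].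
    by left; rewrite /fO /= negbK (negPf ek) /=; case: ifP => _; lia.
  by right; split; [lia | rewrite /fO o1].
case: lhs => [[k1 lhs]|[k1 lhs]]; case: rhs => [rhs|[kE rhs]]; lia.
Qed.

Lemma redw_c2 : (3 <= r)%N -> redw ((evens ++ odds) ++ (evens ++ odds)).
Proof.
move=> r3; rewrite -!catA.
have V0 k : c0 k = k :> nat by [].
have V1 k : c1 k = k.+1 :> nat by rewrite /= /bump /= add1n.
apply: redw_layer uniq_evens par_evens _ _; last first.
  move=> k; rewrite mem_evens !sw_cat !sw_odds !sw_evens !sw_odds V0 V1 => ok.
  exact: fOEO_lt.
apply: redw_layer uniq_odds par_odds _ _; last first.
  move=> k; rewrite mem_odds !sw_cat !sw_odds !sw_evens V0 V1 => ok.
  exact: fOE_lt.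
apply: redw_layer uniq_evens par_evens _ _; last first.
  move=> k; rewrite mem_evens !sw_odds V0 V1 => ok.
  by rewrite /= ok /=; case: ifP => _; lia.
rewrite -[odds]cats0; apply: redw_layer uniq_odds par_odds _ _ => // k _.
by rewrite /sw big_nil !perm1 V1.
Qed.

End Reduced.

Section LeadBlock.
Variables (K : fieldType) (r : nat).
Implicit Types z : 'M[K]_r.+1.

Lemma lead_block1 m z : (m < r.+1)%N ->
  (forall q : 'I_r.+1, (q < m)%N -> z (inord m) q = 0) ->
  lead_minor m.+1 z = lead_minor m z * z (inord m) (inord m).
Proof.
move=> mr z0; rewrite -addn1 !lead_minorE -[lblock (m + 1) z]submxK.
have -> : dlsubmx (lblock (m + 1) z) = 0.
  apply/matrixP => p q; rewrite !mxE (ord1 p) /= addn0 z0 //.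
  by rewrite inordK // (ltn_trans (ltn_ord q)).
rewrite det_ublock; congr (_ * _).
  by congr (\det _); apply/matrixP => p q; rewrite !mxE.
by rewrite det_mx11 !mxE /= addn0.
Qed.

Lemma lead_block2 m z : (m.+1 < r.+1)%N ->
  (forall q : 'I_r.+1, (q < m)%N -> z (inord m) q = 0 /\ z (inord m.+1) q = 0) ->
  lead_minor m.+2 z = lead_minor m z *
    (z (inord m) (inord m) * z (inord m.+1) (inord m.+1)
     - z (inord m) (inord m.+1) * z (inord m.+1) (inord m)).
Proof.
move=> mr z0; rewrite -addn2 !lead_minorE -[lblock (m + 2) z]submxK.
have -> : dlsubmx (lblock (m + 2) z) = 0.
  apply/matrixP => p q; rewrite !mxE.
  have [|H1 H2] := z0 (inord (lshift 2 q)).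
    by rewrite inordK //= (ltn_trans (ltn_ord q)) // ltnW.
  by case: p => [[|[|//]] pP] /=; rewrite ?addn0 ?addn1.
rewrite det_ublock; congr (_ * _).
  by congr (\det _); apply/matrixP => p q; rewrite !mxE.
rewrite (expand_det_row _ ord0) !big_ord_recl big_ord0 addr0 /cofactor !det_mx11 !mxE /=.
by rewrite /bump /= ?addn0 ?addn1 expr0 expr1 !mul1r mulN1r mulrN.
Qed.

End LeadBlock.

(** * Initial minors in the coordinates Y *)

Section Layers.
Variables (K : fieldType) (r : nat).
Implicit Types (y : 'M[K]_r.+1) (ls : seq 'I_r) (t : 'I_r -> K).

Definition lay t ls : 'M[K]_r.+1 := xw [seq (k, t k) | k <- ls].

Lemma lay_cat t l1 l2 : lay t (l1 ++ l2) = lay t l1 * lay t l2.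
Proof. by rewrite /lay /xw map_cat big_cat. Qed.

Lemma mul_lay_notin y t ls p q : (forall k, k \in ls -> (q != c0 k) && (q != c1 k)) ->
  (y * lay t ls) p q = y p q.
Proof.
elim: ls y => [|k ls IH] y H; first by rewrite /lay /xw big_nil mulr1.
rewrite -cat1s lay_cat mulrA IH; last by move=> k' k'l; rewrite H // inE k'l orbT.
rewrite /lay /xw big_seq1 mul_el /=.
by have /andP[/negPf-> /negPf->] := H k (mem_head _ _).
Qed.

Lemma mul_lay_in y t ls k p : uniq ls -> same_parity ls -> k \in ls ->
  (y * lay t ls) p (c0 k) = y p (c0 k) * t k /\
  (y * lay t ls) p (c1 k) = y p (c0 k) + y p (c1 k) / t k.
Proof.
move=> uls par kls; case/splitPr: kls uls par => l1 l2 uls par.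
have H k' : k' \in l1 ++ l2 -> (((c0 k != c0 k') && (c0 k != c1 k')) && ((c1 k != c0 k') && (c1 k != c1 k'))).
  move=> k'l; apply: parity_disjoint.
    by apply: par; move: k'l; rewrite !mem_cat !inE ?eqxx ?orbT // => /orP[] ->; rewrite ?orbT.
  move: uls; rewrite -cat1s uniq_catCA cat1s /= => /andP[kn _].
  by apply: contraNneq kn => ->.
have N1 z : (z * lay t l1) p (c0 k) = z p (c0 k) /\ (z * lay t l1) p (c1 k) = z p (c1 k).
  by split; apply: mul_lay_notin => k' k'l; have /H/andP[] : k' \in l1 ++ l2 by rewrite mem_cat k'l.
have N2 z : (z * lay t l2) p (c0 k) = z p (c0 k) /\ (z * lay t l2) p (c1 k) = z p (c1 k).
  by split; apply: mul_lay_notin => k' k'l; have /H/andP[] : k' \in l1 ++ l2 by rewrite mem_cat k'l orbT.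
rewrite -cat1s !lay_cat !mulrA (N2 _).1 (N2 _).2.
rewrite [lay t [:: k]]/lay /xw big_seq1 !mul_el eqxx /= [c1 k == _]eq_sym c0_neq_c1 eqxx mulr0 addr0 mulr1.
by rewrite (N1 _).1 (N1 _).2.
Qed.

(* 1-based; column 0 is a junk column of zeros, so that the first column needs no special case below *)
Definition ent y (p q : nat) : K := if q == 0%N then 0 else y (inord p.-1) (inord q.-1).

Definition yy (Y : int -> int -> K) (s i : int) : K := if is_node r i then Y s i else 1.

(** Effect of right multiplication by the odd layer on the entries of a row, in 1-based columns;
    [colE] is the same for the even layer. A missing node enters with the value 1 of [yy], so the
    last column obeys the same formula. *)
Definition colO (h : int -> K) (f : nat -> nat -> K) (p q : nat) : K :=
  if odd q then f p q * h q%:Z else f p q.-1 + f p q / h q.-1%:Z.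
Definition colE (h : int -> K) (f : nat -> nat -> K) (p q : nat) : K :=
  if odd q then f p q.-1 + f p q / h q.-1%:Z else f p q * h q%:Z.

Lemma is_nodei (k : 'I_r) : is_node r (nodei k).
Proof. by rewrite /is_node /nodei; have := ltn_ord k; lia. Qed.

Lemma ent_odds y Y s p q : (q <= r.+1)%N ->
  ent (y * lay (fun k => Y s (nodei k)) (odds r)) p q = colO (yy Y s) (ent y) p q.
Proof.
move=> qr; rewrite /colO; case: (posnP q) => [->|q0]; first by rewrite /ent /= mul0r addr0.
have en0 z : ent z p q = z (inord p.-1) (inord q.-1) by rewrite /ent gtn_eqF.
rewrite !en0; case: ifP => [oq|eq].
  case: (leqP q r) => [qr'|qr'].
    have kP : (q.-1 < r)%N by rewrite prednK.
    have -> : inord q.-1 = c0 (Ordinal kP) :> 'I_r.+1 by apply: val_inj; rewrite /= inordK // prednK.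
    rewrite (mul_lay_in _ _ _ (uniq_odds r) (@par_odds r) _).1; last first.
      by rewrite mem_odds /= -oddS prednK.
    congr (_ * _); rewrite /yy /nodei /= prednK // ifT //.
    by rewrite /is_node; lia.
  rewrite mul_lay_notin; last first.
    move=> k; rewrite mem_odds -!val_eqE /= inordK ?prednK // /bump /= add1n.
    by have := ltn_ord k; lia.
  by rewrite /yy ifF ?mulr1 // /is_node; lia.
have kP : (q.-2 < r)%N by move: q0 eq qr; case: (q) => [|[|]].
have -> : inord q.-1 = c1 (Ordinal kP) :> 'I_r.+1.
  by apply: val_inj; rewrite /= inordK ?prednK // /bump /= add1n; move: q0 eq; case: (q) => [|[|]].
rewrite (mul_lay_in _ _ _ (uniq_odds r) (@par_odds r) _).2; last first.
  by rewrite mem_odds /=; lia.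
have q1 : q.-1 == 0%N = false by move: q0 eq; case: (q) => [|[|]].
rewrite /ent q1; congr (y _ _ + _ / _).
  by apply: val_inj; rewrite /= inordK // ltnW // ltnS.
rewrite /yy /nodei /= ifT; last by rewrite /is_node; move: q0 eq qr q1; lia.
by congr (Y s _); move: q1; lia.
Qed.

Lemma ent_evens y Y s p q : (q <= r.+1)%N ->
  ent (y * lay (fun k => Y s (nodei k)) (evens r)) p q = colE (yy Y s) (ent y) p q.
Proof.
move=> qr; rewrite /colE; case: (posnP q) => [->|q0]; first by rewrite /ent /= mul0r.
have en0 z : ent z p q = z (inord p.-1) (inord q.-1) by rewrite /ent gtn_eqF.
rewrite !en0; case: ifP => [oq|eq]; last first.
  case: (leqP q r) => [qr'|qr'].
    have kP : (q.-1 < r)%N by rewrite prednK.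
    have -> : inord q.-1 = c0 (Ordinal kP) :> 'I_r.+1 by apply: val_inj; rewrite /= inordK // prednK.
    rewrite (mul_lay_in _ _ _ (uniq_evens r) (@par_evens r) _).1; last first.
      by rewrite mem_evens /= -[odd _]negbK -oddS prednK // eq.
    congr (_ * _); rewrite /yy /nodei /= prednK // ifT //.
    by rewrite /is_node; lia.
  rewrite mul_lay_notin; last first.
    move=> k; rewrite mem_evens -!val_eqE /= inordK ?prednK // /bump /= add1n.
    by have := ltn_ord k; lia.
  by rewrite /yy ifF ?mulr1 // /is_node; lia.
case: (ltnP 1 q) => [q1|q1]; last first.
  have -> : q = 1%N by lia.
  rewrite mul_lay_notin; first by rewrite /ent /= add0r /yy /is_node /= divr1.
  by move=> k; rewrite mem_evens -!val_eqE /= inordK // /bump /=; lia.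
have kP : (q.-2 < r)%N by lia.
have -> : inord q.-1 = c1 (Ordinal kP) :> 'I_r.+1.
  by apply: val_inj; rewrite /= inordK ?prednK // /bump /= add1n; lia.
rewrite (mul_lay_in _ _ _ (uniq_evens r) (@par_evens r) _).2; last first.
  by rewrite mem_evens /=; lia.
have q2 : q.-1 == 0%N = false by lia.
rewrite /ent q2; congr (y _ _ + _ / _).
  by apply: val_inj; rewrite /= inordK //; lia.
rewrite /yy /nodei /= ifT; last by rewrite /is_node; lia.
by congr (Y s _); lia.
Qed.

Definition xlay (a : 'M[K]_r.+1) (Y : int -> int -> K) : 'M[K]_r.+1 :=
  a * lay (fun k => Y 1 (nodei k)) (evens r) * lay (fun k => Y 1 (nodei k)) (odds r)
    * lay (fun k => Y 2 (nodei k)) (evens r) * lay (fun k => Y 2 (nodei k)) (odds r).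

Definition gd (Y : int -> int -> K) : Prop :=
  forall k : 'I_r, Y 1 (nodei k) != 0 /\ Y 2 (nodei k) != 0.

Lemma xbarE a Y : gd Y -> xbar a Y = xlay a Y.
Proof.
move=> Y0; rewrite /xbar jseqE !big_map !big_cat /= /xlay -!mulrA; congr (a * _).
have E s ls : (s == 1) || (s == 2) -> \prod_(j <- ls) (xmx r (nodei j) (Y s (nodei j)) * coroot r (nodei j) (Y s (nodei j)))
   = lay (fun k => Y s (nodei k)) ls.
  move=> s12; rewrite /lay /xw big_map; apply: eq_bigr => k _ /=.
  have ? : Y s (nodei k) != 0 by case/orP: s12 => /eqP->; have [] := Y0 k.
  by rewrite xmxE corootE el_mul_el; congr el; field.
by rewrite !E.
Qed.

Lemma ent_diag (a : 'M[K]_r.+1) p q : is_diag_mx a -> (p != 0)%N -> (p <= r.+1)%N -> (q <= r.+1)%N ->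
  ent a p q = if p == q then ent a p p else 0.
Proof.
move=> /is_diag_mxP aD p0 pr qr; rewrite /ent (negPf p0); case: eqP => [->|q0].
  by rewrite (negPf p0).
case: eqP => [pq|pq]; first by rewrite -pq.
by rewrite aD // !inordK ?prednK ?lt0n //; [lia|apply/eqP].
Qed.

(** Each layer spreads a row by at most one column to the right, so a row of the diagonal matrix
    keeps few nonzero entries after four layers. In [row_even] only the entries that enter the
    minors are recorded. *)
Lemma row_odd f (u v : int -> K) p (a : K) :
  odd p -> (forall q, f p q = if q == p then a else 0) ->
  let x := colO v (colE v (colO u (colE u f))) in
  [/\ x p p = a / u p.-1%:Z * u p%:Z / v p.-1%:Z * v p%:Z,
      x p p.+1 = a / u p.-1%:Z * u p%:Z / v p.-1%:Z + a / u p.-1%:Z * v p.+1%:Z / v p%:Z,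
      x p p.+2 = a / u p.-1%:Z * v p.+2%:Z,
      x p p.+3 = a / u p.-1%:Z &
      forall q, (q < p)%N -> x p q = 0].
Proof.
move=> op fE; have p_gt0 : (0 < p)%N by case: (p) op.
set f1 := colE u f; set b := a / _.
have f1E q : f1 p q = if q == p then b else 0.
  rewrite /f1 /colE !fE; case: (eqVneq q p) => [->|qp].
    by rewrite op ifF ?add0r //; lia.
  by rewrite mul0r addr0 mul0r; case: ifP => // oq; rewrite ifF //; lia.
set f2 := colO u f1.
have f2E q : f2 p q = if q == p then b * u p%:Z else if q == p.+1 then b else 0.
  rewrite /f2 /colO !f1E; case: (eqVneq q p) => [->|qp]; first by rewrite op.
  rewrite !mul0r addr0; case: (eqVneq q p.+1) => [->|qp1].
    by rewrite /= op eqxx.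
  by case: ifP => // oq; rewrite ifF //; lia.
set f3 := colE v f2.
have f3E q : f3 p q = if q == p then b * u p%:Z / v p.-1%:Z else
   if q == p.+1 then b * v p.+1%:Z else if q == p.+2 then b else 0.
  rewrite /f3 /colE !f2E; case: (eqVneq q p) => [->|qp].
    by rewrite op ifF ?ifF ?add0r //; lia.
  case: (eqVneq q p.+1) => [->|qp1]; first by rewrite /= op.
  rewrite mul0r addr0 mul0r; case: (eqVneq q p.+2) => [->|qp2].
    by rewrite /= op eqxx ifF //; lia.
  by case: ifP => // oq; rewrite ifF ?ifF //; lia.
have N1 : (p.+1 == p) = false by lia.
have N2 : (p.+2 == p) = false by lia.
have N3 : (p.+3 == p) = false by lia.
have N4 : (p.+2 == p.+1) = false by lia.
have N5 : (p.+3 == p.+1) = false by lia.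
have N6 : (p.+3 == p.+2) = false by lia.
split => [||||q qp]; rewrite /colO !f3E.
- by rewrite op eqxx.
- by rewrite /= op eqxx N1 eqxx.
- by rewrite /= op eqxx N2 N4.
- by rewrite /= op /= N2 N3 N4 N5 N6 eqxx mul0r addr0.
- have -> : (q == p) = false by lia.
  have -> : (q == p.+1) = false by lia.
  have -> : (q == p.+2) = false by lia.
  have -> : (q.-1 == p) = false by lia.
  have -> : (q.-1 == p.+1) = false by lia.
  have -> : (q.-1 == p.+2) = false by lia.
  by rewrite !mul0r addr0; case: ifP.
Qed.

Lemma row_even f (u v : int -> K) p (a : K) :
  ~~ odd p -> (0 < p)%N -> (forall q, f p q = if q == p then a else 0) ->
  let x := colO v (colE v (colO u (colE u f))) in
  [/\ x p p = a * u p%:Z / u p.-1%:Z * v p%:Z / v p.-1%:Z,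
      x p p.+1 = (a * u p%:Z / u p.-1%:Z + a * u p.+1%:Z / v p%:Z) * v p.+1%:Z,
      x p p.+2 = a * u p%:Z / u p.-1%:Z + a * u p.+1%:Z / v p%:Z + a * v p.+2%:Z / v p.+1%:Z &
      forall q, (q < p)%N -> x p q = 0].
Proof.
move=> op p_gt0 fE; set f1 := colE u f.
have f1E q : f1 p q = if q == p then a * u p%:Z else if q == p.+1 then a else 0.
  rewrite /f1 /colE !fE; case: (eqVneq q p) => [->|qp]; first by rewrite (negPf op).
  rewrite mul0r addr0 mul0r; case: (eqVneq q p.+1) => [->|qp1].
    by rewrite /= op eqxx.
  by case: ifP => // oq; rewrite ifF //; lia.
set f2 := colO u f1; set b := a * _ / _.
have f2E q : f2 p q = if q == p then b else if q == p.+1 then a * u p.+1%:Z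
    else if q == p.+2 then a else 0.
  rewrite /f2 /colO !f1E; case: (eqVneq q p) => [->|qp].
    by rewrite (negPf op) ifF ?ifF ?add0r //; lia.
  case: (eqVneq q p.+1) => [->|qp1]; first by rewrite /= op.
  rewrite !mul0r addr0; case: (eqVneq q p.+2) => [->|qp2].
    by rewrite /= negbK (negPf op) eqxx ifF //; lia.
  by case: ifP => // oq; rewrite ifF ?ifF //; lia.
set f3 := colE v f2.
have N1 : (p.+1 == p) = false by lia.
have N2 : (p.+2 == p) = false by lia.
have N4 : (p.+2 == p.+1) = false by lia.
have f3E q : f3 p q = if q == p then b * v p%:Z else
   if q == p.+1 then b + a * u p.+1%:Z / v p%:Z
   else if q == p.+2 then a * v p.+2%:Z else if q == p.+3 then a else 0.
  rewrite /f3 /colE !f2E; case: (eqVneq q p) => [->|qp]; first by rewrite (negPf op).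
  case: (eqVneq q p.+1) => [->|qp1]; first by rewrite /= op eqxx.
  case: (eqVneq q p.+2) => [->|qp2]; first by rewrite /= negbK (negPf op).
  rewrite mul0r addr0 mul0r; case: (eqVneq q p.+3) => [->|qp3].
    by rewrite /= negbK op N2 N4 eqxx.
  by case: ifP => // oq; rewrite ifF ?ifF ?ifF //; lia.
split => [|||q qp]; rewrite /colO !f3E.
- have -> : (p.-1 == p) = false by lia.
  have -> : (p.-1 == p.+1) = false by lia.
  have -> : (p.-1 == p.+2) = false by lia.
  have -> : (p.-1 == p.+3) = false by lia.
  by rewrite (negPf op) eqxx add0r.
- by rewrite /= op N1 eqxx.
- by rewrite /= negbK (negPf op) eqxx N1 N2 N4 eqxx.
- have -> : (q == p) = false by lia.
  have -> : (q == p.+1) = false by lia.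
  have -> : (q == p.+2) = false by lia.
  have -> : (q == p.+3) = false by lia.
  have -> : (q.-1 == p) = false by lia.
  have -> : (q.-1 == p.+1) = false by lia.
  have -> : (q.-1 == p.+2) = false by lia.
  have -> : (q.-1 == p.+3) = false by lia.
  by rewrite !mul0r addr0; case: ifP.
Qed.

Lemma colE_ext n f g h p : (forall q, (q <= n)%N -> f p q = g p q) ->
  forall q, (q <= n)%N -> colE h f p q = colE h g p q.
Proof. by move=> fg q' q'r; rewrite /colE !fg // (leq_trans (leq_pred _)). Qed.

Lemma colO_ext n f g h p : (forall q, (q <= n)%N -> f p q = g p q) ->
  forall q, (q <= n)%N -> colO h f p q = colO h g p q.
Proof. by move=> fg q' q'r; rewrite /colO !fg // (leq_trans (leq_pred _)). Qed.

Lemma ent_xlay a Y p q : (q <= r.+1)%N ->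
  ent (xlay a Y) p q = colO (yy Y 2) (colE (yy Y 2) (colO (yy Y 1) (colE (yy Y 1) (ent a)))) p q.
Proof.
move=> qr; rewrite /xlay ent_odds //; apply: colO_ext qr => {}q qr; rewrite ent_evens //.
apply: colE_ext qr => {}q qr; rewrite ent_odds //; apply: colO_ext qr => {}q qr; exact: ent_evens.
Qed.

(** The initial variable M at an odd node, and with [Me] at an even one. The value 1 outside [1, r]
    is what the formula for [Me] needs at the ends of the diagram. *)
Definition Mo (Y : int -> int -> K) (i : int) : K :=
  if is_node r i then yy Y 1 i + yy Y 2 (i - 1) * yy Y 2 (i + 1) / yy Y 2 i else 1.
Definition Me (Y : int -> int -> K) (i : int) : K :=
  if is_node r i then yy Y 1 i + Mo Y (i - 1) * Mo Y (i + 1) / yy Y 2 i else 1.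
Definition fM Y (i : int) : K := if odd `|i|%N then Mo Y i else Me Y i.
Definition fQ Y (i : int) : K := yy Y 1 i * yy Y 2 i.

Definition pa (a : 'M[K]_r.+1) (i : nat) : K := \prod_(p < r.+1 | (p < i)%N) a p p.

Lemma yy_neq0 Y s i : gd Y -> (s == 1) || (s == 2) -> yy Y s i != 0.
Proof.
move=> Y0 s12; rewrite /yy; case: ifP => [iN|_]; last exact: oner_neq0.
have kP : (`|i|%N.-1 < r)%N by move: iN; rewrite /is_node; lia.
have -> : i = nodei (Ordinal kP) by move: iN; rewrite /is_node /nodei /=; lia.
by case/orP: s12 => /eqP->; have [] := Y0 (Ordinal kP).
Qed.

Lemma paS a i (ir : (i < r.+1)%N) : pa a i.+1 = pa a i * a (inord i) (inord i).
Proof.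
rewrite /pa (bigD1 (inord i)) ?inordK //= mulrC; congr (_ * _); apply: eq_bigl => p.
by rewrite -val_eqE /= inordK // ltnS ltn_neqAle andbC.
Qed.

Lemma entE (y : 'M[K]_r.+1) p q : y (inord p) (inord q) = ent y p.+1 q.+1.
Proof. by []. Qed.

Lemma yy0 Y s : yy Y s 0 = 1. Proof. by []. Qed.

Section Xval.
Variables (a : 'M[K]_r.+1) (Y : int -> int -> K).
Hypotheses (aD : is_diag_mx a) (Y0 : gd Y).
Let x := xlay a Y.
Let u := yy Y 1.
Let v := yy Y 2.
Let u0 i : u i != 0. Proof. exact: yy_neq0. Qed.
Let v0 i : v i != 0. Proof. exact: yy_neq0. Qed.
Let ad p := a (inord p.-1) (inord p.-1).

Lemma ent_a p q : (0 < p)%N -> (p <= r.+1)%N -> (q <= r.+1)%N -> ent a p q = if q == p then ad p else 0.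
Proof. move=> p0 pr qr; have pn : p != 0%N by rewrite -lt0n.
by rewrite (ent_diag aD pn pr qr) eq_sym {1}/ent (negPf pn). Qed.

Let df (p q : nat) := if q == p then ad p else 0.

Lemma xlay_row p q : (0 < p)%N -> (p <= r.+1)%N -> (q <= r.+1)%N ->
  ent x p q = colO v (colE v (colO u (colE u df))) p q.
Proof.
move=> p0 pr qr; rewrite ent_xlay //.
apply: colO_ext qr => {}q qr; apply: colE_ext qr => {}q qr; apply: colO_ext qr => {}q qr.
by apply: colE_ext qr => {}q qr; apply: ent_a.
Qed.

Lemma xlay_upper (p q : 'I_r.+1) : (q < p)%N -> x p q = 0.
Proof.
move=> qp; rewrite -[p]inord_val -[q]inord_val entE xlay_row //.
case: (boolP (odd p.+1)) => op.
  by have [_ _ _ _ ->] := row_odd (f := df) u v op (fun q => erefl).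
by have [_ _ _ ->] := row_even (f := df) u v op isT (fun q => erefl).
Qed.

Lemma xlay_diag p : (0 < p <= r.+1)%N -> ent x p p = ad p * u p%:Z * v p%:Z / (u p.-1%:Z * v p.-1%:Z).
Proof.
move=> /andP[p0 pr]; rewrite xlay_row //.
case: (boolP (odd p)) => op.
  by have [-> _ _ _ _] := row_odd (f := df) u v op (fun q => erefl); field; rewrite u0 v0.
by have [-> _ _ _] := row_even (f := df) u v op p0 (fun q => erefl); field; rewrite u0 v0.
Qed.

(** The matrix is upper triangular and the product of its diagonal entries telescopes. *)
Lemma lead_Q i : (i <= r)%N -> lead_minor i x = pa a i * (u i%:Z * v i%:Z).
Proof.
move=> ir; rewrite lead_upper //; [|exact: leqW|exact: xlay_upper].
rewrite -[LHS]/(pa x i); elim: i ir => [|i IH] ir.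
  by rewrite /pa !big_pred0 // /u /v !yy0 !mulr1.
rewrite !paS ?ltnS 1?ltnW // IH 1?ltnW // entE xlay_diag /=; last by rewrite ltnS ltnW.
by rewrite /ad /=; field; rewrite u0 v0.
Qed.

Lemma mul_sbar y (k : 'I_r) p q : (y * sbar K r (nodei k)) p q =
  if q == c0 k then y p (c1 k) else if q == c1 k then - y p (c0 k) else y p q.
Proof.
rewrite sbarE mul_el; case: ifP => _; first by rewrite mulr0 add0r mulr1.
by case: ifP => // _; rewrite mulr0 addr0 mulrN1.
Qed.

Lemma mul_wbar_notin y (w : seq 'I_r) p q : (forall k, k \in w -> (q != c0 k) && (q != c1 k)) ->
  (y * wbar K r [seq nodei k | k <- w]) p q = y p q.
Proof.
rewrite /wbar; elim: w y => [|k w IH] y H; first by rewrite big_nil mulr1.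
rewrite /= big_cons mulrA IH => [|k' k'l]; last by rewrite H // inE k'l orbT.
by rewrite mul_sbar; have /andP[/negPf-> /negPf->] := H k (mem_head _ _).
Qed.

Lemma mul_wbar_in y (w : seq 'I_r) k p : uniq w -> same_parity w -> k \in w ->
  (y * wbar K r [seq nodei k | k <- w]) p (c0 k) = y p (c1 k) /\
  (y * wbar K r [seq nodei k | k <- w]) p (c1 k) = - y p (c0 k).
Proof.
move=> uls par kls; case/splitPr: kls uls par => l1 l2 uls par.
have H k' : k' \in l1 ++ l2 -> (((c0 k != c0 k') && (c0 k != c1 k')) && ((c1 k != c0 k') && (c1 k != c1 k'))).
  move=> k'l; apply: parity_disjoint.
    by apply: par; move: k'l; rewrite !mem_cat !inE ?eqxx ?orbT // => /orP[] ->; rewrite ?orbT.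
  move: uls; rewrite -cat1s uniq_catCA cat1s /= => /andP[kn _].
  by apply: contraNneq kn => ->.
have N1 z : (z * wbar K r [seq nodei k | k <- l1]) p (c0 k) = z p (c0 k) /\
            (z * wbar K r [seq nodei k | k <- l1]) p (c1 k) = z p (c1 k).
  by split; apply: mul_wbar_notin => k' k'l; have /H/andP[] : k' \in l1 ++ l2 by rewrite mem_cat k'l.
have N2 z : (z * wbar K r [seq nodei k | k <- l2]) p (c0 k) = z p (c0 k) /\
            (z * wbar K r [seq nodei k | k <- l2]) p (c1 k) = z p (c1 k).
  by split; apply: mul_wbar_notin => k' k'l; have /H/andP[] : k' \in l1 ++ l2 by rewrite mem_cat k'l orbT.
have -> : wbar K r [seq nodei k | k <- l1 ++ k :: l2] =
    wbar K r [seq nodei k | k <- l1] * sbar K r (nodei k) * wbar K r [seq nodei k | k <- l2].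
  by rewrite map_cat /wbar big_cat /= big_cons mulrA.
rewrite (mulrA y) (mulrA y) (N2 _).1 (N2 _).2 !mul_sbar eqxx [c1 k == _]eq_sym c0_neq_c1 eqxx.
by rewrite (N1 _).1 (N1 _).2.
Qed.

Let So := wbar K r [seq nodei k | k <- rev (odds r)].

Lemma par_rodds : same_parity (rev (odds r)).
Proof. by move=> k1 k2; rewrite !mem_rev; exact: par_odds. Qed.

Lemma So_c0 y (k : 'I_r) p : ~~ odd k -> (y * So) p (c0 k) = y p (c1 k).
Proof.
move=> ok; apply: (mul_wbar_in _ _ _ par_rodds _).1; first by rewrite rev_uniq uniq_odds.
by rewrite mem_rev mem_odds.
Qed.

Lemma So_zero (p q : 'I_r.+1) m : ~~ odd m -> (q < m)%N -> (m <= p)%N -> (m <= r)%N -> (x * So) p q = 0.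
Proof.
move=> om qm mp mr.
have [oq|eq] := boolP (odd q).
  have h : (q.-1 < r)%N by lia.
  have -> : q = c1 (Ordinal h) by apply: val_inj; rewrite /= /bump /=; lia.
  rewrite (mul_wbar_in _ _ _ par_rodds _).2 ?rev_uniq ?uniq_odds //; last first.
    by rewrite mem_rev mem_odds /=; lia.
  by rewrite xlay_upper ?oppr0 //=; lia.
have h : (q < r)%N by lia.
have -> : q = c0 (Ordinal h) by apply: val_inj.
by rewrite So_c0 // xlay_upper //= /bump /=; lia.
Qed.

(** The odd layer replaces the column of k by the next column of x, and row k of the product still
    vanishes left of the diagonal. The minor is thus the preceding Q times one entry of x. *)
Lemma lead_odd_pre (k : 'I_r) : ~~ odd k ->
  lead_minor k.+1 (x * So) = pa a k.+1 * Mo Y (nodei k).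
Proof.
move=> ok; have kr := ltn_ord k; have kr' : (k < r.+1)%N by exact: leqW.
have kn : all (fun k' : 'I_r => nat_of_ord k != k'.+1) (rev (odds r)).
  by apply/allP => k'; rewrite mem_rev mem_odds; lia.
have E0 : inord k = c0 k by apply: val_inj; rewrite /= inordK.
have E1 : inord k.+1 = c1 k by apply: val_inj; rewrite /= inordK ?/bump ?add1n.
rewrite lead_block1 //; last first.
  by move=> q qk; apply: (@So_zero _ _ k) => //; rewrite ?inordK // ltnW.
rewrite lead_wbar ?leqW // 1?ltnW // lead_Q 1?ltnW // E0 So_c0 //.
rewrite -E0 -E1 entE xlay_row //.
have op : odd k.+1 by [].
have [_ -> _ _ _] := row_odd (f := df) u v op (fun q => erefl).
rewrite /Mo is_nodei (paS _ kr') /ad -/u -/v /nodei /=.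
have -> : k.+1%:Z - 1 = k by lia.
have -> : k.+1%:Z + 1 = k.+2 by lia.
by field; rewrite ?u0 ?v0.
Qed.

(** In the decreasing word of the even layer, the letters after k do not change this minor, and
    those before k are larger and act on columns further right. What is left is a smaller Q times a
    2 x 2 minor in rows k - 1 and k. *)
Lemma lead_even_pre (k : 'I_r) : odd k ->
  lead_minor k.+1 (x * So * wbar K r [seq nodei k | k <- rev (evens r)])
  = pa a k.+1 * Me Y (nodei k).
Proof.
move=> ok; have kr := ltn_ord k; have kr' : (k < r.+1)%N by exact: leqW.
have kin : k \in rev (evens r) by rewrite mem_rev mem_evens.
have srt : pairwise (fun k1 k2 : 'I_r => k1 < k2)%N (evens r).
  rewrite -sorted_pairwise; last by move=> y1 y2 y3 /=; exact: ltn_trans.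
  apply: sorted_filter; first by move=> y1 y2 y3 /=; exact: ltn_trans.
  have := iota_ltn_sorted 0 r; rewrite -val_enum_ord sorted_map; exact.
have urev : uniq (rev (evens r)) by rewrite rev_uniq uniq_evens.
case/splitPr def_e: {1}_ / kin => [e1 e2].
have e1k k' : k' \in e1 -> (k < k')%N.
  move=> k'e; move: srt; rewrite -[evens r]revK def_e rev_cat rev_cons cat_rcons.
  rewrite pairwise_cat pairwise_cons => /and3P[_ _ /andP[/allP + _]].
  by apply; rewrite mem_rev.
have e1o k' : k' \in e1 -> odd k'.
  by move=> k'e; rewrite -mem_evens -mem_rev def_e mem_cat k'e.
have k2 : k \notin e2.
  by move: urev; rewrite def_e cat_uniq /= => /and3P[_ _ /andP[]].
rewrite -cat_rcons map_cat /wbar big_cat -!/(wbar _ _ _) mulrA /= -/(wbar _ _ _) lead_wbar ?leqW //; last first.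
  apply/allP => k' k'e; apply: contraNneq k2 => -[kk']; rewrite (_ : k = k') //.
  exact: val_inj.
set z := x * So * _.
have ue : uniq (rcons e1 k).
  by move: urev; rewrite def_e -cat_rcons cat_uniq => /andP[].
have pe : same_parity (rcons e1 k).
  move=> k1 k2'; rewrite !mem_rcons !inE.
  by move=> /orP[/eqP->|/e1o->] /orP[/eqP->|/e1o->].
have zlt p (q : 'I_r.+1) : (q < k)%N -> z p q = (x * So) p q.
  move=> qk; apply: mul_wbar_notin => k'; rewrite mem_rcons inE -!val_eqE /= /bump /= add1n.
  by case/orP => [/eqP->|/e1k]; lia.
have zk p : z p (c0 k) = (x * So) p (c1 k).
  by apply: (mul_wbar_in _ _ ue pe _).1; rewrite mem_rcons mem_head.
have k1 : (k.-1 < r)%N by lia.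
have kS : k.-1.+1 = k :> nat by lia.
have E0 : inord k.-1 = c0 (Ordinal k1) by apply: val_inj; rewrite /= inordK // ltnW.
have E1 : inord k = c0 k by apply: val_inj; rewrite /= inordK.
have E1' : c1 (Ordinal k1) = c0 k by apply: val_inj; rewrite /= /bump /= add1n.
rewrite -[in LHS]kS lead_block2 ?kS //; last first.
  move=> q qk; rewrite !zlt; [|lia|lia].
  by split; apply: (@So_zero _ _ k.-1) => //; rewrite ?inordK; lia.
have -> : lead_minor k.-1 z = lead_minor k.-1 x.
  have kr2 : (k.-1 <= r.+1)%N by lia.
  rewrite /z /So lead_wbar //; last first.
    by apply/allP => k'; rewrite mem_rcons inE => /orP[/eqP->|/e1k]; lia.
  by rewrite lead_wbar //; apply/allP => k'; rewrite mem_rev mem_odds; lia.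
rewrite lead_Q; last by lia.
have kl : (c0 (Ordinal k1) < k)%N by rewrite /=; lia.
have ok1 : ~~ odd (Ordinal k1) by rewrite /=; lia.
rewrite E1 !zk !zlt ?E0 // !So_c0 // E1' -E0 -E1.
have rj q : (q <= r.+1)%N -> ent x k.-1.+1 q = colO v (colE v (colO u (colE u df))) k.-1.+1 q.
  by move=> qr; apply: xlay_row; lia.
have ri q : (q <= r.+1)%N -> ent x k.+1 q = colO v (colE v (colO u (colE u df))) k.+1 q.
  by move=> qr; apply: xlay_row; lia.
have [rk1 rk2] : (k.+1 <= r.+1)%N /\ (k.+2 <= r.+1)%N by lia.
(* The column w is the one that the odd layer brings to position [c1 k]. At the last node there is
   no odd letter to the right and the column stays in place; the convention [Mo] = 1 makes the two
   cases agree. *)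
have [w wE [wj wi]] : exists2 w, forall p, (x * So) p (c1 k) = x p w &
    (x (inord k.-1) w = ad k / u k.-1%:Z) /\
    (x (inord k) w = ad k.+1 * u k.+1%:Z / u k%:Z + ad k.+1 * (if (k.+1 < r)%N then Mo Y k.+2%:Z else 1) / v k.+1%:Z).
  have op : odd k.-1.+1 by rewrite kS.
  have op1 : ~~ odd k.+1 by rewrite /= ok.
  case: (ltnP k.+1 r) => k1r.
    exists (inord k.+2) => [p|].
      have -> : c1 k = c0 (Ordinal k1r) by apply: val_inj; rewrite /= /bump /= add1n.
      rewrite So_c0 /= ?negbK ?ok //; congr (x _ _); apply: val_inj.
      by rewrite /= /bump /= add1n inordK.
    rewrite !entE rj ?ri //.
    have [_ _ _ + _] := row_odd (f := df) u v op (fun q => erefl); rewrite kS => ->.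
    have [_ _ -> _] := row_even (f := df) u v op1 isT (fun q => erefl).
    split; first by [].
    rewrite /Mo ifT; last by rewrite /is_node; lia.
    have -> : k.+2%:Z - 1 = k.+1 by lia.
    have -> : k.+2%:Z + 1 = k.+3 by lia.
    rewrite -/u -/v /=; by field; rewrite ?u0 ?v0.
  have kr1 : k.+1 = r by lia.
  have uk : u k.+2%:Z = 1 by rewrite /u /yy ifF // /is_node; lia.
  have vk : v k.+2%:Z = 1 by rewrite /v /yy ifF // /is_node; lia.
  exists (inord k.+1) => [p|].
    rewrite mul_wbar_notin; first by congr (x _ _); apply: val_inj; rewrite /= /bump /= add1n inordK.
    move=> k'; rewrite mem_rev mem_odds -!val_eqE /= /bump /= !add1n.
    by have := ltn_ord k'; lia.
  rewrite !entE rj ?ri //.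
  have [_ _ + _ _] := row_odd (f := df) u v op (fun q => erefl); rewrite kS => ->.
  have [_ -> _ _] := row_even (f := df) u v op1 isT (fun q => erefl).
  split; first by rewrite vk mulr1.
  by rewrite vk uk /= mulr1.
rewrite !wE wj wi !entE rj ?ri //.
have op : odd k.-1.+1 by rewrite kS.
have op1 : ~~ odd k.+1 by rewrite /= ok.
have [_ + _ _ _] := row_odd (f := df) u v op (fun q => erefl); rewrite kS => ->.
have [-> _ _ _] := row_even (f := df) u v op1 isT (fun q => erefl).
rewrite /Me is_nodei paS // -[in pa a k]kS paS; last by lia.
have -> : nodei k - 1 = k by rewrite /nodei; lia.
have -> : nodei k + 1 = k.+2 by rewrite /nodei; lia.
have -> : (if (k.+1 < r)%N then Mo Y k.+2%:Z else 1) = Mo Y k.+2%:Z.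
  by case: ifP => // k1r; rewrite /Mo ifF // /is_node; lia.
rewrite [Mo Y k]/Mo ifT; last by rewrite /is_node; lia.
have -> : k%:Z - 1 = k.-1 by lia.
have -> : k%:Z + 1 = k.+1 by lia.
rewrite -/u -/v /nodei /ad /=.
by field; rewrite ?u0 ?v0.
Qed.

End Xval.

End Layers.

(** * The image of the chart and the values of the initial minors on it *)

Section Cell.
Variables (K : fieldType) (r : nat).
Implicit Types (a : 'M[K]_r.+1) (Y : int -> int -> K).

Definition jo : seq 'I_r := evens r ++ odds r.

Lemma xlay_xw a Y : xlay a Y = a * xw ([seq (k, Y 1 (nodei k)) | k <- jo] ++ [seq (k, Y 2 (nodei k)) | k <- jo]).
Proof.
by rewrite /xlay /lay /jo !map_cat /xw !big_cat /= !mulrA.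
Qed.

Lemma diag_mul_lower a (y : 'M[K]_r.+1) : torusH a -> lowerN y -> lowerB (a * y).
Proof.
move=> [da aD] yN; have dy := det_lowerN yN; case: yN => yT _; split.
  by rewrite -[a * y]/(a *m y) det_mulmx da dy mulr1.
apply/is_trig_mxP => p q pq; rewrite mxE big1 // => s _.
case: (eqVneq p s) => [<-|ps]; last by rewrite (is_diag_mxP aD) ?mul0r.
by rewrite (is_trig_mxP yT) ?mulr0.
Qed.

Hypothesis r3 : (3 <= r)%N.

Lemma xlay_bruhat a Y : gd r Y -> exists y1 y2, [/\ lowerN y1, lowerN y2 &
   xlay a Y = a * y1 * mw K (jo ++ jo) * y2].
Proof.
move=> Y0; set l := [seq (k, Y 1 (nodei k)) | k <- jo] ++ [seq (k, Y 2 (nodei k)) | k <- jo].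
have lE : [seq d.1 | d <- l] = jo ++ jo.
  by rewrite /l map_cat -!map_comp -[X in _ = X ++ _]map_id -[X in _ = _ ++ X]map_id.
have [||y1 [y2 [y1N y2N xE]]] := @xw_bruhat K r l.
- by rewrite all_cat !all_map; apply/andP; split; apply/allP => k _ /=; have [] := Y0 k.
- by rewrite lE redw_c2.
by exists y1, y2; split; rewrite // xlay_xw xE lE !mulrA.
Qed.

Lemma xlay_SL a Y : torusH a -> gd r Y -> \det (xlay a Y) = 1.
Proof.
move=> [da _] Y0; have [y1 [y2 [y1N y2N ->]]] := xlay_bruhat a Y0.
rewrite -[_ * y2]/(_ *m y2) det_mulmx -[_ * mw _ _]/(_ *m mw _ _) det_mulmx.
by rewrite -[a * y1]/(a *m y1) det_mulmx da (det_lowerN y1N) (det_lowerN y2N) det_mw !mulr1.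
Qed.

Lemma xbar_cell a Y : torusH a -> gd r Y -> bruhat_cell (jseq r ++ jseq r) (xbar a Y).
Proof.
move=> aH Y0; rewrite xbarE //; split.
  split; first exact: xlay_SL.
  by apply/is_trig_mxP => p q pq; rewrite mxE xlay_upper //; case: aH.
have [y1 [y2 [y1N y2N ->]]] := xlay_bruhat a Y0.
have [h hD hE] := mono_diag (mono_mw K (jo ++ jo)) (mono_wbar K (jo ++ jo)).
rewrite hE jseqE -map_cat.
have hH : torusH h.
  split=> //; have := congr1 determinant hE.
  by rewrite -[_ * h]/(_ *m h) det_mulmx det_wbar mul1r det_mw => ->.
exists (a * y1), (h * y2); split; [exact: diag_mul_lower| exact: diag_mul_lower|].
by rewrite !mulrA.
Qed.

(** For the full word, x wbar is a y1 times a conjugate of y2 of the kind treated in [lead_conj], so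
    only the torus part contributes. *)
Lemma lead_P a Y i : torusH a -> gd r Y -> (i <= r)%N ->
  lead_minor i (xlay a Y * wbar K r (rev [seq nodei k | k <- jo ++ jo])) = pa a i.
Proof.
move=> aH Y0 ir; have [y1 [y2 [y1N y2N ->]]] := xlay_bruhat a Y0.
have ir1 : (i <= r.+1)%N by exact: leqW.
have [_ /is_trig_mxP L] := diag_mul_lower aH y1N.
rewrite -mulrA -mulrA lead_mull //; last by move=> p q pi iq; rewrite L // (leq_trans pi).
rewrite mulrA (lead_conj ir1 (mono_mw K _) y2N (mw_wbar K _)) mulr1 lead_lower //.
apply: eq_bigr => p _; rewrite mxE (bigD1 p) //= big1 ?addr0 => [|s sp].
  by case: y1N => _ ->; rewrite mulr1.
by case: aH => _ /is_diag_mxP ->; rewrite ?mul0r // eq_sym.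
Qed.

Definition J2 : seq 'I_r := rev jo ++ rev jo.

Lemma mem_jo k : k \in jo. Proof. by rewrite mem_cat mem_odds mem_evens orbN. Qed.
Lemma uniq_jo : uniq jo.
Proof.
rewrite cat_uniq uniq_odds uniq_evens /= andbT; apply/hasPn => k.
by rewrite mem_odds mem_evens.
Qed.
Lemma size_jo : size jo = r.
Proof. rewrite -[RHS](size_enum_ord r); apply/perm_size/uniq_perm; rewrite ?uniq_jo ?enum_uniq //.
by move=> k; rewrite mem_jo mem_enum. Qed.

(** Here c is the number of letters k read so far: 0, 1 and 2 give Q, M and P. *)
Definition gval a Y (c : nat) (k : 'I_r) : K :=
  pa a k.+1 * (if c == 0%N then fQ r Y (nodei k) else if c == 1%N then fM r Y (nodei k) else 1).

(** Letters other than k leave this minor unchanged. A prefix may thus be replaced by any of no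
    round, one round or two rounds of the Coxeter word with the same number of letters k. *)
Lemma lead_prefix a Y n (k : 'I_r) : torusH a -> gd r Y -> (n <= r + r)%N ->
  lead_minor k.+1 (xlay a Y * wbar K r [seq nodei k | k <- take n J2])
   = gval a Y (count_mem k (take n J2)) k.
Proof.
move=> aH Y0 nr; have kr : (k.+1 <= r.+1)%N by rewrite ltnS ltnW.
have [_ aD] := aH.
have nall w : k \notin w -> all (fun k' : 'I_r => k.+1 != k'.+1) w.
  move=> kw; apply/allP => k' k'w; apply: contraNneq kw => -[kk'].
  by rewrite (_ : k = k') //; apply: val_inj.
have cat y w1 w2 : y * wbar K r [seq nodei k | k <- w1 ++ w2] =
    y * wbar K r [seq nodei k | k <- w1] * wbar K r [seq nodei k | k <- w2].
  by rewrite map_cat /wbar big_cat /= mulrA.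
have cJ : count_mem k (rev jo) = 1%N by rewrite count_uniq_mem ?rev_uniq ?uniq_jo // mem_rev mem_jo.
have c2 : count_mem k J2 = 2%N by rewrite count_cat cJ.
have cle : (count_mem k (take n J2) <= 2)%N.
  by rewrite -c2 -[in X in (_ <= X)%N](cat_take_drop n J2) count_cat leq_addr.
have MJ : lead_minor k.+1 (xlay a Y * wbar K r [seq nodei k | k <- rev jo])
    = pa a k.+1 * fM r Y (nodei k).
  rewrite /jo rev_cat cat /fM /nodei /=; case: ifPn => ok.
    rewrite lead_wbar //; last by apply/nall; rewrite mem_rev mem_evens.
    exact: lead_odd_pre.
  by rewrite negbK in ok; apply: lead_even_pre.
rewrite /gval; case: eqP => [c0|c0].
  rewrite lead_wbar //; last by apply: nall; rewrite -has_pred1 has_count c0.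
  by rewrite lead_Q.
case: eqP => [c1|c1]; last first.
  have c2' : count_mem k (drop n J2) = 0%N.
    by have := count_cat (pred1 k) (take n J2) (drop n J2); rewrite cat_take_drop; lia.
  rewrite mulr1 -(@lead_P a Y) // -map_rev rev_cat -/J2 -{2}(cat_take_drop n J2) cat [RHS]lead_wbar //.
  by apply: nall; rewrite -has_pred1 has_count c2'.
rewrite -MJ; have szJ : size (rev jo) = r by rewrite size_rev size_jo.
case: (leqP n r) => nr'.
  rewrite -[X in _ = lead_minor _ (_ * wbar K r (map _ X))](cat_take_drop n (rev jo)) /J2 take_cat szJ.
  have -> : (if (n < r)%N then take n (rev jo) else rev jo ++ take (n - r) (rev jo)) = take n (rev jo).
    case: ltnP => // rn; have -> : n = r by apply/eqP; rewrite eqn_leq nr' rn.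
    by rewrite subnn take0 cats0 take_oversize // szJ.
  rewrite cat [RHS]lead_wbar //; apply: nall; rewrite -has_pred1 has_count.
  have := count_cat (pred1 k) (take n (rev jo)) (drop n (rev jo)); rewrite cat_take_drop cJ.
  move: c1; rewrite /J2 take_cat szJ; case: ltnP => [_|rn]; first by lia.
  by rewrite count_cat cJ => ?; rewrite take_oversize ?szJ // cJ; lia.
rewrite /J2 take_cat szJ ltnNge (ltnW nr') /= cat lead_wbar //.
apply: nall; rewrite -has_pred1 has_count.
by move: c1; rewrite /J2 take_cat szJ ltnNge (ltnW nr') /= count_cat cJ; lia.
Qed.

Lemma prefixE n : (n <= r + r)%N -> [seq jnode r t | t <- zrange 1 n%:Z] = [seq nodei k | k <- take n J2].
Proof.
move=> nr; have szJ : size (rev (jseq r)) = r by rewrite size_rev jseqE size_map size_jo.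
have -> : zrange 1 n%:Z = [seq 1 + t%:Z | t <- iota 0 n].
  by rewrite /zrange; case: (n) => [|m] //=; congr (_ :: map _ (iota 1 _)); lia.
have E : [seq nodei k | k <- J2] = rev (jseq r) ++ rev (jseq r).
  by rewrite /J2 map_cat map_rev -jseqE.
rewrite -map_comp map_take E.
apply: (@eq_from_nth _ 0) => [|i].
  by rewrite size_map size_iota size_take size_cat szJ; case: ltnP => //; lia.
rewrite size_map size_iota => ni.
rewrite (nth_map 0%N) ?size_iota // nth_iota // add0n nth_take // nth_cat szJ /= /jnode.
case: ltnP => ir.
  by congr (nth 0 _ _); rewrite modz_small; lia.
congr (nth 0 _ _); have -> : 1 + i%:Z - 1 = (i - r)%N%:Z + r%:Z by lia.
by rewrite modzDr modz_small; lia.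
Qed.

End Cell.

(** * LDU decomposition from nonvanishing leading minors *)

Section LDU.
Variable K : fieldType.

Definition ldu n (y : 'M[K]_n) : Prop := exists l h u : 'M[K]_n,
  [/\ is_trig_mx l /\ (forall p, l p p = 1), is_diag_mx h,
      is_trig_mx u^T /\ (forall p, u p p = 1) & y = l *m h *m u].

Lemma lead_minor_inv n (i : nat) (y : 'M[K]_n.+1) l u : (i <= n.+1)%N ->
  lowerN l -> @upperN K n u -> lead_minor i (l *m y *m u) = lead_minor i y.
Proof.
move=> ir [/is_trig_mxP lT l1] [/is_trig_mxP uT u1].
have uT' (p q : 'I_n.+1) : (q < p)%N -> u p q = 0 by move=> qp; have := uT q p qp; rewrite mxE.
rewrite -[_ *m u]/(_ * u) lead_mulr //; last by move=> p q qi ip; rewrite uT' // (leq_trans qi).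
rewrite -[l *m y]/(l * y) lead_mull //; last by move=> p q qi ip; rewrite lT // (leq_trans qi).
rewrite (lead_lower ir lT) (lead_upper ir uT') !big1 ?mul1r ?mulr1 // => p _; exact: u1.
Qed.

(** Gaussian elimination: S is the Schur complement of the corner entry p, and its leading minors
    are those of y divided by p. This places generic points of the chart in N_- H N, where
    [is_gminor] prescribes the value. *)
Lemma ldu_exists n (y : 'M[K]_n.+1) :
  (forall i, (0 < i <= n)%N -> lead_minor i y != 0) -> ldu y.
Proof.
elim: n y => [|n IH] y H.
  exists 1%:M, y, 1%:M; split; rewrite ?mul1mx ?mulmx1 //.
  - by split; [apply/is_trig_mxP => p q; rewrite !ord1 | move=> p; rewrite mxE eqxx].
  - by apply/is_diag_mxP => p q; rewrite !ord1.
  - by split; [apply/is_trig_mxP => p q; rewrite !ord1 | move=> p; rewrite mxE eqxx].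
pose p := y 0 0; pose b : 'rV_n.+1 := ursubmx (y : 'M_(1 + n.+1)).
pose c : 'cV_n.+1 := dlsubmx (y : 'M_(1 + n.+1)).
pose D : 'M_n.+1 := drsubmx (y : 'M_(1 + n.+1)).
have p0 : p != 0.
  have := H 1%N isT; rewrite lead_minorE det_mx11 !mxE.
  by rewrite (_ : inord _ = 0) //; apply: val_inj; rewrite /= inordK.
pose S := D - p^-1 *: (c *m b).
pose l1 : 'M_(1 + n.+1) := block_mx 1%:M 0 (p^-1 *: c) 1%:M.
pose u1 : 'M_(1 + n.+1) := block_mx 1%:M (p^-1 *: b) 0 1%:M.
have yE : (y : 'M_(1 + n.+1)) = l1 *m block_mx p%:M 0 0 S *m u1.
  rewrite /l1 /u1 !mulmx_block !mul1mx !mul0mx !mulmx0 !mulmx1 !addr0 !add0r.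
  rewrite -[LHS](@submxK _ 1 n.+1 1 n.+1 y); congr block_mx.
  - by apply/matrixP => i j; rewrite !mxE !ord1 /= mulr1n; congr (y _ _); apply: val_inj.
  - by rewrite mul_scalar_mx scalerA divff // scale1r.
  - by rewrite mul_mx_scalar scalerA divff // scale1r.
  - by rewrite mul_mx_scalar scalerA divff // scale1r -scalemxAr /S addrC subrK.
have trig_block (A : 'M[K]_1) (C : 'cV[K]_n.+1) (E : 'M[K]_n.+1) : is_trig_mx E ->
    is_trig_mx (block_mx A 0 C E : 'M_(1 + n.+1)).
  move=> /is_trig_mxP ET; apply/is_trig_mxP => i j ij.
  move: ij; rewrite -(splitK i) -(splitK j); case: (fintype.split i) => i'; case: (fintype.split j) => j' /= ij.
  - by move: ij; rewrite !ord1.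
  - by rewrite block_mxEur mxE.
  - by move: ij; rewrite !ord1.
  - by rewrite block_mxEdr ET //; move: ij; rewrite /= ltn_add2l.
have diag_block (A : 'M[K]_1) (B : 'rV[K]_n.+1) (C : 'cV[K]_n.+1) (E : 'M[K]_n.+1) : A 0 0 = 1 -> (forall i, E i i = 1) ->
    forall i, (block_mx A B C E : 'M_(1 + n.+1)) i i = 1.
  move=> A1 E1 i; rewrite -(splitK i); case: (fintype.split i) => i' /=.
    by rewrite block_mxEul ord1.
  by rewrite block_mxEdr.
have id1 m (i : 'I_m) : (1%:M : 'M[K]_m) i i = 1 by rewrite mxE eqxx.
have trig1 m : is_trig_mx (1%:M : 'M[K]_m) by exact: scalar_mx_is_trig.
have l1N : @lowerN K n.+1 l1 by split; [exact: trig_block | exact: diag_block].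
have u1N : @upperN K n.+1 u1.
  split; last exact: diag_block.
  rewrite -[u1^T]/(@trmx K (1 + n.+1) (1 + n.+1) u1) /u1 tr_block_mx trmx0 !trmx1.
  exact: trig_block.
have HS i : (0 < i <= n)%N -> lead_minor i S != 0.
  move=> /andP[i0 iN]; have := H i.+1 iN.
  rewrite (_ : lead_minor i.+1 y = p * lead_minor i S) ?mulf_eq0 ?negb_or => [/andP[]//|].
  rewrite -[y]/(y : 'M_(1 + n.+1)) yE lead_minor_inv ?lead_minorE //; last by rewrite !ltnS leqW.
  set Bm : 'M[K]_(1 + n.+1) := block_mx p%:M 0 0 S.
  have -> : lblock i.+1 (Bm : 'M[K]_n.+2) = (block_mx p%:M 0 0 (lblock i S) : 'M[K]_(1 + i)).
    have sL (s1 : 'I_1) : inord (lshift i s1) = lshift n.+1 s1 :> 'I_(1 + n.+1).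
      by apply: val_inj; rewrite /= inordK ?ord1.
    have sR (s1 : 'I_i) : inord (rshift 1 s1) = rshift 1 (inord s1 : 'I_n.+1) :> 'I_(1 + n.+1).
      have := ltn_ord s1; move=> s1i; apply: val_inj; rewrite /= !inordK //; last lia.
      by rewrite ltnS (leq_trans s1i) // leqW.
    apply/matrixP => s t; rewrite -(@splitK 1 i s) -(@splitK 1 i t).
    rewrite [LHS]mxE.
    case: (fintype.split (m:=1) (n:=i) s) => s1; case: (fintype.split (m:=1) (n:=i) t) => t1; rewrite /= ?sL ?sR /Bm.
    - by rewrite (@block_mxEul K 1 n.+1 1 n.+1) (@block_mxEul K 1 i 1 i).
    - by rewrite (@block_mxEur K 1 n.+1 1 n.+1) (@block_mxEur K 1 i 1 i) !mxE.
    - by rewrite (@block_mxEdl K 1 n.+1 1 n.+1) (@block_mxEdl K 1 i 1 i) !mxE.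
    - by rewrite (@block_mxEdr K 1 n.+1 1 n.+1) (@block_mxEdr K 1 i 1 i) [RHS]mxE.
  by rewrite (@det_ublock K 1 i) det_mx11 mxE mulr1n.
have [l [h [u [[lT ld] hD [uT ud] SE]]]] := IH S HS.
have blkE : block_mx p%:M 0 0 S = block_mx 1%:M 0 0 l *m block_mx p%:M 0 0 h *m block_mx 1%:M 0 0 u :> 'M[K]_(1 + n.+1).
  by rewrite !mulmx_block !(mul1mx, mul0mx, mulmx0, mulmx1, addr0, add0r) -SE.
have diag_blk : is_diag_mx (block_mx p%:M 0 0 h : 'M[K]_(1 + n.+1)).
  apply/is_diag_mxP => i j; rewrite -(splitK i) -(splitK j).
  case: (fintype.split i) => i'; case: (fintype.split j) => j' /= ij.
  - by move: ij; rewrite !ord1 eqxx.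
  - by rewrite block_mxEur mxE.
  - by rewrite block_mxEdl mxE.
  - by rewrite block_mxEdr (is_diag_mxP hD) //; move: ij; rewrite /= eqn_add2l.
exists ((l1 *m block_mx 1%:M 0 0 l : 'M_(1 + n.+1)) : 'M_n.+2), ((block_mx p%:M 0 0 h : 'M_(1 + n.+1)) : 'M_n.+2).
exists ((block_mx 1%:M 0 0 u *m u1 : 'M_(1 + n.+1)) : 'M_n.+2).
have N1 : @lowerN K n.+1 (block_mx 1%:M 0 0 l : 'M_(1 + n.+1)) by split; [exact: trig_block | exact: diag_block].
split.
- exact: (lowerN_mul l1N N1).
- exact: diag_blk.
- have U1 : @lowerN K n.+1 u1^T by case: u1N => uu ud1; split=> // i; rewrite mxE ud1.
  have U2 : @lowerN K n.+1 (block_mx 1%:M 0 0 u : 'M_(1 + n.+1))^T.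
    rewrite -[X in lowerN X]/(@trmx K (1 + n.+1) (1 + n.+1) _) tr_block_mx !trmx0 trmx1; split; first exact: trig_block.
    by apply: diag_block => // i; rewrite mxE ud.
  have [UT UD] := lowerN_mul U1 U2.
  rewrite trmx_mul; split=> // i; have := UD i.
  by rewrite -[_ * _]/(_ *m _) -trmx_mul mxE.
- by rewrite yE blkE !mulmxA.
Qed.

End LDU.

(** * Rational functions of one variable and regular functions along a curve *)

Section RationalCurve.
Variable K : numFieldType.
Implicit Types (g h : K -> K) (p q s : {poly K}).

(* p / q with no pole at 0 and 1; where q vanishes g is unconstrained *)
Definition rat01 g : Prop := exists p q,
  [/\ q.[0] != 0, q.[1] != 0 & forall t, q.[t] != 0 -> g t = p.[t] / q.[t]].

Lemma rat01_ext g h : g =1 h -> rat01 g -> rat01 h.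
Proof. by move=> gh [p [q [q0 q1 gE]]]; exists p, q; split=> // t /gE <-. Qed.

Lemma rat01_poly p : rat01 (fun t => p.[t]).
Proof. by exists p, 1; split=> [||t _]; rewrite hornerC ?oner_neq0 ?divr1. Qed.

Lemma rat01_cst c : rat01 (fun=> c).
Proof. by apply: rat01_ext (rat01_poly c%:P) => t; rewrite hornerC. Qed.

Lemma rat01D g h : rat01 g -> rat01 h -> rat01 (fun t => g t + h t).
Proof.
move=> [p [q [q0 q1 gE]]] [p' [q' [q0' q1' hE]]]; exists (p * q' + p' * q), (q * q').
split=> [||t]; [by rewrite hornerM mulf_neq0|by rewrite hornerM mulf_neq0|].
rewrite !(hornerM, hornerD, horner_exp) mulf_eq0 negb_or => /andP[qt qt'].
by rewrite gE // hE //; field; rewrite qt qt'.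
Qed.

Lemma rat01M g h : rat01 g -> rat01 h -> rat01 (fun t => g t * h t).
Proof.
move=> [p [q [q0 q1 gE]]] [p' [q' [q0' q1' hE]]]; exists (p * p'), (q * q').
split=> [||t]; [by rewrite hornerM mulf_neq0|by rewrite hornerM mulf_neq0|].
rewrite !(hornerM, hornerD, horner_exp) mulf_eq0 negb_or => /andP[qt qt'].
by rewrite gE // hE //; field; rewrite qt qt'.
Qed.

Lemma rat01N g : rat01 g -> rat01 (fun t => - g t).
Proof. by move=> /(rat01M (rat01_cst (- 1))); apply: rat01_ext => t; rewrite mulN1r. Qed.

Lemma rat01V g : rat01 g -> g 0 != 0 -> g 1 != 0 -> rat01 (fun t => (g t)^-1).
Proof.
move=> [p [q [q0 q1 gE]]]; rewrite !gE // !mulf_eq0 !invr_eq0 !negb_or.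
move=> /andP[p0 _] /andP[p1 _]; exists (q ^+ 2), (p * q).
split=> [||t]; [by rewrite hornerM mulf_neq0|by rewrite hornerM mulf_neq0|].
rewrite !(hornerM, hornerD, horner_exp) mulf_eq0 negb_or => /andP[pt qt].
by rewrite gE //; field; rewrite qt pt.
Qed.

Lemma rat01_prod (I : Type) (l : seq I) (F : I -> K -> K) :
  (forall i, rat01 (F i)) -> rat01 (fun t => \prod_(i <- l) F i t).
Proof.
move=> HF; elim: l => [|i l IH].
  by apply: rat01_ext (rat01_cst 1) => t; rewrite big_nil.
by apply: rat01_ext (rat01M (HF i) IH) => t; rewrite big_cons.
Qed.

Lemma rat01_sum (I : Type) (l : seq I) (F : I -> K -> K) :
  (forall i, rat01 (F i)) -> rat01 (fun t => \sum_(i <- l) F i t).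
Proof.
move=> HF; elim: l => [|i l IH].
  by apply: rat01_ext (rat01_cst 0) => t; rewrite big_nil.
by apply: rat01_ext (rat01D (HF i) IH) => t; rewrite big_cons.
Qed.

Lemma rat01X g n : rat01 g -> rat01 (fun t => g t ^+ n).
Proof.
move=> Hg; elim: n => [|n IH]; first by apply: rat01_ext (rat01_cst 1) => t; rewrite expr0.
by apply: rat01_ext (rat01M Hg IH) => t; rewrite exprS.
Qed.

Lemma poly_fun_eq0 p : (forall t, p.[t] = 0) -> p = 0.
Proof.
move=> p0; apply/eqP; apply: contraT => pn0.
have := @max_poly_roots _ p [seq n%:R | n <- iota 0 (size p)] pn0.
rewrite size_map size_iota ltnn; apply.
  by apply/allP => _ /mapP[n _ ->]; rewrite /root p0.
by rewrite map_inj_uniq ?iota_uniq // => m n /eqP; rewrite eqr_nat => /eqP.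
Qed.

Lemma rat01_eq0 g s : rat01 g -> s != 0 -> (forall t, s.[t] != 0 -> g t = 0) -> g 0 = 0.
Proof.
move=> [p [q [q0 q1 gE]]] s0 H.
have qn0 : q != 0 by apply: contraNneq q0 => ->; rewrite horner0.
suff p0 : p = 0 by rewrite gE // p0 horner0 mul0r.
have /eqP : p * (q * s) = 0.
  apply: poly_fun_eq0 => t; rewrite !hornerE; apply/eqP; rewrite !mulf_eq0.
  have [//|st] := eqVneq s.[t] 0; first by rewrite !orbT.
  have [//|qt] := eqVneq q.[t] 0; first by rewrite !orbT.
  by have := H t st; rewrite gE // => /eqP; rewrite mulf_eq0 invr_eq0 (negPf qt) !orbF.
by rewrite !mulf_eq0 (negPf qn0) (negPf s0) !orbF => /eqP.
Qed.

Lemma rat01_neq0 g c : rat01 g -> (c == 0) || (c == 1) -> g c != 0 ->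
  exists2 s, s != 0 & forall t, s.[t] != 0 -> g t != 0.
Proof.
move=> [p [q [q0 q1 gE]]] c01 gc; exists (p * q); last first.
  move=> t; rewrite !hornerE mulf_eq0 negb_or => /andP[pt qt].
  by rewrite gE // mulf_neq0 // invr_eq0.
have qc : q.[c] != 0 by case/orP: c01 => /eqP->.
apply: contraNneq gc => /(congr1 (fun p => p.[c])); rewrite !hornerE => /eqP.
by rewrite mulf_eq0 (negPf qc) orbF gE // => /eqP->; rewrite mul0r.
Qed.

End RationalCurve.

Section RegularCurve.
Variables (K : numFieldType) (r : nat).

Definition ratm (x : K -> 'M[K]_r.+1) : Prop := forall p q, rat01 (fun t => x t p q).

Lemma ratm_mul x y : ratm x -> ratm y -> ratm (fun t => x t * y t).
Proof.
move=> xR yR p q; apply: rat01_ext (rat01_sum _ (F := fun s t => x t p s * y t s q) _) => [t|s].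
  by rewrite [RHS]mxE; exact: erefl.
exact: rat01M.
Qed.

Lemma rat01_meval (x : K -> 'M[K]_r.+1) (P : mpoly.mpoly (r.+1 * r.+1) K) : ratm x ->
  rat01 (fun t => mpoly.meval (fun p => mxvec (x t) ord0 p) P).
Proof.
move=> xR; have v p : rat01 (fun t => mxvec (x t) ord0 p).
  by case/mxvec_indexP: p => i j; apply: rat01_ext (xR i j) => t; rewrite mxvecE.
have H : rat01 (fun t => \sum_(m <- mpoly.msupp P) (mpoly.mcoeff m P *
    \prod_(i <- enum 'I_(r.+1 * r.+1)) mxvec (x t) ord0 i ^+ (mpoly.fun_of_multinom m i))).
  by apply: rat01_sum => m; apply: rat01M; [exact: rat01_cst | apply: rat01_prod => i; exact: rat01X].
apply: rat01_ext H => t; rewrite mpoly.mevalE; apply: eq_bigr => m _; by rewrite big_enum.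
Qed.

(** Since z 1 is nonzero, z can be cancelled for all but finitely many t. Near t = 0 the regular
    function f is a quotient of polynomials along the curve, so the equality extends to t = 0 even
    if z vanishes there. The polynomial [s0] discards the parameters at which the curve may leave
    X. *)
Lemma regular_curve (X : set 'M[K]_r.+1) f (x : K -> 'M[K]_r.+1) (z D : K -> K) s0 :
  regular_on X f -> ratm x -> s0.[0] != 0 -> (forall t, s0.[t] != 0 -> X (x t)) ->
  rat01 z -> z 1 != 0 -> rat01 D ->
  (forall t, s0.[t] != 0 -> z t * f (x t) = z t * D t) -> f (x 0) = D 0.
Proof.
move=> fR xR s00 xX zR z1 DR H.
have s0n0 : s0 != 0 by apply: contraNneq s00 => ->; rewrite horner0.
have [P [Q [Q0 PQ]]] := fR _ (xX _ s00).
have PR := rat01_meval P xR; have QR := rat01_meval Q xR.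
have [|sQ sQ0 sQn] := rat01_neq0 QR _ Q0; first by rewrite eqxx.
have [|sz sz0 szn] := rat01_neq0 zR _ z1; first by rewrite eqxx orbT.
have := @rat01_eq0 _ _ (s0 * sQ * sz) (rat01D PR (rat01N (rat01M DR QR))).
move=> /(_ _ _)/eqP; rewrite subr_eq0 => E.
rewrite PQ //; last exact: xX.
rewrite (eqP (E _ _)) ?mulfK // ?mulf_neq0 // => t.
rewrite !hornerE !mulf_eq0 !negb_or => /andP[/andP[st /sQn Qt] /szn zt].
have /(mulfI zt) := H t st; rewrite PQ //; last exact: xX.
by move=> <-; rewrite divfK ?subrr.
Qed.

End RegularCurve.

(** * Positive rational functions of the coordinates, and the initial minors on the chart *)

Section Nice.
Variables (K : numFieldType) (r : nat).
Notation YT := (int -> int -> K).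
Implicit Types (Y : YT) (phi psi : YT -> K) (a : 'M[K]_r.+1).

Definition crv Y (t : K) : YT := fun s i => Y s i + t * (1 - Y s i).
Definition nz Y : Prop := forall s i, Y s i != 0.
(** The chart sees only Y_{1,i} and Y_{2,i} at nodes. Setting the other coordinates to 1 turns the
    hypothesis [gd], which concerns the visible ones, into [nz], which the line to the all-ones
    point requires. *)
Definition norm Y : YT := fun s i =>
  if ((s == 1) || (s == 2)) && is_node r i then Y s i else 1.

Lemma crv0 Y : crv Y 0 = Y.
Proof. by apply/funext => s; apply/funext => i; rewrite /crv mul0r addr0. Qed.

Lemma crv1 Y : crv Y 1 = (fun _ _ => 1).
Proof. by apply/funext => s; apply/funext => i; rewrite /crv mul1r addrC subrK. Qed.

(* Positivity at (1, 1, ...) makes phi a nonzero rational function on every line through that point,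
   so that it can be cancelled generically in an exchange relation. *)
Definition nice phi : Prop := [/\
  forall Y, nz Y -> rat01 (fun t => phi (crv Y t)),
  0 < phi (fun _ _ => 1) & forall Y, phi (norm Y) = phi Y].

Lemma nz_gd Y : nz Y -> gd r Y. Proof. by move=> Y0 k; split. Qed.

Lemma norm_nz Y : gd r Y -> nz (norm Y).
Proof.
move=> Y0 s i; have := @yy_neq0 K r Y s i Y0; rewrite /yy /norm.
by case: ((s == 1) || (s == 2)) => [/(_ isT)|_] //; exact: oner_neq0.
Qed.

Lemma rat01_crv Y s i : rat01 (fun t => crv Y t s i).
Proof.
apply: rat01_ext (rat01D (rat01_cst (Y s i)) (rat01M (rat01_poly 'X) (rat01_cst (1 - Y s i)))) => t.
by rewrite hornerX.
Qed.

Lemma nice1 : nice (fun=> 1).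
Proof. by split=> [Y _||Y]; [exact: rat01_cst | exact: ltr01|]. Qed.

Lemma nice_yy s i : (s == 1) || (s == 2) -> nice (fun Y => yy r Y s i).
Proof.
move=> s12; rewrite /yy; case iN: (is_node r i); last exact: nice1.
split=> [Y _||Y]; [exact: rat01_crv | exact: ltr01|].
by rewrite /norm s12 iN.
Qed.

Lemma niceD phi psi : nice phi -> nice psi -> nice (fun Y => phi Y + psi Y).
Proof.
move=> [p1 p2 p3] [q1 q2 q3]; split; [|exact: addr_gt0|by move=> Y; rewrite p3 q3].
by move=> Y Y0; apply: rat01D; [exact: p1 | exact: q1].
Qed.

Lemma niceM phi psi : nice phi -> nice psi -> nice (fun Y => phi Y * psi Y).
Proof.
move=> [p1 p2 p3] [q1 q2 q3]; split; [|exact: mulr_gt0|by move=> Y; rewrite p3 q3].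
by move=> Y Y0; apply: rat01M; [exact: p1 | exact: q1].
Qed.

Lemma nice_yyV s i : (s == 1) || (s == 2) -> nice (fun Y => (yy r Y s i)^-1).
Proof.
move=> s12; have [h1 h2 h3] := nice_yy i s12; split; rewrite ?invr_gt0 //; last by move=> Y; rewrite h3.
move=> Y Y0; apply: rat01V; [exact: h1 | rewrite crv0 | rewrite crv1 gt_eqF //].
by rewrite /yy; case: ifP => // _; exact: oner_neq0.
Qed.

Lemma nice_ext phi psi : phi =1 psi -> nice phi -> nice psi.
Proof. by move=> /funext->. Qed.

Lemma nice_if (b : bool) phi psi : nice phi -> nice psi -> nice (fun Y => if b then phi Y else psi Y).
Proof. by case: b. Qed.

Lemma nice_Mo i : nice (fun Y => Mo r Y i).
Proof.
apply: nice_if nice1; apply: niceD; first exact: nice_yy.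
by apply: niceM (nice_yyV _ _) => //; apply: niceM; exact: nice_yy.
Qed.

Lemma nice_fM i : nice (fun Y => fM r Y i).
Proof.
apply: nice_if (nice_Mo i) _; apply: nice_if nice1; apply: niceD; first exact: nice_yy.
by apply: niceM (nice_yyV _ _) => //; apply: niceM; exact: nice_Mo.
Qed.

Lemma nice_fQ i : nice (fun Y => fQ r Y i).
Proof. by apply: niceM; exact: nice_yy. Qed.

Lemma nice_prod (I : Type) (l : seq I) (F : I -> YT -> K) :
  (forall i, nice (F i)) -> nice (fun Y => \prod_(i <- l) F i Y).
Proof.
move=> HF; elim: l => [|i l IH].
  by apply: nice_ext nice1 => Y; rewrite big_nil.
by apply: nice_ext (niceM (HF i) IH) => Y; rewrite big_cons.
Qed.

Lemma xbar_norm a Y : gd r Y -> xbar a (norm Y) = xbar a Y.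
Proof.
move=> Y0; rewrite !xbarE //; last exact/nz_gd/norm_nz.
have E s (l : seq 'I_r) : (s == 1) || (s == 2) ->
    lay (fun k => norm Y s (nodei k)) l = lay (fun k => Y s (nodei k)) l.
  by move=> s12; congr xw; apply: eq_map => k; rewrite /norm s12 is_nodei.
by rewrite /xlay !E.
Qed.

(* vanishes exactly at the t for which crv Y t is not a point of the chart *)
Definition crvp Y : {poly K} := \prod_(k <- enum 'I_r)
   (((Y 1 (nodei k))%:P + 'X * (1 - Y 1 (nodei k))%:P) * ((Y 2 (nodei k))%:P + 'X * (1 - Y 2 (nodei k))%:P)).

Lemma crvp0 Y : nz Y -> (crvp Y).[0] != 0.
Proof.
move=> Y0; rewrite /crvp horner_prod prodf_seq_neq0; apply/allP => k _ /=.
by rewrite hornerM !hornerD !hornerM !hornerX !hornerC !mul0r !addr0 mulf_neq0.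
Qed.

Lemma crvp_gd Y t : (crvp Y).[t] != 0 -> gd r (crv Y t).
Proof.
rewrite /crvp horner_prod prodf_seq_neq0 => /allP H k.
have := H k; rewrite mem_enum => /(_ isT); rewrite /= !hornerE mulf_eq0 negb_or => /andP[h1 h2].
by split.
Qed.

Lemma ratm_cst (m : 'M[K]_r.+1) : ratm (fun=> m).
Proof. by move=> p q; exact: rat01_cst. Qed.

Lemma ratm_prod (l : seq int) (F : int -> K -> 'M[K]_r.+1) :
  (forall i, ratm (F i)) -> ratm (fun t => \prod_(i <- l) F i t).
Proof.
move=> HF; elim: l => [|i l IH].
  by move=> p q; apply: rat01_ext (rat01_cst ((1 : 'M[K]_r.+1) p q)) => t; rewrite big_nil.
by move=> p q; apply: rat01_ext (ratm_mul (HF i) IH p q) => t; rewrite big_cons.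
Qed.

Lemma ratm_xbar a Y : nz Y -> ratm (fun t => xbar a (crv Y t)).
Proof.
move=> Y0.
have H s i : ratm (fun t => xmx r i (crv Y t s i) * coroot r i (crv Y t s i)).
  apply: ratm_mul => p q.
    by apply: rat01_ext (rat01D (rat01_cst _) (rat01M (rat01_crv Y s i) (rat01_cst _))) => t; rewrite /xmx mxE_addscale.
  case: (eqVneq p q) => [<-|pq]; last first.
    by apply: rat01_ext (rat01_cst 0) => t; rewrite !mxE (negPf pq).
  case: (eqVneq p.+1%:Z i) => pi.
    by apply: rat01_ext (rat01_crv Y s i) => t; rewrite !mxE eqxx pi eqxx.
  case: (eqVneq p.+1%:Z (i + 1)) => pi1; last first.
    by apply: rat01_ext (rat01_cst 1) => t; rewrite !mxE eqxx (negPf pi) (negPf pi1).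
  have : rat01 (fun t => (crv Y t s i)^-1).
    by apply: rat01V; [exact: rat01_crv | rewrite crv0 | rewrite crv1 oner_neq0].
  by apply: rat01_ext => t; rewrite !mxE eqxx (negPf pi) pi1 eqxx.
rewrite /xbar; apply: ratm_mul; first apply: ratm_mul; first exact: ratm_cst.
  exact: (@ratm_prod _ (fun i t => xmx r i (crv Y t 1 i) * coroot r i (crv Y t 1 i))).
exact: (@ratm_prod _ (fun i t => xmx r i (crv Y t 2 i) * coroot r i (crv Y t 2 i))).
Qed.

Lemma torus_pa_neq0 a i : torusH a -> pa a i != 0.
Proof.
move=> [da /is_diag_mxP aD]; apply/prodf_neq0 => p _.
have : \prod_(q < r.+1) a q q != 0.
  by rewrite -det_trig ?da ?oner_neq0 //; apply/is_trig_mxP => u v uv; rewrite aD // neq_ltn uv.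
by move/prodf_neq0; apply.
Qed.

Lemma torus_char_Lam a (k : 'I_r) : torus_char a (Lam r (nodei k)) = pa a k.+1.
Proof.
rewrite /torus_char (bigD1 k) //= mxE eqxx expr1z [X in _ * X]big1 ?mulr1 //.
by move=> j ji; rewrite mxE eqz_nat eqSS val_eqE (negPf ji) expr0z.
Qed.

Hypothesis r3 : (3 <= r)%N.

Lemma nice_gval a c k : torusH a -> forall Y, nz Y -> rat01 (fun t => gval a (crv Y t) c k).
Proof.
move=> aH Y Y0; apply: rat01M; first exact: rat01_cst.
case: eqP => _; first by have [h _ _] := nice_fQ (nodei k); exact: h.
case: eqP => _; last exact: rat01_cst.
by have [h _ _] := nice_fM (nodei k); exact: h.
Qed.

(** Where every M is nonzero, all leading minors of x wbar are nonzero by [lead_prefix], so x wbar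
    has an LDU decomposition and [is_gminor] gives f. The product of all M is the function cancelled
    in [regular_curve], which reaches the remaining points. *)
Lemma gminor_val (f : 'M[K]_r.+1 -> K) k n a Y : (n <= r + r)%N ->
  is_gminor (nodei k) [seq nodei j | j <- take n (J2 r)] f -> torusH a -> nz Y ->
  f (xbar a Y) = gval a Y (count_mem k (take n (J2 r))) k.
Proof.
move=> nr [fR fE] aH Y0.
have zN := nice_prod (enum 'I_r) (fun k => nice_fM (nodei k)).
rewrite -{1}(crv0 Y) -{2}(crv0 Y).
apply: (regular_curve (X := @SL K r) (s0 := crvp Y) (x := fun t => xbar a (crv Y t))
   (z := fun t => \prod_(k <- enum 'I_r) fM r (crv Y t) (nodei k))
   (D := fun t => gval a (crv Y t) (count_mem k (take n (J2 r))) k)) => //.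
- exact: ratm_xbar.
- exact: crvp0.
- move=> t /crvp_gd Yt; rewrite xbarE //; exact: xlay_SL.
- by have [h _ _] := zN; exact: h.
- by rewrite crv1 gt_eqF //; have [_ h _] := zN.
- exact: nice_gval.
move=> t /crvp_gd Yt; set z := \prod_(k <- _) _.
have [->|z0] := eqVneq z 0; first by rewrite !mul0r.
congr (_ * _); rewrite xbarE //.
have M0 (k' : 'I_r) : fM r (crv Y t) (nodei k') != 0.
  by move: z0; rewrite /z prodf_seq_neq0 => /allP/(_ k'); rewrite mem_enum => /(_ isT).
pose w := [seq nodei j | j <- take n (J2 r)].
have := @ldu_exists _ _ (xlay a (crv Y t) * wbar K r w).
case=> [i /andP[i0 ir]|l [h [u [[lT l1] hD [uT u1] lduE]]]].
  have iP : (i.-1 < r)%N by rewrite prednK.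
  have -> : i = (Ordinal iP).+1 by rewrite /= prednK.
  rewrite lead_prefix // /gval mulf_neq0 ?torus_pa_neq0 //.
  case: (count_mem _ _ == 0%N); first by rewrite /fQ mulf_neq0 // yy_neq0.
  by case: (count_mem _ _ == 1%N); rewrite ?oner_neq0.
have lN : lowerN l by [].
have dh : \det h = 1.
  have <- : \det (l *m h *m u) = \det h.
    rewrite !det_mulmx (det_lowerN lN) mul1r -(det_tr u) (@det_lowerN _ _ u^T) ?mulr1 //.
    by split=> // p; rewrite mxE.
  rewrite -lduE; transitivity (\det (xlay a (crv Y t)) * \det (wbar K r w)); first exact: det_mulmx.
  by rewrite xlay_SL // det_wbar mulr1.
have hH : torusH h by [].
have uN : upperN u by [].
have E : xlay a (crv Y t) * wbar K r w = l * h * u by exact: lduE.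
have xS : SL (xlay a (crv Y t)) by exact: xlay_SL.
rewrite (fE _ _ _ _ xS lN hH uN E) -(lead_minor_ldu k lN hH uN) -E.
by rewrite lead_prefix.
Qed.

Lemma gminor_val_gd (f : 'M[K]_r.+1 -> K) k n a Y : (n <= r + r)%N ->
  is_gminor (nodei k) [seq nodei j | j <- take n (J2 r)] f -> torusH a -> gd r Y ->
  f (xbar a Y) = gval a Y (count_mem k (take n (J2 r))) k.
Proof.
move=> nr fG aH Y0; rewrite -xbar_norm // (gminor_val nr fG aH (norm_nz Y0)) /gval.
have [_ _ ->] := nice_fQ (nodei k); have [_ _ ->] := nice_fM (nodei k).
by [].
Qed.

End Nice.

Lemma mem_zrange (p q t : int) : (t \in zrange p q) = (p <= t <= q).
Proof.
rewrite /zrange; apply/mapP/idP => [[n]|tpq].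
  by rewrite mem_iota add0n => nr ->; move: nr; case: ifP; lia.
by exists `|t - p|%N; [rewrite mem_iota ifT; lia | lia].
Qed.

Lemma zrange_uniq (p q : int) : uniq (zrange p q).
Proof. by rewrite map_inj_uniq ?iota_uniq // => m n; lia. Qed.

(** * Mutations along a ladder *)

Section Labels.
Variable r : nat.

(* inverse of k |-> j_k *)
Definition lm (i : int) : int :=
  (if odd `|i|%N then uhf r else r%:Z + 1) - (`|i|%N./2)%:Z.

Lemma filter_odd_iota n : [seq i <- iota 1 n | odd i] = [seq i.*2.+1 | i <- iota 0 (n.+1)./2].
Proof.
elim: n => [//|n IH]; rewrite -[n.+1]addn1 iotaD filter_cat IH /= add1n.
have [on|en] := boolP (odd n) => /=.
  rewrite cats0; congr (map _ (iota 0 _)); lia.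
have -> : uphalf (n + 1) = (uphalf n + 1)%N by lia.
by rewrite iotaD map_cat /=; congr (_ ++ [:: _]); lia.
Qed.

Lemma filter_even_iota n : [seq i <- iota 1 n | ~~ odd i] = [seq i.*2 | i <- iota 1 n./2].
Proof.
elim: n => [//|n IH]; rewrite -[n.+1]addn1 iotaD filter_cat IH /= add1n negbK.
have [on|en] := boolP (odd n) => /=.
  have -> : (n + 1)./2 = (n./2 + 1)%N by lia.
  by rewrite iotaD map_cat /=; congr (_ ++ [:: _]); lia.
by rewrite cats0; congr (map _ (iota 1 _)); lia.
Qed.

Lemma jnodeE (k : int) : 1 <= k <= r%:Z ->
  jnode r k = if k <= uhf r then 2 * (uhf r - k) + 1 else 2 * (r%:Z - k + 1).
Proof.
move=> kr; rewrite /jnode modz_small; last by lia.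
rewrite /jseq filter_even_iota filter_odd_iota rev_cat nth_cat size_rev !size_map size_iota.
case: ltnP => kh.
  rewrite nth_rev ?size_map ?size_iota // (nth_map 0%N) ?size_map ?size_iota; last by lia.
  rewrite (nth_map 0%N) ?size_iota; last by lia.
  rewrite nth_iota; last by lia.
  by rewrite ifT /uhf; lia.
rewrite nth_rev ?size_map ?size_iota; last by lia.
rewrite (nth_map 0%N) ?size_map ?size_iota; last by lia.
rewrite (nth_map 0%N) ?size_iota; last by lia.
rewrite nth_iota; last by lia.
by rewrite ifF /uhf; lia.
Qed.

Lemma jnodeD (k : int) : jnode r (r%:Z + k) = jnode r k.
Proof.
rewrite /jnode; congr (nth _ _ `|_|%N).
have -> : r%:Z + k - 1 = (k - 1) + r%:Z by lia.
by rewrite modzDr.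
Qed.

Lemma lm_range i : is_node r i -> 1 <= lm i <= r%:Z.
Proof. by rewrite /is_node /lm /uhf => iN; case: ifP => oi; lia. Qed.

Lemma jnode_lm i : is_node r i -> jnode r (lm i) = i.
Proof.
move=> iN; have := lm_range iN; move=> lr; rewrite (jnodeE lr).
move: iN lr; rewrite /is_node /lm /uhf; case: (boolP (odd `|i|%N)) => oi iN lr.
  by rewrite ifT; lia.
by rewrite ifF; lia.
Qed.

Lemma jnode_node k : 1 <= k <= r%:Z -> is_node r (jnode r k).
Proof. by move=> kr; rewrite jnodeE // /is_node /uhf; case: ifP; lia. Qed.

Lemma lm_jnode k : 1 <= k <= r%:Z -> lm (jnode r k) = k.
Proof.
move=> kr; rewrite (jnodeE kr) /uhf; case: ifP => kh; rewrite /lm /uhf.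
  by rewrite ifT; lia.
by rewrite ifF; lia.
Qed.

Lemma lm_inj i i' : is_node r i -> is_node r i' -> lm i = lm i' -> i = i'.
Proof. by move=> iN iN' E; rewrite -(jnode_lm iN) E jnode_lm. Qed.

Lemma labels_uniq : uniq (labels r).
Proof.
rewrite cat_uniq zrange_uniq map_inj_uniq ?zrange_uniq ?andbT; last exact: oppr_inj.
apply/hasPn => u; rewrite mem_zrange => ur; apply/negP => /mapP[t].
by rewrite mem_zrange => tr; lia.
Qed.

Lemma mem_labels u : (u \in labels r) = ((- r%:Z <= u <= -1) || (1 <= u <= 2 * r%:Z)).
Proof.
rewrite mem_cat mem_zrange; congr (_ || _); apply/mapP/idP => [[t]|ur].
  by rewrite mem_zrange; lia.
by exists (- u); [rewrite mem_zrange; lia | rewrite opprK].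
Qed.

Lemma Lam_nonnode i : ~~ is_node r i -> Lam r i = 0.
Proof.
move=> iN; apply/rowP => p; rewrite !mxE; case: eqP => // pi.
by move: iN; rewrite -pi /is_node; have := ltn_ord p; lia.
Qed.

End Labels.

(** * Columns of the exchange matrix and their mutation *)

Section Columns.
Variables (K : numFieldType) (r : nat).
Implicit Types (S T : seed K r).

(** No loops and no 2-cycles: the signed count [col] then determines the arrows in both
    directions. *)
Definition acyc S : Prop := forall u v, arrows S u v = 0%N \/ arrows S v u = 0%N.
Definition col S (v u : int) : int := (arrows S u v)%:Z - (arrows S v u)%:Z.

Lemma acyc_mutation k S T : acyc S -> is_mutation k S T -> acyc T.
Proof.
move=> aS [E _ _ _] u v; rewrite !E /mutate_arrows.
case: (eqVneq u k) => [->|uk] /=; first by rewrite orbT; exact: aS.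
rewrite orbF; case: (eqVneq v k) => [->|vk] /=; first exact: aS.
by lia.
Qed.

(** The terms with 2 (u == k) produce the sign change of the entry at the mutated vertex, so that
    one formula holds for every u. *)
Lemma col_mutation k S T v u : acyc S -> is_mutation k S T -> v != k ->
  col T v u = col S v u + (arrows S k v)%:Z * ((arrows S u k)%:Z - 2 * (u == k)%:Z)
             - (arrows S v k)%:Z * ((arrows S k u)%:Z - 2 * (u == k)%:Z).
Proof.
move=> aS [E _ _ _] vk; rewrite /col !E /mutate_arrows (negPf vk) orbF.
case: (eqVneq u k) => [->|uk] /=.
  by have [kk|kk] := aS k k; rewrite kk; lia.
have [h1|h1] := aS u v; have [h2|h2] := aS u k; have [h3|h3] := aS v k; rewrite ?h1 ?h2 ?h3; nia.
Qed.

Lemma col_mutation_self k S T u : is_mutation k S T -> col T k u = - col S k u.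
Proof.
move=> [E _ _ _]; rewrite /col !E /mutate_arrows eqxx orbT /=; lia.
Qed.

End Columns.

(** * Seeds seen along a line of adjacent nodes *)

Section Ladder.
Variables (K : numFieldType) (r : nat).
Hypothesis r3 : (3 <= r)%N.
Variables (x0 d : int).
Hypothesis d1 : (d == 1) || (d == -1).
Implicit Types (S T : seed K r).

Definition nd (n : int) : int := x0 + d * n.

(* (None, n), (Some true, n), (Some false, n) stand for the initial M, P, Q at the node nd n *)
Definition vtx : Type := (option bool * int)%type.
Implicit Types (x y k : vtx) (L Ki Ko X Z : seq vtx).
Definition vM (n : int) : vtx := (None, n).
Definition vP (n : int) : vtx := (Some true, n).
Definition vQ (n : int) : vtx := (Some false, n).

Definition vnode x := is_node r (nd x.2).
Definition vlab x : int :=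
  match x.1 with
  | None => lm r (nd x.2)
  | Some true => r%:Z + lm r (nd x.2)
  | Some false => - nd x.2
  end.

Lemma nd_inj : injective nd.
Proof. by move=> m n; rewrite /nd; case/orP: d1 => /eqP->; lia. Qed.

Lemma vlab_inj x y : vnode x -> vnode y -> vlab x = vlab y -> x = y.
Proof.
case: x y => [[[]|] m] [[[]|] n]; rewrite /vnode /vlab /= => xN yN;
  have mr := lm_range xN; have nr := lm_range yN; move=> E;
  try (by exfalso; move: xN yN; rewrite /is_node; lia).
- by have /(lm_inj xN yN)/nd_inj-> : lm r (nd m) = lm r (nd n) by lia.
- by have /nd_inj-> : nd m = nd n by lia.
- by have /(lm_inj xN yN)/nd_inj-> : lm r (nd m) = lm r (nd n) by lia.
Qed.

Lemma vlab_labels x : vnode x -> vlab x \in labels r.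
Proof.
rewrite mem_labels /vnode /vlab => xN; have := lm_range xN; move: xN; rewrite /is_node.
by case: x.1 => [[]|]; lia.
Qed.

(** Multiplicity of the label u in L, vertices off the diagram counting for nothing. The same list
    thus describes a column in the interior and at the ends of the diagram. *)
Definition sm L (u : int) : nat := (\sum_(x <- L) (vnode x && (u == vlab x)))%N.

Lemma sm_nil u : sm [::] u = 0%N. Proof. by rewrite /sm big_nil. Qed.
Lemma sm_cons x L u : sm (x :: L) u = ((vnode x && (u == vlab x)) + sm L u)%N.
Proof. by rewrite /sm big_cons. Qed.
Lemma sm_cat L L' u : sm (L ++ L') u = (sm L u + sm L' u)%N.
Proof. by rewrite /sm big_cat. Qed.

Lemma sm_lab L y : vnode y -> sm L (vlab y) = count_mem y L.
Proof.
move=> yN; elim: L => [|x L IH]; rewrite ?sm_nil // sm_cons IH /=; congr (nat_of_bool _ + _)%N.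
apply/andP/eqP => [[xN /eqP E]|->]; first exact/esym/vlab_inj.
by rewrite eqxx.
Qed.

Lemma sm_gt0 L u : (0 < sm L u)%N -> exists x, [/\ x \in L, vnode x & u = vlab x].
Proof.
elim: L => [|x L IH]; rewrite ?sm_nil // sm_cons.
case: (boolP (vnode x && _)) => [/andP[xN /eqP uE] _|_]; first by exists x; rewrite mem_head.
by rewrite add0n => /IH[y [yL yN yE]]; exists y; rewrite inE yL orbT.
Qed.

(** Arrows into x come from L1 and arrows out of x go to L2. Only the difference is recorded, so
    vertices common to both lists cancel. *)
Definition colis S x L1 L2 : Prop := forall u, col S (vlab x) u = (sm L1 u)%:Z - (sm L2 u)%:Z.
Definition disj L1 L2 := all (fun x => x \notin L2) L1.

Lemma arr_of_col S x L1 L2 u : acyc S -> colis S x L1 L2 -> disj L1 L2 ->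
  arrows S u (vlab x) = sm L1 u /\ arrows S (vlab x) u = sm L2 u.
Proof.
move=> aS cS dj; have := cS u; rewrite /col.
have H : sm L1 u = 0%N \/ sm L2 u = 0%N.
  case: (posnP (sm L1 u)) => [->|/sm_gt0[y [yL yN uE]]]; [by left | right].
  rewrite uE sm_lab //; apply/count_memPn.
  by move/allP: dj => /(_ y yL).
by have := aS u (vlab x); lia.
Qed.

Lemma step_col S T k Ki Ko y L1 L2 u : acyc S -> is_mutation (vlab k) S T ->
  vnode k -> vnode y -> colis S k Ki Ko -> disj Ki Ko -> y != k -> colis S y L1 L2 ->
  col T (vlab y) u = (sm L1 u)%:Z - (sm L2 u)%:Z
    + (count_mem y Ko)%:Z * ((sm Ki u)%:Z - 2 * (sm [:: k] u)%:Z)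
    - (count_mem y Ki)%:Z * ((sm Ko u)%:Z - 2 * (sm [:: k] u)%:Z).
Proof.
move=> aS mT kN yN ck dj yk cy; rewrite (col_mutation _ aS mT); last first.
  by apply: contraNneq yk => /(vlab_inj yN kN) ->.
rewrite cy; have [-> ->] := arr_of_col u aS ck dj; have [-> ->] := arr_of_col (vlab y) aS ck dj.
by rewrite !sm_lab // sm_cons sm_nil kN /= addn0.
Qed.

Definition valx S x m : K := if vnode x then cvar S (vlab x) m else 1.
(* the variables in L have product a^chi phi(Y); nodes outside [1, r] contribute 1 *)
Definition hv S L (chi : 'rV[int]_r) (phi : (int -> int -> K) -> K) : Prop :=
  forall a Y, torusH a -> gd r Y ->
    \prod_(x <- L) valx S x (xbar a Y) = torus_char a chi * phi Y.

Lemma torus_charD (a : 'M[K]_r.+1) chi chi' : torusH a ->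
  torus_char a (chi + chi') = torus_char a chi * torus_char a chi'.
Proof.
move=> aH; rewrite /torus_char -big_split; apply: eq_bigr => i _ /=.
rewrite mxE expfzDr //; have := torus_pa_neq0 i.+1 aH.
by rewrite /pa; congr (~~ (_ == 0)); apply: eq_bigl => p; rewrite ltnS.
Qed.

Lemma torus_char0 (a : 'M[K]_r.+1) : torus_char a 0 = 1.
Proof. by rewrite /torus_char big1 // => i _; rewrite mxE expr0z. Qed.

Lemma torus_char_neq0 (a : 'M[K]_r.+1) chi : torusH a -> torus_char a chi != 0.
Proof.
move=> aH; have := torus_charD chi (- chi) aH; rewrite subrr torus_char0 => /eqP.
by apply: contraTneq => ->; rewrite mul0r oner_neq0.
Qed.

Lemma hv_cat S L L' chi chi' phi phi' : hv S L chi phi -> hv S L' chi' phi' ->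
  hv S (L ++ L') (chi + chi') (fun Y => phi Y * phi' Y).
Proof.
move=> h h' a Y aH Y0; rewrite big_cat /= h // h' // torus_charD //; ring.
Qed.

Lemma hv_cons S x L chi chi' phi phi' : hv S [:: x] chi phi -> hv S L chi' phi' ->
  hv S (x :: L) (chi + chi') (fun Y => phi Y * phi' Y).
Proof. exact: (@hv_cat S [:: x] L). Qed.

Lemma hv_ext S L chi chi' phi phi' : hv S L chi phi -> chi = chi' ->
  (forall Y, gd r Y -> phi Y = phi' Y) -> hv S L chi' phi'.
Proof. by move=> h <- E a Y aH Y0; rewrite h // E. Qed.

Lemma prod_sm L (f : int -> K) (n : int -> nat) : (forall u, n u = sm L u) ->
  \prod_(u <- labels r) f u ^+ n u = \prod_(x <- L) (if vnode x then f (vlab x) else 1).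
Proof.
move=> E; under eq_bigr do rewrite E.
elim: L {E} => [|x L IH].
  by rewrite big_nil big1 // => u _; rewrite sm_nil expr0.
rewrite big_cons -IH; under eq_bigr do rewrite sm_cons exprD.
rewrite big_split /=; congr (_ * _); case: ifP => xN.
  rewrite (bigD1_seq (vlab x)) ?labels_uniq ?vlab_labels //= eqxx expr1 big1 ?mulr1 // => u.
  by move=> /negPf->.
by rewrite big1 // => u _; rewrite /= expr0.
Qed.

(** The exchange relation pulled back to the chart. The candidate phi solves it as a rational
    function, and niceness of phik allows cancellation at generic points of the line to the all-ones
    point; regularity of the new variable gives the value at Y itself. *)
Lemma mutation_val S T k Ki Ko chi chik phik phii phio phi : acyc S ->
  is_mutation (vlab k) S T -> vnode k -> colis S k Ki Ko -> disj Ki Ko ->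
  hv S [:: k] chik phik -> nice r phik -> hv S Ki chi phii -> hv S Ko chi phio ->
  nice r phi -> (forall Y, gd r Y -> phik Y * phi Y = phii Y + phio Y) ->
  hv T [:: k] (chi - chik) phi.
Proof.
move=> aS mT kN ck dj hk nk hi ho nphi E a Y aH Y0; case: mT => [_ _ Treg Tex].
rewrite big_seq1 /valx kN -xbar_norm //; have [_ _ <-] := nphi.
have Y1 := norm_nz Y0; rewrite -(crv0 (norm r Y)).
have [k1 k2 k3] := nk; have [n1 n2 n3] := nphi.
pose D t := torus_char a (chi - chik) * phi (crv (norm r Y) t).
apply: (regular_curve (s0 := crvp r (norm r Y)) (x := fun t => xbar a (crv (norm r Y) t))
   (z := fun t => torus_char a chik * phik (crv (norm r Y) t)) (D := D) Treg).
- exact: ratm_xbar.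
- exact: crvp0.
- by move=> t /crvp_gd Yt; apply: xbar_cell.
- by apply: rat01M; [exact: rat01_cst | exact: k1].
- by rewrite mulf_neq0 ?torus_char_neq0 // crv1 gt_eqF.
- by apply: rat01M; [exact: rat01_cst | exact: n1].
move=> t /crvp_gd Yt; have := hk a _ aH Yt; rewrite big_seq1 /valx kN => <-.
rewrite Tex; last exact: xbar_cell.
rewrite (prod_sm (L := Ki)); last by move=> u; have [] := arr_of_col u aS ck dj.
rewrite (prod_sm (L := Ko)); last by move=> u; have [] := arr_of_col u aS ck dj.
have := hi a _ aH Yt; have := ho a _ aH Yt; rewrite /valx => -> ->.
have := hk a _ aH Yt; rewrite big_seq1 /valx kN => ->.
rewrite /D -mulrDr -E // mulrACA -torus_charD //.
by rewrite addrC subrK.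
Qed.

Lemma hv_other S T k L chi phi : is_mutation (vlab k) S T -> vnode k -> k \notin L ->
  hv S L chi phi -> hv T L chi phi.
Proof.
move=> [_ Tv _ _] kN kL h a Y aH Y0; rewrite -h //; apply: eq_big_seq => x xL.
rewrite /valx; case: ifP => // xN; rewrite Tv //; last exact: xbar_cell.
by apply: contraNneq kL => /(vlab_inj xN kN) <-.
Qed.

Lemma arrows0P u v : reflect
  (exists2 i, is_node r i & [\/ (u = r%:Z + lm r i /\ v = lm r i), (u = lm r i /\ v = - i) |
     exists2 i', is_node r i' & [/\ odd `|i|%N, ~~ odd `|i'|%N, `|i - i'| = 1 &
       [\/ (u = lm r i /\ v = lm r i'), (u = lm r i' /\ v = r%:Z + lm r i) |
           (u = - i' /\ v = lm r i)]]])
  (arrows0 r u v == 1%N).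
Proof.
have H (b : bool) P : reflect P b -> reflect P (nat_of_bool b == 1%N) by case: b.
apply: H; apply: (iffP hasP) => [[k]|[i iN H]].
  rewrite mem_zrange // => kr /or3P[/eqP[-> ->]|/eqP[-> ->]|/hasP[k' + /and4P[o e adj /or3P H]]].
  - by exists (jnode r k); [exact: jnode_node | rewrite lm_jnode //; constructor 1].
  - by exists (jnode r k); [exact: jnode_node | rewrite lm_jnode //; constructor 2].
  rewrite mem_zrange // => kr'; exists (jnode r k); first exact: jnode_node.
  constructor 3; exists (jnode r k'); first exact: jnode_node.
  split=> //; first exact/eqP.
  by rewrite !lm_jnode //; case: H => /eqP[-> ->]; [constructor 1|constructor 2|constructor 3].
exists (lm r i); first by rewrite mem_zrange // lm_range.
case: H => [[-> ->]|[-> ->]|[i' iN' [o e adj H]]]; rewrite ?jnode_lm ?eqxx ?orbT //.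
apply/or3P; constructor 3; apply/hasP; exists (lm r i'); first by rewrite mem_zrange // lm_range.
rewrite !jnode_lm // o e adj eqxx /=.
by case: H => [[-> ->]|[-> ->]|[-> ->]]; rewrite eqxx ?orbT.
Qed.

Lemma sm_uniq L u : uniq L -> sm L u = (0 < sm L u)%N.
Proof.
case: posnP => [->|/sm_gt0[x [xL xN ->]]] // uL.
by rewrite sm_lab // count_uniq_mem // xL.
Qed.

Lemma arrows0_bool u v : arrows0 r u v = (arrows0 r u v == 1%N) :> nat.
Proof. by rewrite /arrows0; case: (has _ _). Qed.

Lemma arr0_sm u v L : uniq L -> ((arrows0 r u v == 1%N) <-> (exists x, [/\ x \in L, vnode x & u = vlab x])) ->
  arrows0 r u v = sm L u.
Proof.
move=> uL H; rewrite arrows0_bool sm_uniq //; congr nat_of_bool; apply/idP/idP => [/H|/sm_gt0 /H //].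
by move=> [x [xL xN ->]]; rewrite sm_lab // count_uniq_mem // xL.
Qed.

Lemma nd_adj n i : `|nd n - i| = 1 -> i = nd (n - 1) \/ i = nd (n + 1).
Proof. by rewrite /nd; case/orP: d1 => /eqP->; lia. Qed.

Lemma nd_adjP n : `|nd n - nd (n - 1)| = 1 /\ `|nd n - nd (n + 1)| = 1.
Proof. by rewrite /nd; case/orP: d1 => /eqP->; lia. Qed.

Lemma nd_parity n : odd `|nd (n - 1)|%N = ~~ odd `|nd n|%N /\ odd `|nd (n + 1)|%N = ~~ odd `|nd n|%N.
Proof. by rewrite /nd; case/orP: d1 => /eqP->; lia. Qed.

Definition Lin n := if odd `|nd n|%N then [:: vP n; vQ (n - 1); vQ (n + 1)] else [:: vP n; vM (n - 1); vM (n + 1)].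
Definition Lout n := if odd `|nd n|%N then [:: vQ n; vM (n - 1); vM (n + 1)] else [:: vQ n; vP (n - 1); vP (n + 1)].

Lemma vtx_eqE (c c' : option bool) (m n : int) : (((c, m) : vtx) == (c', n)) = (c == c') && (m == n).
Proof. by rewrite xpair_eqE. Qed.

Lemma Lin_uniq n : uniq (Lin n).
Proof. by rewrite /Lin; case: ifP => _; rewrite /= !inE !vtx_eqE /=; lia. Qed.
Lemma Lout_uniq n : uniq (Lout n).
Proof. by rewrite /Lout; case: ifP => _; rewrite /= !inE !vtx_eqE /=; lia. Qed.

Lemma init_col V n : is_initial_seed V -> is_node r (nd n) -> colis V (vM n) (Lin n) (Lout n).
Proof.
move=> [E _ _] nN u; rewrite /col !E /vlab /=.
have nr := lm_range nN; have [p1 p2] := nd_parity n; have [a1 a2] := nd_adjP n.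
congr (Posz _ - Posz _).
  apply: arr0_sm; first exact: Lin_uniq.
  split=> [/arrows0P[i iN]|[x [xL xN ->]]].
    have ir := lm_range iN.
    case=> [[-> /(lm_inj nN iN) ni]|[_ h]|[i' iN' [o e adj]]].
    - by exists (vP n); rewrite /vlab /= ni; split=> //; rewrite /Lin; case: ifP; rewrite mem_head.
    - by exfalso; clear -iN h nr; move: iN; rewrite /is_node; lia.
    have ir' := lm_range iN'.
    case=> [[-> /(lm_inj nN iN') ni]|[_ h]|[-> /(lm_inj nN iN) ni]].
    - rewrite /Lin ni (negPf e); have adj' : `|nd n - i| = 1 by rewrite ni distrC.
      case: (nd_adj adj') => iE; [exists (vM (n - 1)) | exists (vM (n + 1))];
        by rewrite !inE !eqxx ?orbT /vnode /vlab /= -iE.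
    - by exfalso; clear -h nr ir; lia.
    - rewrite /Lin ni o; have adj' : `|nd n - i'| = 1 by rewrite ni.
      case: (nd_adj adj') => iE; [exists (vQ (n - 1)) | exists (vQ (n + 1))];
        by rewrite !inE !eqxx ?orbT /vnode /vlab /= -iE.
  apply/arrows0P; exists (if odd `|nd n|%N then nd n else if x.1 is Some _ then nd n else nd x.2).
    by move: xL; rewrite /Lin; case: ifP => _ //; rewrite !inE => /or3P[]/eqP xE; move: xN; rewrite xE.
  move: xL; rewrite /Lin; case: ifP => o; rewrite !inE => /or3P[]/eqP xE; rewrite xE /vlab /= in xN *.
  - by constructor 1.
  - by constructor 3; exists (nd (n - 1)) => //; split; rewrite ?p1 ?o //; constructor 3.
  - by constructor 3; exists (nd (n + 1)) => //; split; rewrite ?p2 ?o //; constructor 3.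
  - by constructor 1.
  - by constructor 3; exists (nd n) => //; split; rewrite ?p1 ?o // 1?distrC //; constructor 1.
  - by constructor 3; exists (nd n) => //; split; rewrite ?p2 ?o // 1?distrC //; constructor 1.
have swap : arrows0 r (lm r (nd n)) u = sm (Lout n) u.
  rewrite arrows0_bool sm_uniq ?Lout_uniq //; congr nat_of_bool; apply/arrows0P/idP.
    move=> [i iN]; have ir := lm_range iN.
    have S x : x \in Lout n -> vnode x -> u = vlab x -> (0 < sm (Lout n) u)%N.
      by move=> xL xN ->; rewrite sm_lab // count_uniq_mem ?Lout_uniq // xL.
    case=> [[h _]|[/(lm_inj nN iN) ni uE]|[i' iN' [o e adj]]].
    - by exfalso; clear -h nr ir; lia.
    - by apply: (S (vQ n)); rewrite ?/Lout ?uE -?ni //; case: ifP; rewrite mem_head.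
    have ir' := lm_range iN'.
    case=> [[/(lm_inj nN iN) ni uE]|[/(lm_inj nN iN') ni uE]|[h _]].
    - have adj' : `|nd n - i'| = 1 by rewrite ni.
      have inL c : c \in [:: vM (n - 1); vM (n + 1)] -> c \in Lout n by rewrite /Lout ni o !inE => /orP[]->; rewrite ?orbT.
      case: (nd_adj adj') => iE; [apply: (S (vM (n - 1))) | apply: (S (vM (n + 1)))];
        by rewrite ?inL ?inE ?eqxx ?orbT /vnode /vlab /= -?iE.
    - have adj' : `|nd n - i| = 1 by rewrite ni distrC.
      have inL c : c \in [:: vP (n - 1); vP (n + 1)] -> c \in Lout n by rewrite /Lout ni (negPf e) !inE => /orP[]->; rewrite ?orbT.
      case: (nd_adj adj') => iE; [apply: (S (vP (n - 1))) | apply: (S (vP (n + 1)))];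
        by rewrite ?inL ?inE ?eqxx ?orbT /vnode /vlab /= -?iE.
    - by exfalso; clear -iN' h nr; move: iN'; rewrite /is_node; lia.
  move=> /sm_gt0[x [xL xN ->]].
  exists (if odd `|nd n|%N then nd n else if x.1 is Some true then nd x.2 else nd n).
    by move: xL; rewrite /Lout; case: ifP => _ //; rewrite !inE => /or3P[]/eqP xE; move: xN; rewrite xE.
  move: xL; rewrite /Lout; case: ifP => o; rewrite !inE => /or3P[]/eqP xE; rewrite xE /vlab /= in xN *.
  - by constructor 2.
  - by constructor 3; exists (nd (n - 1)) => //; split; rewrite ?p1 ?o //; constructor 1.
  - by constructor 3; exists (nd (n + 1)) => //; split; rewrite ?p2 ?o //; constructor 1.
  - by constructor 2.
  - by constructor 3; exists (nd n) => //; split; rewrite ?p1 ?o // 1?distrC //; constructor 2.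
  - by constructor 3; exists (nd n) => //; split; rewrite ?p2 ?o // 1?distrC //; constructor 2.
exact: swap.
Qed.

Lemma init_acyc (V : seed K r) : is_initial_seed V -> acyc V.
Proof.
move=> [E _ _] u v; rewrite !E.
have [h|h] := boolP (arrows0 r u v == 1%N); last first.
  by left; rewrite arrows0_bool (negPf h).
have [h'|h'] := boolP (arrows0 r v u == 1%N); last first.
  by right; rewrite arrows0_bool (negPf h').
exfalso; case/arrows0P: h => i iN H; case/arrows0P: h' => j jN H'.
have ir := lm_range iN; have jr := lm_range jN.
move: (iN) (jN); rewrite /is_node => iN0 jN0.
case: H => [[uE vE]|[uE vE]|[i' iN' [o e adj H]]]; case: H' => [[vE' uE']|[vE' uE']|[j' jN' [o' e' adj' H']]];
  try (have ir' := lm_range iN'; move: (iN'); rewrite /is_node => iN0');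
  try (have jr' := lm_range jN'; move: (jN'); rewrite /is_node => jN0');
  try (case: H => [[uE vE]|[uE vE]|[uE vE]]); try (case: H' => [[vE' uE']|[vE' uE']|[vE' uE']]);
  try lia;
  have q1 := lm_inj iN jN; try have q2 := lm_inj iN jN'; try have q3 := lm_inj iN' jN; try have q4 := lm_inj iN' jN'; lia.
Qed.

(** The label of i is its position in one round of the word: the prefix of that length ends with the
    letter i. *)
Lemma lm_nat i : is_node r i -> exists m : nat, [/\ lm r i = m%:Z, (0 < m <= r)%N &
  forall k : 'I_r, i = nodei k -> count_mem k (take m (rev (jo r))) = 1%N].
Proof.
move=> iN; have ir := lm_range iN; exists `|lm r i|%N; split; [by lia|by lia|move=> k ik].
have uj : uniq (rev (jo r)) by rewrite rev_uniq uniq_jo.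
rewrite count_uniq_mem ?take_uniq // in_take ?mem_rev ?mem_jo //.
suff -> : index k (rev (jo r)) = `|lm r i|.-1 by rewrite prednK; [rewrite leqnn|lia].
have lt : (`|lm r i|.-1 < size (rev (jo r)))%N by rewrite size_rev size_jo; lia.
have := jnode_lm iN; rewrite /jnode modz_small; last by lia.
have -> : `|lm r i - 1|%N = `|lm r i|.-1 by lia.
rewrite jseqE -/(jo r) -map_rev (nth_map k) // ik => E.
have nk : nth k (rev (jo r)) `|lm r (nodei k)|.-1 = k by apply/val_inj; rewrite /nodei in E *; case: E.
by rewrite -{1}nk index_uniq // -ik.
Qed.

Lemma node_nodei i : is_node r i -> exists k : 'I_r, i = nodei k.
Proof.
move=> iN; have kP : (`|i|%N.-1 < r)%N by move: iN; rewrite /is_node; lia.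
by exists (Ordinal kP); move: iN; rewrite /is_node /nodei /=; lia.
Qed.

Lemma init_hvM V n : is_initial_seed V -> hv V [:: vM n] (Lam r (nd n)) (fun Y => fM r Y (nd n)).
Proof.
move=> [_ VM _] a Y aH Y0; rewrite big_seq1 /valx /vnode /vlab /=; case: ifPn => nN; last first.
  by rewrite Lam_nonnode // torus_char0 /fM /Mo /Me (negPf nN) if_same mulr1.
have [m [mE mr cm]] := lm_nat nN; have [k kE] := node_nodei nN.
have mr2 : (m <= r + r)%N by lia.
have : is_gminor (jnode r (lm r (nd n))) [seq jnode r t | t <- zrange 1 m%:Z] (cvar V (lm r (nd n))).
  by rewrite -mE; apply: VM; have := lm_range nN; lia.
rewrite jnode_lm // (prefixE r3 mr2) kE => /(gminor_val_gd r3 mr2)->//.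
have -> : take m (J2 r) = take m (rev (jo r)).
  rewrite /J2 take_cat size_rev size_jo; case: ltnP => // rm.
  by rewrite (_ : (m - r = 0)%N) ?take0 ?cats0 ?[RHS]take_oversize ?size_rev ?size_jo //; lia.
by rewrite cm // /gval /= torus_char_Lam.
Qed.

Lemma init_hvP V n : is_initial_seed V -> hv V [:: vP n] (Lam r (nd n)) (fun=> 1).
Proof.
move=> [_ VM _] a Y aH Y0; rewrite big_seq1 /valx /vnode /vlab /=; case: ifPn => nN; last first.
  by rewrite Lam_nonnode // torus_char0 mulr1.
have [m [mE mr cm]] := lm_nat nN; have [k kE] := node_nodei nN.
have mr2 : (r + m <= r + r)%N by lia.
have : is_gminor (jnode r (r%:Z + lm r (nd n))) [seq jnode r t | t <- zrange 1 (r + m)%N%:Z] (cvar V (r%:Z + lm r (nd n))).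
  have -> : (r + m)%N%:Z = r%:Z + lm r (nd n) by rewrite mE PoszD.
  by apply: VM; have := lm_range nN; lia.
rewrite jnodeD jnode_lm // (prefixE r3 mr2) kE => /(gminor_val_gd r3 mr2)->//.
rewrite /J2 take_cat size_rev size_jo ltnNge leq_addr /= addKn count_cat cm //.
by rewrite count_uniq_mem ?rev_uniq ?uniq_jo // mem_rev mem_jo /gval /= torus_char_Lam.
Qed.

Lemma init_hvQ V n : is_initial_seed V -> hv V [:: vQ n] (Lam r (nd n)) (fun Y => fQ r Y (nd n)).
Proof.
move=> [_ _ VQ] a Y aH Y0; rewrite big_seq1 /valx /vnode /vlab /=; case: ifPn => nN; last first.
  by rewrite Lam_nonnode // torus_char0 /fQ /yy (negPf nN) !mulr1.
have [k kE] := node_nodei nN; rewrite kE.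
have : is_gminor (nodei k) [seq nodei j | j <- take 0 (J2 r)] (cvar V (- nodei k)).
  by rewrite take0; apply: VQ; rewrite -kE.
by move=> /(gminor_val_gd r3 (leq0n _))->//; rewrite take0 /gval /= torus_char_Lam.
Qed.

Definition at1 x (u : int) : nat := vnode x && (u == vlab x).
Lemma sm_at x L u : sm (x :: L) u = (at1 x u + sm L u)%N.
Proof. exact: sm_cons. Qed.
Definition smE := (sm_cat, sm_at, sm_nil).

Ltac wtring := apply/rowP => ?; rewrite !mxE; ring.

Ltac smlia := rewrite !smE; clear;
  repeat match goal with |- context [at1 ?x ?u] => generalize (at1 x u); intro end;
  repeat match goal with |- context [sm ?x ?u] => generalize (sm x u); intro end;
  lia.

Definition initM S (m : int) : Prop := hv S [:: vM m] (Lam r (nd m)) (fun Y => fM r Y (nd m)).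
Definition frozen_ok S : Prop := forall m, hv S [:: vP m] (Lam r (nd m)) (fun=> 1) /\
  hv S [:: vQ m] (Lam r (nd m)) (fun Y => fQ r Y (nd m)).
Definition init_from S (p : int) : Prop :=
  forall m, p <= m -> initM S m /\ (vnode (vM m) -> colis S (vM m) (Lin m) (Lout m)).

Lemma init_from_le S p q : p <= q -> init_from S p -> init_from S q.
Proof. by move=> pq H m qm; apply: H; apply: le_trans qm. Qed.

Lemma frozen_mutation S T m : is_mutation (vlab (vM m)) S T -> vnode (vM m) -> frozen_ok S -> frozen_ok T.
Proof.
move=> mT mN H n; have [hP hQ] := H n.
by split; [apply: hv_other mT mN _ hP | apply: hv_other mT mN _ hQ]; rewrite inE.
Qed.

Lemma step_col0 S T k Ki Ko y L1 L2 : acyc S -> is_mutation (vlab k) S T ->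
  vnode k -> vnode y -> colis S k Ki Ko -> disj Ki Ko -> y != k -> colis S y L1 L2 ->
  y \notin Ki -> y \notin Ko -> colis T y L1 L2.
Proof.
move=> aS mT kN yN ck dj yk cy yi yo u.
by rewrite (step_col u aS mT kN yN ck dj yk cy) !(count_memPn _) // !mul0r subr0 addr0.
Qed.

Lemma init_from_mutation S T m Ki Ko p : acyc S -> is_mutation (vlab (vM m)) S T -> vnode (vM m) ->
  colis S (vM m) Ki Ko -> disj Ki Ko -> m < p -> all (fun x => x.2 < p) (Ki ++ Ko) ->
  init_from S p -> init_from T p.
Proof.
move=> aS mT mN ck dj mp /allP H IS n pn; have [h1 h2] := IS n pn; split.
  by apply: hv_other mT mN _ h1; rewrite inE vtx_eqE; lia.
move=> nN; apply: (step_col0 aS mT mN nN ck dj _ (h2 nN)).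
- by rewrite vtx_eqE; lia.
- by apply/negP => nK; have := H (vM n); rewrite mem_cat nK => /(_ isT) /=; lia.
- by apply/negP => nK; have := H (vM n); rewrite mem_cat nK orbT => /(_ isT) /=; lia.
Qed.

(* The quiver next to the node p just before a group of three mutations: the node p still carries its
   initial variable, and X, Z are the part of its exchange relation left by the preceding group. *)
Record preA S (p : int) X Z (chi : 'rV[int]_r) fX fZ : Prop := PreA {
  preA_acyc : acyc S;
  preA_col : vnode (vM p) -> colis S (vM p) (vQ (p + 1) :: X) ([:: vQ p; vM (p + 1)] ++ Z);
  preA_init : init_from S (p + 1);
  preA_M : initM S p;
  preA_frozen : frozen_ok S;
  preA_X : hv S X (chi + Lam r (nd p)) fX;
  preA_Z : hv S Z chi fZ;
  preA_lt : all (fun x => x.2 < p) (X ++ Z);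
  preA_disj : disj X Z }.

Record postA S (p : int) Z (chi : 'rV[int]_r) fF fZ : Prop := PostA {
  postA_acyc : acyc S;
  postA_col1 : colis S (vM (p + 1)) [:: vQ (p + 1); vM p] ([:: vP (p + 1); vM (p + 2); vQ p] ++ Z);
  postA_col2 : vnode (vM (p + 2)) -> colis S (vM (p + 2)) [:: vQ (p + 3); vM (p + 1)] [:: vQ (p + 2); vM (p + 3); vP p];
  postA_init : init_from S (p + 3);
  postA_M2 : initM S (p + 2);
  postA_frozen : frozen_ok S;
  postA_F : hv S [:: vM p] (chi + Lam r (nd p) + Lam r (nd (p + 2))) fF;
  postA_v : hv S [:: vM (p + 1)] (Lam r (nd p) + Lam r (nd (p + 2))) (fun Y => yy r Y 2 (nd (p + 1)));
  postA_Z : hv S Z chi fZ;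
  postA_lt : all (fun x => x.2 < p) Z }.

Lemma fM_even (Y : int -> int -> K) i : gd r Y -> is_node r i -> ~~ odd `|i|%N ->
  fM r Y i * yy r Y 2 i = fM r Y (i - 1) * fM r Y (i + 1) + fQ r Y i.
Proof.
move=> Y0 iN ei; have [o1 o2] : odd `|(i - 1)%R|%N /\ odd `|(i + 1)%R|%N by lia.
rewrite /fM (negPf ei) o1 o2 /Me iN /fQ; field; exact: yy_neq0.
Qed.

Lemma fM_odd (Y : int -> int -> K) i : gd r Y -> is_node r i -> odd `|i|%N ->
  fM r Y i * yy r Y 2 i = yy r Y 2 (i - 1) * yy r Y 2 (i + 1) + fQ r Y i.
Proof.
move=> Y0 iN oi; rewrite /fM oi /Mo iN /fQ; field; exact: yy_neq0.
Qed.

Lemma nd_neighbours (f : int -> K) n : f (nd n - 1) * f (nd n + 1) = f (nd (n - 1)) * f (nd (n + 1)).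
Proof.
have [-> ->] : nd (n - 1) = nd n - d /\ nd (n + 1) = nd n + d by rewrite /nd; lia.
by case/orP: d1 => /eqP-> //; rewrite opprK mulrC.
Qed.

Lemma fM_even_nd (Y : int -> int -> K) n : gd r Y -> vnode (vM n) -> ~~ odd `|nd n|%N ->
  fM r Y (nd n) * yy r Y 2 (nd n) = fM r Y (nd (n - 1)) * fM r Y (nd (n + 1)) + fQ r Y (nd n).
Proof. by move=> Y0 nN en; rewrite fM_even // nd_neighbours. Qed.

Lemma fM_odd_nd (Y : int -> int -> K) n : gd r Y -> vnode (vM n) -> odd `|nd n|%N ->
  fM r Y (nd n) * yy r Y 2 (nd n) = yy r Y 2 (nd (n - 1)) * yy r Y 2 (nd (n + 1)) + fQ r Y (nd n).
Proof. by move=> Y0 nN en; rewrite fM_odd // (nd_neighbours (yy r Y 2)). Qed.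

Lemma mutation_hvM S T k Ki Ko chi chik phik phii phio phi : acyc S ->
  is_mutation (vlab k) S T -> vnode k -> colis S k Ki Ko -> disj Ki Ko ->
  hv S [:: k] chik phik -> nice r phik -> hv S Ki (chi + chik) phii -> hv S Ko (chi + chik) phio ->
  nice r phi -> (forall Y, gd r Y -> phik Y * phi Y = phii Y + phio Y) ->
  hv T [:: k] chi phi.
Proof.
move=> aS mT kN ck dj hk nk hi ho nphi E.
have := mutation_val aS mT kN ck dj hk nk hi ho nphi E.
by rewrite addrK.
Qed.

Lemma disj_lt p X1 X2 X Z : disj X1 X2 -> all (fun x => p <= x.2) X1 -> all (fun x => p <= x.2) X2 ->
  disj X Z -> all (fun x => x.2 < p) (X ++ Z) -> disj (X1 ++ X) (X2 ++ Z).
Proof.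
move=> /allP dj /allP p1 /allP p2 /allP dXZ /allP lt; apply/allP => x.
rewrite !mem_cat => /orP[xX|xX]; apply/norP; split.
- exact: dj.
- by apply/negP => xZ; have := lt x; rewrite mem_cat xZ orbT => /(_ isT); have := p1 x xX; lia.
- by apply/negP => xZ; have := lt x; rewrite mem_cat xX => /(_ isT); have := p2 x xZ; lia.
- exact: dXZ.
Qed.

Lemma posE (p : int) : (((p <= p)%R = true) * ((p == p + 1)%R = false) * ((p < p + 1)%R = true) * ((p <= p + 1)%R = true)
  * ((p == p + 2)%R = false) * ((p < p + 2)%R = true) * ((p <= p + 2)%R = true) * ((p == p + 3)%R = false)
  * ((p < p + 3)%R = true) * ((p <= p + 3)%R = true) * ((p + 1 == p)%R = false) * ((p + 1 <= p + 1)%R = true)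
  * ((p + 1 == p + 2)%R = false) * ((p + 1 < p + 2)%R = true) * ((p + 1 <= p + 2)%R = true) * ((p + 1 == p + 3)%R = false)
  * ((p + 1 < p + 3)%R = true) * ((p + 1 <= p + 3)%R = true) * ((p + 2 == p)%R = false) * ((p + 2 == p + 1)%R = false)
  * ((p + 2 <= p + 2)%R = true) * ((p + 2 == p + 3)%R = false) * ((p + 2 < p + 3)%R = true) * ((p + 2 <= p + 3)%R = true)
  * ((p + 3 == p)%R = false) * ((p + 3 == p + 1)%R = false) * ((p + 3 == p + 2)%R = false) * ((p + 3 <= p + 3)%R = true))%type.
Proof. do !split; lia. Qed.

(** The column at p + 1 is still initial, so the first mutation replaces M by Y_2 through
    [fM_even_nd]. It also rewires p: the relation there then has X and this Y_2 on one side, Q and Z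
    on the other, apart from frozen variables of value 1. *)
Lemma preA_postA S1 S2 S3 (p : int) X Z chi fX fZ fF : odd `|nd p|%N -> vnode (vM p) -> vnode (vM (p + 1)) ->
  preA S1 p X Z chi fX fZ -> is_mutation (vlab (vM (p + 1))) S1 S2 ->
  is_mutation (vlab (vM p)) S2 S3 -> nice r fF ->
  (forall Y, gd r Y -> fM r Y (nd p) * fF Y = fX Y * yy r Y 2 (nd (p + 1)) + fZ Y * fQ r Y (nd p)) ->
  postA S3 p Z chi fF fZ.
Proof.
move=> op pN qN [aS cp iS hM fr hX hZ lt dj] m1 m2 nF FE.
have [_ e2] := nd_parity p; have [_ f2] := nd_parity (p + 1).
have pp : p + 1 - 1 = p by lia. have p2 : p + 1 + 1 = p + 2 by lia. have p3 : p + 2 + 1 = p + 3 by lia.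
have p1 : p + 2 - 1 = p + 1 by lia.
rewrite p2 in f2.
have [hM1 cM1] := iS (p + 1) (lexx _).
have c1 : colis S1 (vM (p + 1)) [:: vP (p + 1); vM p; vM (p + 2)] [:: vQ (p + 1); vP p; vP (p + 2)].
  by have := cM1 qN; rewrite /Lin /Lout e2 op /= pp p2.
have d1' : disj [:: vP (p + 1); vM p; vM (p + 2)] [:: vQ (p + 1); vP p; vP (p + 2)].
  by rewrite /disj /= !inE !vtx_eqE ?posE.
have pp2 : p + 1 <= p + 2 by lia.
have [hM2 cM2] := iS (p + 2) pp2.
have /allP lt' := lt.
have notin (n : option bool) m L : p <= m -> L \in [:: X; Z] -> ((n, m) : vtx) \notin L.
  move=> pm LX; apply/negP => h; have := lt' (n, m); rewrite mem_cat ltNge pm.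
  by move: LX h; rewrite !inE => /orP[]/eqP-> ->; rewrite ?orbT => /(_ isT).
have XL : X \in [:: X; Z] by rewrite inE eqxx.
have ZL : Z \in [:: X; Z] by rewrite !inE eqxx orbT.
have c2p : colis S2 (vM p) (vM (p + 1) :: X) ([:: vQ p; vP p; vP (p + 2)] ++ Z).
  move=> u; rewrite (step_col u aS m1 qN pN c1 d1' _ (cp pN)); last by rewrite vtx_eqE ?posE.
  have -> : count_mem (vM p) [:: vP (p + 1); vM p; vM (p + 2)] = 1%N by rewrite /= ?vtx_eqE ?posE ?eqxx /=.
  have -> : count_mem (vM p) [:: vQ (p + 1); vP p; vP (p + 2)] = 0%N by rewrite /= ?vtx_eqE ?posE ?eqxx /=.
  by smlia.
have c2q : vnode (vM (p + 2)) -> colis S2 (vM (p + 2)) [:: vQ (p + 3); vM (p + 1)] [:: vQ (p + 2); vM (p + 3); vP p].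
  move=> q2N u; have := cM2 q2N; rewrite /Lin /Lout f2 e2 op /= p1 p3 => cM2'.
  rewrite (step_col u aS m1 qN q2N c1 d1' _ cM2'); last by rewrite vtx_eqE ?posE.
  have -> : count_mem (vM (p + 2)) [:: vP (p + 1); vM p; vM (p + 2)] = 1%N by rewrite /= ?vtx_eqE ?posE ?eqxx /=.
  have -> : count_mem (vM (p + 2)) [:: vQ (p + 1); vP p; vP (p + 2)] = 0%N by rewrite /= ?vtx_eqE ?posE ?eqxx /=.
  by smlia.
have c2s : colis S2 (vM (p + 1)) [:: vQ (p + 1); vP p; vP (p + 2)] [:: vP (p + 1); vM p; vM (p + 2)].
  by move=> u; rewrite (col_mutation_self _ m1) c1; clear; lia.
have d2 : disj (vM (p + 1) :: X) ([:: vQ p; vP p; vP (p + 2)] ++ Z).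
  apply: (@disj_lt p [:: vM (p + 1)]) => //.
  - by rewrite /= !posE.
  - by rewrite /= !posE.
have hv1 : hv S2 [:: vM (p + 1)] (Lam r (nd p) + Lam r (nd (p + 2))) (fun Y => yy r Y 2 (nd (p + 1))).
  have [frP frQ] := fr (p + 1).
  apply: (mutation_hvM aS m1 qN c1 d1' hM1 (nice_fM _ _ _)).
  - apply: hv_ext (hv_cons frP (hv_cons hM hM2)) _ _; first by rewrite addrC.
    by move=> Y _; rewrite mul1r.
  - apply: hv_ext (hv_cons frQ (hv_cons (fr p).1 (fr (p + 2)).1)) _ _; first by rewrite addrC.
    by move=> Y _; rewrite !mulr1.
  - exact: nice_yy.
  by move=> Y Y0; rewrite fM_even_nd ?e2 ?op // pp p2.
have a2 := acyc_mutation aS m1.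
have hX2 : hv S2 X (chi + Lam r (nd p)) fX by apply: hv_other m1 qN (notin _ _ _ _ XL) hX; rewrite ?posE.
have hZ2 : hv S2 Z chi fZ by apply: hv_other m1 qN (notin _ _ _ _ ZL) hZ; rewrite ?posE.
have hp2 : initM S2 p by apply: hv_other m1 qN _ hM; rewrite inE vtx_eqE ?posE.
have hq2 : initM S2 (p + 2) by apply: hv_other m1 qN _ hM2; rewrite inE vtx_eqE ?posE.
have fr2 := frozen_mutation m1 qN fr.
have i2 : init_from S2 (p + 3).
  apply: init_from_mutation aS m1 qN c1 d1' _ _ _; first by rewrite posE.
    by rewrite /= ?posE.
  by apply: init_from_le iS; rewrite posE.
have a3 := acyc_mutation a2 m2.
split=> //.
- move=> u; rewrite (step_col u a2 m2 pN qN c2p d2 _ c2s); last by rewrite vtx_eqE ?posE.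
  have -> : count_mem (vM (p + 1)) ([:: vQ p; vP p; vP (p + 2)] ++ Z) = 0%N.
    by rewrite count_cat (count_memPn (notin _ _ _ _ ZL)) /= ?vtx_eqE ?posE.
  have -> : count_mem (vM (p + 1)) (vM (p + 1) :: X) = 1%N.
    by rewrite /= eqxx (count_memPn (notin _ _ _ _ XL)) ?posE.
  by smlia.
- move=> q2N; apply: (step_col0 a2 m2 pN q2N c2p d2 _ (c2q q2N)).
  + by rewrite vtx_eqE ?posE.
  + by rewrite inE negb_or vtx_eqE (notin _ _ _ _ XL) ?posE.
  + by rewrite mem_cat negb_or (notin _ _ _ _ ZL) ?inE ?vtx_eqE ?posE.
- apply: init_from_mutation a2 m2 pN c2p d2 _ _ i2; first by rewrite posE.
  have lt3 : all (fun x => x.2 < p + 3) (X ++ Z).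
    by apply: sub_all lt => x xp; apply: lt_trans xp _; rewrite posE.
  by move: lt3; rewrite /= !all_cat /= !posE.
- by apply: hv_other m2 pN _ hq2; rewrite inE vtx_eqE ?posE.
- exact: frozen_mutation m2 pN fr2.
- apply: (mutation_hvM a2 m2 pN c2p d2 hp2 (nice_fM _ _ _) _ _ nF).
  + apply: hv_ext (hv_cons hv1 hX2) _ _; last by move=> Y _; exact: erefl.
    by wtring.
  + apply: hv_ext (hv_cat (hv_cons (fr2 p).2 (hv_cons (fr2 p).1 (fr2 (p + 2)).1)) hZ2) _ _.
      by wtring.
    by move=> Y _; exact: erefl.
  by move=> Y Y0; rewrite FE // !mulr1; ring.
- by apply: hv_other m2 pN _ hv1; rewrite inE vtx_eqE ?posE.
- exact: hv_other m2 pN (notin _ _ _ (lexx _) ZL) hZ2.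
- by move: lt; rewrite all_cat => /andP[].
Qed.

(** The last mutation of the group reverses the arrow from p + 1 to p + 2 and composes it with those
    into p + 1. This leaves at p + 2 the two short lists X and Z of the next [preA] state, whatever
    the previous Z was. *)
Lemma postA_preA S1 S2 (p : int) Z chi fF fZ fG : odd `|nd p|%N -> vnode (vM (p + 1)) ->
  postA S1 p Z chi fF fZ -> is_mutation (vlab (vM (p + 1))) S1 S2 -> nice r fG ->
  (forall Y, gd r Y -> yy r Y 2 (nd (p + 1)) * fG Y =
     fQ r Y (nd (p + 1)) * fF Y + fM r Y (nd (p + 2)) * fQ r Y (nd p) * fZ Y) ->
  hv S2 [:: vM (p + 1)] (Lam r (nd (p + 1)) + chi) fG /\
  preA S2 (p + 2) [:: vQ (p + 1); vM p] [:: vM (p + 1); vP p] (Lam r (nd (p + 1)) + chi + Lam r (nd p))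
    (fun Y => fQ r Y (nd (p + 1)) * fF Y) fG.
Proof.
move=> op qN [aS c1 c2 iS hM fr hF hv1 hZ lt] m1 nG GE.
have p3 : p + 2 + 1 = p + 3 by lia.
have /allP lt' := lt.
have notin (n : option bool) m : p <= m -> ((n, m) : vtx) \notin Z.
  by move=> pm; apply/negP => /lt'; rewrite ltNge pm.
have dj : disj [:: vQ (p + 1); vM p] ([:: vP (p + 1); vM (p + 2); vQ p] ++ Z).
  by rewrite /disj /= !inE !negb_or !vtx_eqE !notin ?posE.
have hG : hv S2 [:: vM (p + 1)] (Lam r (nd (p + 1)) + chi) fG.
  have [hP hQ] := fr (p + 1); have [_ hQp] := fr p.
  apply: (mutation_hvM aS m1 qN c1 dj hv1 (@nice_yy K r 2 _ isT) _ _ nG) => //.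
  - apply: hv_ext (hv_cons hQ hF) _ _; last by move=> Y _; exact: erefl.
    by wtring.
  - apply: hv_ext (hv_cat (hv_cons hP (hv_cons hM hQp)) hZ) _ _; last by move=> Y _; exact: erefl.
    by wtring.
  by move=> Y Y0; rewrite GE // mul1r.
have fr2 := frozen_mutation m1 qN fr.
split=> //; split.
- exact: acyc_mutation aS m1.
- move=> q2N u; rewrite p3 (step_col u aS m1 qN q2N c1 dj _ (c2 q2N)); last by rewrite vtx_eqE ?posE.
  have -> : count_mem (vM (p + 2)) [:: vQ (p + 1); vM p] = 0%N by rewrite /= ?vtx_eqE ?posE ?eqxx /=.
  have -> : count_mem (vM (p + 2)) ([:: vP (p + 1); vM (p + 2); vQ p] ++ Z) = 1%N.
    by rewrite /= (count_memPn (notin _ _ _)) ?vtx_eqE ?posE ?eqxx /=.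
  by smlia.
- rewrite p3; apply: init_from_mutation aS m1 qN c1 dj _ _ iS; first by rewrite posE.
  have lt3 : all (fun x => x.2 < p + 3) Z.
    by apply: sub_all lt => x xp; apply: lt_trans xp _; rewrite posE.
  by move: lt3; rewrite /= !posE.
- by apply: hv_other m1 qN _ hM; rewrite inE vtx_eqE ?posE.
- exact: fr2.
- apply: hv_ext (hv_cons (fr2 (p + 1)).2 (hv_other m1 qN _ hF)) _ _.
  + by rewrite inE vtx_eqE ?posE.
  + by wtring.
  by [].
- apply: hv_ext (hv_cons hG (fr2 p).1) _ _; first by [].
  by move=> Y _; rewrite mulr1.
- by rewrite /= !posE.
- by rewrite /disj /= !inE !vtx_eqE ?posE.
Qed.

(** When p + 1 is not a node, a single mutation at p ends the ladder; the factor Y_2 of the missing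
    node is absent from the relation. *)
Lemma preA_last S1 S2 (p : int) X Z chi fX fZ fF : odd `|nd p|%N -> vnode (vM p) -> ~~ vnode (vM (p + 1)) ->
  preA S1 p X Z chi fX fZ -> is_mutation (vlab (vM p)) S1 S2 -> nice r fF ->
  (forall Y, gd r Y -> fM r Y (nd p) * fF Y = fX Y + fZ Y * fQ r Y (nd p)) ->
  hv S2 [:: vM p] chi fF.
Proof.
move=> op pN qN [aS cp iS hM fr hX hZ lt dj] m1 nF FE.
have c1 : colis S1 (vM p) X ([:: vQ p] ++ Z).
  move=> u; rewrite (cp pN) !smE /at1 (negPf qN).
  by have -> : vnode (vQ (p + 1)) = false by apply/negbTE.
have d2 : disj X ([:: vQ p] ++ Z).
  by apply: (@disj_lt p [::]) => //; rewrite /= posE.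
have [_ hQ] := fr p.
apply: (mutation_hvM aS m1 pN c1 d2 hM (nice_fM _ _ _) hX _ nF).
- apply: hv_ext (hv_cons hQ hZ) _ _; last by move=> Y _; exact: erefl.
  by wtring.
by move=> Y Y0; rewrite FE // [fZ Y * _]mulrC.
Qed.

(** Start of [mu1]: the mutation at the even position 0 replaces M by Y_2, and Z consists of one
    frozen variable of value 1. *)
Lemma init_preA1 V S : is_initial_seed V -> ~~ odd `|nd 0|%N -> vnode (vM 0) ->
  is_mutation (vlab (vM 0)) V S ->
  preA S 1 [:: vM 0] [:: vP (-1)] (Lam r (nd (-1))) (fun Y => yy r Y 2 (nd 0)) (fun=> 1).
Proof.
move=> V0 e0 N0 m1.
have aV := init_acyc V0.
have [n1 n2] : (0 - 1 = -1 :> int) /\ (0 + 1 = 1 :> int) by [].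
have [_ o1] := nd_parity 0; rewrite n2 in o1.
have c0 : colis V (vM 0) [:: vP 0; vM (-1); vM 1] [:: vQ 0; vP (-1); vP 1].
  by have := init_col V0 N0; rewrite /Lin /Lout (negPf e0).
have h0 := init_hvM 0 V0; have hP0 := init_hvP 0 V0; have hQ0 := init_hvQ 0 V0.
have fr0 : frozen_ok V by move=> m; split; [exact: init_hvP | exact: init_hvQ].
have dj : disj [:: vP 0; vM (-1); vM 1] [:: vQ 0; vP (-1); vP 1] by [].
have h1 : hv S [:: vM 0] (Lam r (nd (-1)) + Lam r (nd 1)) (fun Y => yy r Y 2 (nd 0)).
  apply: (mutation_hvM aV m1 N0 c0 dj h0 (nice_fM _ _ _) _ _ (@nice_yy K r 2 _ isT)).
  - apply: hv_ext (hv_cons hP0 (hv_cons (init_hvM (-1) V0) (init_hvM 1 V0))) _ _; last by move=> Y _; exact: erefl.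
    by wtring.
  - apply: hv_ext (hv_cons hQ0 (hv_cons (init_hvP (-1) V0) (init_hvP 1 V0))) _ _; last by move=> Y _; exact: erefl.
    by wtring.
  by move=> Y Y0; rewrite fM_even_nd // n1 n2 mul1r !mulr1.
have fr := frozen_mutation m1 N0 fr0.
split=> //.
- exact: acyc_mutation aV m1.
- move=> N1 u; have cV : colis V (vM 1) [:: vP 1; vQ 0; vQ 2] [:: vQ 1; vM 0; vM 2].
    by have := init_col V0 N1; rewrite /Lin /Lout o1 e0.
  change (col S (vlab (vM 1)) u = (sm [:: vQ 2; vM 0] u)%:Z - (sm [:: vQ 1; vM 2; vP (-1)] u)%:Z).
  rewrite (step_col u aV m1 N0 N1 c0 dj _ cV) //.
  have -> : count_mem (vM 1) [:: vP 0; vM (-1); vM 1] = 1%N by [].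
  have -> : count_mem (vM 1) [:: vQ 0; vP (-1); vP 1] = 0%N by [].
  by smlia.
- apply: init_from_mutation aV m1 N0 c0 dj _ _ _ => //.
  by move=> m _; split; [exact: init_hvM | move=> mN; exact: init_col].
- by apply: hv_other m1 N0 _ (init_hvM 1 V0).
- exact: (fr (-1)).1.
Qed.

(** Start of [mu2] and [mu3]: the odd position -1 is mutated before position 0. The functions fG and
    fF are the new variables at these two positions, and both enter the first relation at position
    1. *)
Lemma init_preA2 V S1 S2 fG fF : is_initial_seed V -> ~~ odd `|nd 0|%N -> vnode (vM 0) -> vnode (vM (-1)) ->
  is_mutation (vlab (vM (-1))) V S1 -> is_mutation (vlab (vM 0)) S1 S2 -> nice r fG -> nice r fF ->
  (forall Y, gd r Y -> fM r Y (nd (-1)) * fG Y =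
     fQ r Y (nd (-2)) * fQ r Y (nd 0) + fQ r Y (nd (-1)) * fM r Y (nd (-2)) * fM r Y (nd 0)) ->
  (forall Y, gd r Y -> fM r Y (nd 0) * fF Y = fM r Y (nd 1) * fQ r Y (nd (-2)) + fG Y) ->
  [/\ hv S1 [:: vM (-1)] (Lam r (nd (-2)) + Lam r (nd 0)) fG,
      hv S2 [:: vM 0] (Lam r (nd (-2)) + Lam r (nd 1)) fF &
  preA S2 1 [:: vQ 0; vM 0] [:: vM (-1)] (Lam r (nd (-2)) + Lam r (nd 0)) (fun Y => fQ r Y (nd 0) * fF Y) fG].
Proof.
move=> V0 e0 N0 N1 m1 m2 nG nF GE FE.
have aV := init_acyc V0.
have [n1 n2] : (0 - 1 = -1 :> int) /\ (0 + 1 = 1 :> int) by [].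
have [o0 o1] := nd_parity 0; rewrite n1 n2 in o0 o1.
have cm1 : colis V (vM (-1)) [:: vP (-1); vQ (-2); vQ 0] [:: vQ (-1); vM (-2); vM 0].
  by have := init_col V0 N1; rewrite /Lin /Lout o0 e0.
have c0 : colis V (vM 0) [:: vP 0; vM (-1); vM 1] [:: vQ 0; vP (-1); vP 1].
  by have := init_col V0 N0; rewrite /Lin /Lout (negPf e0).
have hM n := init_hvM n V0; have hP n := init_hvP n V0; have hQ n := init_hvQ n V0.
have fr0 : frozen_ok V by move=> m; split; [exact: hP | exact: hQ].
have dj : disj [:: vP (-1); vQ (-2); vQ 0] [:: vQ (-1); vM (-2); vM 0] by [].
have hG : hv S1 [:: vM (-1)] (Lam r (nd (-2)) + Lam r (nd 0)) fG.
  apply: (mutation_hvM aV m1 N1 cm1 dj (hM _) (nice_fM _ _ _) _ _ nG).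
  - apply: hv_ext (hv_cons (hP _) (hv_cons (hQ _) (hQ _))) _ _; last by move=> Y _; exact: erefl.
    by wtring.
  - apply: hv_ext (hv_cons (hQ _) (hv_cons (hM _) (hM _))) _ _; last by move=> Y _; exact: erefl.
    by wtring.
  by move=> Y Y0; rewrite GE // mul1r mulrA.
have fr1 := frozen_mutation m1 N1 fr0.
have a1 := acyc_mutation aV m1.
have c01 : colis S1 (vM 0) [:: vP 0; vM 1; vQ (-2)] [:: vP 1; vM (-1)].
  move=> u; rewrite (step_col u aV m1 N1 N0 cm1 dj _ c0) //.
  have -> : count_mem (vM 0) [:: vP (-1); vQ (-2); vQ 0] = 0%N by [].
  have -> : count_mem (vM 0) [:: vQ (-1); vM (-2); vM 0] = 1%N by [].
  by smlia.
have d2 : disj [:: vP 0; vM 1; vQ (-2)] [:: vP 1; vM (-1)] by [].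
have hM1 : initM S1 1 by apply: hv_other m1 N1 _ (hM 1).
have hM0 : initM S1 0 by apply: hv_other m1 N1 _ (hM 0).
have i1 : init_from S1 1.
  apply: init_from_mutation aV m1 N1 cm1 dj _ _ _ => //.
  by move=> m _; split; [exact: hM | move=> mN; exact: init_col].
have hF : hv S2 [:: vM 0] (Lam r (nd (-2)) + Lam r (nd 1)) fF.
  apply: (mutation_hvM a1 m2 N0 c01 d2 hM0 (nice_fM _ _ _) _ _ nF).
  - apply: hv_ext (hv_cons (fr1 0).1 (hv_cons hM1 (fr1 (-2)).2)) _ _; last by move=> Y _; exact: erefl.
    by wtring.
  - apply: hv_ext (hv_cons (fr1 1).1 hG) _ _; last by move=> Y _; exact: erefl.
    by wtring.
  by move=> Y Y0; rewrite FE // !mul1r.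
have fr2 := frozen_mutation m2 N0 fr1.
split=> //; split=> //.
- exact: acyc_mutation a1 m2.
- move=> N2 u; have c1 : colis S1 (vM 1) [:: vP 1; vQ 0; vQ 2] [:: vQ 1; vM 0; vM 2].
    by have := (i1 1 (lexx _)).2 N2; rewrite /Lin /Lout o1 e0.
  change (col S2 (vlab (vM 1)) u = (sm [:: vQ 2; vQ 0; vM 0] u)%:Z - (sm [:: vQ 1; vM 2; vM (-1)] u)%:Z).
  rewrite (step_col u a1 m2 N0 N2 c01 d2 _ c1) //.
  have -> : count_mem (vM 1) [:: vP 0; vM 1; vQ (-2)] = 1%N by [].
  have -> : count_mem (vM 1) [:: vP 1; vM (-1)] = 0%N by [].
  by smlia.
- apply: init_from_mutation a1 m2 N0 c01 d2 _ _ _ => //.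
  by apply: init_from_le i1.
- by apply: hv_other m2 N0 _ hM1.
- apply: hv_ext (hv_cons (fr2 0).2 hF) _ _; last by move=> Y _; exact: erefl.
  by wtring.
- by apply: hv_other m2 N0 _ hG.
Qed.

(** * The recursion for the variables produced along the ladder *)

Implicit Types (F G : (int -> int -> K) -> K) (Y : int -> int -> K).
Local Notation u n Y := (yy r Y 1 (nd n)).
Local Notation v n Y := (yy r Y 2 (nd n)).
Local Notation fm n Y := (fM r Y (nd n)).
Local Notation fq n Y := (fQ r Y (nd n)).

(** The exchange relations divide by M at 2n + 1 and by Y_2 at 2n. Here the quotients are written
    with coordinates as the only denominators, which gives niceness at once; [stepF_eq] and
    [stepG_eq] verify the relations. *)
Definition stepF (n : int) F G Y : K :=
  u (2 * n) Y * v (2 * n + 1) Y * F Y + fq (2 * n + 1) Y * fq (2 * n - 1) Y * G Y / v (2 * n) Y.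
Definition stepG (n : int) F G Y : K :=
  u (2 * n) Y * F Y + fm (2 * n + 1) Y * fq (2 * n - 1) Y * G Y / v (2 * n) Y.
Fixpoint lad F0 G0 (n : nat) := if n is n'.+1 then
    let FG := lad F0 G0 n' in (stepF n%:Z FG.1 FG.2, stepG n%:Z FG.1 FG.2)
  else (F0, G0).

Lemma nice_stepF n F G : nice r F -> nice r G -> nice r (stepF n F G).
Proof.
move=> nF nG; apply: niceD; last first.
  by apply: niceM; [apply: niceM => //; apply: niceM; exact: nice_fQ | exact: (@nice_yyV K r 2)].
by apply: niceM => //; apply: niceM; [exact: (@nice_yy K r 1) | exact: (@nice_yy K r 2)].
Qed.

Lemma nice_stepG n F G : nice r F -> nice r G -> nice r (stepG n F G).
Proof.
move=> nF nG; apply: niceD; last first.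
  apply: niceM; last exact: (@nice_yyV K r 2).
  by apply: niceM => //; apply: niceM; [exact: nice_fM | exact: nice_fQ].
by apply: niceM => //; exact: (@nice_yy K r 1).
Qed.

Lemma nice_lad F0 G0 n : nice r F0 -> nice r G0 -> nice r (lad F0 G0 n).1 /\ nice r (lad F0 G0 n).2.
Proof. by move=> nF nG; elim: n => //= n [IF IG]; split; [exact: nice_stepF | exact: nice_stepG]. Qed.

(** After multiplication by Y_2 at 2n, everything follows from the relation [fM_odd_nd] for M at 2n
    + 1, used in the term containing F. *)
Lemma stepF_eq n F G Y : gd r Y -> odd `|nd (2 * n + 1)|%N -> vnode (vM (2 * n + 1)) ->
  fm (2 * n + 1) Y * stepF n F G Y =
    fq (2 * n) Y * F Y * v (2 * n + 2) Y + stepG n F G Y * fq (2 * n + 1) Y.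
Proof.
move=> Y0 o N; have := fM_odd_nd Y0 N o; rewrite addrK (_ : 2 * n + 1 + 1 = 2 * n + 2); last by lia.
move=> E; have v0 : v (2 * n) Y != 0 by exact: yy_neq0.
apply: (mulIf v0); transitivity (u (2 * n) Y * v (2 * n) Y * (fm (2 * n + 1) Y * v (2 * n + 1) Y) * F Y
   + fm (2 * n + 1) Y * (fq (2 * n + 1) Y * fq (2 * n - 1) Y * G Y)).
  by rewrite /stepF; field.
by rewrite E /stepG [fq (2 * n) Y]/fQ; field.
Qed.

Lemma stepG_eq n F G Y : gd r Y -> v (2 * n) Y * stepG n F G Y =
  fq (2 * n) Y * F Y + fm (2 * n + 1) Y * fq (2 * n - 1) Y * G Y.
Proof.
move=> Y0; rewrite /stepG /fQ; field; exact: yy_neq0.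
Qed.

Lemma is_mutated_cat s1 s2 V T : is_mutated (s1 ++ s2) V T <->
  exists2 U, is_mutated s2 V U & is_mutated s1 U T.
Proof.
elim: s1 T => [|k s1 IH] T /=; first by split=> [|[U]]; [exists T | move=> ? ->].
split=> [[U /IH[W h1 h2] h3]|[W h1 [U h2 h3]]]; first by exists W => //; exists U.
by exists U => //; apply/IH; exists W.
Qed.

Lemma yy_out Y s i : ~~ is_node r i -> yy r Y s i = 1.
Proof. by rewrite /yy => /negPf->. Qed.
Lemma fQ_out Y i : ~~ is_node r i -> fQ r Y i = 1.
Proof. by move=> iN; rewrite /fQ !yy_out // mulr1. Qed.
Lemma fM_out Y i : ~~ is_node r i -> fM r Y i = 1.
Proof. by rewrite /fM /Mo /Me => /negPf->; rewrite if_same. Qed.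

(** Composites act from right to left, so the mutation at 2q comes first. It completes the rung
    below, hence the groups of the word straddle the [preA] states. *)
Definition grp (q : nat) : seq int := [seq vlab (vM (2 * q%:Z + n)) | n <- [:: 1; 2; 0]].
Definition run (l : nat) : seq int := flatten [seq grp q | q <- rev (iota 0 l)].

Lemma runS l : run l.+1 = grp l ++ run l.
Proof. by rewrite /run -[l.+1]addn1 iotaD rev_cat. Qed.

Lemma odd_nd (n : int) : ~~ odd `|nd 0|%N -> odd `|nd (2 * n + 1)|%N.
Proof. by rewrite /nd; case/orP: d1 => /eqP->; lia. Qed.

(** What a start has to supply: the mutation at position 0 leads to a [preA] state at p = 1 in which
    Z has value G0, and F0 solves the relation at position 1. *)
Definition opens S F0 G0 : Prop := forall T, is_mutation (vlab (vM 0)) S T ->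
  exists X Z chi fX, preA T 1 X Z chi fX G0 /\
    forall Y, gd r Y -> fm 1 Y * F0 Y = fX Y * v 2 Y + G0 Y * fq 1 Y.

Lemma run_post S F0 G0 l T : ~~ odd `|nd 0|%N -> nice r F0 -> nice r G0 -> opens S F0 G0 ->
  (forall n : int, 0 <= n <= 2 * l%:Z + 2 -> vnode (vM n)) ->
  is_mutated (run l.+1) S T ->
  exists Z chi, postA T (2 * l%:Z + 1) Z chi (lad F0 G0 l).1 (lad F0 G0 l).2.
Proof.
move=> e0 nF nG op; elim: l T => [|l IH] T Nl.
  move=> [U3 [U2 [U1 -> /op[X [Z [chi [fX [pA E]]]]]] m2] m1].
  exists Z, chi; apply: (preA_postA _ _ _ pA m2 m1 nF).
  - by have := odd_nd 0 e0.
  - by apply: Nl.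
  - by apply: Nl.
  by move=> Y Y0; rewrite E.
rewrite runS => /is_mutated_cat[U hU]; have [|Z [chi pA]] := IH _ _ hU; first by move=> n nl; apply: Nl; lia.
have [nFl nGl] := nice_lad l nF nG.
have lE : l.+1%:Z = l%:Z + 1 by lia.
have e1 : 2 * l%:Z + 1 + 1 = 2 * l.+1%:Z by lia.
have e2 : 2 * l%:Z + 1 + 2 = 2 * l.+1%:Z + 1 by lia.
have e3 : 2 * l%:Z + 1 = 2 * l.+1%:Z - 1 by lia.
move=> [U3 [U2 [U1 -> m3] m2] m1].
have N1 : vnode (vM (2 * l%:Z + 1 + 1)) by apply: Nl; lia.
rewrite addr0 -e1 in m3.
have GE Y : gd r Y -> v (2 * l%:Z + 1 + 1) Y * stepG l.+1%:Z (lad F0 G0 l).1 (lad F0 G0 l).2 Y =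
    fq (2 * l%:Z + 1 + 1) Y * (lad F0 G0 l).1 Y + fm (2 * l%:Z + 1 + 2) Y * fq (2 * l%:Z + 1) Y * (lad F0 G0 l).2 Y.
  by move=> Y0; rewrite e1 e2 e3 stepG_eq.
have [hG pA'] := postA_preA (odd_nd l%:Z e0) N1 pA m3 (nice_stepG l.+1%:Z nFl nGl) GE.
exists [:: vM (2 * l%:Z + 1 + 1); vP (2 * l%:Z + 1)], (Lam r (nd (2 * l%:Z + 1 + 1)) + chi + Lam r (nd (2 * l%:Z + 1))).
rewrite e2 in pA'.
apply: (preA_postA _ _ _ pA' (S2 := U3)) => //.
- exact: odd_nd.
- by apply: Nl; lia.
- by apply: Nl; lia.
- by rewrite -addrA.
- exact: nice_stepF.
move=> Y Y0; rewrite e1 stepF_eq //; [|exact: odd_nd|by apply: Nl; lia].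
by rewrite -[2 * l.+1%:Z + 1 + 1]addrA.
Qed.

Lemma run_F S F0 G0 l T : ~~ odd `|nd 0|%N -> nice r F0 -> nice r G0 -> opens S F0 G0 ->
  (forall n : int, 0 <= n <= 2 * l%:Z + 2 -> vnode (vM n)) ->
  is_mutated (run l.+1) S T -> exists chi, hv T [:: vM (2 * l%:Z + 1)] chi (lad F0 G0 l).1.
Proof.
move=> e0 nF nG op N /(run_post e0 nF nG op N)[Z [chi []]] *; by eexists; eassumption.
Qed.

Lemma run_pre S F0 G0 l T : ~~ odd `|nd 0|%N -> nice r F0 -> nice r G0 -> opens S F0 G0 ->
  (forall n : int, 0 <= n <= 2 * l%:Z + 2 -> vnode (vM n)) ->
  is_mutated (vlab (vM (2 * l%:Z + 2)) :: run l.+1) S T ->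
  exists chi, hv T [:: vM (2 * l%:Z + 2)] chi (lad F0 G0 l.+1).2 /\
  exists X Z chi', preA T (2 * l.+1%:Z + 1) X Z chi'
    (fun Y => fq (2 * l.+1%:Z) Y * (lad F0 G0 l).1 Y) (lad F0 G0 l.+1).2.
Proof.
move=> e0 nF nG op N [U /(run_post e0 nF nG op N)[Z [chi pA]] m3].
have [nFl nGl] := nice_lad l nF nG.
have e1 : 2 * l%:Z + 1 + 1 = 2 * l.+1%:Z by lia.
have e1' : 2 * l%:Z + 2 = 2 * l.+1%:Z by lia.
have e2 : 2 * l%:Z + 1 + 2 = 2 * l.+1%:Z + 1 by lia.
have e3 : 2 * l%:Z + 1 = 2 * l.+1%:Z - 1 by lia.
have N1 : vnode (vM (2 * l%:Z + 1 + 1)) by apply: N; lia.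
rewrite e1' -e1 in m3.
have GE Y : gd r Y -> v (2 * l%:Z + 1 + 1) Y * stepG l.+1%:Z (lad F0 G0 l).1 (lad F0 G0 l).2 Y =
    fq (2 * l%:Z + 1 + 1) Y * (lad F0 G0 l).1 Y + fm (2 * l%:Z + 1 + 2) Y * fq (2 * l%:Z + 1) Y * (lad F0 G0 l).2 Y.
  by move=> Y0; rewrite e1 e2 e3 stepG_eq.
have [hG pA'] := postA_preA (odd_nd l%:Z e0) N1 pA m3 (nice_stepG l.+1%:Z nFl nGl) GE.
eexists; split; first by rewrite e1' -e1; exact: hG.
by rewrite e1 e2 in pA'; do 3!eexists; exact: pA'.
Qed.

Lemma run_last S F0 G0 n T : ~~ odd `|nd 0|%N -> nice r F0 -> nice r G0 -> opens S F0 G0 ->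
  (forall m : int, 0 <= m <= 2 * n%:Z + 1 -> vnode (vM m)) -> ~~ vnode (vM (2 * n%:Z + 2)) ->
  is_mutated [:: vlab (vM (2 * n%:Z + 1)), vlab (vM (2 * n%:Z)) & run n] S T ->
  exists chi, hv T [:: vM (2 * n%:Z + 1)] chi (lad F0 G0 n).1.
Proof.
move=> e0 nF nG op N NN [U hU m1].
have v1 Y : v (2 * n%:Z + 2) Y = 1 by exact: yy_out.
have N1 : vnode (vM (2 * n%:Z + 1)) by apply: N; lia.
have NN' : ~~ vnode (vM (2 * n%:Z + 1 + 1)) by rewrite -addrA.
case: n N NN hU m1 v1 N1 NN' => [|n] N NN hU m1 v1 N1 NN'.
  have {hU} [W -> /op[X [Z [chi [fX [pA E]]]]]] := hU.
  exists chi; apply: (preA_last _ N1 NN' pA m1 nF); first exact: (odd_nd 0).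
  by move=> Y Y0; have := v1 Y; rewrite mulr0 !add0r => v1'; rewrite E // v1' mulr1.
have [nFl nGl] := nice_lad n nF nG.
have N' (m : int) : 0 <= m <= 2 * n%:Z + 2 -> vnode (vM m) by move=> nl; apply: N; lia.
have e1 : 2 * n.+1%:Z = 2 * n%:Z + 2 by lia.
rewrite {1}e1 in hU; have [chi [_ [X [Z [chi' pA]]]]] := run_pre e0 nF nG op N' hU.
exists chi'; apply: (preA_last _ N1 NN' pA m1 (nice_stepF _ nFl nGl)); first exact: odd_nd.
by move=> Y Y0; rewrite stepF_eq //; [rewrite v1 mulr1 | exact: odd_nd].
Qed.

Lemma opens1 V : is_initial_seed V -> ~~ odd `|nd 0|%N -> vnode (vM 0) -> vnode (vM 1) ->
  opens V (fun Y => v 1 Y) (fun=> 1).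
Proof.
move=> V0 e0 N0 N1 T m1; do 4!eexists; split; first exact: init_preA1 V0 e0 N0 m1.
by move=> Y Y0; rewrite fM_odd_nd //; [rewrite mul1r | exact: (odd_nd 0)].
Qed.

(** With [Fm], the pair one step before the start of [mu2] and [mu3]. [Fm] is the variable at
    position 0 after the mutations at -1 and 0, and [stepG 0 Fm Gm] is the one at position -1; so
    the start is the step n = 0. If position -2 is not a node, the pair reduces to Y_2 at -1 and
    1. *)
Definition Gm : (int -> int -> K) -> K := fun Y => fm (-2) Y.
Definition Fm : (int -> int -> K) -> K := fun Y =>
  if vnode (vM (-2)) then v (-1) Y * (u (-2) Y + u (-1) Y * fm (-3) Y / v (-2) Y) else v (-1) Y.

Lemma nice_Fm : nice r Fm.
Proof.
rewrite /Fm; apply: nice_if; last exact: (@nice_yy K r 2).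
apply: niceM; first exact: (@nice_yy K r 2).
apply: niceD; first exact: (@nice_yy K r 1).
apply: niceM; last exact: (@nice_yyV K r 2).
by apply: niceM; [exact: (@nice_yy K r 1) | exact: nice_fM].
Qed.

(** The relation required by [opens], moved from position 1 to position -1, with Q at -2 as the
    value of X. *)
Lemma Fm_eq Y : gd r Y -> ~~ odd `|nd 0|%N -> vnode (vM (-1)) ->
  fm (-1) Y * Fm Y = v 0 Y * fq (-2) Y + fq (-1) Y * Gm Y.
Proof.
move=> Y0 e0 N1; have o1 : odd `|nd (-1)|%N by exact: (odd_nd (-1)).
have := fM_odd_nd Y0 N1 o1; rewrite (_ : -1 - 1 = -2 :> int) // (_ : -1 + 1 = 0 :> int) // => E.
rewrite /Fm /Gm; case: ifPn => N2; last first.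
  have N2' : ~~ is_node r (nd (-2)) by [].
  by rewrite E (fM_out _ N2') (fQ_out _ N2') (yy_out _ _ N2') mul1r !mulr1.
have e2 : ~~ odd `|nd (-2)|%N by have := (nd_parity (-1)).1; rewrite o1 => ->.
have := fM_even_nd Y0 N2 e2; rewrite (_ : -2 - 1 = -3 :> int) // (_ : -2 + 1 = -1 :> int) // => E2.
have v0 : v (-2) Y != 0 by exact: yy_neq0.
apply: (mulIf v0).
transitivity (fm (-1) Y * v (-1) Y * (fq (-2) Y + u (-1) Y * fm (-3) Y)).
  by rewrite [fq (-2) Y]/fQ; field.
transitivity (v 0 Y * v (-2) Y * fq (-2) Y + fq (-1) Y * (fm (-2) Y * v (-2) Y)); last by ring.
rewrite E2 E; transitivity (v (-2) Y * v 0 Y * fq (-2) Y + fq (-1) Y * fq (-2) Y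
   + u (-1) Y * fm (-3) Y * (v (-2) Y * v 0 Y + fq (-1) Y)); first by ring.
by rewrite -E [fq (-1) Y]/fQ; ring.
Qed.

Lemma opens2 V S : is_initial_seed V -> ~~ odd `|nd 0|%N -> vnode (vM 0) -> vnode (vM (-1)) -> vnode (vM 1) ->
  is_mutation (vlab (vM (-1))) V S ->
  opens S (stepF 0 Fm Gm) (stepG 0 Fm Gm).
Proof.
move=> V0 e0 N0 N1 N2 m1 T m2.
have nG : nice r Gm by exact: nice_fM.
have FmE Y (Y0 : gd r Y) := @Fm_eq Y Y0 e0 N1.
have M0E Y (Y0 : gd r Y) := @fM_even_nd Y 0 Y0 N0 e0.
have GE Y : gd r Y -> v 0 Y * stepG 0 Fm Gm Y = fq 0 Y * Fm Y + fm 1 Y * fq (-1) Y * Gm Y.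
  exact: (@stepG_eq 0).
(* Both exchange relations of [init_preA2] follow after multiplication by the nonzero Y_2 at
   position 0, by eliminating with [Fm_eq] and with the relation for M at position 0. *)
have E1 Y : gd r Y -> fm (-1) Y * stepG 0 Fm Gm Y = fq (-2) Y * fq 0 Y + fq (-1) Y * fm (-2) Y * fm 0 Y.
  move=> Y0; have v0 : v 0 Y != 0 by exact: yy_neq0.
  apply: (mulfI v0); rewrite mulrCA GE //.
  transitivity (fq 0 Y * (fm (-1) Y * Fm Y) + fm (-1) Y * fm 1 Y * (fq (-1) Y * Gm Y)); first by ring.
  transitivity (v 0 Y * fq (-2) Y * fq 0 Y + fq (-1) Y * fm (-2) Y * (fm 0 Y * v 0 Y)); last by ring.
  by rewrite FmE // M0E // /Gm; ring.
have E2 Y : gd r Y -> fm 0 Y * Fm Y = fm 1 Y * fq (-2) Y + stepG 0 Fm Gm Y.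
  move=> Y0; have v0 : v 0 Y != 0 by exact: yy_neq0.
  apply: (mulfI v0); rewrite mulrDr GE //.
  transitivity (fm 0 Y * v 0 Y * Fm Y); first by ring.
  rewrite M0E //; transitivity (fm 1 Y * (fm (-1) Y * Fm Y) + fq 0 Y * Fm Y); first by ring.
  by rewrite FmE //; ring.
have [hG hF pA] := init_preA2 V0 e0 N0 N1 m1 m2 (nice_stepG 0 nice_Fm nG) nice_Fm E1 E2.
do 4!eexists; split; first exact: pA.
by move=> Y Y0; have := @stepF_eq 0 Fm Gm Y Y0 (odd_nd 0 e0); rewrite mulr0 add0r => ->.
Qed.

End Ladder.

(** * Demazure crystals of flat monomials *)

Section Monomials.
Implicit Types (M N Z : monom) (s i k : int).

(** Supports of formal sums are not additive. Moving the index set to a common list D, where the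
    extra terms are trivial, makes evaluation and weight additive. *)
Lemma big_dom (R : Type) (idx : R) (op : Monoid.com_law idx) Z (D : seq (int * int)) (P : pred (int * int)) (F : int * int -> R) :
  uniq D -> (forall p, P p -> p \in dom Z -> p \notin D -> F p = idx) ->
  (forall p, P p -> p \in D -> p \notin dom Z -> F p = idx) ->
  \big[op/idx]_(p <- dom Z | P p) F p = \big[op/idx]_(p <- D | P p) F p.
Proof.
move=> uD h1 h2.
have red (s t : seq (int * int)) : (forall p, P p -> p \in s -> p \notin t -> F p = idx) ->
    \big[op/idx]_(p <- s | P p) F p = \big[op/idx]_(p <- [seq p <- s | p \in t] | P p) F p.
  move=> h; rewrite [RHS]big_filter_cond [LHS](bigID (fun p => p \in t)) /=.
  rewrite [X in op _ X]big_seq_cond [X in op _ X]big1 ?Monoid.mulm1; last first.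
    by move=> p /and3P[ps Pp pt]; exact: h.
  by apply: eq_bigl => p; rewrite andbC.
rewrite (red _ _ h1) (red _ _ h2); apply: perm_big; apply: uniq_perm.
- exact/filter_uniq/uniq_dom.
- exact: filter_uniq.
by move=> p; rewrite !mem_filter andbC.
Qed.

Lemma coeff_sum (I : Type) (r : seq I) (P : pred I) (F : I -> monom) p :
  coeff p (\sum_(x <- r | P x) F x) = \sum_(x <- r | P x) coeff p (F x).
Proof. exact: raddf_sum. Qed.

Section Eval.
Variables (K : fieldType) (Y : int -> int -> K).
Hypothesis Y0 : forall s i, Y s i != 0.

Lemma monom_evalE M D : uniq D -> {subset dom M <= D} ->
  monom_eval Y M = \prod_(p <- D) Y p.1 p.2 ^ coeff p M.
Proof.
move=> uD sD; rewrite /monom_eval; apply: big_dom => // p _ pD; last by move/coeff_outdom->.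
by move/negP; case; exact: sD.
Qed.

Lemma monom_evalD M N : monom_eval Y (M + N) = monom_eval Y M * monom_eval Y N.
Proof.
pose D := undup (dom M ++ dom N).
rewrite !(@monom_evalE _ D) ?undup_uniq //.
- by rewrite -big_split; apply: eq_bigr => p _; rewrite coeffD expfzDr.
- by move=> p pN; rewrite mem_undup mem_cat pN orbT.
- by move=> p pN; rewrite mem_undup mem_cat pN.
- by move=> p /domD_subset; rewrite mem_undup.
Qed.

Lemma monom_eval0 : monom_eval Y 0 = 1.
Proof. by rewrite /monom_eval dom0 big_nil. Qed.

Lemma monom_eval_neq0 M : monom_eval Y M != 0.
Proof. by rewrite /monom_eval prodf_seq_neq0; apply/allP => p _; rewrite expfz_neq0. Qed.

Lemma monom_evalN M : monom_eval Y (- M) = (monom_eval Y M)^-1.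
Proof.
apply: (mulfI (monom_eval_neq0 M)); rewrite -monom_evalD subrr monom_eval0 mulfV //.
exact: monom_eval_neq0.
Qed.

Lemma monom_eval_sum (I : Type) (r : seq I) (P : pred I) (F : I -> monom) :
  monom_eval Y (\sum_(x <- r | P x) F x) = \prod_(x <- r | P x) monom_eval Y (F x).
Proof. exact: (big_morph _ monom_evalD monom_eval0). Qed.

Lemma monom_eval_Yvar r s i : monom_eval Y (Yvar r s i) = yy r Y s i.
Proof.
rewrite /Yvar /yy; case: ifP => _; last exact: monom_eval0.
by rewrite /monom_eval domU1 big_seq1 coeffU eqxx mulr1 expr1z.
Qed.

End Eval.

Variable r : nat.

Lemma wtD M N : wt r (M + N) = wt r M + wt r N.
Proof.
pose D := undup (dom M ++ dom N).
have E X : {subset dom X <= D} -> wt r X = \sum_(p <- D) Lam r p.2 *~ coeff p X.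
  move=> sD; rewrite /wt; apply: big_dom; rewrite ?undup_uniq // => p _ pD; last by move/coeff_outdom->; rewrite mulr0z.
  by move/negP; case; exact: sD.
rewrite !E.
- by rewrite -big_split; apply: eq_bigr => p _; rewrite coeffD mulrzDr.
- by move=> p pN; rewrite mem_undup mem_cat pN orbT.
- by move=> p pN; rewrite mem_undup mem_cat pN.
- by move=> p /domD_subset; rewrite mem_undup.
Qed.

Lemma wt0 : wt r 0 = 0. Proof. by rewrite /wt dom0 big_nil. Qed.
Lemma wtN M : wt r (- M) = - wt r M.
Proof. by apply/eqP; rewrite -addr_eq0 -wtD addNr wt0. Qed.
Lemma wt_sum (I : Type) (s : seq I) (P : pred I) (F : I -> monom) :
  wt r (\sum_(x <- s | P x) F x) = \sum_(x <- s | P x) wt r (F x).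
Proof. exact: (big_morph _ wtD wt0). Qed.

Lemma wt_Yvar s i : wt r (Yvar r s i) = Lam r i.
Proof.
rewrite /Yvar; case: ifPn => iN; first by rewrite /wt domU1 big_seq1 coeffU eqxx mulr1 mulr1z.
apply/esym; rewrite wt0; apply/rowP => p; rewrite !mxE; case: eqP => // pi.
by move: iN; rewrite -pi /is_node; have := ltn_ord p; lia.
Qed.

Lemma coeff_Yvar s k s' i : coeff (s, k) (Yvar r s' i) = (is_node r i && ((s == s') && (k == i)))%:R.
Proof.
rewrite /Yvar; case: ifP => iN; last by rewrite coeff0.
by rewrite coeffU mul1r xpair_eqE eq_sym [i == k]eq_sym.
Qed.

Lemma wt_Amon s i : wt r (Amon r s i) = alpha r i.
Proof.
rewrite /Amon /alpha; case: ifP => iN; last exact: wt0.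
rewrite !wtD !wt_Yvar wt_sum; apply/rowP => p; rewrite !mxE summxE /cartan.
have wtz M n : wt r (M *~ n) = wt r M *~ n.
  have wtn m : wt r (M *+ m) = wt r M *+ m by elim: m => [|m IH]; rewrite ?wt0 // !mulrS wtD IH.
  by case: n => m; rewrite /intmul ?wtN wtn.
under eq_bigr do rewrite wtz wt_Yvar.
have pN : p.+1%:Z \in zrange 1 r%:Z by rewrite mem_zrange; have := ltn_ord p; lia.
rewrite (eq_bigr (fun j => (p.+1%:Z == j)%:R * cartan j i)); last first.
  by move=> j _; rewrite -scaler_int !mxE intz mulrC.
rewrite big_mkcond (bigD1_seq _ pN) ?zrange_uniq //= eqxx mul1r big1 ?addr0; last first.
  by move=> j; rewrite eq_sym => /negPf->; rewrite mul0r if_same.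
rewrite /cartan; case: eqVneq => [pi|pi] /=; first by rewrite addr0.
by rewrite add0r.
Qed.

(** Adjacent nodes have opposite parity, and the even ones come first in [jseq]. *)
Lemma pexpE j i : is_node r i -> is_node r j -> `|j - i| = 1 -> pexp r j i = (odd `|i|%N)%:Z.
Proof.
move=> iN jN ji; rewrite /pexp /jseq; congr (nat_of_bool _)%:Z.
set E := map _ _; set O := map _ _.
have memE k : is_node r k -> (k \in E) = ~~ odd `|k|%N.
  move=> kN; apply/mapP/idP => [[m]|ek]; first by rewrite mem_filter => /andP[em _] ->.
  by exists `|k|%N; [rewrite mem_filter ek mem_iota; move: kN; rewrite /is_node; lia | move: kN; rewrite /is_node; lia].
rewrite !index_cat !memE //.
have ojk : odd `|j|%N = ~~ odd `|i|%N by move: iN jN; rewrite /is_node; lia.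
rewrite ojk negbK; case: (boolP (odd `|i|%N)) => oi /=.
  by apply: leq_trans (leq_addr _ _); rewrite index_mem memE // ojk oi.
apply/negbTE; rewrite -leqNgt; apply: leq_trans (index_size _ _) _; exact: leq_addr.
Qed.

Lemma coeff_Amon s k i : is_node r i -> is_node r k ->
  coeff (s, k) (Amon r 1 i) =
    ((k == i) && ((s == 1) || (s == 2)))%:R - ((`|k - i| == 1) && (s == 1 + (odd `|i|%N)%:Z))%:R.
Proof.
move=> iN kN; rewrite /Amon iN !coeffD !coeff_Yvar iN /= coeff_sum.
have kz : k \in zrange 1 r%:Z by rewrite mem_zrange.
have cz (z : int) (p : int * int) M : coeff p (M *~ z) = coeff p M * z.
  by rewrite raddfMz -mulrzr intz.
under eq_bigr do rewrite cz coeff_Yvar.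
rewrite big_mkcond (bigD1_seq _ kz) ?zrange_uniq //= [X in _ + (_ + X)]big1 ?addr0; last first.
  by move=> j /negPf jk; rewrite [k == j]eq_sym jk !andbF mul0r if_same.
rewrite /cartan kN eqxx /=; case: (eqVneq k i) => [->|ki] /=.
  by rewrite subrr normr0 !andbT /= subr0 addr0; case: eqP => [->|]; case: eqP => //; lia.
rewrite ?andbF !add0r.
case: ifP => [/eqP ki1|_] /=; last by rewrite mulr0 oppr0.
by rewrite pexpE // andbT mulrN1.
Qed.

Lemma psumE i Z s : (forall k, k != 1 -> k != 2 -> coeff (k, i) Z = 0) ->
  psum i Z s = (1 <= s)%R%:R * coeff (1, i) Z + (2 <= s)%R%:R * coeff (2, i) Z.
Proof.
move=> Z0; rewrite /psum (@big_dom _ _ _ _ [:: (1, i); (2, i)]) //.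
- by rewrite !big_cons big_nil /= !eqxx /=; case: (1 <= s); case: (2 <= s); rewrite ?mul1r ?mul0r ?addr0 ?add0r.
- move=> [k j] /andP[/= /eqP-> _] _; rewrite !inE !xpair_eqE eqxx !andbT negb_or => /andP[k1 k2].
  exact: Z0.
by move=> p _ _ /coeff_outdom.
Qed.

Lemma total_psum i Z : (forall k, k != 1 -> k != 2 -> coeff (k, i) Z = 0) ->
  \sum_(p <- dom Z | p.2 == i) coeff p Z = coeff (1, i) Z + coeff (2, i) Z.
Proof.
move=> Z0; rewrite (@big_dom _ _ _ _ [:: (1, i); (2, i)]) //.
- by rewrite !big_cons big_nil /= !eqxx addr0.
- move=> [k j] /= /eqP-> _; rewrite !inE !xpair_eqE eqxx !andbT negb_or => /andP[k1 k2].
  exact: Z0.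
by move=> p _ _ /coeff_outdom.
Qed.

(** The partial sums are 0, the exponent for s = 1, and the total; the two inequalities say that the
    total is the largest of them. *)
Lemma crystal_eps_eq0 i Z : (forall k, k != 1 -> k != 2 -> coeff (k, i) Z = 0) ->
  0 <= coeff (2, i) Z -> 0 <= coeff (1, i) Z + coeff (2, i) Z -> crystal_eps i Z = 0.
Proof.
move=> Z0 c2 c12; rewrite /crystal_eps total_psum //.
have [ge [s Es]] := crystal_phiP i Z; have := ge 2; move: Es; rewrite !psumE //= !mul1r.
move: (coeff (1, i) Z) (coeff (2, i) Z) (crystal_phi i Z) c2 c12 => a b c.
by case: (lerP 1 s) => h1; case: (lerP 2 s) => h2; rewrite /= ?mul1r ?mul0r; lia.
Qed.

(* on these monomials f_i acts at most once, by A_{1,i}^{-1} *)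
Definition flat i Z : Prop :=
  (forall k, k != 1 -> coeff (k, i) Z = 0) /\ (coeff (1, i) Z == 0) || (coeff (1, i) Z == 1).

Lemma ftilde_flat i Z : flat i Z ->
  ftilde r i Z = if coeff (1, i) Z == 1 then Some (Z - Amon r 1 i) else None.
Proof.
move=> [Z0 c1]; have Z0' k : k != 1 -> k != 2 -> coeff (k, i) Z = 0 by move=> /Z0.
have c2 : coeff (2, i) Z = 0 by apply: Z0.
have [ge [s Es]] := crystal_phiP i Z; have := ge 1; have := ge 0.
move: Es; rewrite !psumE //= c2 => Es g0 g1.
rewrite /ftilde; case: (eqVneq (coeff (1, i) Z) 1) => [E1|N1]; last first.
  rewrite ifF //; move: c1; rewrite (negPf N1) orbF => /eqP E0.
  by rewrite -Es E0 !mulr0 addr0 ltxx.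
have phi1 : crystal_phi i Z = 1.
  move: Es g1; rewrite E1 mulr0 addr0 /= !mulr1; move: (crystal_phi i Z) => c.
  by case: (1 <= s) => /=; lia.
rewrite ifT ?phi1 //; have /fnodeP[] : 0 < crystal_phi i Z by rewrite phi1.
rewrite psumE // phi1 c2 E1 => h1 h2; have := h2 1; rewrite psumE // c2 E1 => h3.
have h4 := h3 erefl.
have -> : fnode i Z = 1 by move: h1; case: (lerP 1 (fnode i Z)) => /=; lia.
by [].
Qed.

(** After one step the exponents of Y_{1,i} and Y_{2,i} are 0 and -1, so no partial sum is
    positive. *)
Lemma ftilde_flat2 i Z : is_node r i -> flat i Z -> coeff (1, i) Z = 1 -> ftilde r i (Z - Amon r 1 i) = None.
Proof.
move=> iN [Z0 _] c1; pose Z' := Z - Amon r 1 i.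
have cE k : coeff (k, i) Z' = coeff (k, i) Z - ((k == 1) || (k == 2))%:R.
  by rewrite coeffB coeff_Amon // eqxx subrr normr0 /= subr0.
have Z0' k : k != 1 -> k != 2 -> coeff (k, i) Z' = 0.
  by move=> k1 k2; rewrite cE Z0 // (negPf k1) (negPf k2).
have [ge [s Es]] := crystal_phiP i Z'.
rewrite /ftilde ifF //; apply/negbTE; rewrite -leNgt -Es psumE // !cE c1 Z0 //=.
by case: (lerP 1 s) => /= h1; case: (lerP 2 s) => /= h2; lia.
Qed.

Definition flist w M (L : seq monom) : Prop := demazure r w M = [set` L]%classic /\ uniq L.

Lemma flist_nil M : flist [::] M [:: M].
Proof.
split=> //; apply/seteqP; split=> Z /=; rewrite inE.
  by move=> [m _ [->]].
by move=> /eqP->; exists [::].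
Qed.

Definition fext i (L : seq monom) := L ++ [seq Z - Amon r 1 i | Z <- L & coeff (1, i) Z == 1].

(** On flat monomials powers of f_i beyond the first give 0. The new monomials carry the exponent -1
    on Y_{2,i}, where those of L have 0, so nothing is listed twice. *)
Lemma flist_cons i w M L : is_node r i -> flist w M L -> {in L, forall Z, flat i Z} ->
  flist (i :: w) M (fext i L).
Proof.
move=> iN [LE uL] fl; split; last first.
  rewrite cat_uniq uL map_inj_uniq ?filter_uniq ?andbT //=; last exact: subIr.
  apply/hasPn => X /mapP[Z]; rewrite mem_filter => /andP[/eqP c1 ZL] XE; apply/negP => /fl[h _].
  have [h' _] := fl Z ZL.
  by have := h 2 isT; rewrite XE coeffB coeff_Amon // h' // eqxx subrr normr0.
have iterN n f : iter n (obind f) None = None :> option monom by elim: n => //= n ->.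
have inL Z m : size m = size w -> fpow r w m M = Some Z -> Z \in L.
  by move=> sm Zm; have : demazure r w M Z by [exists m]; rewrite LE.
apply/seteqP; split=> Z /=.
  move=> [[//|n m] /= [sm]]; case E : (fpow r w m M) => [Z1|]; last by rewrite iterN.
  have Z1L := inL _ _ sm E; have fZ := fl _ Z1L.
  case: n => [|[|n]] /=.
  - by move=> [<-]; rewrite mem_cat Z1L.
  - rewrite ftilde_flat //; case: ifP => // c1 [<-]; rewrite mem_cat; apply/orP; right.
    by apply/mapP; exists Z1; rewrite // mem_filter c1.
  rewrite -!iterS iterSr iterSr /= ftilde_flat //; case: eqP => /= [c1|_].
    by rewrite ftilde_flat2 // iterN.
  by rewrite iterN.
rewrite mem_cat => /orP[ZL|/mapP[Z1]].
  have : demazure r w M Z by rewrite LE.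
  by move=> [m sm Em]; exists (0%N :: m); rewrite /= ?sm.
rewrite mem_filter => /andP[c1 Z1L] ->; have : demazure r w M Z1 by rewrite LE.
move=> [m sm Em]; exists (1%N :: m); rewrite /= ?sm // Em /= ftilde_flat ?c1 //.
exact: fl.
Qed.

Definition far k (w : seq int) := all (fun i => 1 < `|k - i|) w.
(** The second clause localises the effect of w: exponents at nodes neither equal nor adjacent to a
    letter of w are still those of M, which keeps later letters under control. *)
Definition dstate w M L : Prop := flist w M L /\
  {in L, forall Z s k, is_node r k -> far k w -> coeff (s, k) Z = coeff (s, k) M}.
Definition prof (b : bool) i Z : Prop := forall s, coeff (s, i) Z = (b && (s == 1))%:R.

Lemma prof_flat b i Z : prof b i Z -> flat i Z.
Proof. by move=> h; split; [move=> k /negPf k1; rewrite h k1 andbF | rewrite h eqxx andbT; case: b {h}]. Qed.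

Lemma dstate_nil M : dstate [::] M [:: M].
Proof. by split; [exact: flist_nil | move=> Z; rewrite inE => /eqP->]. Qed.

Lemma dstate_cons i w M L : is_node r i -> dstate w M L -> {in L, forall Z, flat i Z} ->
  dstate (i :: w) M (fext i L).
Proof.
move=> iN [fL st] fl; split; first exact: flist_cons.
move=> Z; rewrite mem_cat => /orP[ZL s k kN /andP[_ kw]|]; first exact: st.
move=> /mapP[Z1]; rewrite mem_filter => /andP[_ Z1L] -> s k kN /andP[/= ki kw].
rewrite coeffB coeff_Amon // (st _ Z1L) //.
have -> : (k == i) = false by apply/eqP => ki'; move: ki; rewrite ki' subrr normr0.
by rewrite (gt_eqF ki) /= !subr0.
Qed.

Section Sums.
Variables (K : fieldType) (Y : int -> int -> K).
Hypothesis Y0 : forall s i, Y s i != 0.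
Local Notation ev := (monom_eval Y).
Definition va i : K := ev (- Amon r 1 i).
(** Zero off the diagram: a letter dropped by [sword] then contributes the factor 1 + 0. *)
Definition vo i : K := if is_node r i then va i else 0.
Definition evs (L : seq monom) : K := \sum_(Z <- L) ev Z.

Lemma demazure_sumE w M L : flist w M L -> demazure_sum r Y w M = evs L.
Proof. by move=> [E uL]; rewrite /demazure_sum E -fsbig_seq. Qed.

Lemma evs_fext i L : evs (fext i L) = evs L + va i * \sum_(Z <- L | coeff (1, i) Z == 1) ev Z.
Proof.
rewrite /evs big_cat big_map big_filter mulr_sumr; congr (_ + _).
by apply: eq_bigr => Z _; rewrite monom_evalD // mulrC.
Qed.

Lemma dstep_one i w M L : is_node r i -> dstate w M L -> far i w -> prof true i M ->
  [/\ dstate (i :: w) M (fext i L), evs (fext i L) = evs L * (1 + va i) &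
     fext i L = L ++ [seq Z - Amon r 1 i | Z <- L]].
Proof.
move=> iN [fL st] iw p1.
have pL : {in L, forall Z, prof true i Z} by move=> Z ZL s; rewrite st.
split; first by apply: dstate_cons => // Z /pL /prof_flat.
  rewrite evs_fext mulrDr mulr1 [_ * va i]mulrC; congr (_ + _ * _).
  by rewrite big_seq_cond [RHS]big_seq; apply: eq_bigl => Z; case ZL: (Z \in L); rewrite //= pL.
rewrite /fext; congr (_ ++ map _ _); apply/all_filterP/allP => Z ZL.
by rewrite pL.
Qed.

Lemma dblock es M : all (is_node r) es -> pairwise (fun i j => 1 < `|i - j|) es ->
  {in es, forall i, prof true i M} ->
  exists L, dstate es M L /\ evs L = ev M * \prod_(i <- es) (1 + va i).
Proof.
elim: es => [|i es IH] /=; first by exists [:: M]; rewrite big_nil mulr1 /evs big_seq1; split=> //; exact: dstate_nil.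
move=> /andP[iN esN] /andP[ies pes] p1.
have [|L [dL sL]] := IH esN pes; first by move=> k kes; apply: p1; rewrite inE kes orbT.
have [|d s _] := dstep_one iN dL ies; first by apply: p1; rewrite mem_head.
by exists (fext i L); split=> //; rewrite s sL big_cons; ring.
Qed.

Lemma far_sub k w w' : {subset w' <= w} -> far k w -> far k w'.
Proof. by move=> sw /allP h; apply/allP => i /sw; exact: h. Qed.

(** Here o is the odd node beyond the even node e of an end slot. If the slot is free, Y_{1,o}
    appears only through the inverse of A_{1,e}, so f_o can act only after f_e. If it is covered,
    the letter e is absent and M already contains Y_{1,o}. *)
Lemma dpair (cov : bool) o e w M L : is_node r e -> ~~ odd `|e|%N -> `|o - e| = 1 ->
  dstate w M L -> far o w -> far e w -> all (is_node r) w ->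
  (~~ cov -> prof true e M) -> (is_node r o -> prof cov o M) ->
  exists L', dstate (sword r (o :: nseq (~~ cov) e ++ w)) M L' /\
    evs L' = evs L * (if cov then 1 + vo o else 1 + va e * (1 + vo o)).
Proof.
move=> eN ee oe dL ow ew wN pe po.
have sw : sword r w = w by apply/all_filterP.
case: cov pe po => [_ po|/(_ isT) pe po]; rewrite /sword /= -/(sword r w) sw.
  case: ifP => oN; last by exists L; rewrite /vo oN addr0 mulr1.
  by have [d s _] := dstep_one oN dL ow (po oN); exists (fext o L); rewrite /vo oN.
rewrite eN; have [d1 s1 fE] := dstep_one eN dL ew pe.
case: ifP => oN; last by exists (fext e L); rewrite /vo oN addr0 mulr1.
have [_ st] := dL; have pL : {in L, forall Z, prof false o Z} by move=> Z ZL s; rewrite st //; exact: po.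
have pL' : {in L, forall Z, prof true o (Z - Amon r 1 e)}.
  move=> Z ZL s; rewrite coeffB pL // coeff_Amon // oe eqxx (negPf ee) addr0 sub0r opprB.
  have -> : (o == e) = false by apply/eqP => oe'; move: oe; rewrite oe' subrr normr0.
  by rewrite subr0.
exists (fext o (fext e L)); split.
  apply: dstate_cons => // Z; rewrite fE mem_cat => /orP[/pL/prof_flat//|/mapP[Z1 Z1L ->]].
  by apply: prof_flat (pL' _ Z1L).
rewrite evs_fext s1 /vo oN fE big_cat big_map /= big_seq_cond big1 ?add0r; last first.
  by move=> Z /andP[ZL]; rewrite pL.
rewrite big_seq_cond; rewrite (eq_bigl (fun Z => Z \in L)); last first.
  by move=> Z; case ZL: (Z \in L); rewrite //= pL'.
rewrite -big_seq; under eq_bigr do rewrite monom_evalD //.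
by rewrite -mulr_suml -/(evs L) -/(va e); ring.
Qed.

End Sums.
End Monomials.

(** * Disjoint intervals and the transfer recursion *)

Section Configurations.
Implicit Types (bc : seq (int * int)) (b c t lo hi : int).

Lemma zrange_iota (p : int) (n : nat) : zrange p (p + n%:Z - 1) = [seq p + x%:Z | x <- iota 0 n].
Proof. by rewrite /zrange; congr (map _ (iota 0 _)); case: ifP; lia. Qed.

Lemma zrange0 (p q : int) : q < p -> zrange p q = [::].
Proof. by move=> qp; rewrite /zrange ifF //; lia. Qed.

Lemma zrange_cat (p m q : int) : p <= m -> m <= q + 1 -> zrange p q = zrange p (m - 1) ++ zrange m q.
Proof.
move=> pm mq; have [n1 e1] : exists n1 : nat, m = p + n1%:Z by exists `|(m - p)%R|%N; lia.
have [n2 e2] : exists n2 : nat, q = m + n2%:Z - 1 by exists `|(q + 1 - m)%R|%N; lia.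
rewrite e2 zrange_iota e1 zrange_iota (_ : p + n1%:Z + n2%:Z - 1 = p + (n1 + n2)%N%:Z - 1); last by lia.
rewrite zrange_iota iotaD map_cat add0n; congr (_ ++ _).
rewrite -[n1 in iota n1]addn0 iotaDl -map_comp; apply: eq_map => t /=; lia.
Qed.

Lemma zrange1 (p : int) : zrange p p = [:: p].
Proof.
have -> : zrange p p = zrange p (p + 1%N%:Z - 1) by congr (zrange _ _); lia.
by rewrite zrange_iota /= addr0.
Qed.

Lemma zrange_rcons (p q : int) : p <= q -> zrange p q = zrange p (q - 1) ++ [:: q].
Proof. by move=> pq; rewrite (@zrange_cat p q q) ?zrange1 //; lia. Qed.

Lemma zrange_cons (p q : int) : p <= q -> zrange p q = p :: zrange (p + 1) q.
Proof. by move=> pq; rewrite (@zrange_cat p (p + 1) q) ?addrK ?zrange1 //; lia. Qed.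

Definition ends bc := flatten [seq [:: d.1; d.2] | d <- bc].
(** The conditions of [Rset] with a movable lower bound and with the empty configuration allowed.
    The upper bound varies in inductions on the last interval; the lower bound expresses b_1 > 0. *)
Definition good lo hi bc := sorted <%R (ends bc) && all (fun t => lo <= t <= hi) (ends bc).
Definition cov bc t := has (fun d => d.1 <= t <= d.2) bc.

Lemma ends_rcons bc d : ends (rcons bc d) = ends bc ++ [:: d.1; d.2].
Proof. by rewrite /ends map_rcons flatten_rcons. Qed.

Lemma good_rcons lo hi bc b c :
  good lo hi (rcons bc (b, c)) = [&& good lo (b - 1) bc, lo <= b, b < c & c <= hi].
Proof.
rewrite /good ends_rcons !(sorted_pairwise lt_trans) pairwise_cat all_cat /= !andbT.
apply/idP/idP.
  case/and3P=> [/and3P[/allrelP ar ps bc0] /allP al /andP[bl cl]]; rewrite ps /=; apply/and4P; split; try lia.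
  by apply/allP => t te; have := al t te; have := ar t b te (mem_head _ _); lia.
case/and4P=> [/andP[ps /allP al] lb bc0 ch]; rewrite ps bc0 /=; apply/and3P; split; try lia.
  rewrite andbT; apply/allrelP => t u te; rewrite !inE => /orP[]/eqP->; have := al t te; lia.
by apply/allP => t te; have := al t te; lia.
Qed.

Lemma good_mem lo hi bc d : good lo hi bc -> d \in bc -> [&& lo <= d.1, d.1 < d.2 & d.2 <= hi].
Proof.
elim/last_ind: bc hi => [//|bc [b c] IH] hi; rewrite good_rcons mem_rcons inE.
case/and4P=> g lb bc0 ch /orP[/eqP->/=|/(IH _ g)]; lia.
Qed.

Lemma cov_range lo hi bc t : good lo hi bc -> cov bc t -> lo <= t <= hi.
Proof. by move=> g /hasP[[b c] /(good_mem g)] /=; lia. Qed.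

Lemma cov_rcons bc d t : cov (rcons bc d) t = (d.1 <= t <= d.2) || cov bc t.
Proof. exact: has_rcons. Qed.

Lemma cov_count lo hi bc t : good lo hi bc -> count (fun d => d.1 <= t <= d.2) bc = cov bc t.
Proof.
elim/last_ind: bc hi => [//|bc [b c] IH] hi; rewrite good_rcons => /and4P[g lb bc0 ch].
rewrite -cats1 count_cat /= addn0 (IH _ g) cats1 cov_rcons /=.
case cv: (cov bc t); last by rewrite orbF.
by have := cov_range g cv; case: (boolP (b <= t <= c)); lia.
Qed.

Lemma good_b1 lo hi bc : bc != [::] -> good lo hi bc -> cov bc (b1 bc) /\ forall t, cov bc t -> b1 bc <= t.
Proof.
elim/last_ind: bc hi => [//|bc [b c] IH] hi _; rewrite good_rcons => /and4P[g lb bc0 ch].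
case: bc IH g => [|d bc] IH g.
  rewrite /b1 /cov /=; split; first by rewrite lexx; lia.
  by move=> t; lia.
have [h1 h2] := IH (b - 1) isT g; split; first by rewrite cov_rcons h1 orbT.
move=> t; rewrite cov_rcons => /orP[/=|/h2 //]; have := cov_range g h1; rewrite /b1 /=; lia.
Qed.

Lemma good_cp lo hi bc : bc != [::] -> good lo hi bc -> cov bc (cp bc) /\ forall t, cov bc t -> t <= cp bc.
Proof.
elim/last_ind: bc => [//|bc [b c] _] _; rewrite good_rcons => /and4P[g lb bc0 ch].
rewrite /cp last_rcons /=; split; first by rewrite cov_rcons /=; lia.
by move=> t; rewrite cov_rcons => /orP[/=|/(cov_range g)]; lia.
Qed.

Lemma good_widen lo lo' hi hi' bc : lo' <= lo -> hi <= hi' -> good lo hi bc -> good lo' hi' bc.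
Proof.
move=> l h /andP[s /allP al]; rewrite /good s; apply/allP => t /al; lia.
Qed.

Lemma good_lo lo lo' hi bc : bc != [::] -> lo <= lo' -> good lo' hi bc = good lo hi bc && (lo' <= b1 bc).
Proof.
move=> n0 l; apply/idP/andP => [g|[g lb]].
  split; first exact: good_widen g.
  by have [h _] := good_b1 n0 g; have := cov_range g h; lia.
have [_ h2] := good_b1 n0 g; move: (g) => /andP[s /allP al]; rewrite /good s; apply/allP => t te.
suff ct : cov bc t by have := h2 t ct; have := al t te; lia.
move: te => /flatten_mapP[[b c] dbc]; rewrite !inE /= => td; apply/hasP; exists (b, c) => //=.
by have := good_mem g dbc; rewrite /=; case/orP: td => /eqP->; lia.
Qed.

(* the second component lists configurations with an interval starting at b and still open at lo + m *)
Fixpoint gen lo (m : nat) : seq (seq (int * int)) * seq (seq (int * int) * int) :=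
  if m is m'.+1 then
    let LO := gen lo m' in let q := lo + m'%:Z in
    (LO.1 ++ [seq rcons x.1 (x.2, q) | x <- LO.2], [seq (bc, q) | bc <- LO.1] ++ LO.2)
  else ([:: [::]], [::]).

Lemma mem_gen lo m : (forall bc, (bc \in (gen lo m).1) = good lo (lo + m%:Z - 1) bc) /\
  (forall bc b, ((bc, b) \in (gen lo m).2) = (lo <= b < lo + m%:Z) && good lo (b - 1) bc).
Proof.
elim: m => [|m [IL IO]] /=; split.
- move=> bc; rewrite inE; elim/last_ind: bc => [//|bc [b c] _].
  rewrite good_rcons; apply/idP/idP; first by case: bc.
  by case/and4P; lia.
- by move=> bc b; rewrite in_nil; case: (boolP (lo <= b < _)) => //; lia.
- move=> bc; rewrite mem_cat IL; elim/last_ind: bc => [//|bc [b c] _].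
  rewrite !good_rcons; have -> : (rcons bc (b, c) \in [seq rcons x.1 (x.2, lo + m%:Z) | x <- (gen lo m).2])
       = (c == lo + m%:Z) && ((bc, b) \in (gen lo m).2).
    apply/mapP/andP => [[[bc' b'] h /rcons_inj[-> -> ->]]|[/eqP-> h]]; first by rewrite eqxx.
    by exists (bc, b).
  by rewrite IO; case: (good lo (b - 1) bc); rewrite /= ?andbT ?andbF //; lia.
move=> bc b; rewrite mem_cat IO.
have -> : ((bc, b) \in [seq (bc0, lo + m%:Z) | bc0 <- (gen lo m).1]) = (b == lo + m%:Z) && good lo (lo + m%:Z - 1) bc.
  apply/mapP/andP => [[bc' h [-> ->]]|[/eqP-> h]]; first by rewrite eqxx -IL.
  by exists bc; rewrite ?IL.
case: (eqVneq b (lo + m%:Z)) => [->|bm] /=; last by congr (_ && _); lia.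
by case: (good _ _ bc); rewrite ?andbT ?andbF //=; lia.
Qed.

Lemma uniq_gen lo m : uniq (gen lo m).1 /\ uniq (gen lo m).2.
Proof.
elim: m => [//|m [uL uO]] /=; have [mL mO] := mem_gen lo m.
rewrite !cat_uniq uL uO /= !andbT; split; apply/andP; split=> //.
- apply/hasPn => bc /mapP[[bc' b] h ->]; rewrite mL good_rcons; lia.
- by rewrite map_inj_uniq // => [[x1 x2] [y1 y2]] /= /rcons_inj[-> ->].
- by rewrite map_inj_uniq // => x y [].
- by apply/hasPn => [[bc b]]; rewrite mO => h; apply/mapP => [[bc' _ [_ bE]]]; lia.
Qed.

Lemma prod_zrange_ends (K : comPzRingType) lo hi (sl sr : bool) (f : int -> K) : lo + sl%:Z + sr%:Z <= hi + 1 ->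
  \prod_(t <- zrange lo hi) f t =
    (if sl then f lo else 1) * \prod_(t <- zrange (lo + sl%:Z) (hi - sr%:Z)) f t * (if sr then f hi else 1).
Proof.
case: sl; case: sr => /= h.
- have h1 : lo <= hi by lia. have h2 : lo + 1 <= hi by lia.
  by rewrite (zrange_cons h1) (zrange_rcons h2) big_cons big_cat big_seq1 /= mulrA.
- have h1 : lo <= hi by lia.
  by rewrite (zrange_cons h1) big_cons subr0 mulr1.
- have h1 : lo <= hi by lia.
  by rewrite (zrange_rcons h1) big_cat big_seq1 addr0 mul1r.
by rewrite addr0 subr0 mulr1 mul1r.
Qed.

Section Weights.
Variables (K : comPzRingType) (A O : int -> K).

Lemma cov_prod lo hi bc b c (f g : int -> K) : good lo hi (rcons bc (b, c)) ->
  \prod_(t <- zrange lo hi) (if cov (rcons bc (b, c)) t then f t else g t) =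
  \prod_(t <- zrange lo (b - 1)) (if cov bc t then f t else g t)
    * \prod_(t <- zrange b c) f t * \prod_(t <- zrange (c + 1) hi) g t.
Proof.
rewrite good_rcons => /and4P[gd lb bc0 ch].
rewrite (@zrange_cat lo b hi) ?(@zrange_cat b (c + 1) hi) ?addrK; try lia.
rewrite !big_cat /= mulrA; congr (_ * _ * _); apply: eq_big_seq => t; rewrite mem_zrange cov_rcons /= => tr.
- by rewrite (_ : b <= t <= c = false) //; lia.
- by rewrite tr.
have -> : b <= t <= c = false by lia.
by case: ifP => // /(cov_range gd); lia.
Qed.

Lemma prod_segs lo hi bc (f : int -> K) : good lo hi bc ->
  \prod_(x <- bc) \prod_(t <- zrange x.1 x.2) f t = \prod_(t <- zrange lo hi) (if cov bc t then f t else 1).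
Proof.
elim/last_ind: bc hi => [|bc [b c] IH] h g; first by rewrite big_nil big1.
rewrite (cov_prod _ _ g) [X in _ * _ * X]big1 // mulr1 big_rcons /= (IH (b - 1)) //.
by move: g; rewrite good_rcons => /and4P[].
Qed.

(** Contribution of one configuration relative to the common highest weight monomial: A for a
    covered slot, 1 + A for a free one whose letter acts or not, and O for the odd nodes between
    consecutive slots of an interval. *)
Definition wgt lo hi bc : K :=
  \prod_(t <- zrange lo hi) (if cov bc t then A t else 1 + A t)
  * \prod_(d <- bc) \prod_(t <- zrange (d.1 + 1) d.2) O t.

Definition wint b c : K := \prod_(t <- zrange b c) A t * \prod_(t <- zrange (b + 1) c) O t.

Lemma wgt_rcons lo hi bc b : good lo hi (rcons bc (b, hi)) ->
  wgt lo hi (rcons bc (b, hi)) = wgt lo (b - 1) bc * wint b hi.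
Proof.
move=> g; rewrite /wgt (cov_prod _ _ g) (@zrange0 (hi + 1)) ?big_nil ?mulr1; last by lia.
by rewrite big_rcons /wint /=; ring.
Qed.

Lemma wgt_next lo hi bc : lo <= hi -> good lo (hi - 1) bc -> wgt lo hi bc = wgt lo (hi - 1) bc * (1 + A hi).
Proof.
move=> lh g; rewrite /wgt (zrange_rcons lh) big_cat big_seq1 /= ifF; last first.
  by apply/negP => /(cov_range g); lia.
by ring.
Qed.

(* transfer matrix for the sum of the weights over gen: A for slots covered by an interval,
   O for the nodes strictly inside one *)
Fixpoint UE lo (m : nat) : K * K :=
  if m is m'.+1 then
    let u := UE lo m' in let q := lo + m'%:Z in
    let E := A q * (u.1 + O q * u.2) in (u.1 + E, E)
  else (1, 0).

(** At a new slot, leaving it free gives U (1 + A) and closing an older interval there gives A O E.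
    Intervals have at least two slots, and the A of the free slot stands exactly where a one-point
    interval would; the sum is U plus the new E. *)
Lemma sum_wgt lo m :
  \sum_(bc <- (gen lo m).1) wgt lo (lo + m%:Z - 1) bc = (UE lo m).1 /\
  \sum_(x <- (gen lo m).2) wgt lo (x.2 - 1) x.1 * wint x.2 (lo + m%:Z - 1) = (UE lo m).2.
Proof.
elim: m => [|m [IL IO]] /=.
  by rewrite !big_seq1 big_nil /wgt zrange0 ?big_nil ?mulr1 //; lia.
have q1 : lo + m.+1%:Z - 1 = lo + m%:Z by lia.
have [mL mO] := mem_gen lo m; rewrite q1.
have EO : \sum_(x <- (gen lo m).2) wgt lo (x.2 - 1) x.1 * wint x.2 (lo + m%:Z) =
    A (lo + m%:Z) * O (lo + m%:Z) * (UE lo m).2.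
  rewrite -IO mulr_sumr; apply: eq_big_seq => [[bc b]]; rewrite mO => /andP[br _] /=.
  have [r1 r2] : b <= lo + m%:Z /\ b + 1 <= lo + m%:Z by move: br; clear; lia.
  rewrite /wint (zrange_rcons r1) (zrange_rcons r2) !big_cat !big_seq1 /=.
  by ring.
have E2 : \sum_(x <- [seq (bc, lo + m%:Z) | bc <- (gen lo m).1] ++ (gen lo m).2)
    wgt lo (x.2 - 1) x.1 * wint x.2 (lo + m%:Z) = A (lo + m%:Z) * ((UE lo m).1 + O (lo + m%:Z) * (UE lo m).2).
  rewrite big_cat big_map EO -IL mulrDr mulr_sumr mulrA; congr (_ + _).
  apply: eq_bigr => bc _; rewrite mulrC /wint zrange1 zrange0 ?big_seq1 ?big_nil ?mulr1 //=; lia.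
split=> //; rewrite big_cat big_map.
transitivity ((UE lo m).1 * (1 + A (lo + m%:Z)) + A (lo + m%:Z) * O (lo + m%:Z) * (UE lo m).2); last by ring.
congr (_ + _).
  rewrite -IL mulr_suml; apply: eq_big_seq => bc; rewrite mL => g; apply: wgt_next => //; lia.
rewrite -EO; apply: eq_big_seq => [[bc b]]; rewrite mO => /andP[br g] /=.
by apply: wgt_rcons; rewrite good_rcons g; lia.
Qed.

End Weights.
End Configurations.

(** * Highest weight monomials and Demazure words in slot coordinates *)

Section Slots.
Variables (r : nat) (y0 d : int).
Hypotheses (d1 : (d == 1) || (d == -1)) (y0_even : ~~ odd `|y0|%N).
Implicit Types (bc : seq (int * int)) (b c q t lo hi s : int).

(** Slot q is the even node [es q], counted in the direction d, and [os q] is the odd node between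
    the slots q - 1 and q. *)
Definition es q : int := y0 + 2 * d * q.
Definition os q : int := es q - d.

Lemma es_even q : ~~ odd `|es q|%N.
Proof. by rewrite /es; case/orP: d1 => /eqP->; lia. Qed.
Lemma os_odd q : odd `|os q|%N.
Proof. by rewrite /os /es; case/orP: d1 => /eqP->; lia. Qed.
Lemma esP (i : int) : ~~ odd `|i|%N -> exists q, i = es q.
Proof.
move=> ei; exists (d * ((i - y0) %/ 2)%Z); rewrite /es.
have : (i - y0 = ((i - y0) %/ 2)%Z * 2) by lia.
by move: ((i - y0) %/ 2)%Z => h; case/orP: d1 => /eqP->; lia.
Qed.
Lemma osP (i : int) : odd `|i|%N -> exists q, i = os q.
Proof.
move=> oi; have [|q qE] := @esP (i + d); first by case/orP: d1 => /eqP->; lia.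
by exists q; rewrite /os -qE addrK.
Qed.

Lemma es_eq q t : (es q == es t) = (q == t).
Proof. by rewrite /es; case/orP: d1 => /eqP->; lia. Qed.
Lemma os_eq q t : (os q == os t) = (q == t).
Proof. by rewrite /os /es; case/orP: d1 => /eqP->; lia. Qed.
Lemma es_os q t : (es q == os t) = false.
Proof. by rewrite /os /es; case/orP: d1 => /eqP->; lia. Qed.
Lemma os_es q t : (os q == es t) = false.
Proof. by rewrite eq_sym es_os. Qed.
Lemma adj_es_es q t : (`|es q - es t| == 1) = false.
Proof. by rewrite /es; case/orP: d1 => /eqP->; lia. Qed.
Lemma adj_os_os q t : (`|os q - os t| == 1) = false.
Proof. by rewrite /os /es; case/orP: d1 => /eqP->; lia. Qed.
Lemma adj_os_es q t : (`|os q - es t| == 1) = (q == t) || (q - 1 == t).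
Proof. by rewrite /os /es; case/orP: d1 => /eqP->; lia. Qed.
Lemma adj_es_os q t : (`|es q - os t| == 1) = (q == t) || (q + 1 == t).
Proof. by rewrite /os /es; case/orP: d1 => /eqP->; lia. Qed.

Definition ind (b : bool) : int := b%:R.

Lemma sum_zrange (p q t : int) : \sum_(x <- zrange p q) ind (t == x) = ind (p <= t <= q).
Proof.
case: (boolP (p <= t <= q)) => tr; last first.
  rewrite big_seq big1 // => x; rewrite mem_zrange => xr; rewrite /ind; case: eqP => // tx.
  by move: tr; rewrite tx xr.
rewrite (bigD1_seq t) ?mem_zrange ?zrange_uniq //= /ind eqxx big1 ?addr0 // => x.
by rewrite eq_sym => /negPf->.
Qed.

(** The factor A[b, c; x] in slot coordinates. The second sum starts at b + 1 because [os t] comes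
    before slot t. *)
Definition Bseg (x : int * int) : monom :=
  \sum_(t <- zrange x.1 x.2) - Amon r 1 (es t) + \sum_(t <- zrange (x.1 + 1) x.2) - Amon r 1 (os t).
Definition Bm bc : monom := \sum_(x <- bc) Bseg x.

Section Range.
Variables (lo hi : int).
Hypothesis eN : forall t, lo <= t <= hi -> is_node r (es t).

Lemma oN t : lo < t <= hi -> is_node r (os t).
Proof.
move=> tr; have h1 : lo <= t <= hi by lia. have h2 : lo <= t - 1 <= hi by lia.
have := eN h1; have := eN h2; rewrite /is_node /os /es.
by case/orP: d1 => /eqP->; lia.
Qed.

(** Its own A lowers both Y_1 and Y_2 at a node. The A of an adjacent odd node raises Y_2, since
    p_{j,i} = 1 for i odd; in [coeff_Bseg_o] the adjacent even nodes raise Y_1 instead. *)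
Lemma coeff_Bseg_e x s q : lo <= x.1 -> x.2 <= hi -> is_node r (es q) ->
  coeff (s, es q) (Bseg x) =
   ind (s == 2) * (ind (x.1 < q <= x.2) + ind (x.1 <= q < x.2)) - ind ((s == 1) || (s == 2)) * ind (x.1 <= q <= x.2).
Proof.
case: x => b c /= lb ch qN; rewrite coeffD !coeff_sum.
rewrite (eq_big_seq (fun t => - ind ((s == 1) || (s == 2)) * ind (q == t))); last first.
  move=> t; rewrite mem_zrange /= => tr; rewrite coeffN coeff_Amon ?es_eq ?adj_es_es ?subr0 /=; last by [].
    by rewrite mulNr /ind; case: (q == t); case: (_ || _).
  by apply: eN; lia.
rewrite -mulr_sumr sum_zrange.
rewrite (eq_big_seq (fun t => ind (s == 2) * (ind (q == t) + ind (q + 1 == t)))); last first.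
  move=> t; rewrite mem_zrange /= => tr; rewrite coeffN coeff_Amon ?es_os ?adj_es_os ?os_odd ?opprB ?subr0 //=; last first.
    by apply: oN; lia.
  rewrite /ind; case: (eqVneq q t) => [->|qt]; case: (eqVneq (q + 1) t) => [E|qt1]; case: (s == 2) => //=; lia.
have -> : (b < q <= c) = (b + 1 <= q <= c) by lia.
have -> : (b <= q < c) = (b + 1 <= q + 1 <= c) by lia.
by rewrite [LHS]addrC -mulr_sumr big_split /= !sum_zrange mulNr.
Qed.

Lemma coeff_Bseg_o x s q : lo <= x.1 -> x.2 <= hi -> is_node r (os q) ->
  coeff (s, os q) (Bseg x) =
   ind (s == 1) * (ind (x.1 <= q <= x.2) + ind (x.1 <= q - 1 <= x.2)) - ind ((s == 1) || (s == 2)) * ind (x.1 < q <= x.2).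
Proof.
case: x => b c /= lb ch qN; rewrite coeffD !coeff_sum.
rewrite (eq_big_seq (fun t => ind (s == 1) * (ind (q == t) + ind (q - 1 == t)))); last first.
  move=> t; rewrite mem_zrange /= => tr; rewrite coeffN coeff_Amon ?os_es ?adj_os_es ?(negPf (es_even _)) ?opprB ?subr0 //=; last first.
    by apply: eN; lia.
  rewrite /ind; case: (eqVneq q t) => [->|qt]; case: (eqVneq (q - 1) t) => [E|qt1]; case: (s == 1) => //=; lia.
rewrite -mulr_sumr big_split /= !sum_zrange /=.
rewrite (eq_big_seq (fun t => - ind ((s == 1) || (s == 2)) * ind (q == t))); last first.
  move=> t; rewrite mem_zrange /= => tr; rewrite coeffN coeff_Amon ?os_eq ?adj_os_os ?subr0 /=; last by [].
    by rewrite mulNr /ind; case: (q == t); case: (_ || _).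
  by apply: oN; lia.
by rewrite -mulr_sumr sum_zrange mulNr /=; congr (_ - _ * ind _); lia.
Qed.

Lemma coeff_Bm_e bc s q : good lo hi bc -> is_node r (es q) -> coeff (s, es q) (Bm bc) =
   \sum_(x <- bc) (ind (s == 2) * (ind (x.1 < q <= x.2) + ind (x.1 <= q < x.2)) - ind ((s == 1) || (s == 2)) * ind (x.1 <= q <= x.2)).
Proof.
move=> g qN; rewrite coeff_sum; apply: eq_big_seq => x xbc.
by have := good_mem g xbc => /and3P[h1 h2 h3]; exact: coeff_Bseg_e.
Qed.

Lemma coeff_Bm_o bc s q : good lo hi bc -> is_node r (os q) -> coeff (s, os q) (Bm bc) =
   \sum_(x <- bc) (ind (s == 1) * (ind (x.1 <= q <= x.2) + ind (x.1 <= q - 1 <= x.2)) - ind ((s == 1) || (s == 2)) * ind (x.1 < q <= x.2)).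
Proof.
move=> g qN; rewrite coeff_sum; apply: eq_big_seq => x xbc.
by have := good_mem g xbc => /and3P[h1 h2 h3]; exact: coeff_Bseg_o.
Qed.

Lemma sum_cov bc q : good lo hi bc -> \sum_(x <- bc) ind (x.1 <= q <= x.2) = ind (cov bc q).
Proof.
move=> g; rewrite /ind -(cov_count q g); elim: bc {g} => [|x l IH]; first by rewrite big_nil.
by rewrite big_cons IH /= natrD.
Qed.

Variables (sl sr : bool).
Hypothesis slr : lo + sl%:Z + sr%:Z <= hi + 1.

(** The flags [sl] and [sr] tell whether the word has an additional odd letter beyond the first or
    the last slot; Y_2 of that odd node is then missing from the monomial. *)
Definition Hm : monom := \sum_(t <- zrange lo hi) Yvar r 1 (es t) + \sum_(t <- zrange (lo + sl%:Z) (hi + 1 - sr%:Z)) Yvar r 2 (os t).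

Lemma coeff_Hm_e s q : is_node r (es q) -> coeff (s, es q) Hm = ind ((s == 1) && (lo <= q <= hi)).
Proof.
move=> qN; rewrite coeffD !coeff_sum [X in _ + X]big1 ?addr0; last first.
  by move=> t _; rewrite coeff_Yvar es_os !andbF.
transitivity (\sum_(t <- zrange lo hi) ind (s == 1) * ind (q == t)).
  apply: eq_bigr => t _; rewrite coeff_Yvar es_eq /ind; case: (eqVneq q t) => [<-|_]; rewrite ?andbF ?mulr0 // qN mulr1 /= andbT //.
by rewrite -mulr_sumr sum_zrange /ind; case: (s == 1); case: (_ <= _ <= _).
Qed.

Lemma coeff_Hm_o s q : is_node r (os q) ->
  coeff (s, os q) Hm = ind ((s == 2) && (lo + sl%:Z <= q <= hi + 1 - sr%:Z)).
Proof.
move=> qN; rewrite coeffD !coeff_sum [X in X + _]big1 ?add0r; last first.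
  by move=> t _; rewrite coeff_Yvar os_es !andbF.
transitivity (\sum_(t <- zrange (lo + sl%:Z) (hi + 1 - sr%:Z)) ind (s == 2) * ind (q == t)).
  apply: eq_bigr => t _; rewrite coeff_Yvar os_eq /ind; case: (eqVneq q t) => [<-|_]; rewrite ?andbF ?mulr0 // qN mulr1 /= andbT //.
by rewrite -mulr_sumr sum_zrange /ind; case: (s == 2); case: (_ <= _ <= _).
Qed.

(** At an odd node inside an interval, Y_2 of [Hm] compensates the inverse of A. At a covered slot
    the exponent of Y_1 drops to 0, and the loss in Y_2 is made up by at least one odd neighbour
    inside the interval, which exists because b < c. *)
Lemma eps_Hm_Bm bc i : good lo hi bc -> is_node r i -> crystal_eps i (Hm + Bm bc) = 0.
Proof.
move=> g iN; case: (boolP (odd `|i|%N)) => [/osP|/esP] [q qE]; rewrite qE in iN *.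
  apply: crystal_eps_eq0; rewrite ?(coeffD _ Hm (Bm bc)).
  - move=> s /negPf s1 /negPf s2; rewrite (coeffD _ Hm (Bm bc)) coeff_Hm_o // coeff_Bm_o // s1 s2 /= big1 ?addr0 // => x _.
    by rewrite /ind /= !mul0r subr0.
  - rewrite coeff_Hm_o // coeff_Bm_o //=.
    have E : \sum_(x <- bc) (ind (2 == 1 :> int) * (ind (x.1 <= q <= x.2) + ind (x.1 <= q - 1 <= x.2)) - ind (2 == 2 :> int) * ind (x.1 < q <= x.2))
       = - \sum_(x <- bc) ind (x.1 < q <= x.2).
      rewrite [LHS](eq_bigr (fun x => - ind (x.1 < q <= x.2))) ?sumrN // => x _.
      by rewrite /ind /= mul0r mul1r add0r.
    rewrite E; case: (boolP (lo < q <= hi)) => qr.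
      have : \sum_(x <- bc) ind (x.1 < q <= x.2) <= 1.
        apply: (@le_trans _ _ (\sum_(x <- bc) ind (x.1 <= q <= x.2))).
          by apply: ler_sum => x _; rewrite /ind; lia.
        by rewrite sum_cov // /ind; case: cov.
      move: (\sum_(x <- bc) _) => S; rewrite /ind (_ : _ <= q <= _) /=; lia.
    rewrite big_seq big1; first by rewrite subr0 /ind; case: (_ <= _ <= _).
    by move=> [b c] /(good_mem g) /and3P[/= h1 h2 h3]; rewrite /ind (_ : b < q <= c = false) //; lia.
  rewrite !coeff_Hm_o // !coeff_Bm_o //= addrACA -big_split addr_ge0 //.
    by rewrite /ind; case: (_ <= _ <= _).
  by apply: sumr_ge0 => x _; rewrite /ind /=; lia.
apply: crystal_eps_eq0; rewrite ?(coeffD _ Hm (Bm bc)).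
- move=> s /negPf s1 /negPf s2; rewrite (coeffD _ Hm (Bm bc)) coeff_Hm_e // coeff_Bm_e // s1 s2 /= big1 ?addr0 // => x _.
  by rewrite /ind /= !mul0r subr0.
- rewrite coeff_Hm_e // coeff_Bm_e //= addr_ge0 // big_seq; apply: sumr_ge0 => [[b c]] /(good_mem g)/and3P[/= h1 h2 h3].
  by rewrite /ind /=; lia.
rewrite !coeff_Hm_e // !coeff_Bm_e //= addrACA -big_split addr0.
have : - ind (cov bc q) <= \sum_(x <- bc) (ind (1 == 2 :> int) * (ind (x.1 < q <= x.2) + ind (x.1 <= q < x.2)) - ind true * ind (x.1 <= q <= x.2)
   + (ind true * (ind (x.1 < q <= x.2) + ind (x.1 <= q < x.2)) - ind true * ind (x.1 <= q <= x.2))).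
  rewrite -(sum_cov q g) -sumrN big_seq [X in _ <= X]big_seq; apply: ler_sum => [[b c]] /(good_mem g)/and3P[/= h1 h2 h3].
  by rewrite /ind /=; lia.
move: (\sum_(x <- bc) _) => S; have := @cov_range _ _ _ q g.
by rewrite /ind; case: cov => [/(_ isT)->|_] /=; case: (lo <= q <= hi) => /=; lia.
Qed.

Lemma prof_e bc q : good lo hi bc -> lo <= q <= hi -> ~~ cov bc q -> prof true (es q) (Hm + Bm bc).
Proof.
move=> g qr qc s; have qN := eN qr; rewrite (coeffD _ Hm (Bm bc)) coeff_Hm_e // coeff_Bm_e // qr andbT.
rewrite big_seq big1 ?addr0 // => x xbc.
have : x.1 <= q <= x.2 = false by apply/negbTE; apply: contra qc => xq; apply/hasP; exists x.
by rewrite /ind; case: (s == 1); case: (s == 2) => /=; lia.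
Qed.

Lemma prof_o_lo bc : good lo hi bc -> sl -> is_node r (os lo) -> prof (cov bc lo) (os lo) (Hm + Bm bc).
Proof.
move=> g sl1 oNl s; rewrite (coeffD _ Hm (Bm bc)) coeff_Hm_o // coeff_Bm_o // sl1.
have -> : lo + true%:Z <= lo <= hi + 1 - sr%:Z = false by lia.
rewrite andbF add0r (eq_big_seq (fun x => ind (s == 1) * ind (x.1 <= lo <= x.2))); last first.
  move=> [b c] /(good_mem g)/and3P[/= h1 h2 h3].
  have [-> ->] : (b < lo <= c = false) /\ (b <= lo - 1 <= c = false) by lia.
  by rewrite /ind mulr0 subr0 addr0.
by rewrite -mulr_sumr sum_cov // /ind; case: (s == 1); case: cov.
Qed.

Lemma prof_o_hi bc : good lo hi bc -> sr -> is_node r (os (hi + 1)) -> prof (cov bc hi) (os (hi + 1)) (Hm + Bm bc).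
Proof.
move=> g sr1 oNl s; rewrite (coeffD _ Hm (Bm bc)) coeff_Hm_o // coeff_Bm_o // sr1.
have -> : lo + sl%:Z <= hi + 1 <= hi + 1 - true%:Z = false by lia.
rewrite andbF add0r (eq_big_seq (fun x => ind (s == 1) * ind (x.1 <= hi <= x.2))); last first.
  move=> [b c] /(good_mem g)/and3P[/= h1 h2 h3]; rewrite addrK.
  have [-> ->] : (b < hi + 1 <= c = false) /\ (b <= hi + 1 <= c = false) by lia.
  by rewrite /ind mulr0 subr0 add0r.
by rewrite -mulr_sumr sum_cov // /ind; case: (s == 1); case: cov.
Qed.

Definition wword bc : seq int := sword r
  ((if sl then os lo :: nseq (~~ cov bc lo) (es lo) else [::])
   ++ (if sr then os (hi + 1) :: nseq (~~ cov bc hi) (es hi) else [::])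
   ++ [seq es t | t <- zrange_minus (lo + sl%:Z) (hi - sr%:Z) bc]).

Lemma sword_cat w w' : sword r (w ++ w') = sword r w ++ sword r w'.
Proof. exact: filter_cat. Qed.

Lemma zrange_minusE (p q : int) bc : zrange_minus p q bc = [seq t <- zrange p q | ~~ cov bc t].
Proof. by []. Qed.

Lemma far_es_inner q bc (p p' : int) : (forall t, p <= t <= p' -> q != t) ->
  far (es q) [seq es t | t <- zrange_minus p p' bc].
Proof.
move=> h; rewrite /far all_map; apply/allP => t; rewrite mem_filter mem_zrange => /andP[_ /h] /=.
by rewrite /es; case/orP: d1 => /eqP->; lia.
Qed.

Lemma far_os_inner q bc (p p' : int) : (forall t, p <= t <= p' -> (q != t) && (q != t + 1)) ->
  far (os q) [seq es t | t <- zrange_minus p p' bc].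
Proof.
move=> h; rewrite /far all_map; apply/allP => t; rewrite mem_filter mem_zrange => /andP[_ /h] /=.
by rewrite /os /es; case/orP: d1 => /eqP->; lia.
Qed.

Section Values.
Variables (K : fieldType) (Y : int -> int -> K).
Hypothesis Y0 : forall s i, Y s i != 0.
Local Notation ev := (monom_eval Y).
Local Notation va := (va r Y).
Local Notation vo := (vo r Y).

(** An end slot with an additional odd letter has its [va] multiplied by 1 + [vo]. Both outcomes of
    [dpair], together with the [va] that a covered slot takes from [Bm], then fit the pattern of
    [wgt]. *)
Definition AA t : K := va (es t) * (if sl && (t == lo) then 1 + vo (os lo) else 1)
   * (if sr && (t == hi) then 1 + vo (os (hi + 1)) else 1).
Definition OO t : K := va (os t).

Lemma ev_Bm bc : good lo hi bc -> ev (Bm bc) =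
  \prod_(t <- zrange lo hi) (if cov bc t then va (es t) else 1)
   * \prod_(x <- bc) \prod_(t <- zrange (x.1 + 1) x.2) OO t.
Proof.
have h0 : good lo hi bc -> ev (Bm bc) = \prod_(x <- bc) (\prod_(t <- zrange x.1 x.2) va (es t) * \prod_(t <- zrange (x.1 + 1) x.2) OO t).
  move=> g; rewrite monom_eval_sum //; apply: eq_bigr => x _.
  by rewrite monom_evalD // !monom_eval_sum.
move=> g; rewrite h0 // big_split; congr (_ * _).
exact: prod_segs.
Qed.

(** The word acts from its right end: the free inner slots are mutually far and are handled by
    [dblock], then [dpair] treats the right and finally the left end. *)
Lemma wword_state bc : good lo hi bc -> exists L, flist r (wword bc) (Hm + Bm bc) L /\
  evs Y L = ev Hm * wgt AA OO lo hi bc.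
Proof.
move=> g; set M := Hm + Bm bc; pose inner := [seq es t | t <- zrange_minus (lo + sl%:Z) (hi - sr%:Z) bc].
have inR t : lo + sl%:Z <= t <= hi - sr%:Z -> lo <= t <= hi by lia.
have innerN : all (is_node r) inner.
  by rewrite all_map; apply/allP => t; rewrite mem_filter mem_zrange => /andP[_ /inR /eN].
have innerP : pairwise (fun i j => 1 < `|i - j|) inner.
  rewrite pairwise_map; apply: (@sub_in_pairwise _ predT (fun i j => i < j)); first by move=> i j _ _ /=; rewrite /es; case/orP: d1 => /eqP->; lia.
    by apply/allP.
  rewrite -(sorted_pairwise lt_trans); apply: sorted_filter; first exact: lt_trans.
  by rewrite /zrange sorted_map; apply: sub_sorted (iota_ltn_sorted _ _) => i j /=; lia.
have [|L0 [d0 s0]] := @dblock r K Y Y0 inner M innerN innerP.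
  move=> i /mapP[t]; rewrite mem_filter mem_zrange => /andP[nc tr] ->.
  by apply: prof_e => //; exact: inR.
pose w1 := if sr then os (hi + 1) :: nseq (~~ cov bc hi) (es hi) else [::].
pose F1 : K := if sr then (if cov bc hi then 1 + vo (os (hi + 1)) else 1 + va (es hi) * (1 + vo (os (hi + 1)))) else 1.
have swi : sword r inner = inner by apply/all_filterP.
have [L1 [dL1 s1]] : exists L1, dstate r (sword r (w1 ++ inner)) M L1 /\ evs Y L1 = evs Y L0 * F1.
  rewrite /w1 /F1; case sr1 : sr; last by exists L0; rewrite mulr1 swi.
  have hr : lo <= hi <= hi by move: slr; rewrite sr1; case: sl; lia.
  apply: dpair => //.
  - exact: eN.
  - exact: es_even.
  - by apply/eqP; rewrite adj_os_es; lia.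
  - apply: far_os_inner => t; rewrite sr1; lia.
  - apply: far_es_inner => t; rewrite sr1; lia.
  - by move=> nc; exact: prof_e.
  - by move=> oN1; exact: prof_o_hi.
pose F2 : K := if sl then (if cov bc lo then 1 + vo (os lo) else 1 + va (es lo) * (1 + vo (os lo))) else 1.
have [L2 [[dL2 _] s2]] : exists L2, dstate r (wword bc) M L2 /\ evs Y L2 = evs Y L1 * F2.
  rewrite /F2 /wword -/w1 -/inner; case sl1 : sl; last by exists L1; rewrite mulr1.
  have hr : lo <= lo <= hi by move: slr; rewrite sl1; case: sr; lia.
  have -> : sword r ((os lo :: nseq (~~ cov bc lo) (es lo)) ++ w1 ++ inner) =
    sword r (os lo :: nseq (~~ cov bc lo) (es lo) ++ sword r (w1 ++ inner)).
    rewrite -cat_cons !sword_cat; congr (_ ++ _).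
    by rewrite /sword !filter_id.
  have fsub k w : far k w -> far k (sword r w).
    by apply: far_sub => x; rewrite mem_filter => /andP[].
  have farcat k (w w' : seq int) : far k w -> far k w' -> far k (w ++ w') by rewrite /far all_cat => -> ->.
  apply: dpair => //.
  - exact: eN.
  - exact: es_even.
  - by apply/eqP; rewrite adj_os_es eqxx.
  - apply/fsub/farcat; last by apply: far_os_inner => t; rewrite sl1; lia.
    rewrite /w1; case sr1 : sr => //; rewrite /far /=.
    have lh : lo < hi by move: slr; rewrite sl1 sr1; lia.
    by case: (cov bc hi) => /=; rewrite ?andbT /os /es; case/orP: d1 => /eqP->; lia.
  - apply/fsub/farcat; last by apply: far_es_inner => t; rewrite sl1; lia.
    rewrite /w1; case sr1 : sr => //; rewrite /far /=.
    have lh : lo < hi by move: slr; rewrite sl1 sr1; lia.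
    by case: (cov bc hi) => /=; rewrite ?andbT /os /es; case/orP: d1 => /eqP->; lia.
  - by rewrite /sword filter_all.
  - by move=> nc; exact: prof_e.
  - by move=> oN1; exact: prof_o_lo.
exists L2; split=> //; rewrite s2 s1 s0 /M monom_evalD // ev_Bm // -!mulrA; congr (_ * _).
rewrite /wgt mulrCA [RHS]mulrC; congr (_ * _).
have -> : \prod_(i <- inner) (1 + va i) = \prod_(t <- zrange (lo + sl%:Z) (hi - sr%:Z)) (if cov bc t then 1 else 1 + va (es t)).
  rewrite big_map big_filter big_mkcond; apply: eq_bigr => t _.
  by rewrite -/(cov bc t); case: (cov bc t).
have spl (f : int -> K) := prod_zrange_ends f slr.
rewrite !spl /F1 /F2 /AA !eqxx !andbT.
set P1 := \prod_(t <- _) (if _ then va _ else 1); set P2 := \prod_(t <- _) (if _ then 1 else _).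
have -> : \prod_(t <- zrange (lo + sl%:Z) (hi - sr%:Z)) (if cov bc t then va (es t) * (if sl && (t == lo) then 1 + vo (os lo) else 1)
   * (if sr && (t == hi) then 1 + vo (os (hi + 1)) else 1) else 1 + va (es t) * (if sl && (t == lo) then 1 + vo (os lo) else 1)
   * (if sr && (t == hi) then 1 + vo (os (hi + 1)) else 1)) = P1 * P2.
  rewrite -big_split; apply: eq_big_seq => t; rewrite mem_zrange => tr /=.
  have -> : sl && (t == lo) = false by case: sl tr => //=; lia.
  have -> : sr && (t == hi) = false by case: sr tr => //=; lia.
  by rewrite !mulr1; case: cov; rewrite ?mulr1 ?mul1r.
have lh : sl -> sr -> (lo == hi) = false /\ (hi == lo) = false by move: slr; case: sl; case: sr => //= *; lia.
case: sl lh => lh; case: sr lh => lh; rewrite /= ?mulr1 ?mul1r.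
- have [-> ->] := lh isT isT; case: cov; case: cov; ring.
- case: cov; ring.
- case: cov; ring.
- by [].
Qed.

End Values.
End Range.
End Slots.

Section Values.
Variables (K : numFieldType) (r : nat).
Implicit Types (Y : int -> int -> K).

Lemma prod_zrange_if (f : int -> K) k : \prod_(j <- zrange 1 r%:Z) (if j == k then f j else 1) = if is_node r k then f k else 1.
Proof.
case: ifPn => kN.
  rewrite (bigD1_seq k) ?mem_zrange ?zrange_uniq //= eqxx big1 ?mulr1 // => j /negPf->.
  by [].
rewrite big_seq big1 // => j; rewrite mem_zrange => jr; case: eqP => // jk.
by move: kN; rewrite -jk /is_node jr.
Qed.

Lemma va_node Y i : (forall s j, Y s j != 0) -> is_node r i ->
  va r Y i = yy r Y (1 + (odd `|i|%N)%:Z) (i - 1) * yy r Y (1 + (odd `|i|%N)%:Z) (i + 1) / (yy r Y 1 i * yy r Y 2 i).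
Proof.
move=> Y0 iN; set s := 1 + _; rewrite /va monom_evalN // /Amon iN !monom_evalD // !monom_eval_Yvar // monom_eval_sum //.
have yz s' j : yy r Y s' j != 0 by rewrite /yy; case: ifP => // _; exact: oner_neq0.
rewrite [X in _ * _ * X](_ : _ = (yy r Y s (i - 1) * yy r Y s (i + 1))^-1).
  by field; rewrite !yz.
have E k : yy r Y s k = \prod_(j <- zrange 1 r%:Z) (if j == k then yy r Y s j else 1).
  by rewrite prod_zrange_if /yy; case: ifP.
rewrite (E (i - 1)) (E (i + 1)) -big_split -prodfV /= big_mkcond.
apply: eq_big_seq => j; rewrite mem_zrange => jr; have jN : is_node r j by [].
rewrite /cartan; case: (eqVneq j i) => [->|ji] /=.
  by rewrite !ifF ?mulr1 ?invr1 //; lia.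
case: ifP => [/eqP a1|a1]; last first.
  by rewrite mulr0z monom_eval0 !ifF ?mulr1 ?invr1 //; lia.
rewrite mulrN1z monom_evalN // monom_eval_Yvar // pexpE // -/s.
case: (eqVneq j (i - 1)) => [E1|j1]; first by rewrite ifF ?mulr1 //; lia.
by rewrite ifT ?mul1r //; lia.
Qed.

(** This is where a cluster variable first shows the shape of a Demazure sum: the two terms of M are
    Y_1 and its image under f_i. *)
Lemma fM_odd_vo Y i : (forall s j, Y s j != 0) -> odd `|i|%N -> fM r Y i = yy r Y 1 i * (1 + vo r Y i).
Proof.
move=> Y0 oi; rewrite /fM oi /Mo /vo; case: ifP => iN; last by rewrite /yy iN addr0 mulr1.
have yz s' j : yy r Y s' j != 0 by rewrite /yy; case: ifP => // _; exact: oner_neq0.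
by rewrite va_node // oi; field; rewrite !yz.
Qed.

End Values.

(** * The ladder recursion agrees with the transfer recursion *)

Section Link.
Variables (K : numFieldType) (r : nat).
Hypothesis r3 : (3 <= r)%N.
Variables (x0 d y0 : int).
Hypothesis d1 : (d == 1) || (d == -1).
Hypotheses (y0_even : ~~ odd `|y0|%N).
Variables (lo : int) (sl : bool).
Implicit Types (Y : int -> int -> K) (F G : (int -> int -> K) -> K) (m n : nat).
Local Notation ndx := (nd x0 d).
Local Notation e := (es y0 d).
Local Notation o := (os y0 d).
Local Notation u i Y := (yy r Y 1 i).
Local Notation v i Y := (yy r Y 2 i).

(** The weight [AA] without the correction at the right end, which depends on where the ladder
    stops. *)
Definition LA Y (t : int) : K := va r Y (e t) * (if sl && (t == lo) then 1 + vo r Y (o lo) else 1).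
Definition LO Y (t : int) : K := va r Y (o t).
(** Values of the highest weight monomials belonging to F and, with [gm], to G after m slots; F has
    in addition Y_2 of the odd node after the last slot. *)
Definition hm m Y : K := \prod_(t <- zrange lo (lo + m%:Z - 1)) u (e t) Y * \prod_(t <- zrange (lo + sl%:Z) (lo + m%:Z)) v (o t) Y.
Definition gm m Y : K := \prod_(t <- zrange lo (lo + m%:Z - 1)) u (e t) Y * \prod_(t <- zrange (lo + sl%:Z) (lo + m%:Z - 1)) v (o t) Y.
(** For G the odd letter beyond the last slot is available. It acts only after that slot has been
    used, so the terms counted by E acquire the factor 1 + [vo], and the others remain. *)
Definition linked m F G : Prop := forall Y, (forall s i, Y s i != 0) ->
  F Y = hm m Y * (UE (LA Y) (LO Y) lo m).1 /\
  G Y = gm m Y * ((UE (LA Y) (LO Y) lo m).1 + vo r Y (o (lo + m%:Z)) * (UE (LA Y) (LO Y) lo m).2).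

Lemma hmE m Y : sl%:Z <= m%:Z -> hm m Y = gm m Y * v (o (lo + m%:Z)) Y.
Proof.
move=> slm; rewrite /hm /gm -mulrA; congr (_ * _).
by rewrite zrange_rcons ?big_cat ?big_seq1 //=; lia.
Qed.

Lemma gmS m Y : gm m.+1 Y = hm m Y * u (e (lo + m%:Z)) Y.
Proof.
rewrite /gm /hm (_ : lo + m.+1%:Z - 1 = lo + m%:Z); last by lia.
by rewrite (@zrange_rcons lo) ?big_cat ?big_seq1 /=; [rewrite mulrAC | lia].
Qed.

(** Two substitutions suffice: the weight of the new slot is the explicit quotient of [va_node], and
    M at the next odd node is Y_1 (1 + [vo]) by [fM_odd_vo]. *)
Lemma linked_step m (n : int) F G : linked m F G -> sl%:Z <= m%:Z ->
  e (lo + m%:Z) = ndx (2 * n) -> is_node r (ndx (2 * n)) -> is_node r (ndx (2 * n - 1)) ->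
  linked m.+1 (stepF r x0 d n F G) (stepG r x0 d n F G).
Proof.
move=> lk slm eE eN oN Y Y0; have [FE GE] := lk Y Y0.
have ee : ~~ odd `|ndx (2 * n)|%N by rewrite -eE es_even.
have o1 : o (lo + m%:Z) = ndx (2 * n - 1) by rewrite /os eE /nd; lia.
have o2 : o (lo + m.+1%:Z) = ndx (2 * n + 1).
  by move: eE; rewrite /os /es /nd; case/orP: d1 => /eqP->; lia.
have oo2 : odd `|ndx (2 * n + 1)|%N by rewrite -o2 os_odd.
have yz s' j : yy r Y s' j != 0 by rewrite /yy; case: ifP => // _; exact: oner_neq0.
have AE : LA Y (lo + m%:Z) = u (ndx (2 * n - 1)) Y * u (ndx (2 * n + 1)) Y / (u (ndx (2 * n)) Y * v (ndx (2 * n)) Y).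
  rewrite /LA ifF ?mulr1; last by move: slm; case: sl => //= slm; lia.
  by rewrite eE va_node // (negPf ee) addr0 (nd_neighbours r3 x0 d1 (yy r Y 1)).
have OE : LO Y (lo + m%:Z) = vo r Y (ndx (2 * n - 1)) by rewrite /LO o1 /vo oN.
rewrite /= AE OE; have := FE; have := GE; rewrite hmE // o1.
move: (UE _ _ _ _) => [U E] /= {}GE {}FE.
have FG : fM r Y (ndx (2 * n + 1)) = u (ndx (2 * n + 1)) Y * (1 + vo r Y (ndx (2 * n + 1))) by exact: fM_odd_vo.
rewrite hmE; last by lia.
rewrite gmS hmE // o1 o2 eE /stepF /stepG FE GE FG /fQ.
by split; field; rewrite !yz.
Qed.

Lemma linked_lad m0 F0 G0 n : linked m0 F0 G0 -> sl%:Z <= m0%:Z ->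
  (forall t, e t = ndx (2 * (t - lo - m0%:Z + 1))) ->
  (forall t : int, 1 <= t <= 2 * n%:Z -> is_node r (ndx t)) ->
  linked (m0 + n) (lad r x0 d F0 G0 n).1 (lad r x0 d F0 G0 n).2.
Proof.
move=> lk slm eE; elim: n => [|n IH] N; first by rewrite addn0.
have IH' : linked (m0 + n) (lad r x0 d F0 G0 n).1 (lad r x0 d F0 G0 n).2 by apply: IH => t tr; apply: N; lia.
rewrite addnS /=; apply: linked_step IH' _ _ _ _.
- by rewrite PoszD; lia.
- by rewrite eE; congr (ndx _); lia.
- by apply: N; lia.
- by apply: N; lia.
Qed.

Lemma linked0 (F : (int -> int -> K) -> K) : sl = false -> (forall Y, F Y = v (o lo) Y) -> linked 0 F (fun=> 1).
Proof.
move=> sl0 FE Y Y0; rewrite /hm /gm sl0 FE !addr0 zrange1 zrange0 ?zrange0 ?big_nil ?big_seq1 /=; try lia.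
by rewrite !mulr1 !mul1r !mulr0 addr0.
Qed.

(** If position -2 is a node, the pair [Fm], [Gm] already contains one slot, whose additional odd
    letter on the left gives the flag [sl]; n will be -2. *)
Lemma linked_init F G (n : int) : sl = true -> e lo = ndx n -> is_node r (ndx n) -> is_node r (ndx (n + 1)) ->
  (forall Y, F Y = v (ndx (n + 1)) Y * (u (ndx n) Y + u (ndx (n + 1)) Y * fM r Y (ndx (n - 1)) / v (ndx n) Y)) ->
  (forall Y, G Y = fM r Y (ndx n)) -> linked 1 F G.
Proof.
move=> sl1 eE eN oN FE GE Y Y0; rewrite FE GE.
have ee : ~~ odd `|ndx n|%N by rewrite -eE es_even.
have o0 : o lo = ndx (n - 1) by rewrite /os eE /nd; lia.
have o1 : o (lo + 1) = ndx (n + 1).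
  by move: eE; rewrite /os /es /nd; case/orP: d1 => /eqP->; lia.
have oo0 : odd `|ndx (n - 1)|%N by rewrite -o0 os_odd.
have oo1 : odd `|ndx (n + 1)|%N by rewrite -o1 os_odd.
have yz s' j : yy r Y s' j != 0 by rewrite /yy; case: ifP => // _; exact: oner_neq0.
have gY : gd r Y by move=> k; split.
have l1 : lo + 1%N%:Z - 1 = lo by lia.
rewrite /hm /gm sl1 l1 zrange1 zrange1 (@zrange0 (lo + true%:Z)) ?big_nil ?big_seq1 /= ?addr0; last by lia.
rewrite mulr0 addr0 mulr1 /LA sl1 eqxx /= eE o0 o1 va_node // (negPf ee) addr0 (nd_neighbours r3 x0 d1 (yy r Y 1)).
rewrite (fM_odd_vo r Y0 oo0); split; first by field; rewrite !yz.
have vz := yz 2 (ndx n); apply: (mulIf vz).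
rewrite (fM_even_nd r3 d1 gY eN ee) !fM_odd_vo // /fQ.
by field; rewrite !yz.
Qed.

Lemma UE_ext (A A' O : int -> K) m : (forall t, t < lo + m%:Z -> A t = A' t) -> UE A O lo m = UE A' O lo m.
Proof.
elim: m => [//|m IH] h /=; rewrite IH; last by move=> t tm; apply: h; lia.
by rewrite h //; lia.
Qed.

Lemma linked_F m F G Y : linked m F G -> (forall s i, Y s i != 0) ->
  F Y = monom_eval Y (Hm r y0 d lo (lo + m%:Z - 1) sl false)
    * (UE (AA r y0 d lo (lo + m%:Z - 1) sl false Y) (OO r y0 d Y) lo m).1.
Proof.
move=> lk Y0; have [-> _] := lk Y Y0; congr (_ * _).
  rewrite /hm /Hm monom_evalD // !monom_eval_sum //.
  have -> : lo + m%:Z - 1 + 1 - false%:Z = lo + m%:Z by rewrite /=; lia.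
  by congr (_ * _); apply: eq_bigr => t _; rewrite monom_eval_Yvar.
by rewrite (@UE_ext _ (LA Y)) // => t _; rewrite /AA /= mulr1.
Qed.

(** Every term of E contains the weight of the last slot, so the factor 1 + [vo] on E can be moved
    into that weight, as in [AA] with [sr] true. *)
Lemma linked_G m F G Y : linked m.+1 F G -> (forall s i, Y s i != 0) ->
  G Y = monom_eval Y (Hm r y0 d lo (lo + m.+1%:Z - 1) sl true)
    * (UE (AA r y0 d lo (lo + m.+1%:Z - 1) sl true Y) (OO r y0 d Y) lo m.+1).1.
Proof.
move=> lk Y0; have [_ ->] := lk Y Y0; congr (_ * _).
  rewrite /gm /Hm monom_evalD // !monom_eval_sum //.
  have -> : lo + m.+1%:Z - 1 + 1 - true%:Z = lo + m.+1%:Z - 1 by rewrite /=; lia.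
  by congr (_ * _); apply: eq_bigr => t _; rewrite monom_eval_Yvar.
rewrite /= (@UE_ext (AA r y0 d lo (lo + m.+1%:Z - 1) sl true Y) (LA Y)); last first.
  move=> t tm; rewrite /AA /LA; have -> : t == lo + m.+1%:Z - 1 = false by lia.
  by rewrite andbF mulr1.
have -> : AA r y0 d lo (lo + m.+1%:Z - 1) sl true Y (lo + m%:Z) = LA Y (lo + m%:Z) * (1 + vo r Y (o (lo + m.+1%:Z))).
  have t1 : (lo + m%:Z == lo + m.+1%:Z - 1) by lia.
  rewrite /AA /LA t1 andbT.
  by rewrite (_ : lo + m.+1%:Z - 1 + 1 = lo + m.+1%:Z); last by lia.
by rewrite /OO /LO; ring.
Qed.

End Link.

(** * From sums over configurations to sums over Demazure crystals *)

Section Total.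
Variables (K : numFieldType) (r : nat).

(** The common form of all items: what remains for each is to match its monomials, words and weights
    with [Hm], [wword] and [Bm], and its index set with nonempty configurations. *)
Lemma demazure_total_intro (phi : 'M[K]_r.+1 -> K) (y0 d lo hi : int) (m : nat) (sl sr : bool) chi
  lam w M (I : set (seq (int * int))) lamI wI MI :
  (d == 1) || (d == -1) -> ~~ odd `|y0|%N -> hi = lo + m%:Z - 1 ->
  (forall t, lo <= t <= hi -> is_node r (es y0 d t)) -> lo + sl%:Z + sr%:Z <= hi + 1 ->
  lam = wt r M -> M = Hm r y0 d lo hi sl sr -> w = wword r y0 d lo hi sl sr [::] ->
  (forall bc, I bc <-> bc != [::] /\ good lo hi bc) ->
  (forall bc, bc != [::] -> good lo hi bc -> [/\ wI bc = wword r y0 d lo hi sl sr bc,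
     MI bc = M + Bm r y0 d bc & lamI bc = lam + wt r (Bm r y0 d bc)]) ->
  (forall a Y, torusH a -> (forall s i, Y s i != 0) -> phi (xbar a Y) = torus_char a chi *
     (monom_eval Y M * (UE (AA r y0 d lo hi sl sr Y) (OO r y0 d Y) lo m).1)) ->
  is_demazure_total phi lam w M I lamI wI MI.
Proof.
move=> d1 ey hiE eN slr -> -> -> IE WE phiE.
have g0 : good lo hi [::] by [].
have Bm0 : Bm r y0 d [::] = 0 by rewrite /Bm big_nil.
split.
- split=> // i iN; have := eps_Hm_Bm d1 ey eN slr g0 iN; by rewrite Bm0 addr0.
- move=> bc /IE[n0 g]; have [_ -> ->] := WE bc n0 g; split; last by rewrite wtD.
  by move=> i iN; exact: eps_Hm_Bm.
exists chi => a Y aH Y0; rewrite phiE //; congr (_ * _).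
have := (sum_wgt (AA r y0 d lo hi sl sr Y) (OO r y0 d Y) lo m).1; rewrite -hiE => <-.
have [mL _] := mem_gen lo m; have [uL _] := uniq_gen lo m; rewrite -hiE in mL.
have dE bc : good lo hi bc -> monom_eval Y (Hm r y0 d lo hi sl sr) * wgt (AA r y0 d lo hi sl sr Y) (OO r y0 d Y) lo hi bc =
    demazure_sum r Y (wword r y0 d lo hi sl sr bc) (Hm r y0 d lo hi sl sr + Bm r y0 d bc).
  by move=> g; have [L [fL <-]] := wword_state d1 ey eN slr Y0 g; rewrite (demazure_sumE Y fL).
(* The empty configuration gives the leading Demazure crystal; the others are the index set I. *)
rewrite mulr_sumr (bigD1_seq [::]) ?mL //= dE // Bm0 addr0; congr (_ + _).
have -> : I = [set` [seq bc <- (gen lo m).1 | bc != [::]]]%classic.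
  apply/seteqP; split=> bc /=.
    by move=> /IE[n0 g]; rewrite mem_filter n0 mL.
  by rewrite mem_filter mL => /andP[n0 g]; apply/IE.
rewrite -fsbig_seq ?filter_uniq // big_filter big_seq_cond [RHS]big_seq_cond.
apply: eq_bigr => bc /andP[]; rewrite mL => g n0.
by have [-> -> _] := WE bc n0 g; rewrite dE.
Qed.

Lemma hv_phi (T : seed K r) x0 d p chi f : vnode r x0 d (vM p) -> hv x0 d T [:: vM p] chi f ->
  forall a Y, torusH a -> (forall s i, Y s i != 0) -> cvar T (vlab r x0 d (vM p)) (xbar a Y) = torus_char a chi * f Y.
Proof.
move=> pN h a Y aH Y0; have gY : gd r Y by move=> k; split.
by have := h a Y aH gY; rewrite big_seq1 /valx pN.
Qed.

Lemma sum_nodes (V : nmodType) (f : int -> V) (D1 D2 : seq int) : uniq D1 -> uniq D2 ->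
  (forall i, ~~ is_node r i -> f i = 0) -> (forall i, is_node r i -> (i \in D1) = (i \in D2)) ->
  \sum_(i <- D1) f i = \sum_(i <- D2) f i.
Proof.
move=> u1 u2 f0 h.
have red D : \sum_(i <- D) f i = \sum_(i <- [seq i <- D | is_node r i]) f i.
  rewrite big_filter [RHS]big_mkcond; apply: eq_bigr => i _.
  by case: ifPn => // /f0.
rewrite red [RHS]red; apply: perm_big; apply: uniq_perm; rewrite ?filter_uniq // => i.
by rewrite !mem_filter; case iN: (is_node r i); rewrite //= h.
Qed.

Lemma sum_shift (V : nmodType) (f : int -> V) (p q : int) :
  \sum_(t <- zrange p q) f t = \sum_(t <- zrange (p + 1) (q + 1)) f (t - 1).
Proof.
rewrite -(big_map (fun t => t - 1) predT f); congr (\big[_/_]_(t <- _) _).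
rewrite /zrange -map_comp (_ : (p + 1 <= q + 1) = (p <= q)); last by lia.
rewrite (_ : q + 1 - (p + 1) = q - p); last by lia.
by apply: eq_map => t /=; lia.
Qed.

Lemma Yvar_out s i : ~~ is_node r i -> Yvar r s i = 0.
Proof. by rewrite /Yvar => /negPf->. Qed.
Lemma Amon_out s i : ~~ is_node r i -> Amon r s i = 0.
Proof. by rewrite /Amon => /negPf->. Qed.

Section Interval.
Variables (y0 d : int).
Hypotheses (d1 : (d == 1) || (d == -1)) (y0_even : ~~ odd `|y0|%N).

Lemma mem_es p q i : (i \in [seq es y0 d t | t <- zrange p q]) =
  ~~ odd `|i|%N && (if d == 1 then es y0 d p <= i <= es y0 d q else es y0 d q <= i <= es y0 d p).
Proof.
apply/mapP/andP => [[t]|[ei h]].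
  rewrite mem_zrange => tr ->; rewrite es_even //; split=> //; move: tr; rewrite /es.
  by case/orP: d1 => /eqP-> /=; lia.
have [t tE] := esP d1 y0_even ei; exists t => //; rewrite mem_zrange; move: h; rewrite tE /es.
by case/orP: d1 => /eqP-> /=; lia.
Qed.

Lemma mem_os p q i : (i \in [seq os y0 d t | t <- zrange p q]) =
  odd `|i|%N && (if d == 1 then os y0 d p <= i <= os y0 d q else os y0 d q <= i <= os y0 d p).
Proof.
apply/mapP/andP => [[t]|[ei h]].
  rewrite mem_zrange => tr ->; rewrite os_odd //; split=> //; move: tr; rewrite /os /es.
  by case/orP: d1 => /eqP-> /=; lia.
have [t tE] := osP d1 y0_even ei; exists t => //; rewrite mem_zrange; move: h; rewrite tE /os /es.
by case/orP: d1 => /eqP-> /=; lia.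
Qed.

Lemma interval_sum (V : nmodType) (f : int -> V) p q p' q' P Q :
  (forall i, ~~ is_node r i -> f i = 0) ->
  (forall i, is_node r i -> (i \in [seq es y0 d t | t <- zrange p q]) || (i \in [seq os y0 d t | t <- zrange p' q']) = (P <= i <= Q)) ->
  \sum_(t <- zrange p q) f (es y0 d t) + \sum_(t <- zrange p' q') f (os y0 d t) = \sum_(i <- zrange P Q) f i.
Proof.
move=> f0 h; rewrite -(big_map (es y0 d) predT f) -(big_map (os y0 d) predT f) -big_cat.
apply: sum_nodes => //; rewrite ?zrange_uniq //; last first.
  by move=> i iN; rewrite mem_cat h // mem_zrange.
have ie : injective (es y0 d) by move=> i j /eqP; rewrite es_eq // => /eqP.
have io : injective (os y0 d) by move=> i j /eqP; rewrite os_eq // => /eqP.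
rewrite cat_uniq (map_inj_uniq ie) (map_inj_uniq io) !zrange_uniq andbT /=.
by apply/hasPn => i; rewrite mem_os => /andP[oi _]; rewrite mem_es oi.
Qed.

(** Listed by nodes, an interval forgets the direction d, which only decides which end is the
    smaller. This allows comparing intervals written in opposite directions. *)
Lemma BsegE b c (P Q : int) : b <= c -> (P = if d == 1 then es y0 d b else es y0 d c) ->
  (Q = if d == 1 then es y0 d c else es y0 d b) ->
  Bseg r y0 d (b, c) = \sum_(i <- zrange P Q) - Amon r 1 i.
Proof.
move=> bc -> ->; apply: (interval_sum (f := fun i => - Amon r 1 i)).
  by move=> i /Amon_out->; rewrite oppr0.
move=> i _; rewrite mem_es mem_os; move: bc; rewrite /os /es.
by case/orP: d1 => /eqP->; rewrite ?eqxx /=; lia.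
Qed.

Lemma wt_BsegE b c (P Q : int) : b <= c -> (P = if d == 1 then es y0 d b else es y0 d c) ->
  (Q = if d == 1 then es y0 d c else es y0 d b) ->
  wt r (Bseg r y0 d (b, c)) = - \sum_(i <- zrange P Q) alpha r i.
Proof.
move=> bc hP hQ; rewrite (BsegE bc hP hQ) wt_sum -sumrN; apply: eq_bigr => i _.
by rewrite wtN wt_Amon.
Qed.

Lemma wt_Hm lo hi (sl sr : bool) (P Q : int) :
  (forall i, is_node r i -> (i \in [seq es y0 d t | t <- zrange lo hi]) || (i \in [seq os y0 d t | t <- zrange (lo + sl%:Z) (hi + 1 - sr%:Z)]) = (P <= i <= Q)) ->
  wt r (Hm r y0 d lo hi sl sr) = \sum_(s <- zrange P Q) Lam r s.
Proof.
move=> h; rewrite wtD !wt_sum; under eq_bigr do rewrite wt_Yvar.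
under [X in _ + X]eq_bigr do rewrite wt_Yvar.
by apply: interval_sum => // i /Lam_nonnode.
Qed.

End Interval.

(** The node x - 2s - 3 is [os (s + 1)], hence the shift of the second sum by one. *)
Lemma Abr_Bseg b c x : b <= c -> Abr r b c x = Bseg r (x - 2) (-1) (b, c).
Proof.
move=> bc; rewrite /Abr /Bseg /= (zrange_rcons bc) big_cat big_seq1 /= big_split opprD /= addrAC.
congr (_ + _); first congr (_ + _).
- by rewrite -sumrN; apply: eq_bigr => t _; congr (- Amon _ _ _); rewrite /es; lia.
- by congr (- Amon _ _ _); rewrite /es; lia.
rewrite sum_shift subrK -sumrN; apply: eq_bigr => t _; congr (- Amon _ _ _); rewrite /os /es; lia.
Qed.

Lemma Abrs_Bm lo hi bc x : good lo hi bc -> Abrs r bc x = Bm r (x - 2) (-1) bc.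
Proof.
by move=> g; apply: eq_big_seq => [[b c]] /(good_mem g) /and3P[_ /= bc0 _]; apply: Abr_Bseg; apply: ltW.
Qed.

(** With x = 2 the reversed pair (-c, -b) runs down from 2c to 2b, through the nodes that the slots
    b to c meet upwards. *)
Lemma Abrs_opp lo hi bc : good lo hi bc -> Abrs r (opp_bc bc) 2 = Bm r 0 1 bc.
Proof.
move=> g; rewrite /Abrs big_map; apply: eq_big_seq => [[b c]] /(good_mem g) /and3P[_ /= bc0 _].
rewrite Abr_Bseg; last by lia.
rewrite (@BsegE 0 1 _ _ _ _ (2 * b) (2 * c)) ?(@BsegE _ (-1) _ _ _ _ (2 * b) (2 * c)) // /es /=; lia.
Qed.

Lemma wt_Bm_alpha lo hi bc x : ~~ odd `|x|%N -> good lo hi bc -> wt r (Bm r (x - 2) (-1) bc) = - alphabr r bc x.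
Proof.
move=> ex g; rewrite wt_sum -sumrN; apply: eq_big_seq => [[b c]] /(good_mem g) /and3P[_ /= bc0 _].
by apply: wt_BsegE; rewrite // /es /=; lia.
Qed.

Lemma wt_Bm_opp lo hi bc : good lo hi bc -> wt r (Bm r 0 1 bc) = - alphabr r (opp_bc bc) 2.
Proof.
move=> g; rewrite wt_sum /alphabr big_map -sumrN; apply: eq_big_seq => [[b c]] /(good_mem g) /and3P[_ /= bc0 _].
by apply: wt_BsegE; rewrite // /es /=; lia.
Qed.

End Total.

Lemma dm : (-1 == 1 :> int) || (-1 == -1 :> int). Proof. by []. Qed.
Lemma dp : (1 == 1 :> int) || (1 == -1 :> int). Proof. by []. Qed.

Lemma parity_interval i p q p' q' P Q : ~~ odd `|p|%N -> ~~ odd `|q|%N -> odd `|p'|%N -> odd `|q'|%N ->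
  P = Num.min p p' -> Q = Num.max q q' -> `|p - p'| = 1 -> `|q - q'| = 1 ->
  ~~ odd `|i|%N && (p <= i <= q) || odd `|i|%N && (p' <= i <= q') = (P <= i <= Q).
Proof.
move=> hp hq hp' hq' -> -> pp qq; rewrite minEle maxEle.
case: (boolP (odd `|i|%N)) => oi; case: ifP; case: ifP; lia.
Qed.

Section Membership.
Variables (y0 : int) (ey : ~~ odd `|y0|%N).

Lemma mem_esN p q i : (i \in [seq es y0 (-1) t | t <- zrange p q]) = ~~ odd `|i|%N && (y0 - 2 * q <= i <= y0 - 2 * p).
Proof. by rewrite (mem_es dm) // (_ : (-1 == 1 :> int) = false) // /es; congr (_ && _); lia. Qed.
Lemma mem_osN p q i : (i \in [seq os y0 (-1) t | t <- zrange p q]) = odd `|i|%N && (y0 + 1 - 2 * q <= i <= y0 + 1 - 2 * p).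
Proof. by rewrite (mem_os dm) // (_ : (-1 == 1 :> int) = false) // /os /es; congr (_ && _); lia. Qed.
Lemma mem_esP p q i : (i \in [seq es y0 1 t | t <- zrange p q]) = ~~ odd `|i|%N && (y0 + 2 * p <= i <= y0 + 2 * q).
Proof. by rewrite (mem_es dp) // eqxx /es; congr (_ && _); lia. Qed.
Lemma mem_osP p q i : (i \in [seq os y0 1 t | t <- zrange p q]) = odd `|i|%N && (y0 - 1 + 2 * p <= i <= y0 - 1 + 2 * q).
Proof. by rewrite (mem_os dp) // eqxx /os /es; congr (_ && _); lia. Qed.

End Membership.

(** * The three mutation sequences *)

Section Cases.
Variables (K : numFieldType) (r : nat).
Hypothesis r3 : (3 <= r)%N.
Variable V : seed K r.
Hypothesis V0 : is_initial_seed V.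

Lemma RsetE l bc : Rset l bc <-> bc != [::] /\ good 0 l bc.
Proof. by []. Qed.

Lemma run_zrange (x0 d : int) (n : nat) (G : int -> seq int) :
  (forall q : nat, (q < n)%N -> G q%:Z = grp r x0 d q) ->
  flatten [seq G q | q <- rev (zrange 0 (n%:Z - 1))] = run r x0 d n.
Proof.
move=> h; rewrite /run -[n%:Z]add0r zrange_iota -map_rev -map_comp; congr flatten.
by apply/eq_in_map => q; rewrite mem_rev mem_iota => qn /=; rewrite add0r h //; lia.
Qed.

Lemma sword_out i w : ~~ is_node r i -> sword r (i :: w) = sword r w.
Proof. by rewrite /sword /= => /negPf->. Qed.

Lemma sword_nseq_out (m : nat) i w : ~~ is_node r i -> sword r (nseq m i ++ w) = sword r w.
Proof. by move=> iN; elim: m => // m IH; rewrite -IH -[RHS](sword_out _ iN). Qed.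

Lemma b1_cov hi bc : bc != [::] -> good 0 hi bc -> (1 - (b1 bc == 0))%N = ~~ cov bc 0.
Proof.
move=> n0 g; have [c1 c2] := good_b1 n0 g; have c3 := cov_range g c1.
case: (eqVneq (b1 bc) 0) => [E|NE]; first by rewrite E in c1; rewrite c1.
by case cn: (cov bc 0) => //; have := c2 _ cn; lia.
Qed.

Lemma cp_cov lo hi bc : bc != [::] -> good lo hi bc -> (1 - (cp bc == hi))%N = ~~ cov bc hi.
Proof.
move=> n0 g; have [c1 c2] := good_cp n0 g; have c3 := cov_range g c1.
case cn: (cov bc hi); last by case: eqP => // E; rewrite -E c1 in cn.
by have := c2 _ cn; case: eqP => //; lia.
Qed.

Lemma linked_ext (d y0 lo : int) sl m (F F' G G' : (int -> int -> K) -> K) : (forall Y, F' Y = F Y) -> (forall Y, G' Y = G Y) ->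
  linked r d y0 lo sl m F G -> linked r d y0 lo sl m F' G'.
Proof. by move=> FE GE lk Y Y0; rewrite FE GE; exact: lk. Qed.

(** * Descending ladder from an even node *)

Section Case1.
Variables (k j : int) (n : nat).
Hypotheses (jj : j = jnode r k) (hk : uhf r + 1 <= k <= r%:Z - 1) (hn : n%:Z <= r%:Z - k - 1).

Lemma j1E : j = 2 * (r%:Z - k + 1).
Proof. by rewrite jj jnodeE ?ifF //; move: hk; rewrite /uhf; lia. Qed.

Lemma j1_bounds : [/\ ~~ odd `|j|%N, 2 * n%:Z + 4 <= j & j <= r%:Z].
Proof. by rewrite j1E; move: hk hn; rewrite /uhf; split; lia. Qed.

Lemma mu1E : mu1 r k n%:Z = run r j (-1) n.+1.
Proof.
rewrite /mu1 (_ : n%:Z = n.+1%:Z - 1); last by lia.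
apply: (run_zrange (G := fun q => [:: k - hf r + q; k + q + 1; k + q])) => q qn.
have [ej lj jr] := j1_bounds; have jE := j1E; have hk' := hk; rewrite /grp /vlab /lm /nd /hf /uhf /= in hk' *.
by congr [:: _; _; _]; case: ifP; lia.
Qed.

Let F0 : (int -> int -> K) -> K := fun Y => yy r Y 2 (nd j (-1) 1).
Let G0 : (int -> int -> K) -> K := fun=> 1.

Lemma nice_start1 : nice r F0 /\ nice r G0.
Proof. by split; [exact: (@nice_yy K r 2) | exact: nice1]. Qed.

(** Position 0 is the node j and slot t is the node j - 2t - 2, at position 2t + 2. The ladder
    therefore starts before any slot, and each rung adds one. *)
Lemma linked1 m : (m <= n.+1)%N ->
  linked r (-1) (j - 2) 0 false m (lad r j (-1) F0 G0 m).1 (lad r j (-1) F0 G0 m).2.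
Proof.
have [ej lj jr] := j1_bounds; move=> mn.
have e2 : ~~ odd `|(j - 2)%R|%N by lia.
apply: (@linked_lad K r r3 j (-1) (j - 2) isT e2 0 false 0) => //.
- by apply: linked0 => // Y; rewrite /F0; congr yy; rewrite /nd /os /es; lia.
- by move=> t; rewrite /nd /es; lia.
- by move=> t tr; rewrite /is_node /nd; lia.
Qed.

Lemma case1a T : is_mutated (mu1 r k n%:Z) V T ->
  let H1 := \sum_(t <- zrange 0 (n%:Z - 1)) Yvar r 1 (j - 2 * t - 2)
              + \sum_(t <- zrange 0 n%:Z) Yvar r 2 (j - 2 * t - 1) in
  is_demazure_total (cvar T (k - hf r + n%:Z))
        (\sum_(s <- zrange (j - 2 * n%:Z - 1) (j - 1)) Lam r s)
        (sword r [seq j - 2 * q - 2 | q <- zrange 0 (n%:Z - 1)])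
        H1
        (Rset (n%:Z - 1))
        (fun bc => \sum_(s <- zrange (j - 2 * n%:Z - 1) (j - 1)) Lam r s
                   - alphabr r bc j)
        (fun bc => sword r [seq j - 2 * q - 2 | q <- zrange_minus 0 (n%:Z - 1) bc])
        (fun bc => H1 + Abrs r bc j).
Proof.
rewrite mu1E => mT H1; have [ej lj jr] := j1_bounds.
have e2 : ~~ odd `|(j - 2)%R|%N by lia.
have [nF nG] := nice_start1.
have ej0 : ~~ odd `|nd j (-1) 0|%N by rewrite /nd mulr0 addr0.
have N (p : int) : 0 <= p <= 2 * n%:Z + 2 -> vnode r j (-1) (vM p) by rewrite /vnode /is_node /nd /=; lia.
have op : opens j (-1) V F0 G0 by apply: (opens1 r3 dm V0 ej0); apply: N; lia.
have [chi hT] := run_F r3 dm ej0 nF nG op N mT.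
have HE : H1 = Hm r (j - 2) (-1) 0 (n%:Z - 1) false false.
  rewrite /H1 /Hm addr0 subr0 subrK.
  by congr (_ + _); apply: eq_bigr => t _; congr Yvar; rewrite /os /es; lia.
have LE : vlab r j (-1) (vM (2 * n%:Z + 1)) = k - hf r + n%:Z.
  have jE := j1E; have hk' := hk; rewrite /vlab /lm /nd /hf /uhf /= in hk' *; case: ifP; lia.
rewrite -LE; apply: (@demazure_total_intro _ _ _ (j - 2) (-1) 0 (n%:Z - 1) n false false chi) => //.
- by move=> t tr; rewrite /is_node /es; lia.
- by lia.
- rewrite HE; apply/esym/wt_Hm => // i _; rewrite mem_esN // mem_osN //=.
  apply: parity_interval; rewrite ?minEle ?maxEle; try case: ifP; clear -ej; lia.
- rewrite /wword; congr (sword r _); rewrite /= addr0 subr0 zrange_minusE filter_predT.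
  by apply: eq_map => t; rewrite /es; lia.
- move=> bc n0 g; split.
  + rewrite /wword; congr (sword r _); rewrite /= addr0 subr0.
    by apply: eq_map => t; rewrite /es; lia.
  + by rewrite (Abrs_Bm _ _ g).
  + by rewrite (wt_Bm_alpha _ _ g).
move=> a Y aH Y0; rewrite (hv_phi _ hT) //; last by apply: N; lia.
congr (_ * _); rewrite HE.
have lk : linked r (-1) (j - 2) 0 false n (lad r j (-1) F0 G0 n).1 (lad r j (-1) F0 G0 n).2 by apply: linked1.
by have := linked_F r3 dm e2 lk Y0; rewrite add0r.
Qed.

Lemma case1b T : is_mutated (k + n%:Z + 1 :: mu1 r k n%:Z) V T ->
  let H2 := \sum_(t <- zrange 0 n%:Z)
                (Yvar r 1 (j - 2 * t - 2) + Yvar r 2 (j - 2 * t - 1)) in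
  is_demazure_total (cvar T (k + n%:Z + 1))
        (\sum_(s <- zrange (j - 2 * n%:Z - 2) (j - 1)) Lam r s)
        (sword r ([:: j - 2 * n%:Z - 3; j - 2 * n%:Z - 2]
                  ++ [seq j - 2 * q - 2 | q <- zrange 0 (n%:Z - 1)]))
        H2
        (Rset n%:Z)
        (fun bc => \sum_(s <- zrange (j - 2 * n%:Z - 2) (j - 1)) Lam r s
                   - alphabr r bc j)
        (fun bc => sword r ([:: j - 2 * n%:Z - 3]
                  ++ nseq (1 - (cp bc == n%:Z)) (j - 2 * n%:Z - 2)
                  ++ [seq j - 2 * q - 2 | q <- zrange_minus 0 (n%:Z - 1) bc]))
        (fun bc => H2 + Abrs r bc j).
Proof.
rewrite mu1E => mT H2; have [ej lj jr] := j1_bounds.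
have e2 : ~~ odd `|(j - 2)%R|%N by lia.
have [nF nG] := nice_start1.
have ej0 : ~~ odd `|nd j (-1) 0|%N by rewrite /nd mulr0 addr0.
have N (p : int) : 0 <= p <= 2 * n%:Z + 2 -> vnode r j (-1) (vM p) by rewrite /vnode /is_node /nd /=; lia.
have op : opens j (-1) V F0 G0 by apply: (opens1 r3 dm V0 ej0); apply: N; lia.
have LE : vlab r j (-1) (vM (2 * n%:Z + 2)) = k + n%:Z + 1.
  have jE := j1E; have hk' := hk; rewrite /vlab /lm /nd /hf /uhf /= in hk' *; case: ifP; lia.
rewrite -LE in mT *.
have [chi [hT _]] := run_pre r3 dm ej0 nF nG op N mT.
have HE : H2 = Hm r (j - 2) (-1) 0 n%:Z false true.
  rewrite /H2 /Hm addr0 addrK big_split.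
  by congr (_ + _); apply: eq_bigr => t _; congr Yvar; rewrite /os /es; lia.
apply: (@demazure_total_intro _ _ _ (j - 2) (-1) 0 n%:Z n.+1 false true chi) => //.
- by rewrite add0r; lia.
- by move=> t tr; rewrite /is_node /es; lia.
- by rewrite /=; lia.
- rewrite HE; apply/esym/wt_Hm => // i _; rewrite mem_esN // mem_osN //=.
  apply: parity_interval; rewrite ?minEle ?maxEle; try case: ifP; clear -ej; lia.
- rewrite /wword; congr (sword r _); rewrite /= addr0 zrange_minusE filter_predT.
  congr [:: _, _ & _]; try by rewrite /os /es; lia.
  by apply: eq_map => t; rewrite /es; lia.
- move=> bc n0 g; split.
  + rewrite /wword (cp_cov n0 g); congr (sword r _); rewrite /= addr0; congr (_ :: _ ++ _); first by rewrite /os /es; lia.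
      by congr nseq; rewrite /es; lia.
    by apply: eq_map => t; rewrite /es; lia.
  + by rewrite (Abrs_Bm _ _ g).
  + by rewrite (wt_Bm_alpha _ _ g).
move=> a Y aH Y0; rewrite (hv_phi _ hT) //; last by apply: N; lia.
congr (_ * _); rewrite HE.
have lk : linked r (-1) (j - 2) 0 false n.+1 (lad r j (-1) F0 G0 n.+1).1 (lad r j (-1) F0 G0 n.+1).2 by apply: linked1.
have := linked_G r3 dm e2 lk Y0; by rewrite (_ : 0 + n.+1%:Z - 1 = n%:Z); last by lia.
Qed.

End Case1.

(** * Descending ladder from an odd node *)

Section Case2.
Variables (k j : int) (n : nat).
Hypotheses (jj : j = jnode r k) (hk : 1 <= k <= uhf r - 2) (hn : n%:Z <= uhf r - k - 2).
(** Slot 0 is the node j + 1. For j = r it does not exist: the slots then begin at 1 without an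
    additional letter on the left, which is the origin of the condition b_1 > 0. *)
Let sl := (j != r%:Z).
Let lo : int := 1 - sl%:Z.

Lemma j2E : j = 2 * (uhf r - k) + 1.
Proof. by rewrite jj jnodeE ?ifT //; move: hk; rewrite /uhf; lia. Qed.

Lemma j2_bounds : [/\ odd `|j|%N, 2 * n%:Z + 5 <= j & j <= r%:Z].
Proof. by rewrite j2E; move: hk hn; rewrite /uhf; split; lia. Qed.

Lemma mu2E : mu2 r k n%:Z = run r (j - 1) (-1) n.+1 ++ [:: vlab r (j - 1) (-1) (vM (-1))].
Proof.
have [oj lj jr] := j2_bounds; have jE := j2E; rewrite /mu2; congr (_ ++ [:: _]); last first.
  rewrite /vlab /= (_ : nd (j - 1) (-1) (-1) = j); last by rewrite /nd; lia.
  by rewrite jj lm_jnode //; move: hk; rewrite /uhf; lia.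
rewrite (_ : n%:Z = n.+1%:Z - 1); last by lia.
apply: (run_zrange (G := fun q => [:: k + q + 1; hf r + k + q + 2; hf r + k + q + 1])) => q qn.
have hk' := hk; rewrite /grp /vlab /lm /nd /hf /uhf /= in hk' jE *.
by congr [:: _; _; _]; case: ifP; lia.
Qed.

Local Notation FM := (@Fm K r (j - 1) (-1)).
Local Notation GM := (@Gm K r (j - 1) (-1)).
Let F0 := stepF r (j - 1) (-1) 0 FM GM.
Let G0 := stepG r (j - 1) (-1) 0 FM GM.

Lemma nice_start2 : nice r F0 /\ nice r G0.
Proof.
have nG : nice r GM by exact: nice_fM.
by split; [apply: nice_stepF | apply: nice_stepG] => //; exact: nice_Fm.
Qed.

Lemma node2 (p : int) : -1 <= p <= 2 * n%:Z + 3 -> is_node r (nd (j - 1) (-1) p).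
Proof. by have [oj lj jr] := j2_bounds; rewrite /is_node /nd; lia. Qed.

Lemma opens_case2 T : is_mutated (mu2 r k n%:Z) V T ->
  exists2 S, opens (j - 1) (-1) S F0 G0 & is_mutated (run r (j - 1) (-1) n.+1) S T.
Proof.
rewrite mu2E => /is_mutated_cat[S [_ -> m1] mT]; exists S => //.
have [oj lj jr] := j2_bounds.
have ej0 : ~~ odd `|nd (j - 1) (-1) 0|%N by rewrite /nd; lia.
have [N0 N1 N2] : [/\ is_node r (nd (j - 1) (-1) 0), is_node r (nd (j - 1) (-1) (-1)) & is_node r (nd (j - 1) (-1) 1)].
  by split; apply: node2; lia.
exact: (opens2 r3 dm V0 ej0 N0 N1 N2 m1).
Qed.

Lemma ey2 : ~~ odd `|(j + 1)%R|%N. Proof. by have [oj _ _] := j2_bounds; lia. Qed.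

(** The pair [Fm], [Gm] contains [sl] slots, and the step n = 0 hidden in [F0] and [G0] adds one
    more. *)
Lemma linked2 m : (m <= n.+1)%N ->
  linked r (-1) (j + 1) lo sl (sl.+1 + m) (lad r (j - 1) (-1) F0 G0 m).1 (lad r (j - 1) (-1) F0 G0 m).2.
Proof.
have [oj lj jr] := j2_bounds; move=> mn.
have lb : linked r (-1) (j + 1) lo sl sl FM GM.
  have e2 := ey2; rewrite /lo; case slE : sl; move: slE; rewrite /sl => slE.
    apply: (linked_init r3 dm e2 (n := -2)) => //.
    - by rewrite /es /nd; lia.
    - by rewrite /is_node /nd; lia.
    - by apply: node2; lia.
    move=> Y; rewrite /Fm ifT // /vnode /is_node /nd /=; lia.
  have N2 : ~~ is_node r (nd (j - 1) (-1) (-2)) by rewrite /is_node /nd; lia.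
  apply: (@linked_ext _ _ _ _ _ (fun Y => yy r Y 2 (os (j + 1) (-1) 1)) _ (fun=> 1)).
  - by move=> Y; rewrite /Fm ifF; [congr yy; rewrite /os /es /nd; lia | apply/negbTE].
  - by move=> Y; rewrite /Gm fM_out.
  by rewrite subr0; apply: (linked0 r3 dm e2).
apply: (linked_lad r3 dm ey2).
- apply: (linked_step r3 dm ey2 lb) => //.
  + by rewrite /lo /es /nd; case: sl => /=; lia.
  + by apply: node2; lia.
  + by apply: node2; lia.
- by case: sl.
- by move=> t; rewrite /lo /es /nd; case: sl => /=; lia.
- by move=> t tr; apply: node2; lia.
Qed.

Lemma IE2 (h : int) bc : [set bc | Rset h bc /\ (j = r%:Z -> 0 < b1 bc)]%classic bc <-> bc != [::] /\ good lo h bc.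
Proof.
rewrite /= RsetE /lo; case slE : sl; move: slE; rewrite /sl => slE.
  by rewrite subrr; split=> [[h1 _]|h1] //; split=> // jr; move: slE; rewrite jr eqxx.
move/negbT: slE; rewrite negbK => /eqP jr; rewrite subr0; split=> [[[n0 g] /(_ jr) b0]|[n0]].
  by split=> //; rewrite (@good_lo 0) ?g //; lia.
by rewrite (@good_lo 0) // => /andP[g b0]; split=> // _; lia.
Qed.

Lemma eN2 (h t : int) : h <= n%:Z + 2 -> lo <= t <= h -> is_node r (es (j + 1) (-1) t).
Proof.
have [oj lj jr] := j2_bounds; rewrite /lo /is_node /es; case slE : sl; move: slE; rewrite /sl => slE; lia.
Qed.

Lemma sum2 (h : int) : 0 <= h -> \sum_(t <- zrange 0 h) Yvar r 1 (j - 2 * t + 1) = \sum_(t <- zrange lo h) Yvar r 1 (es (j + 1) (-1) t).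
Proof.
move=> h0; have [oj lj jr] := j2_bounds.
transitivity (\sum_(t <- zrange 0 h) Yvar r 1 (es (j + 1) (-1) t)).
  by apply: eq_bigr => t _; congr Yvar; rewrite /es; lia.
rewrite /lo; case slE : sl; move: slE; rewrite /sl => slE; first by rewrite subrr.
by rewrite (zrange_cons h0) big_cons subr0 Yvar_out ?add0r // /is_node /es; lia.
Qed.

Lemma case2a T : is_mutated (mu2 r k n%:Z) V T ->
  let H3 := \sum_(t <- zrange 0 (n%:Z + 1))
                (Yvar r 1 (j - 2 * t + 1) + Yvar r 2 (j - 2 * t)) in
      is_demazure_total (cvar T (k + n%:Z + 1))
        (\sum_(s <- zrange (j - 2 * n%:Z - 2) (j + 1)) Lam r s)
        (sword r ([:: j + 2; j + 1]
                  ++ [seq j - 2 * q + 1 | q <- zrange 1 (n%:Z + 1)]))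
        H3
        [set bc | Rset (n%:Z + 1) bc /\ (j = r%:Z -> 0 < b1 bc)]%classic
        (fun bc => \sum_(s <- zrange (j - 2 * n%:Z - 2) (j + 1)) Lam r s
                   - alphabr r bc (j + 3))
        (fun bc => sword r ([:: j + 2]
                  ++ nseq (1 - (b1 bc == 0)) (j + 1)
                  ++ [seq j - 2 * q + 1 | q <- zrange_minus 1 (n%:Z + 1) bc]))
        (fun bc => H3 + Abrs r bc (j + 3)).
Proof.
move=> /opens_case2[S op mT] H3; have [oj lj jr] := j2_bounds; have e2 := ey2.
have [nF nG] := nice_start2.
have ej0 : ~~ odd `|nd (j - 1) (-1) 0|%N by rewrite /nd; lia.
have N (p : int) : 0 <= p <= 2 * n%:Z + 2 -> vnode r (j - 1) (-1) (vM p) by move=> pr; apply: (@node2 p); lia.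
have [chi hT] := run_F r3 dm ej0 nF nG op N mT.
have lo1 : lo + sl%:Z = 1 by rewrite /lo subrK.
have HE : H3 = Hm r (j + 1) (-1) lo (n%:Z + 1) sl false.
  rewrite /H3 /Hm big_split lo1 subr0 sum2 //; congr (_ + _); rewrite sum_shift add0r.
  by apply: eq_bigr => t _; congr Yvar; rewrite /os /es; lia.
have LE : vlab r (j - 1) (-1) (vM (2 * n%:Z + 1)) = k + n%:Z + 1.
  have jE := j2E; have hk' := hk; rewrite /vlab /lm /nd /hf /uhf /= in hk' jE *; case: ifP; lia.
have j3 : j + 3 - 2 = j + 1 by lia.
have ej3 : ~~ odd `|(j + 3)%R|%N by clear -oj; lia.
rewrite -LE; apply: (@demazure_total_intro _ _ _ (j + 1) (-1) lo (n%:Z + 1) (sl.+1 + n) sl false chi) => //.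
- by rewrite /lo; case: sl => /=; lia.
- by move=> t; apply: eN2; lia.
- by rewrite lo1; lia.
- rewrite HE; apply/esym/wt_Hm => // i iN; rewrite mem_esN // mem_osN // lo1.
  (* For j = r the bound j + 1 is not a node, so both ranges select the same nodes. *)
  have -> : (j - 2 * n%:Z - 2 <= i <= j + 1) = (j - 2 * n%:Z - 2 <= i <= j + sl%:Z).
    by move: iN; rewrite /is_node /sl; case: eqP => /=; lia.
  clear -oj; rewrite /lo; apply: parity_interval; rewrite ?minEle ?maxEle; try case: ifP; case: sl => /=; lia.
- rewrite /wword lo1 zrange_minusE filter_predT subr0.
  have E : [seq j - 2 * q + 1 | q <- zrange 1 (n%:Z + 1)] = [seq es (j + 1) (-1) t | t <- zrange 1 (n%:Z + 1)].
    by apply: eq_map => t; rewrite /es; lia.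
  rewrite E /lo; case slE : sl; move: slE; rewrite /sl => slE.
    by congr (sword r _); congr [:: _, _ & _]; rewrite /os /es; lia.
  by rewrite !sword_out // /is_node; lia.
- by move=> bc; exact: IE2.
- move=> bc n0 g; split.
  + rewrite /wword lo1 subr0.
    have E : [seq j - 2 * q + 1 | q <- zrange_minus 1 (n%:Z + 1) bc] = [seq es (j + 1) (-1) t | t <- zrange_minus 1 (n%:Z + 1) bc].
      by apply: eq_map => t; rewrite /es; lia.
    move: g; rewrite E /lo; case slE : sl; move: slE; rewrite /sl => slE g.
      rewrite subrr in g *; rewrite (b1_cov n0 g).
      by congr (sword r (_ :: nseq _ _ ++ _)); rewrite /os /es; lia.
    by rewrite sword_out ?sword_nseq_out // /is_node; lia.
  + by rewrite (Abrs_Bm _ _ g) j3.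
  + by rewrite -j3 (wt_Bm_alpha _ _ g).
move=> a Y aH Y0; rewrite (hv_phi _ hT) //; last by apply: N; lia.
congr (_ * _); rewrite HE.
have lk := linked2 (leqnSn n).
have := linked_F r3 dm e2 lk Y0; rewrite (_ : lo + (sl.+1 + n)%N%:Z - 1 = n%:Z + 1) //.
by rewrite /lo; case: sl => /=; lia.
Qed.

Lemma case2b T : is_mutated (hf r + k + n%:Z + 2 :: mu2 r k n%:Z) V T ->
  let H4 := \sum_(t <- zrange 0 (n%:Z + 2)) Yvar r 1 (j - 2 * t + 1)
              + \sum_(t <- zrange 0 (n%:Z + 1)) Yvar r 2 (j - 2 * t) in
      is_demazure_total (cvar T (hf r + k + n%:Z + 2))
        (\sum_(s <- zrange (j - 2 * n%:Z - 3) (j + 1)) Lam r s)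
        (sword r ([:: j + 2; j + 1; j - 2 * n%:Z - 4; j - 2 * n%:Z - 3]
                  ++ [seq j - 2 * q + 1 | q <- zrange 1 (n%:Z + 1)]))
        H4
        [set bc | Rset (n%:Z + 2) bc /\ (j = r%:Z -> 0 < b1 bc)]%classic
        (fun bc => \sum_(s <- zrange (j - 2 * n%:Z - 3) (j + 1)) Lam r s
                   - alphabr r bc (j + 3))
        (fun bc => sword r ([:: j + 2]
                  ++ nseq (1 - (b1 bc == 0)) (j + 1)
                  ++ [:: j - 2 * n%:Z - 4]
                  ++ nseq (1 - (cp bc == n%:Z + 2)) (j - 2 * n%:Z - 3)
                  ++ [seq j - 2 * q + 1 | q <- zrange_minus 1 (n%:Z + 1) bc]))
        (fun bc => H4 + Abrs r bc (j + 3)).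
Proof.
move=> [U /opens_case2[S op mU] mT'] H4; have [oj lj jr] := j2_bounds; have e2 := ey2.
have [nF nG] := nice_start2.
have ej0 : ~~ odd `|nd (j - 1) (-1) 0|%N by rewrite /nd; lia.
have N (p : int) : 0 <= p <= 2 * n%:Z + 2 -> vnode r (j - 1) (-1) (vM p) by move=> pr; apply: (@node2 p); lia.
have LE : vlab r (j - 1) (-1) (vM (2 * n%:Z + 2)) = hf r + k + n%:Z + 2.
  have jE := j2E; have hk' := hk; rewrite /vlab /lm /nd /hf /uhf /= in hk' jE *; case: ifP; lia.
have mT : is_mutated (vlab r (j - 1) (-1) (vM (2 * n%:Z + 2)) :: run r (j - 1) (-1) n.+1) S T.
  by exists U; rewrite ?LE.
have [chi [hT _]] := run_pre r3 dm ej0 nF nG op N mT.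
have lo1 : lo + sl%:Z = 1 by rewrite /lo subrK.
have hi1 : n%:Z + 2 - true%:Z = n%:Z + 1 by rewrite /=; lia.
have hi2 : n%:Z + 2 + 1 - true%:Z = n%:Z + 2 by rewrite /=; lia.
have HE : H4 = Hm r (j + 1) (-1) lo (n%:Z + 2) sl true.
  rewrite /H4 /Hm lo1 hi2 sum2 //; congr (_ + _); rewrite sum_shift add0r.
  rewrite (_ : n%:Z + 1 + 1 = n%:Z + 2); last by lia.
  by apply: eq_bigr => t _; congr Yvar; rewrite /os /es; lia.
have j3 : j + 3 - 2 = j + 1 by lia.
have ej3 : ~~ odd `|(j + 3)%R|%N by clear -oj; lia.
rewrite -LE; apply: (@demazure_total_intro _ _ _ (j + 1) (-1) lo (n%:Z + 2) (sl.+1 + n).+1 sl true chi) => //.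
- by rewrite /lo; case: sl => /=; lia.
- by move=> t; apply: eN2; lia.
- by rewrite lo1 /=; lia.
- rewrite HE; apply/esym/wt_Hm => // i iN; rewrite mem_esN // mem_osN // lo1 hi2.
  have -> : (j - 2 * n%:Z - 3 <= i <= j + 1) = (j - 2 * n%:Z - 3 <= i <= j + sl%:Z).
    by move: iN; rewrite /is_node /sl; case: eqP => /=; lia.
  clear -oj; rewrite /lo; apply: parity_interval; rewrite ?minEle ?maxEle; try case: ifP; case: sl => /=; lia.
- rewrite /wword lo1 hi1 zrange_minusE filter_predT.
  have E : [seq j - 2 * q + 1 | q <- zrange 1 (n%:Z + 1)] = [seq es (j + 1) (-1) t | t <- zrange 1 (n%:Z + 1)].
    by apply: eq_map => t; rewrite /es; lia.
  have E4 : j - 2 * n%:Z - 4 = os (j + 1) (-1) (n%:Z + 2 + 1) by rewrite /os /es; lia.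
  have E3 : j - 2 * n%:Z - 3 = es (j + 1) (-1) (n%:Z + 2) by rewrite /es; lia.
  rewrite E E3 E4 /lo; case slE : sl; move: slE; rewrite /sl => slE.
    by congr (sword r _); congr [:: _, _ & _]; rewrite /os /es; lia.
  have o1 : ~~ is_node r (j + 2) by rewrite /is_node; lia.
  have o2 : ~~ is_node r (j + 1) by rewrite /is_node; lia.
  by rewrite [LHS](sword_out _ o1) [LHS](sword_out _ o2).
- by move=> bc; exact: IE2.
- move=> bc n0 g; split.
  + rewrite /wword lo1 hi1 (cp_cov n0 g).
    have E : [seq j - 2 * q + 1 | q <- zrange_minus 1 (n%:Z + 1) bc] = [seq es (j + 1) (-1) t | t <- zrange_minus 1 (n%:Z + 1) bc].
      by apply: eq_map => t; rewrite /es; lia.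
    have E4 : j - 2 * n%:Z - 4 = os (j + 1) (-1) (n%:Z + 2 + 1) by rewrite /os /es; lia.
    have E3 : j - 2 * n%:Z - 3 = es (j + 1) (-1) (n%:Z + 2) by rewrite /es; lia.
    move: g; rewrite E E3 E4 /lo; case slE : sl; move: slE; rewrite /sl => slE g.
      rewrite subrr in g *; rewrite (b1_cov n0 g).
      by congr (sword r (_ :: nseq _ _ ++ _)); rewrite /os /es; lia.
    by rewrite sword_out ?sword_nseq_out // /is_node; lia.
  + by rewrite (Abrs_Bm _ _ g) j3.
  + by rewrite -j3 (wt_Bm_alpha _ _ g).
move=> a Y aH Y0; rewrite (hv_phi _ hT) //; last by apply: N; lia.
congr (_ * _); rewrite HE.
have lk := linked2 (leqnn n.+1); rewrite addnS in lk.
have := linked_G r3 dm e2 lk Y0; rewrite (_ : lo + (sl.+1 + n).+1%:Z - 1 = n%:Z + 2) //.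
by rewrite /lo; case: sl => /=; lia.
Qed.

End Case2.

(** * Ascending ladder from the first node *)

Section Case3.

Lemma mu3E (n : nat) : n%:Z <= hf r - 1 -> mu3 r (n%:Z - 1) = run r 2 1 n ++ [:: vlab r 2 1 (vM (-1))].
Proof.
move=> hn; rewrite /mu3; congr (_ ++ [:: _]); last first.
  by rewrite /vlab /lm /nd /uhf /=; lia.
apply: (run_zrange (G := fun q => [:: uhf r - q - 1; r%:Z - q - 1; r%:Z - q])) => q qn.
rewrite /grp /vlab /lm /nd /uhf /=; rewrite /hf in hn.
by congr [:: _; _; _]; case: ifP; lia.
Qed.

Local Notation FM := (@Fm K r 2 1).
Local Notation GM := (@Gm K r 2 1).
Let F0 := stepF r 2 1 0 FM GM.
Let G0 := stepG r 2 1 0 FM GM.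

Lemma nice_start3 : nice r F0 /\ nice r G0.
Proof.
have nG : nice r GM by exact: nice_fM.
by split; [apply: nice_stepF | apply: nice_stepG] => //; exact: nice_Fm.
Qed.

Lemma node3 (p : int) : -1 <= p <= r%:Z - 2 -> is_node r (nd 2 1 p).
Proof. by rewrite /is_node /nd; lia. Qed.

Lemma opens_case3 (w : seq int) T : is_mutated (w ++ [:: vlab r 2 1 (vM (-1))]) V T ->
  exists2 S, opens 2 1 S F0 G0 & is_mutated w S T.
Proof.
move=> /is_mutated_cat[S [_ -> m1] mT]; exists S => //.
have [N0 N1 N2] : [/\ is_node r (nd 2 1 0), is_node r (nd 2 1 (-1)) & is_node r (nd 2 1 1)].
  by split; apply: node3; lia.
exact: (opens2 r3 dp V0 _ N0 N1 N2 m1).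
Qed.

(** Slot t is the node 2t. Slot 0 would be the node 0, so the slots start at 1, and the first one
    comes from the step n = 0 inside [F0] and [G0]. *)
Lemma linked3 m : 2 * m%:Z + 2 <= r%:Z ->
  linked r 1 0 1 false m.+1 (lad r 2 1 F0 G0 m).1 (lad r 2 1 F0 G0 m).2.
Proof.
move=> mr; have e2 : ~~ odd `|0|%N by [].
have lb : linked r 1 0 1 false 0 FM GM.
  have N2 : ~~ is_node r (nd 2 1 (-2)) by rewrite /is_node /nd; lia.
  apply: (@linked_ext _ _ _ _ _ (fun Y => yy r Y 2 (os 0 1 1)) _ (fun=> 1)).
  - have N2' : vnode r 2 1 (vM (-2)) = false by apply/negbTE.
    by move=> Y; rewrite /Fm N2'.
  - by move=> Y; rewrite /Gm fM_out.
  by apply: (linked0 r3 dp).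
rewrite -add1n; apply: (linked_lad r3 dp) => //.
- apply: (linked_step r3 dp _ lb) => //; apply: node3; lia.
- by move=> t; rewrite /es /nd; lia.
- by move=> t tr; apply: node3; lia.
Qed.

Lemma IE3 (h : int) bc : [set bc | Rset h bc /\ 0 < b1 bc]%classic bc <-> bc != [::] /\ good 1 h bc.
Proof.
rewrite /= RsetE; split=> [[[n0 g] b0]|[n0]].
  by split=> //; rewrite (@good_lo 0) ?g //; lia.
by rewrite (@good_lo 0) // => /andP[g b0]; split=> //; lia.
Qed.

(** Shared by the variable obtained from [mu3] and by the one that closes the ladder for odd r: only
    the label differs, and h is the number of slots. *)
Lemma case3F T (n : nat) chi lab h : 2 * n%:Z + 3 <= r%:Z -> h = n%:Z + 1 ->
  hv 2 1 T [:: vM (2 * n%:Z + 1)] chi (lad r 2 1 F0 G0 n).1 -> lab = vlab r 2 1 (vM (2 * n%:Z + 1)) ->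
  let H5 := \sum_(t <- zrange 0 (h - 1)) Yvar r 1 (2 * t + 2)
              + \sum_(t <- zrange 0 h) Yvar r 2 (2 * t + 1) in
      is_demazure_total (cvar T lab)
        (\sum_(s <- zrange 1 (2 * h + 1)) Lam r s)
        (sword r [seq 2 * q | q <- zrange 1 h])
        H5
        [set bc | Rset h bc /\ 0 < b1 bc]%classic
        (fun bc => \sum_(s <- zrange 1 (2 * h + 1)) Lam r s
                   - alphabr r (opp_bc bc) 2)
        (fun bc => sword r [seq 2 * q | q <- zrange_minus 1 h bc])
        (fun bc => H5 + Abrs r (opp_bc bc) 2).
Proof.
move=> hn -> hT -> H5; have e2 : ~~ odd `|0|%N by [].
have HE : H5 = Hm r 0 1 1 (n%:Z + 1) false false.
  rewrite /H5 /Hm addr0 subr0 addrK sum_shift add0r [X in _ + X]sum_shift add0r.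
  by congr (_ + _); apply: eq_bigr => t _; congr Yvar; rewrite /os /es; lia.
apply: (@demazure_total_intro _ _ _ 0 1 1 (n%:Z + 1) n.+1 false false chi) => //.
- by lia.
- by move=> t tr; rewrite /is_node /es; lia.
- by rewrite /=; lia.
- rewrite HE; apply/esym/wt_Hm => // i _; rewrite mem_esP // mem_osP //.
  rewrite (_ : 0 + 2 * 1 = 2) // (_ : 0 - 1 + 2 * (1 + false%:Z) = 1) //.
  by apply: parity_interval; rewrite ?minEle ?maxEle //; try case: ifP => /=; lia.
- rewrite /wword zrange_minusE filter_predT; congr (sword r _); rewrite /= addr0 subr0.
  by apply: eq_map => t; rewrite /es; lia.
- by move=> bc; exact: IE3.
- move=> bc n0 g; split.
  + rewrite /wword; congr (sword r _); rewrite /= addr0 subr0.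
    by apply: eq_map => t; rewrite /es; lia.
  + by rewrite (Abrs_opp _ g).
  + by rewrite (wt_Bm_opp _ g).
have N1 : is_node r (nd 2 1 (2 * n%:Z + 1)) by apply: node3; lia.
move=> a Y aH Y0; rewrite (hv_phi N1 hT) //.
congr (_ * _); rewrite HE.
have lk : linked r 1 0 1 false n.+1 (lad r 2 1 F0 G0 n).1 (lad r 2 1 F0 G0 n).2 by apply: linked3; lia.
by have := linked_F r3 dp e2 lk Y0; rewrite (_ : 1 + n.+1%:Z - 1 = n%:Z + 1); last by lia.
Qed.

Lemma case3a (n : nat) T : n%:Z <= hf r - 2 -> is_mutated (mu3 r n%:Z) V T ->
  exists chi, hv 2 1 T [:: vM (2 * n%:Z + 1)] chi (lad r 2 1 F0 G0 n).1.
Proof.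
move=> hn; have nr : 2 * n%:Z + 4 <= r%:Z by move: hn; rewrite /hf; lia.
rewrite (_ : n%:Z = n.+1%:Z - 1); last by lia.
rewrite mu3E; last by lia.
move=> /opens_case3[S op mT]; have [nF nG] := nice_start3.
rewrite (_ : n.+1%:Z - 1 = n%:Z); last by lia.
apply: (run_F r3 dp _ nF nG op _ mT) => // p pr; apply: (@node3 p); lia.
Qed.

Lemma case3b (n : nat) T : n%:Z <= hf r - 2 -> is_mutated (r%:Z - n%:Z - 1 :: mu3 r n%:Z) V T ->
    let H6 := \sum_(t <- zrange 0 (n%:Z + 1))
                (Yvar r 1 (2 * t + 2) + Yvar r 2 (2 * t + 1)) in
      is_demazure_total (cvar T (r%:Z - n%:Z - 1))
        (\sum_(s <- zrange 1 (2 * n%:Z + 4)) Lam r s)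
        (sword r ([:: 2 * n%:Z + 5; 2 * n%:Z + 4]
                  ++ [seq 2 * q | q <- zrange 1 (n%:Z + 1)]))
        H6
        [set bc | Rset (n%:Z + 2) bc /\ 0 < b1 bc]%classic
        (fun bc => \sum_(s <- zrange 1 (2 * n%:Z + 4)) Lam r s
                   - alphabr r (opp_bc bc) 2)
        (fun bc => sword r ([:: 2 * n%:Z + 5]
                  ++ nseq (1 - (cp bc == n%:Z + 2)) (2 * n%:Z + 4)
                  ++ [seq 2 * q | q <- zrange_minus 1 (n%:Z + 1) bc]))
        (fun bc => H6 + Abrs r (opp_bc bc) 2).
Proof.
move=> hn mT' H6; have nr : 2 * n%:Z + 4 <= r%:Z by move: hn; rewrite /hf; lia.
have e2 : ~~ odd `|0|%N by [].
have LE : vlab r 2 1 (vM (2 * n%:Z + 2)) = r%:Z - n%:Z - 1.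
  by rewrite /vlab /lm /nd /=; case: ifP; lia.
have muE : mu3 r n%:Z = run r 2 1 n.+1 ++ [:: vlab r 2 1 (vM (-1))].
  rewrite -mu3E; [congr (mu3 r _) |]; lia.
rewrite muE -LE -cat_cons in mT'; have [S op mT] := opens_case3 mT'.
have [nF nG] := nice_start3.
have ej0 : ~~ odd `|nd 2 1 0|%N by [].
have N (p : int) : 0 <= p <= 2 * n%:Z + 2 -> vnode r 2 1 (vM p) by move=> pr; apply: (@node3 p); lia.
have [chi [hT _]] := run_pre r3 dp ej0 nF nG op N mT.
have hi1 : n%:Z + 2 - true%:Z = n%:Z + 1 by rewrite /=; lia.
have hi2 : n%:Z + 2 + 1 - true%:Z = n%:Z + 2 by rewrite /=; lia.
have HE : H6 = Hm r 0 1 1 (n%:Z + 2) false true.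
  rewrite /H6 /Hm addr0 hi2 sum_shift add0r (_ : n%:Z + 1 + 1 = n%:Z + 2); last by lia.
  by rewrite big_split; congr (_ + _); apply: eq_bigr => t _; congr Yvar; rewrite /os /es; lia.
rewrite -LE; apply: (@demazure_total_intro _ _ _ 0 1 1 (n%:Z + 2) n.+2 false true chi) => //.
- by lia.
- by move=> t tr; rewrite /is_node /es; lia.
- by rewrite /=; lia.
- rewrite HE; apply/esym/wt_Hm => // i _; rewrite mem_esP // mem_osP // hi2.
  rewrite (_ : 0 + 2 * 1 = 2) // (_ : 0 - 1 + 2 * (1 + false%:Z) = 1) //.
  by apply: parity_interval; rewrite ?minEle ?maxEle //; try case: ifP => /=; lia.
- rewrite /wword zrange_minusE filter_predT hi1; congr (sword r _); rewrite /= addr0.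
  congr [:: _, _ & _]; try by rewrite /os /es; lia.
  by apply: eq_map => t; rewrite /es; lia.
- by move=> bc; exact: IE3.
- move=> bc n0 g; split.
  + rewrite /wword hi1 (cp_cov n0 g); congr (sword r _); rewrite /= addr0.
    congr (_ :: _ ++ _); first by rewrite /os /es; lia.
      by congr nseq; rewrite /es; lia.
    by apply: eq_map => t; rewrite /es; lia.
  + by rewrite (Abrs_opp _ g).
  + by rewrite (wt_Bm_opp _ g).
have N1 : is_node r (nd 2 1 (2 * n%:Z + 2)) by apply: node3; lia.
move=> a Y aH Y0; rewrite (hv_phi N1 hT) //.
congr (_ * _); rewrite HE.
have lk : linked r 1 0 1 false n.+2 (lad r 2 1 F0 G0 n.+1).1 (lad r 2 1 F0 G0 n.+1).2 by apply: linked3; lia.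
by have := linked_G r3 dp e2 lk Y0; rewrite (_ : 1 + n.+2%:Z - 1 = n%:Z + 2); last by lia.
Qed.

(** For odd r the position 2n + 1 is the node r and the next position is off the diagram, so the
    ladder ends through [run_last]. *)
Lemma case3c (n : nat) T : odd r -> n%:Z = hf r - 1 -> is_mutated (1 :: uhf r + 1 :: mu3 r (n%:Z - 1)) V T ->
  exists chi, hv 2 1 T [:: vM (2 * n%:Z + 1)] chi (lad r 2 1 F0 G0 n).1.
Proof.
move=> or hn; have nr : 2 * n%:Z + 3 = r%:Z by move: hn; rewrite /hf; lia.
rewrite mu3E; last by lia.
have L1 : vlab r 2 1 (vM (2 * n%:Z + 1)) = 1 by rewrite /vlab /lm /nd /uhf /=; case: ifP; lia.
have L2 : vlab r 2 1 (vM (2 * n%:Z)) = uhf r + 1 by rewrite /vlab /lm /nd /uhf /=; case: ifP; lia.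
have -> : [:: 1, uhf r + 1 & run r 2 1 n ++ [:: vlab r 2 1 (vM (-1))]] =
    [:: vlab r 2 1 (vM (2 * n%:Z + 1)), vlab r 2 1 (vM (2 * n%:Z)) & run r 2 1 n] ++ [:: vlab r 2 1 (vM (-1))] by rewrite L1 L2.
move=> /opens_case3[S op mT]; have [nF nG] := nice_start3.
apply: (run_last r3 dp _ nF nG op _ _ mT) => //.
  by move=> p pr; apply: (@node3 p); lia.
by rewrite /vnode /is_node /nd /=; lia.
Qed.

End Case3.
End Cases.

Theorem theorem6p8 (R : realType) (r : nat) (hr : (3 <= r)%N)
    (V : seed R[i] r) (hV : is_initial_seed V) :
  [/\
  (* (1) *)
  forall k l : int,
    uhf r + 1 <= k <= r%:Z - 1 -> 0 <= l <= r%:Z - k - 1 ->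
    let j := jnode r k in
    let H1 := \sum_(t <- zrange 0 (l - 1)) Yvar r 1 (j - 2 * t - 2)
              + \sum_(t <- zrange 0 l) Yvar r 2 (j - 2 * t - 1) in
    let H2 := \sum_(t <- zrange 0 l)
                (Yvar r 1 (j - 2 * t - 2) + Yvar r 2 (j - 2 * t - 1)) in
    (* (a) *)
    (forall T : seed R[i] r, is_mutated (mu1 r k l) V T ->
      is_demazure_total (cvar T (k - hf r + l))
        (\sum_(s <- zrange (j - 2 * l - 1) (j - 1)) Lam r s)
        (sword r [seq j - 2 * q - 2 | q <- zrange 0 (l - 1)])
        H1
        (Rset (l - 1))
        (fun bc => \sum_(s <- zrange (j - 2 * l - 1) (j - 1)) Lam r s
                   - alphabr r bc j)
        (fun bc => sword r [seq j - 2 * q - 2 | q <- zrange_minus 0 (l - 1) bc])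
        (fun bc => H1 + Abrs r bc j)) /\
    (* (b) *)
    (forall T : seed R[i] r, is_mutated (k + l + 1 :: mu1 r k l) V T ->
      is_demazure_total (cvar T (k + l + 1))
        (\sum_(s <- zrange (j - 2 * l - 2) (j - 1)) Lam r s)
        (sword r ([:: j - 2 * l - 3; j - 2 * l - 2]
                  ++ [seq j - 2 * q - 2 | q <- zrange 0 (l - 1)]))
        H2
        (Rset l)
        (fun bc => \sum_(s <- zrange (j - 2 * l - 2) (j - 1)) Lam r s
                   - alphabr r bc j)
        (fun bc => sword r ([:: j - 2 * l - 3]
                  ++ nseq (1 - (cp bc == l)) (j - 2 * l - 2)
                  ++ [seq j - 2 * q - 2 | q <- zrange_minus 0 (l - 1) bc]))
        (fun bc => H2 + Abrs r bc j)),
  (* (2) *)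
  forall k l : int,
    1 <= k <= uhf r - 2 -> 0 <= l <= uhf r - k - 2 ->
    let j := jnode r k in
    let H3 := \sum_(t <- zrange 0 (l + 1))
                (Yvar r 1 (j - 2 * t + 1) + Yvar r 2 (j - 2 * t)) in
    let H4 := \sum_(t <- zrange 0 (l + 2)) Yvar r 1 (j - 2 * t + 1)
              + \sum_(t <- zrange 0 (l + 1)) Yvar r 2 (j - 2 * t) in
    (* (a) *)
    (forall T : seed R[i] r, is_mutated (mu2 r k l) V T ->
      is_demazure_total (cvar T (k + l + 1))
        (\sum_(s <- zrange (j - 2 * l - 2) (j + 1)) Lam r s)
        (sword r ([:: j + 2; j + 1]
                  ++ [seq j - 2 * q + 1 | q <- zrange 1 (l + 1)]))
        H3
        [set bc | Rset (l + 1) bc /\ (j = r%:Z -> 0 < b1 bc)]%classic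
        (fun bc => \sum_(s <- zrange (j - 2 * l - 2) (j + 1)) Lam r s
                   - alphabr r bc (j + 3))
        (fun bc => sword r ([:: j + 2]
                  ++ nseq (1 - (b1 bc == 0)) (j + 1)
                  ++ [seq j - 2 * q + 1 | q <- zrange_minus 1 (l + 1) bc]))
        (fun bc => H3 + Abrs r bc (j + 3))) /\
    (* (b) *)
    (forall T : seed R[i] r, is_mutated (hf r + k + l + 2 :: mu2 r k l) V T ->
      is_demazure_total (cvar T (hf r + k + l + 2))
        (\sum_(s <- zrange (j - 2 * l - 3) (j + 1)) Lam r s)
        (sword r ([:: j + 2; j + 1; j - 2 * l - 4; j - 2 * l - 3]
                  ++ [seq j - 2 * q + 1 | q <- zrange 1 (l + 1)]))
        H4
        [set bc | Rset (l + 2) bc /\ (j = r%:Z -> 0 < b1 bc)]%classic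
        (fun bc => \sum_(s <- zrange (j - 2 * l - 3) (j + 1)) Lam r s
                   - alphabr r bc (j + 3))
        (fun bc => sword r ([:: j + 2]
                  ++ nseq (1 - (b1 bc == 0)) (j + 1)
                  ++ [:: j - 2 * l - 4]
                  ++ nseq (1 - (cp bc == l + 2)) (j - 2 * l - 3)
                  ++ [seq j - 2 * q + 1 | q <- zrange_minus 1 (l + 1) bc]))
        (fun bc => H4 + Abrs r bc (j + 3))),
  (* (3) *)
  forall l : int,
    0 <= l <= hf r - 2 ->
    let H5 := \sum_(t <- zrange 0 l) Yvar r 1 (2 * t + 2)
              + \sum_(t <- zrange 0 (l + 1)) Yvar r 2 (2 * t + 1) in
    let H6 := \sum_(t <- zrange 0 (l + 1))
                (Yvar r 1 (2 * t + 2) + Yvar r 2 (2 * t + 1)) in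
    (* (a) *)
    (forall T : seed R[i] r, is_mutated (mu3 r l) V T ->
      is_demazure_total (cvar T (uhf r - l - 1))
        (\sum_(s <- zrange 1 (2 * l + 3)) Lam r s)
        (sword r [seq 2 * q | q <- zrange 1 (l + 1)])
        H5
        [set bc | Rset (l + 1) bc /\ 0 < b1 bc]%classic
        (fun bc => \sum_(s <- zrange 1 (2 * l + 3)) Lam r s
                   - alphabr r (opp_bc bc) 2)
        (fun bc => sword r [seq 2 * q | q <- zrange_minus 1 (l + 1) bc])
        (fun bc => H5 + Abrs r (opp_bc bc) 2)) /\
    (* (b) *)
    (forall T : seed R[i] r, is_mutated (r%:Z - l - 1 :: mu3 r l) V T ->
      is_demazure_total (cvar T (r%:Z - l - 1))
        (\sum_(s <- zrange 1 (2 * l + 4)) Lam r s)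
        (sword r ([:: 2 * l + 5; 2 * l + 4]
                  ++ [seq 2 * q | q <- zrange 1 (l + 1)]))
        H6
        [set bc | Rset (l + 2) bc /\ 0 < b1 bc]%classic
        (fun bc => \sum_(s <- zrange 1 (2 * l + 4)) Lam r s
                   - alphabr r (opp_bc bc) 2)
        (fun bc => sword r ([:: 2 * l + 5]
                  ++ nseq (1 - (cp bc == l + 2)) (2 * l + 4)
                  ++ [seq 2 * q | q <- zrange_minus 1 (l + 1) bc]))
        (fun bc => H6 + Abrs r (opp_bc bc) 2)) &
  (* (3), r odd: here hf r = (r - 1) / 2 and uhf r + 1 = (r + 3) / 2 *)
  odd r ->
    let H7 := \sum_(t <- zrange 0 (hf r - 1)) Yvar r 1 (2 * t + 2)
              + \sum_(t <- zrange 0 (hf r)) Yvar r 2 (2 * t + 1) in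
    forall T : seed R[i] r,
      is_mutated (1 :: uhf r + 1 :: mu3 r (hf r - 2)) V T ->
      is_demazure_total (cvar T 1)
        (\sum_(s <- zrange 1 r%:Z) Lam r s)
        (sword r [seq 2 * q | q <- zrange 1 (hf r)])
        H7
        [set bc | Rset (hf r) bc /\ 0 < b1 bc]%classic
        (fun bc => \sum_(s <- zrange 1 r%:Z) Lam r s
                   - alphabr r (opp_bc bc) 2)
        (fun bc => sword r [seq 2 * q | q <- zrange_minus 1 (hf r) bc])
        (fun bc => H7 + Abrs r (opp_bc bc) 2)].

Proof.
split.
- move=> k l hk hl j H1 H2; have [n lE] : exists n : nat, l = n%:Z by exists `|l|%N; lia.
  rewrite {}/H1 {}/H2 {}lE in hl *; have hn : n%:Z <= r%:Z - k - 1 by lia.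
  by split=> T mT; [exact: case1a mT | exact: case1b mT].
- move=> k l hk hl j H3 H4; have [n lE] : exists n : nat, l = n%:Z by exists `|l|%N; lia.
  rewrite {}/H3 {}/H4 {}lE in hl *; have hn : n%:Z <= uhf r - k - 2 by lia.
  by split=> T mT; [exact: case2a mT | exact: case2b mT].
- move=> l hl H5 H6; have [n lE] : exists n : nat, l = n%:Z by exists `|l|%N; lia.
  rewrite {}/H5 {}/H6 {}lE in hl *; have hn : n%:Z <= hf r - 2 by lia.
  split=> T mT; last by exact: case3b mT.
  have [chi hT] := case3a hr hV hn mT.
  have h1 : 2 * n%:Z + 3 <= r%:Z by move: hn; rewrite /hf; lia.
  have LE : uhf r - n%:Z - 1 = vlab r 2 1 (vM (2 * n%:Z + 1)).
    by move: hn; rewrite /vlab /lm /nd /hf /uhf /=; case: ifP; lia.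
  have := case3F hr h1 erefl hT LE; rewrite addrK.
  by rewrite (_ : 2 * (n%:Z + 1) + 1 = 2 * n%:Z + 3); last by lia.
(* With n one less than half of r - 1, the sequence is [mu3] at n - 1; for r = 3 this is the single
   initial mutation, with no group. *)
move=> or H7 T mT; have [n nE] : exists n : nat, n%:Z = hf r - 1 by exists (r./2.-1); rewrite /hf; lia.
rewrite (_ : hf r - 2 = n%:Z - 1) in mT; last by lia.
have [chi hT] := case3c hr hV or nE mT.
have h1 : 2 * n%:Z + 3 <= r%:Z by move: nE; rewrite /hf; lia.
have hE : hf r = n%:Z + 1 by lia.
have LE : 1 = vlab r 2 1 (vM (2 * n%:Z + 1)).
  by move: nE; rewrite /vlab /lm /nd /hf /uhf /=; case: ifP; lia.
have := case3F hr h1 hE hT LE.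
by rewrite (_ : 2 * hf r + 1 = r%:Z); last by rewrite /hf; lia.
Qed.
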